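(* Let $X \subset \mathbb{R}^N$ be a closed subanalytic set with $0 \in X$. Let $C_1,\dots,C_r$ be the connected components of $X\setminus \{0\}$ as a germ at $0$. For $t>0$ put $X_t=X\cap\mathbb{S}^{N-1}(0;t)$. Then the following statements are equivalent: (i) $X$ is LNE at $0$; (ii) each $\overline{C}_i$ is LNE at $0$, and there exists $K>0$ such that $d_0(X_t)\geq Kt$ for all small enough $t>0$; (iii) each $\overline{C}_i$ is LLNE at $0$, and there exists $K>0$ such that $d_0(X_t)\geq Kt$ for all small enough $t>0$.
   Context: Throughout, $\|\cdot\|$ is the Euclidean norm on $\mathbb{R}^N$ and $\mathbb{S}^{N-1}(0;t)=\{x\in\mathbb{R}^N : \|x\|=t\}$. For $Z\subset\mathbb{R}^N$ and $q,\tilde q\in Z$, the inner distance is $d_Z(q,\tilde q)=\inf\{\mathrm{Length}(\gamma)\}$, where $\gamma$ runs over rectifiable paths in $Z$ connecting $q$ to $\tilde q$ (with value $+\infty$ if there is none). For $C\ge 1$, $Z$ is $C$-LNE (Lipschitz normally embedded) if $d_Z(q,\tilde q)\le C\|q-\tilde q\|$ for all $q,\tilde q\in Z$; $Z$ is LNE if it is $C$-LNE for some $C\geq 1$. $Z$ is LNE at $0$ if there exists an open neighbourhood $U$ of $0$ such that $Z\cap U$ is LNE. $Z$ is LLNE (link Lipschitz normally embedded) at $0$ if there exist $C\geq 1$ and $\delta>0$ such that $Z\cap \mathbb{S}^{N-1}(0;t)$ is $C$-LNE for all $0<t\leq \delta$. The connected components of $X\setminus\{0\}$ as a germ at $0$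 are represented by the connected components of $(X\setminus\{0\})\cap B(0;\epsilon)$ for sufficiently small $\epsilon>0$ (finitely many, independent of small $\epsilon$ as germs), $B(0;\epsilon)$ being the open Euclidean ball. For a subset $A\subset\mathbb{R}^N$, let $\pi_0(A)$ be the collection of path-connected components of $A$. If $A$ is path-connected, $d_0(A)=1$; if $A$ is not path-connected, $d_0(A)=\inf\{d(Y,Z) : Y,Z\in\pi_0(A),\ Y\neq Z\}$, where $d(Y,Z)=\inf\{\|y-z\| : y\in Y, z\in Z\}$. *)

(* Defs.v *)
From HB Require Import structures.
From mathcomp Require Import all_boot all_order all_algebra.
From mathcomp Require Import all_classical all_reals all_analysis.
Set Implicit Arguments.
Unset Strict Implicit.
Unset Printing Implicit Defensive.
Import Order.TTheory GRing.Theory Num.Theory.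
Import numFieldNormedType.Exports.
Local Open Scope classical_set_scope.
Local Open Scope ring_scope.

Section Euclidean.
Context {R : realType} {n : nat}.
Implicit Types (x y : 'rV[R]_n) (A Z : set 'rV[R]_n) (g : R -> 'rV[R]_n).

(* The library norm on 'rV[R]_n is the sup norm; it induces the same topology
   as the Euclidean norm, so open, closed, closure, continuous and connected
   are taken from the library. *)
Definition enorm x : R := Num.sqrt (\sum_i x 0 i ^+ 2).

Definition esphere (t : R) : set 'rV[R]_n := [set x | enorm x = t].

Definition eball (e : R) : set 'rV[R]_n := [set x | enorm x < e].

Definition path_in Z x y g :=
  [/\ {within `[0, 1], continuous g}, g 0 = x, g 1 = y &
      forall t : R, t \in `[0, 1] -> Z (g t)].

(* In itv_partition 0 1 s, the sequence s omits the left endpoint 0. *)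
Definition path_length g : \bar R :=
  ereal_sup [set (\sum_(0 <= k < size s)
      enorm (g (nth 1 (0 :: s) k.+1) - g (nth 1 (0 :: s) k)))%:E
    | s in itv_partition 0 1].

Definition inner_dist Z x y : \bar R :=
  ereal_inf [set path_length g | g in
    [set g | path_in Z x y g /\ (path_length g < +oo)%E]].

Definition C_LNE (C : R) Z := forall x y, Z x -> Z y ->
  (inner_dist Z x y <= (C * enorm (x - y))%:E)%E.

Definition LNE Z := exists2 C : R, 1 <= C & C_LNE C Z.

Definition LNE_at0 Z :=
  exists U : set 'rV[R]_n, [/\ open U, U 0 & LNE (Z `&` U)].

Definition LLNE_at0 Z :=
  exists C d : R, [/\ 1 <= C, 0 < d &
    forall t : R, 0 < t <= d -> C_LNE C (Z `&` esphere t)].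

Definition path_connected A :=
  forall x y, A x -> A y -> exists g, path_in A x y g.

Definition path_component A x : set 'rV[R]_n :=
  [set y | exists g, path_in A x y g].

Definition pi0 A : set (set 'rV[R]_n) := [set path_component A x | x in A].

Definition set_dist A B : \bar R :=
  ereal_inf [set (enorm (y - z))%:E | y in A & z in B].

Definition d0 A : \bar R :=
  if `[< path_connected A >] then 1%E
  else ereal_inf [set d | exists Y Z : set 'rV[R]_n,
    [/\ pi0 A Y, pi0 A Z, Y <> Z & d = set_dist Y Z]].

Definition components_of A r (C : 'I_r -> set 'rV[R]_n) :=
  injective C /\ range C = [set connected_component A x | x in A].

(* The germs at 0 of the components of X minus the origin are represented by
   the components C_1, ..., C_r of its trace on a ball eball e which is small
   enough that shrinking the ball further only restricts these components. *)
Definition germ_components (X : set 'rV[R]_n) r (C : 'I_r -> set 'rV[R]_n) :=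
  exists e : R, [/\ 0 < e,
    components_of ((X `\ 0) `&` eball e) C &
    forall d : R, 0 < d < e ->
      components_of ((X `\ 0) `&` eball d) (fun i => C i `&` eball d)].

Definition monomial (h : 'rV[R]_n) (m : {ffun 'I_n -> nat}) : R :=
  \prod_i h 0 i ^+ m i.

(* f agrees near a with the sum of an absolutely convergent power series;
   the sum of the real family u is the difference of the sums of its positive
   and negative parts. *)
Definition analytic_at (f : 'rV[R]_n -> R) (a : 'rV[R]_n) :=
  exists c : {ffun 'I_n -> nat} -> R, \forall x \near a,
    let u := fun m => (c m * monomial (x - a) m)%:E in
    summable setT u /\
    ((f x)%:E = \esum_(m in setT) (u^\+ m) - \esum_(m in setT) (u^\- m))%E.

Definition analytic_on (U : set 'rV[R]_n) (f : 'rV[R]_n -> R) :=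
  forall a, U a -> analytic_at f a.

Definition semianalytic A :=
  forall a : 'rV[R]_n, exists U : set 'rV[R]_n, [/\ open U, U a &
    exists (p q : nat) (f : 'I_p -> 'I_q -> 'rV[R]_n -> R)
           (s : 'I_p -> 'I_q -> bool),
      (forall i j, analytic_on U (f i j)) /\
      A `&` U = [set x | U x /\ exists i, forall j,
                   if s i j then f i j x = 0 else 0 < f i j x]].

End Euclidean.

Definition subanalytic (R : realType) (n : nat) (X : set 'rV[R]_n) :=
  forall x : 'rV[R]_n, exists U : set 'rV[R]_n, [/\ open U, U x &
    exists (k : nat) (A : set 'rV[R]_(n + k)),
      [/\ semianalytic A, compact (closure A) &
          X `&` U = [set lsubmx z | z in A]]].

(* Main.v *)
(* Subanalytic sets are definable in an o-minimal structure (quantifier elimination of Denef and van den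
   Dries: Weierstrass preparation reduces an existential quantifier to the polynomial case).  From this we
   use that definable functions of one variable are monotone near 0, that a definable germ f with
   |f(t)| <= t is Lipschitz, that bounded definable families can be parametrised by definable selections,
   and that chain connected pairs of points of the sets of a definable family are joined by chains of
   uniformly bounded length.
   Consequently points of X on a sphere of radius t can be moved to nearby spheres at comparable cost.  If X
   is LNE at 0, two points of X_t at distance at most a small multiple of t are joined by a chain of a fixed
   number of steps, each at most a quarter of their distance; iterating, they are joined in X_t by a chain
   of length comparable to their distance.  Hence distinct components of X_t are separated linearly in t,
   and each X_t meets each C_i in a single component, whose inner diameter is O(t).  Conversely, moving the
   outer of two points to the sphere of the inner one reduces the LNE inequality to the links when both lie
   in the same C_i, and otherwise their distance is comparable to their norms, and they are joined through
   the origin.  Chains are turned into paths by a compactness argument. *)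

Require Import Defs.
From HB Require Import structures.
From mathcomp Require Import all_boot all_order all_algebra.
From mathcomp Require Import all_classical all_reals all_analysis.
From mathcomp Require qe_rcf_th qe_rcf.
From mathcomp Require Import ring lra zify.
Set Implicit Arguments.
Unset Strict Implicit.
Unset Printing Implicit Defensive.
Import Order.TTheory GRing.Theory Num.Theory.
Import numFieldNormedType.Exports.
Local Open Scope classical_set_scope.
Local Open Scope ring_scope.

(** * Convergent power series *)

Section RealSums.
Context {R : realType}.
Implicit Types (a b u v : nat -> R) (l M : R).

(** Paths and their lengths are not definable, whereas being a chain with a fixed number of points
    is a definable condition; hence the argument runs on chains ([chn], [conn]). Definability is
    local at each point of affine space and says nothing at infinity, so only bounded quantifiers
    preserve it; this is why sets are so often rescaled to a cube. One device replaces curve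
    selection: if a statement about the radius t fails for arbitrarily small t, tameness makes it
    fail for all small t, a definable selection of counterexamples is Lipschitz in t by [Lip_germ],
    and such a family refutes itself ([sheets], [refine_arc]). Iterated refinement on a sphere does
    not bound the length of the chains, which each round may multiply by m / 4; it bounds the ball
    in which they stay. The length comes from [fibre_diam] applied to a rescaled piece of the sphere
    ([window]). Restricted quotients enter elimination because an analytic family may vanish
    identically on one fibre; dividing by its largest coefficient in the parameters removes this
    obstacle. *)

Definition has_sum a l := forall e : R, 0 < e ->
  exists K0, forall K, (K0 <= K)%N -> `|l - \sum_(k < K) a k| <= e.

Definition tsum a : R := limn (series a).

Lemma Xle (x y : R) n : 0 <= x -> x <= y -> x ^+ n <= y ^+ n.
Proof. by move=> x0 xy; apply: lerXn2r; rewrite ?nnegrE // (le_trans x0 xy). Qed.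

Lemma has_sum_lim a l : has_sum a l <-> series a @ \oo --> l.
Proof.
split=> [H | H e e0].
  apply/cvgrPdist_le => e e0; have [K0 HK] := H e e0.
  exists K0 => // K /= K0K; rewrite seriesEnat /= big_mkord; exact: HK.
have /cvgrPdist_le /(_ e e0) [K0 _ HK] := H.
exists K0 => K K0K; have := HK K K0K; by rewrite seriesEnat /= big_mkord.
Qed.

Lemma has_sum_tsum a l : has_sum a l -> tsum a = l.
Proof. by move=> /has_sum_lim H; rewrite /tsum; exact: cvg_lim. Qed.

Lemma sum_le_mono u (u0 : forall k, 0 <= u k) K L : (K <= L)%N ->
  \sum_(k < K) u k <= \sum_(k < L) u k.
Proof.
move=> KL; rewrite -(subnKC KL) big_split_ord /= lerDl.
by apply: sumr_ge0.
Qed.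

Lemma has_sum_ex a u M : (forall k, `|a k| <= u k) ->
  (forall K, \sum_(k < K) u k <= M) -> has_sum a (tsum a).
Proof.
move=> au uM.
have u0 k : 0 <= u k by exact: le_trans (normr_ge0 _) (au k).
have cu : cvgn (series u).
  apply: nondecreasing_is_cvgn => [n m nm|].
    by rewrite !seriesEnat /= !big_mkord sum_le_mono.
  exists M => _ [n _ <-]; rewrite seriesEnat /= big_mkord; exact: uM.
apply/has_sum_lim; apply: normed_cvg; by apply: (series_le_cvg _ u0 _ cu) => //=.
Qed.

Lemma has_sum_tail a u M l : has_sum a l -> (forall k, `|a k| <= u k) ->
  (forall K, \sum_(k < K) u k <= M) ->
  forall K, `|l - \sum_(k < K) a k| <= M - \sum_(k < K) u k.
Proof.
move=> al au uM K; apply/ler_addgt0Pr => e e0.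
have [K0 HK] := al e e0.
have := HK (K + K0)%N (leq_addl _ _).
have -> : l - \sum_(k < K) a k
  = (l - \sum_(k < K + K0) a k) + \sum_(k < K0) a (K + k)%N.
  by rewrite big_split_ord /=; lra.
move=> H; apply: le_trans (ler_normD _ _) _.
have H2 : `|\sum_(k < K0) a (K + k)%N| <= \sum_(k < K0) u (K + k)%N.
  by apply: le_trans (ler_norm_sum _ _ _) _; apply: ler_sum => i _; exact: au.
have := uM (K + K0)%N; rewrite big_split_ord /=; lra.
Qed.

Lemma has_sum_norm a u M l : has_sum a l -> (forall k, `|a k| <= u k) ->
  (forall K, \sum_(k < K) u k <= M) -> `|l| <= M.
Proof.
by move=> al au uM; have := has_sum_tail al au uM 0; rewrite !big_ord0 !subr0.
Qed.

Lemma has_sumD a b l l' : has_sum a l -> has_sum b l' ->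
  has_sum (fun k => a k + b k) (l + l').
Proof.
move=> Ha Hb e e0; have e20 : 0 < e / 2 by lra.
have [K1 H1] := Ha _ e20; have [K2 H2] := Hb _ e20.
exists (maxn K1 K2) => K; rewrite geq_max => /andP[/H1 h1 /H2 h2].
rewrite big_split /= opprD addrACA.
by apply: le_trans (ler_normD _ _) _; lra.
Qed.

Lemma has_sumZ c a l : has_sum a l -> has_sum (fun k => c * a k) (c * l).
Proof.
move=> Ha e e0.
have c0 : 0 < `|c| + 1 by rewrite ltr_wpDl.
have [K1 H1] := Ha (e / (`|c| + 1)) (divr_gt0 e0 c0).
exists K1 => K /H1 h; rewrite -mulr_sumr -mulrBr normrM.
apply: le_trans (ler_wpM2l (normr_ge0 _) h) _.
rewrite mulrA ler_pdivrMr // mulrC ler_wpM2l ?ltW //; lra.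
Qed.

Lemma has_sum_sum K (a : nat -> nat -> R) (l : nat -> R) :
  (forall k, (k < K)%N -> has_sum (a k) (l k)) ->
  has_sum (fun j => \sum_(k < K) a k j) (\sum_(k < K) l k).
Proof.
elim: K => [|K IH] H.
  rewrite big_ord0 => e e0; exists 0%N => K _.
  by rewrite big1 ?subrr ?normr0 ?ltW // => i _; rewrite big_ord0.
rewrite big_ord_recr /= (_ : (fun _ => _) = (fun j => \sum_(k < K) a k j + a K j)).
  apply: has_sumD; last exact: H.
  by apply: IH => k kK; apply: H; apply: ltnW.
by apply/funext => j; rewrite big_ord_recr.
Qed.

Lemma has_sum_ge0 a l : has_sum a l -> (forall k, 0 <= a k) ->
  forall K, \sum_(k < K) a k <= l.
Proof.
move=> al a0 K; apply/ler_addgt0Pr => e e0; have [K0 H] := al e e0.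
have := H (K + K0)%N (leq_addl _ _); rewrite ler_distlC => /andP[_ h].
have := sum_le_mono a0 (leq_addr K0 K); lra.
Qed.

Lemma has_sum_le a l M : has_sum a l -> (forall K, \sum_(k < K) a k <= M) -> l <= M.
Proof.
move=> al aM; apply/ler_addgt0Pr => e e0; have [K0 H] := al e e0.
have := H K0 (leqnn _); rewrite ler_distlC => /andP[h _].
by have := aM K0; lra.
Qed.

Lemma has_sum_finsupp a n : (forall k, (n <= k)%N -> a k = 0) ->
  has_sum a (\sum_(k < n) a k).
Proof.
move=> H e e0; exists n => K nK.
rewrite -(subnKC nK) big_split_ord /= opprD addrA subrr sub0r normrN.
by rewrite big1 ?normr0 ?ltW // => i _; apply: H; exact: leq_addr.
Qed.

Definition conv (A : pzSemiRingType) (f g : nat -> A) (k : nat) : A :=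
  \sum_(i < k.+1) f i * g (k - i)%N.

(** A coefficient of a product involves finitely many others, so the ring laws of formal series can
    be read off from those of polynomials. *)
Lemma conv_poly (A : nzSemiRingType) (f g : nat -> A) K k : (k < K)%N ->
  conv f g k = ((\poly_(i < K) f i) * (\poly_(i < K) g i))`_k.
Proof.
move=> kK; rewrite coefM; apply: eq_bigr => i _; rewrite !coef_poly.
have iK : (i < K)%N by apply: leq_ltn_trans kK; rewrite -ltnS.
by rewrite iK (leq_ltn_trans (leq_subr _ _) kK).
Qed.

Lemma sum_conv a b K : \sum_(k < K) conv a b k =
  \sum_(i < K) \sum_(j < K | (i + j < K)%N) a i * b j.
Proof.
transitivity (\sum_(k < K) \sum_(i < K | (i < k.+1)%N) a i * b (k - i)%N).
  apply: eq_bigr => k _.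
  by rewrite /conv (big_ord_widen_cond K xpredT (fun i => a i * b (k - i)%N)).
rewrite (exchange_big_dep xpredT) //=; apply: eq_bigr => i _.
rewrite (reindex_onto (fun j : 'I_K => insubd j (i + j)%N)
   (fun k : 'I_K => insubd k (k - i)%N)) /=; last first.
  move=> k; rewrite ltnS => ik; apply/val_inj; rewrite /= !val_insubd.
  have ki : (k - i < K)%N by apply: leq_ltn_trans (leq_subr _ _) (ltn_ord k).
  by rewrite ki subnKC // ltn_ord.
rewrite big_mkcond [RHS]big_mkcond /=; apply: eq_bigr => j _.
rewrite val_insubd; case: (ltnP (i + j) K) => ijK; last first.
  case: ifP => // /andP[h1 /eqP h2].
  have := congr1 val h2; rewrite !val_insubd.
  have -> : (i + j < K)%N = false by rewrite ltnNge ijK.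
  rewrite (leq_ltn_trans (leq_subr _ _) (ltn_ord j)) => h4.
  have h1' : (i <= j)%N := h1.
  have h4' : (j - i)%N = j := h4.
  have i0 : (i:nat) = 0%N by lia.
  by have := ltn_ord j; move: ijK; rewrite i0; lia.
rewrite ltnS leq_addr /= (_ : insubd _ _ == j).
  by rewrite addKn.
by apply/eqP/val_inj; rewrite /= !val_insubd ijK addKn ltn_ord.
Qed.

Lemma sum_conv_le u v (u0 : forall k, 0 <= u k) (v0 : forall k, 0 <= v k) K :
  \sum_(k < K) conv u v k <= (\sum_(k < K) u k) * (\sum_(k < K) v k).
Proof.
rewrite sum_conv big_distrlr /=; apply: ler_sum => i _.
rewrite big_mkcond /=; apply: ler_sum => j _; case: ifP => // _; exact: mulr_ge0.
Qed.

(** The square of indices below h lies in the triangle i + j < K. *)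
Lemma sum_conv_ge u v (u0 : forall k, 0 <= u k) (v0 : forall k, 0 <= v k) h K :
  (h + h <= K)%N ->
  (\sum_(k < h) u k) * (\sum_(k < h) v k) <= \sum_(k < K) conv u v k.
Proof.
move=> hK; rewrite sum_conv big_distrlr /=.
have hK' : (h <= K)%N by lia.
rewrite (big_ord_widen K (fun i => \sum_(j < h) u i * v j) hK') /= big_mkcond /=.
apply: ler_sum => i _; case: ifP => ih; last first.
  by apply: sumr_ge0 => j _; exact: mulr_ge0.
rewrite (big_ord_widen K (fun j => u i * v j) hK') /= big_mkcond [leRHS]big_mkcond /=.
apply: ler_sum => j _; case: ifP => jh; last by case: ifP => // _; exact: mulr_ge0.
by rewrite (_ : (i + j < K)%N) //; apply: leq_trans hK; move: ih jh; lia.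
Qed.

(** The gap between the product of partial sums and the partial sum of the Cauchy product is at most
    the same gap for the majorants u, v. By [sum_conv_ge] the latter is at most U K * V K - U h * V
    h, which is small since both series of majorants converge. *)
Lemma has_sum_conv a b u v M N l l' : has_sum a l -> has_sum b l' ->
  (forall k, `|a k| <= u k) -> (forall k, `|b k| <= v k) ->
  (forall K, \sum_(k < K) u k <= M) -> (forall K, \sum_(k < K) v k <= N) ->
  has_sum (conv a b) (l * l').
Proof.
move=> al bl au bv uM vN.
have u0 k : 0 <= u k by exact: le_trans (normr_ge0 _) (au k).
have v0 k : 0 <= v k by exact: le_trans (normr_ge0 _) (bv k).
pose A K := \sum_(k < K) a k; pose B K := \sum_(k < K) b k.
pose U K := \sum_(k < K) u k; pose V K := \sum_(k < K) v k.
have [Us HU] : exists Us, has_sum u Us.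
  by eexists; apply: has_sum_ex uM => k; rewrite ger0_norm.
have [Vs HV] : exists Vs, has_sum v Vs.
  by eexists; apply: has_sum_ex vN => k; rewrite ger0_norm.
have M0 : 0 <= M by have := uM 0%N; rewrite big_ord0.
have N0 : 0 <= N by have := vN 0%N; rewrite big_ord0.
(* The error terms below add up to at most 2 (M + N) d. *)
move=> e e0; pose d := e / (2 * (M + N + 1)).
have MN : 0 < 2 * (M + N + 1) by lra.
have d0 : 0 < d by apply: divr_gt0.
have de : d * (2 * (M + N + 1)) = e by rewrite divfK // gt_eqF.
have [K1 H1] := HU d d0; have [K2 H2] := HV d d0.
pose h := maxn K1 K2; exists (h + h)%N => K hK.
have hK' : (h <= K)%N by lia.
have tA : `|l - A K| <= d.
  have := has_sum_tail al au (has_sum_ge0 HU u0) K.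
  have := H1 K (leq_trans (leq_maxl _ _) hK'); rewrite ler_norml -/(U K) -/(A K) => /andP[_ q]; lra.
have tB : `|l' - B K| <= d.
  have := has_sum_tail bl bv (has_sum_ge0 HV v0) K.
  have := H2 K (leq_trans (leq_maxr _ _) hK'); rewrite ler_norml -/(V K) -/(B K) => /andP[_ q]; lra.
have diff : `|A K * B K - \sum_(k < K) conv a b k| <= U K * V K - \sum_(k < K) conv u v k.
  rewrite !sum_conv !big_distrlr /= -!sumrB.
  apply: le_trans (ler_norm_sum _ _ _) _; apply: ler_sum => i _.
  rewrite (bigID (fun j : 'I_K => (i + j < K)%N)) /= addrC addrK.
  rewrite [X in _ <= X - _](bigID (fun j : 'I_K => (i + j < K)%N)) /= [X in _ <= X - _]addrC addrK.
  apply: le_trans (ler_norm_sum _ _ _) _; apply: ler_sum => j _.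
  by rewrite normrM ler_pM.
have Uh : U h <= U K by exact: sum_le_mono.
have Vh : V h <= V K by exact: sum_le_mono.
have h1 : U K - U h <= d.
  have := H1 h (leq_maxl _ _); rewrite ler_norml -/(U h) => /andP[_ q].
  have := has_sum_ge0 HU u0 K; rewrite -/(U K); lra.
have h2 : V K - V h <= d.
  have := H2 h (leq_maxr _ _); rewrite ler_norml -/(V h) => /andP[_ q].
  have := has_sum_ge0 HV v0 K; rewrite -/(V K); lra.
have W := sum_conv_ge u0 v0 hK; rewrite -/(U h) -/(V h) in W.
have UM := uM K; have VN := vN K; rewrite -/(U K) -/(V K) in UM VN.
have U0 : 0 <= U h by apply: sumr_ge0.
have V0 : 0 <= V h by apply: sumr_ge0.
have lM : `|l| <= M by exact: has_sum_norm al au uM.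
have BN : `|B K| <= N.
  apply: le_trans (vN K); apply: le_trans (ler_norm_sum _ _ _) _; apply: ler_sum => i _; exact: bv.
have -> : l * l' - \sum_(k < K) conv a b k =
   l * (l' - B K) + (l - A K) * B K + (A K * B K - \sum_(k < K) conv a b k) by ring.
apply: le_trans (ler_normD _ _) _.
apply: le_trans (lerD (ler_normD _ _) (lexx _)) _; rewrite !normrM.
have q1 : `|l| * `|l' - B K| <= M * d by apply: ler_pM.
have q2 : `|l - A K| * `|B K| <= d * N by apply: ler_pM.
have q3 : U K * V K - U h * V h <= M * d + d * N by nra.
nra.
Qed.

End RealSums.

(** * The ring of formal power series in one variable *)

Section FormalSeries.

Definition fps (A : Type) : Type := nat -> A.

HB.instance Definition _ (A : nzRingType) := GRing.Zmodule.copy (fps A) (nat -> A).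

Variable A : comNzRingType.
Implicit Types f g h : fps A.

Let one : fps A := fun k => (k == 0%N)%:R.
Let mul f g : fps A := conv f g.

Let coef_conv f g k K : (k < K)%N ->
  mul f g k = ((\poly_(i < K) f i) * (\poly_(i < K) g i))`_k.
Proof. exact: conv_poly. Qed.

Let mulC : commutative mul.
Proof. by move=> f g; apply/funext => k; rewrite !(@coef_conv _ _ _ k.+1) // mulrC. Qed.

Let mulA : associative mul.
Proof.
move=> f g h; apply/funext => k; set P := fun f : fps A => \poly_(i < k.+1) f i.
transitivity ((P f * (P g * P h))`_k).
  rewrite coefM /mul /conv; apply: eq_bigr => i _.
  rewrite coef_poly ltn_ord -/(conv g h (k - i)); congr (_ * _).
  by rewrite (@conv_poly _ _ _ k.+1) // ltnS leq_subr.
rewrite mulrA coefM /mul /conv; apply: eq_bigr => i _.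
rewrite coef_poly ltnS leq_subr -/(conv f g i); congr (_ * _).
by rewrite (@conv_poly _ _ _ k.+1).
Qed.

Let mul1 : left_id one mul.
Proof.
move=> f; apply/funext => k; rewrite /mul /conv big_ord_recl /one eqxx mul1r subn0.
by rewrite big1 ?addr0 // => i _; rewrite mul0r.
Qed.

Let mulDl : left_distributive mul +%R.
Proof.
move=> f g h; apply/funext => k; rewrite /mul /conv.
rewrite [RHS](_ : _ = conv f h k + conv g h k) // /conv -big_split /=.
by apply: eq_bigr => i _; rewrite -mulrDl.
Qed.

Let oneN0 : one != 0.
Proof.
apply/eqP => /(congr1 (fun f => f 0%N)); rewrite /one eqxx /= => /eqP.
by rewrite (negPf (oner_neq0 _)).
Qed.

HB.instance Definition _ :=
  GRing.Zmodule_isComNzRing.Build (fps A) mulA mulC mul1 mulDl oneN0.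

End FormalSeries.

Lemma fpsME (A : comNzRingType) (f g : fps A) k : (f * g) k = conv f g k.
Proof. by []. Qed.
Lemma fpsDE (A : comNzRingType) (f g : fps A) k : (f + g) k = f k + g k.
Proof. by []. Qed.
Lemma fpsNE (A : comNzRingType) (f : fps A) k : (- f) k = - f k.
Proof. by []. Qed.
Lemma fps0E (A : comNzRingType) k : (0 : fps A) k = 0.
Proof. by []. Qed.
Lemma fps1E (A : comNzRingType) k : (1 : fps A) k = (k == 0%N)%:R.
Proof. by []. Qed.
Lemma fps_sumE (A : comNzRingType) (I : Type) (s : seq I) P (F : I -> fps A) k :
  (\sum_(i <- s | P i) F i) k = \sum_(i <- s | P i) F i k.
Proof. by apply: (big_morph (fun f : fps A => f k)). Qed.

Definition fpsC (A : comNzRingType) (a : A) : fps A := fun k => if k is 0%N then a else 0.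
Definition fpsX (A : comNzRingType) n : fps A := fun k => (k == n)%:R.

Lemma fpsCM (A : comNzRingType) (a : A) (f : fps A) k : (fpsC a * f) k = a * f k.
Proof.
rewrite fpsME /conv big_ord_recl /= subn0 big1 ?addr0 // => i _.
by rewrite mul0r.
Qed.

Lemma fpsXM (A : comNzRingType) n (f : fps A) k :
  (fpsX A n * f) k = if (n <= k)%N then f (k - n)%N else 0.
Proof.
rewrite fpsME /conv; case: ifP => nk.
  have nk' : (n < k.+1)%N by rewrite ltnS.
  rewrite (bigD1 (Ordinal nk')) //= /fpsX eqxx mul1r big1 ?addr0 // => i ni.
  rewrite (_ : (i : nat) == n = false) ?mul0r //.
  by apply/negbTE; apply: contraNneq ni => h; apply/eqP/val_inj.
rewrite big1 // => i _; rewrite /fpsX (_ : (i : nat) == n = false) ?mul0r //.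
by apply/eqP => h; move: (ltn_ord i); rewrite h ltnS nk.
Qed.

(** * Iterated power series: norms, values, substitution, analytic germs *)

Section PowerSeries.
Context {R : realType}.
Local Notation env := (nat -> R).

(* Power series in the variables of index less than [m]; the sequence of a series in
   [PSr m.+1] lists its coefficients with respect to the last variable, of index [m]. *)
Fixpoint PSr (m : nat) : comNzRingType :=
  if m is m'.+1 then (fps (PSr m') : comNzRingType) else (R : comNzRingType).

(* [nrm r c M]: the l^1 norm of [c] with weights the powers of the radii [r] is at most [M]. *)
Fixpoint nrm (m : nat) (r : env) : PSr m -> R -> Prop :=
  match m return PSr m -> R -> Prop with
  | 0 => fun c M => `|c : R| <= M
  | m'.+1 => fun c M => exists mu : nat -> R, (forall k, nrm r (c k) (mu k)) /\
       forall K, \sum_(k < K) mu k * r m' ^+ k <= M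
  end.

(** An iterated sum, the last variable outermost. It is meaningful on a box on which [nrm] gives a
    bound; elsewhere [tsum] may be a default value of the limit. *)
Fixpoint ev (m : nat) : PSr m -> env -> R :=
  match m return PSr m -> env -> R with
  | 0 => fun c _ => c
  | m'.+1 => fun c e => tsum (fun k => ev (c k) e * e m' ^+ k)
  end.

Definition pos (r : env) := forall i, 0 < r i.
Definition inbox m (r e : env) := forall i, (i < m)%N -> `|e i| <= r i.

Lemma inboxS m r e : inbox m.+1 r e -> inbox m r e.
Proof. by move=> H i im; apply: H; apply: ltnW. Qed.

Section Nrm.
Variable r : env.
Hypothesis r0 : pos r.

Lemma nrm_ge0 m (c : PSr m) M : nrm r c M -> 0 <= M.
Proof.
case: m c => [|m] c /=; first by exact: le_trans.
by move=> [mu [_ /(_ 0%N)]]; rewrite big_ord0.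
Qed.

Lemma nrm_le m (c : PSr m) M M' : M <= M' -> nrm r c M -> nrm r c M'.
Proof.
case: m c => [|m] c /= MM'; first by move/le_trans; apply.
by move=> [mu [h1 h2]]; exists mu; split=> // K; apply: le_trans (h2 K) MM'.
Qed.

Lemma nrm0 m : nrm r (0 : PSr m) 0.
Proof.
elim: m => [|m IH] /=; first by rewrite normr0.
by exists (fun=> 0); split=> // K; rewrite big1 // => i _; rewrite mul0r.
Qed.

Lemma nrmD m (c d : PSr m) M N : nrm r c M -> nrm r d N -> nrm r (c + d) (M + N).
Proof.
elim: m c d M N => [|m IH] c d M N /=.
  by move=> h1 h2; apply: le_trans (ler_normD _ _) (lerD h1 h2).
move=> [mu [h1 h2]] [nu [h3 h4]]; exists (fun k => mu k + nu k); split=> [k|K].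
  exact: IH.
under eq_bigr do rewrite mulrDl; rewrite big_split; exact: lerD.
Qed.

Lemma nrmN m (c : PSr m) M : nrm r c M -> nrm r (- c) M.
Proof.
elim: m c M => [|m IH] c M /=; first by rewrite normrN.
by move=> [mu [h1 h2]]; exists mu; split=> // k; apply: IH.
Qed.

Lemma nrmB m (c d : PSr m) M N : nrm r c M -> nrm r d N -> nrm r (c - d) (M + N).
Proof. by move=> h1 h2; apply: nrmD => //; apply: nrmN. Qed.

Lemma nrm_sum m (I : Type) (s : seq I) (P : pred I) (c : I -> PSr m) M :
  (forall i, P i -> nrm r (c i) (M i)) ->
  nrm r (\sum_(i <- s | P i) c i) (\sum_(i <- s | P i) M i).
Proof.
move=> H; elim: s => [|i s IH]; first by rewrite !big_nil; exact: nrm0.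
by rewrite !big_cons; case: ifP => // Pi; apply: nrmD => //; apply: H.
Qed.

Lemma nrmM m (c d : PSr m) M N : nrm r c M -> nrm r d N -> nrm r (c * d) (M * N).
Proof.
elim: m c d M N => [|m IH] c d M N /=; first by move=> h1 h2; rewrite normrM ler_pM.
move=> [mu [h1 h2]] [nu [h3 h4]]; exists (conv mu nu); split=> [k|K].
  by rewrite fpsME /conv; apply: nrm_sum => i _; apply: IH.
have mu0 k : 0 <= mu k * r m ^+ k.
  by rewrite mulr_ge0 ?(nrm_ge0 (h1 k)) // exprn_ge0 // ltW.
have nu0 k : 0 <= nu k * r m ^+ k.
  by rewrite mulr_ge0 ?(nrm_ge0 (h3 k)) // exprn_ge0 // ltW.
have N0 : 0 <= N by have := h4 0%N; rewrite big_ord0.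
have -> : \sum_(k < K) conv mu nu k * r m ^+ k =
   \sum_(k < K) conv (fun k => mu k * r m ^+ k) (fun k => nu k * r m ^+ k) k.
  apply: eq_bigr => k _; rewrite /conv mulr_suml; apply: eq_bigr => i _.
  have ik : (i <= k)%N by rewrite -ltnS.
  have -> : r m ^+ k = r m ^+ i * r m ^+ (k - i) by rewrite -exprD subnKC.
  by ring.
apply: le_trans (sum_conv_le mu0 nu0 K) _.
have A0 : 0 <= \sum_(k < K) mu k * r m ^+ k by apply: sumr_ge0.
have B0 : 0 <= \sum_(k < K) nu k * r m ^+ k by apply: sumr_ge0.
exact: (ler_pM A0 B0 (h2 K) (h4 K)).
Qed.

Lemma nrm_ext m (r' : env) (c : PSr m) M :
  (forall i, (i < m)%N -> 0 <= r' i <= r i) -> nrm r c M -> nrm r' c M.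
Proof.
elim: m c M => [|m IH] c M //= H [mu [h1 h2]].
exists mu; split=> [k|K].
  by apply: IH => // i im; apply: H; apply: ltnW.
apply: le_trans (h2 K); apply: ler_sum => k _; apply: ler_wpM2l.
  exact: nrm_ge0 (h1 k).
have /andP[a b] := H m (ltnSn m).
by apply: lerXn2r; rewrite ?nnegrE // (le_trans a b).
Qed.

Lemma nrm_C m (c : PSr m) M : nrm r c M -> nrm r (fpsC c : PSr m.+1) M.
Proof.
move=> H; exists (fun k => if k is 0%N then M else 0); split=> [[|k]|[|K]] //=.
- exact: nrm0.
- by rewrite big_ord0; exact: nrm_ge0 H.
- by rewrite big_ord_recl mulr1 big1 ?addr0 // => i _; rewrite mul0r.
Qed.

Lemma nrm1 m : nrm r (1 : PSr m) 1.
Proof.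
elim: m => [|m IH]; first by rewrite /= normr1.
suff -> : (1 : PSr m.+1) = fpsC (1 : PSr m) by exact: nrm_C.
by apply/funext => -[|k].
Qed.

Lemma nrm_X m n : nrm r (fpsX (PSr m) n : PSr m.+1) (r m ^+ n).
Proof.
exists (fun k => (k == n)%:R); split=> [k|K].
  by rewrite /fpsX; case: eqP => _; [exact: nrm1|exact: nrm0].
case: (ltnP n K) => nK.
  rewrite (bigD1 (Ordinal nK)) //= eqxx mul1r big1 ?addr0 // => i /negbTE ni.
  by rewrite (_ : (i : nat) == n = false) ?mul0r // -ni.
rewrite big1 ?exprn_ge0 ?ltW // => i _; rewrite (_ : (i : nat) == n = false) ?mul0r //.
by apply/eqP => h; move: (ltn_ord i); lia.
Qed.

(** Completeness of the weighted l^1 space, with an explicit bound on the tails. Both the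
    substitution of series and the iteration in Weierstrass division are summed by it. *)
Lemma nrm_series m (c : nat -> PSr m) (M : nat -> R) B :
  (forall j, nrm r (c j) (M j)) -> (forall J, \sum_(j < J) M j <= B) ->
  exists s, forall J, nrm r (s - \sum_(j < J) c j) (B - \sum_(j < J) M j).
Proof.
elim: m c M B => [|m IH] c M B cM MB.
  exists (tsum (c : nat -> R)) => J /=.
  exact: (has_sum_tail (has_sum_ex cM MB) cM MB).
have /choice[mu Hmu] : forall j, exists mu : nat -> R,
  (forall k, nrm r (c j k) (mu k)) /\ forall K, \sum_(k < K) mu k * r m ^+ k <= M j.
  by move=> j; have [mu ?] := cM j; exists mu.
have mu0 j k : 0 <= mu j k by exact: nrm_ge0 ((Hmu j).1 k).
have rk0 k : 0 < r m ^+ k by exact: exprn_gt0.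
have muM j k : mu j k * r m ^+ k <= M j.
  have := (Hmu j).2 k.+1; rewrite big_ord_recr /=.
  have : 0 <= \sum_(i < k) mu j i * r m ^+ i.
    by apply: sumr_ge0 => i _; rewrite mulr_ge0 // ltW.
  lra.
pose b k := tsum (fun j => mu j k).
have hb k : has_sum (fun j => mu j k) (b k).
  apply: (@has_sum_ex _ _ (fun j => mu j k) (B / r m ^+ k)) => [j|J].
    by rewrite ger0_norm.
  rewrite ler_pdivlMr // mulr_suml; apply: le_trans (MB J); exact: ler_sum.
have bJ k J : \sum_(j < J) mu j k <= b k
  by exact: (has_sum_ge0 (hb k) (fun j => mu0 j k) J).
have /choice[s Hs] : forall k, exists s, forall J,
   nrm r (s - \sum_(j < J) c j k) (b k - \sum_(j < J) mu j k).
  move=> k; apply: (IH (fun j => c j k) (fun j => mu j k) (b k)) => // j.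
  exact: (Hmu j).1.
exists s => J; exists (fun k => b k - \sum_(j < J) mu j k); split=> [k|K].
  by rewrite fpsDE fpsNE fps_sumE.
pose F j := \sum_(k < K) mu (J + j)%N k * r m ^+ k.
have HF : has_sum F (\sum_(k < K) (b k - \sum_(j < J) mu j k) * r m ^+ k).
  rewrite /F; refine (@has_sum_sum _ K (fun k j => mu (J + j)%N k * r m ^+ k) (fun k => (b k - \sum_(j < J) mu j k) * r m ^+ k) _) => k _.
  have hK : has_sum (fun j => r m ^+ k * mu (J + j)%N k) (r m ^+ k * (b k - \sum_(j < J) mu j k)).
    apply: has_sumZ => e e0; have [K0 HK0] := hb k e e0.
    exists K0 => L K0L; have := HK0 (J + L)%N (leq_trans K0L (leq_addl _ _)).
    by rewrite big_split_ord /= opprD addrA.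
  rewrite mulrC (_ : (fun _ => _) = (fun j => r m ^+ k * mu (J + j)%N k)) //.
  by apply/funext => j; rewrite mulrC.
apply: (has_sum_le HF) => L; rewrite lerBrDr addrC.
apply: le_trans (MB (J + L)%N); rewrite big_split_ord /= lerD2l.
by apply: ler_sum => j _; exact: (Hmu _).2.
Qed.

End Nrm.

Section Eval.
Variable r : env.
Hypothesis r0 : pos r.

Lemma ev_ext m (c : PSr m) (e e' : env) :
  (forall i, (i < m)%N -> e i = e' i) -> ev c e = ev c e'.
Proof.
elim: m c => [|m IH] c //= H; rewrite (H m) //; congr tsum; apply/funext => k.
by rewrite (IH (c k)) // => i im; apply: H; apply: ltnW.
Qed.

Lemma ev_bound m (c : PSr m) M (e : env) : nrm r c M -> inbox m r e ->
  `|ev c e| <= M.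
Proof.
elim: m c M => [|m IH] c M //= [mu [h1 h2]] He.
have h k : `|ev (c k) e * e m ^+ k| <= mu k * r m ^+ k.
  rewrite normrM normrX; apply: ler_pM; rewrite ?exprn_ge0 //.
    by apply: IH => //; apply: inboxS.
  by apply: lerXn2r; rewrite ?nnegrE ?(ltW (r0 m)) //; apply: He.
exact: has_sum_norm (has_sum_ex h h2) h h2.
Qed.

Lemma ev_term m (c : PSr m.+1) M (e : env) : nrm r c M -> inbox m.+1 r e ->
  exists u : nat -> R, (forall k, `|ev (c k) e * e m ^+ k| <= u k) /\
     forall K, \sum_(k < K) u k <= M.
Proof.
move=> [mu [h1 h2]] He; exists (fun k => mu k * r m ^+ k); split=> // k.
rewrite normrM normrX; apply: ler_pM; rewrite ?exprn_ge0 //.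
  by apply: ev_bound (h1 k) _; apply: inboxS.
by apply: lerXn2r; rewrite ?nnegrE ?(ltW (r0 m)) //; apply: He.
Qed.

Lemma ev_sum m (c : PSr m.+1) M (e : env) : nrm r c M -> inbox m.+1 r e ->
  has_sum (fun k => ev (c k) e * e m ^+ k) (ev c e).
Proof. by move=> h He; have [u [h1 h2]] := ev_term h He; exact: has_sum_ex h1 h2. Qed.

Lemma evC m (c : PSr m) M e : nrm r c M -> inbox m r e ->
  ev (fpsC c : PSr m.+1) e = ev c e.
Proof.
move=> h He /=; apply: has_sum_tsum.
have ev0 : forall n, ev (0 : PSr n) e = 0.
  elim=> [|n IHn] //=; apply: has_sum_tsum.
  rewrite (_ : (fun _ => _) = fun=> 0); last by apply/funext => k; rewrite fps0E IHn mul0r.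
  by move=> d d0; exists 0%N => K _; rewrite big1 // subrr normr0 ltW.
have := @has_sum_finsupp R (fun k => ev ((fpsC c : fps _) k) e * e m ^+ k) 1.
rewrite big_ord1 /= mulr1; apply => -[|k] // _.
by rewrite /= ev0 mul0r.
Qed.

Lemma ev0 m e : ev (0 : PSr m) e = 0.
Proof.
elim: m => [|n IHn] //=; apply: has_sum_tsum.
rewrite (_ : (fun _ => _) = fun=> 0); last by apply/funext => k; rewrite fps0E IHn mul0r.
by move=> d d0; exists 0%N => K _; rewrite big1 // subrr normr0 ltW.
Qed.

Lemma ev1 m e : ev (1 : PSr m) e = 1.
Proof.
elim: m => [|n IHn] //=; apply: has_sum_tsum.
have := @has_sum_finsupp R (fun k => ev ((1 : fps (PSr n)) k) e * e n ^+ k) 1.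
rewrite big_ord1 /= mulr1 fps1E eqxx IHn; apply => -[|k] // _.
by rewrite fps1E /= ev0 mul0r.
Qed.

Lemma evX m n e : ev (fpsX (PSr m) n : PSr m.+1) e = e m ^+ n.
Proof.
apply: has_sum_tsum.
have E1 : ev (fpsX (PSr m) n n) e = 1 by rewrite /fpsX eqxx ev1.
have E0 k : k != n -> ev (fpsX (PSr m) n k) e = 0.
  by move=> /negbTE kn; rewrite /fpsX kn ev0.
have h := @has_sum_finsupp R (fun k => ev ((fpsX (PSr m) n) k) e * e m ^+ k) n.+1.
move: h; rewrite big_ord_recr /= E1 mul1r big1 ?add0r; last first.
  by move=> i _; rewrite E0 ?mul0r // neq_ltn ltn_ord.
by apply=> k nk; rewrite E0 ?mul0r // gtn_eqF.
Qed.

Lemma evD m (c d : PSr m) M N e : nrm r c M -> nrm r d N -> inbox m r e ->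
  ev (c + d) e = ev c e + ev d e.
Proof.
elim: m c d M N => [|m IH] c d M N //= hc hd He.
have /(has_sumD (ev_sum hc He)) h := ev_sum hd He.
apply: has_sum_tsum; move: h; congr has_sum; apply/funext => k.
have [mu [h1 _]] := hc; have [nu [h3 _]] := hd.
by rewrite fpsDE (IH _ _ _ _ (h1 k) (h3 k) (inboxS He)) mulrDl.
Qed.

Lemma evN m (c : PSr m) M e : nrm r c M -> inbox m r e -> ev (- c) e = - ev c e.
Proof.
elim: m c M => [|m IH] c M //= hc He.
have /(has_sumZ (-1)) h := ev_sum hc He.
apply: has_sum_tsum; move: h; rewrite mulN1r; congr has_sum; apply/funext => k.
have [mu [h1 _]] := hc.
by rewrite fpsNE (IH _ _ (h1 k) (inboxS He)) mulN1r mulNr.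
Qed.

Lemma evB m (c d : PSr m) M N e : nrm r c M -> nrm r d N -> inbox m r e ->
  ev (c - d) e = ev c e - ev d e.
Proof.
by move=> hc hd He; rewrite (evD hc (nrmN hd) He) (evN hd He).
Qed.

Lemma ev_sumr m (I : Type) (s : seq I) (P : pred I) (c : I -> PSr m) M e :
  (forall i, P i -> nrm r (c i) (M i)) -> inbox m r e ->
  ev (\sum_(i <- s | P i) c i) e = \sum_(i <- s | P i) ev (c i) e.
Proof.
move=> h He; elim: s => [|i s IH]; first by rewrite !big_nil ev0.
rewrite !big_cons; case: ifP => // Pi.
by rewrite (evD (h i Pi) (nrm_sum s h) He) IH.
Qed.

Lemma evM m (c d : PSr m) M N e : nrm r c M -> nrm r d N -> inbox m r e ->
  ev (c * d) e = ev c e * ev d e.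
Proof.
elim: m c d M N => [|m IH] c d M N //= hc hd He.
have [u [u1 u2]] := ev_term hc He; have [v [v1 v2]] := ev_term hd He.
have h := has_sum_conv (ev_sum hc He) (ev_sum hd He) u1 v1 u2 v2.
apply: has_sum_tsum; move: h; congr has_sum; apply/funext => k.
have [mu [h1 _]] := hc; have [nu [h3 _]] := hd.
rewrite fpsME /conv (ev_sumr _ (M := fun i : 'I_k.+1 => mu i * nu (k - i)%N)).
- rewrite mulr_suml; apply: eq_bigr => i _.
  rewrite (IH _ _ _ _ (h1 i) (h3 _) (inboxS He)).
  have ik : (i <= k)%N by rewrite -ltnS.
  have -> : e m ^+ k = e m ^+ i * e m ^+ (k - i) by rewrite -exprD subnKC.
  by ring.
- by move=> i _; apply: nrmM.
- exact: inboxS.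
Qed.

End Eval.

(** The first nonzero coefficient would dominate near 0. Once the lower ones vanish, comparing s ^+
    j with (s / r) ^+ k.+1 * r ^+ j for j > k yields [|a k| <= C * s] for all small s, with C = M /
    r ^+ k.+1. *)
Lemma ps_coef_zero (a u : nat -> R) (r M d : R) : 0 < r -> 0 < d ->
  (forall k, `|a k| <= u k) -> (forall K, \sum_(k < K) u k * r ^+ k <= M) ->
  (forall s, 0 < s <= d -> tsum (fun k => a k * s ^+ k) = 0) -> forall k, a k = 0.
Proof.
move=> r0 d0 au uM H k; elim/ltn_ind: k => k IH.
have u0 j : 0 <= u j by exact: le_trans (normr_ge0 _) (au j).
apply/eqP; rewrite -normr_eq0; apply/eqP/le_anti; rewrite normr_ge0 andbT.
pose C := M / r ^+ k.+1.
have rk : 0 < r ^+ k.+1 by exact: exprn_gt0.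
have M0 : 0 <= M by have := uM 0%N; rewrite big_ord0.
have C0 : 0 <= C by apply: divr_ge0 => //; apply: ltW.
have key s : 0 < s -> s <= d -> s <= r -> `|a k| <= C * s.
  move=> s0 sd sr.
  have sk : 0 < s ^+ k by exact: exprn_gt0.
  have bnd j : `|a j * s ^+ j| <= u j * s ^+ j.
    by rewrite normrM (ger0_norm (exprn_ge0 _ (ltW s0))) ler_wpM2r // exprn_ge0 // ltW.
  have le_s K : \sum_(j < K) u j * s ^+ j <= M.
    apply: le_trans (uM K); apply: ler_sum => j _; apply: ler_wpM2l => //.
    by apply: Xle => //; apply: ltW.
  have hs := has_sum_ex bnd le_s; rewrite H ?s0 // in hs.
  have tl L : \sum_(j < L) u (k.+1 + j)%N * s ^+ (k.+1 + j) <= C * s * s ^+ k.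
    have -> : C * s * s ^+ k = (s / r) ^+ k.+1 * M.
      by rewrite expr_div_n /C [s ^+ k.+1]exprS; set x := (_)^-1; ring.
    have -> : \sum_(j < L) u (k.+1 + j)%N * s ^+ (k.+1 + j) =
       \sum_(j < L) (s / r) ^+ k.+1 * (u (k.+1 + j)%N * (r ^+ k.+1 * s ^+ j)).
      apply: eq_bigr => j _; rewrite expr_div_n exprD.
      set y := r ^+ k.+1; set x := s ^+ k.+1; set z := s ^+ j; field.
      by rewrite gt_eqF.
    rewrite -mulr_sumr; apply: ler_wpM2l; first by rewrite exprn_ge0 // divr_ge0 // ltW.
    apply: le_trans (uM (k.+1 + L)%N); rewrite [leRHS]big_split_ord /=.
    rewrite -[leLHS]add0r; apply: lerD.
      by apply: sumr_ge0 => j _; rewrite mulr_ge0 // exprn_ge0 // ltW.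
    apply: ler_sum => j _; rewrite exprD; apply: ler_wpM2l => //.
    by apply: ler_wpM2l; [apply: ltW | apply: Xle => //; apply: ltW].
  have : `|a k| * s ^+ k <= C * s * s ^+ k; last by rewrite ler_pM2r.
  apply/ler_addgt0Pr => e e0; have [K0 HK] := hs e e0.
  have := HK (k.+1 + K0)%N (leq_addl _ _); rewrite sub0r normrN big_split_ord /=.
  rewrite big_ord_recr /= big1 ?add0r; last by move=> i _; rewrite IH ?mul0r.
  have : `|\sum_(i < K0) a (k.+1 + i)%N * s ^+ (k.+1 + i)| <= C * s * s ^+ k.
    apply: le_trans (ler_norm_sum _ _ _) _; apply: le_trans (tl K0); exact: ler_sum.
  set y := \sum_(i < K0) _ => hy hxy.
  have -> : `|a k| * s ^+ k = `|(a k * s ^+ k + y) - y|.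
    by rewrite addrK normrM (ger0_norm (ltW sk)).
  by apply: le_trans (ler_normB _ _) _; lra.
apply/ler_addgt0Pr => e e0; rewrite add0r.
pose s := Num.min (Num.min d r) (e / (C + 1)).
have C1 : 0 < C + 1 by lra.
have s0 : 0 < s by rewrite !lt_min d0 r0 divr_gt0.
have sd : s <= d by rewrite !ge_min lexx.
have sr : s <= r by rewrite !ge_min lexx orbT.
have se : s * (C + 1) <= e by rewrite -ler_pdivlMr // !ge_min lexx orbT.
by have := key s s0 sd sr; nra.
Qed.

Lemma nrmSP m r (c : PSr m.+1) M : nrm r c M -> exists mu : nat -> R,
  (forall k, nrm r (c k : PSr m) (mu k)) /\ forall K, \sum_(k < K) mu k * r m ^+ k <= M.
Proof. by []. Qed.

Lemma ev_inj_le m (r d : env) (c : PSr m) M : pos r -> pos d ->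
  (forall i, d i <= r i) -> nrm r c M -> (forall e, inbox m d e -> ev c e = 0) -> c = 0.
Proof.
move=> r0 d0 dr; elim: m c M => [|m IH] c M hc H; first by apply: (H (fun=> 0)).
have [mu [h1 h2]] := nrmSP hc; apply/funext => k; rewrite fps0E.
apply: (IH _ _ (h1 k)) => e he.
apply: (@ps_coef_zero (fun k => ev (c k : PSr m) e) mu (r m) M (d m)) k => // [k|s /andP[s0 sd]].
  by apply: (ev_bound r0 (h1 k)) => i im; apply: le_trans (he i im) _.
have := H (fun i => if i == m then s else e i).
rewrite /= eqxx => <-.
  congr tsum; apply/funext => j; congr (_ * _); apply: ev_ext => i im.
  by rewrite (ltn_eqF im).
move=> i; rewrite ltnS leq_eqVlt; case: eqP => [-> _|_ /= im]; last exact: he.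
by rewrite ger0_norm ?(ltW s0).
Qed.

Lemma inbox_min m (d r e : env) : inbox m (fun i => Num.min (d i) (r i)) e <->
  inbox m d e /\ inbox m r e.
Proof.
split=> [H|[H1 H2] i im]; last by rewrite le_min H1 ?H2.
by split=> i im; have := H i im; rewrite le_min => /andP[].
Qed.

Lemma min_bnd (x y : R) : 0 < x -> 0 < y ->
  (0 <= Num.min x y <= x) * (0 <= Num.min x y <= y).
Proof.
by move=> x0 y0; split; rewrite le_min (ltW x0) (ltW y0) ge_min lexx ?orbT.
Qed.

Lemma pos_min (d r : env) : pos d -> pos r -> pos (fun i => Num.min (d i) (r i)).
Proof. by move=> d0 r0 i; rewrite lt_min d0 r0. Qed.

Lemma ev_inj m (r d : env) (c c' : PSr m) M M' : pos r -> pos d ->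
  nrm r c M -> nrm r c' M' -> (forall e, inbox m d e -> ev c e = ev c' e) -> c = c'.
Proof.
move=> r0 d0 hc hc' H; apply/subr0_eq.
apply: (ev_inj_le r0 (pos_min d0 r0) _ (nrmB hc hc')) => [i|e /inbox_min[he he']].
  by rewrite ge_min lexx orbT.
by rewrite (evB r0 hc hc' he') H // subrr.
Qed.

Lemma cst_ps k (rho : env) (c M : R) : pos rho -> `|c| <= M ->
  exists2 d : PSr k, nrm rho d M & forall e, inbox k rho e -> ev d e = c.
Proof.
move=> rho0 hc; elim: k => [|k [d h1 h2]]; first by exists (c : PSr 0).
exists (fpsC d); first exact: nrm_C.
by move=> e he; rewrite (evC h1 (inboxS he)) h2 //; apply: inboxS.
Qed.

(** Substitution is possible because the radii of the outer series bound the norms of the inner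
    ones: the term of degree j in the last variable has norm at most mu j * r m ^+ j. *)
Lemma ev_comp m k (r rho : env) (c : PSr m) M (h : nat -> PSr k) : pos r -> pos rho ->
  (forall i, (i < m)%N -> nrm rho (h i) (r i)) -> nrm r c M ->
  exists2 d : PSr k, nrm rho d M &
    forall e, inbox k rho e -> ev d e = ev c (fun i => ev (h i) e).
Proof.
move=> r0 rho0; elim: m c M => [|m IH] c M hr hc.
  exact: (cst_ps k rho0 hc).
have [mu [h1 h2]] := nrmSP hc.
have /choice[d Hd] : forall j, exists d : PSr k, nrm rho d (mu j) /\
    forall e, inbox k rho e -> ev d e = ev (c j : PSr m) (fun i => ev (h i) e).
  move=> j; have [|d] := IH (c j) _ _ (h1 j); last by exists d.
  by move=> i im; apply: hr; apply: ltnW.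
have hX j : nrm rho (h m ^+ j) (r m ^+ j).
  elim: j => [|j IHj]; first by rewrite !expr0; exact: nrm1.
  by rewrite !exprS; apply: nrmM => //; apply: hr.
have dX j : nrm rho (d j * h m ^+ j) (mu j * r m ^+ j).
  by apply: nrmM => //; exact: (Hd j).1.
have m0 j : 0 <= mu j * r m ^+ j.
  by rewrite mulr_ge0 ?exprn_ge0 ?(ltW (r0 m)) //; exact: nrm_ge0 (h1 j).
(* M may exceed the total of these norms; with the exact total T the tails T minus partial sums tend
   to 0, and this identifies the value of the sum. *)
have hM : has_sum (fun j => mu j * r m ^+ j) (tsum (fun j => mu j * r m ^+ j)).
  apply: (@has_sum_ex _ _ (fun j => mu j * r m ^+ j) M) => // j.
  by rewrite ger0_norm.
set T := tsum _ in hM; have TM : T <= M := has_sum_le hM h2.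
have [s Hs] := nrm_series rho0 dX (has_sum_ge0 hM m0).
have s0 : nrm rho s T by have := Hs 0%N; rewrite !big_ord0 !subr0.
exists s => [|e he]; first exact: nrm_le s0.
symmetry; apply: has_sum_tsum => eps eps0.
have evd j : ev (d j * h m ^+ j) e = ev (c j : PSr m) (fun i => ev (h i) e) * ev (h m) e ^+ j.
  rewrite (evM rho0 (Hd j).1 (hX j) he) (Hd j).2 //; congr (_ * _).
  elim: j => [|j IHj]; first by rewrite !expr0 ev1.
  by rewrite !exprS (evM rho0 (hr m (ltnSn m)) (hX j) he) IHj.
have bnd J : `|ev s e - \sum_(j < J) ev (c j : PSr m) (fun i => ev (h i) e) * ev (h m) e ^+ j|
    <= T - \sum_(j < J) mu j * r m ^+ j.
  have := ev_bound rho0 (Hs J) he.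
  rewrite (evB rho0 s0 (nrm_sum (M := fun j : 'I_J => mu j * r m ^+ j) _ _) he); last by move=> j _; exact: dX.
  rewrite (ev_sumr rho0 _ (M := fun j : 'I_J => mu j * r m ^+ j)) //.
  by under eq_bigr do rewrite evd.
have [K0 HK] := hM eps eps0; exists K0 => K K0K; apply: le_trans (bnd K) _.
by apply: le_trans (HK K K0K); exact: ler_norm.
Qed.

(* The box is also the domain of the centred representation [f e = ev c (e - a)]. *)
Definition an m (a : env) (f : env -> R) := exists (c : PSr m) (r : env) M,
  [/\ pos r, nrm r c M & forall e, inbox m r (fun i => e i - a i) ->
     f e = ev c (fun i => e i - a i)].

Definition nearm m (a : env) (P : env -> Prop) := exists2 d : R, 0 < d &
  forall e, (forall i, (i < m)%N -> `|e i - a i| <= d) -> P e.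

Lemma nearmI m a P Q : nearm m a P -> nearm m a Q -> nearm m a (fun e => P e /\ Q e).
Proof.
move=> [d d0 H] [d' d0' H']; exists (Num.min d d'); first by rewrite lt_min d0.
by move=> e He; split; [apply: H|apply: H'] => i im; apply: le_trans (He i im) _;
  rewrite ge_min lexx ?orbT.
Qed.

Lemma nearmW m a (P Q : env -> Prop) : (forall e, P e -> Q e) -> nearm m a P -> nearm m a Q.
Proof. by move=> PQ [d d0 H]; exists d => // e /H /PQ. Qed.

Lemma nearmT m a (P : env -> Prop) : (forall e, P e) -> nearm m a P.
Proof. by move=> H; exists 1. Qed.

Lemma nearm_at m a (P : env -> Prop) : nearm m a P -> P a.
Proof. by move=> [d d0]; apply => i _; rewrite subrr normr0 ltW. Qed.

Lemma min_rad m (r : env) : pos r -> exists2 d : R, 0 < d & forall i, (i < m)%N -> d <= r i.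
Proof.
move=> r0; elim: m => [|m [d d0 H]]; first by exists 1.
exists (Num.min d (r m)) => [|i]; first by rewrite lt_min d0 r0.
rewrite ltnS leq_eqVlt => /orP[/eqP ->|/H]; first by rewrite ge_min lexx orbT.
by apply: le_trans; rewrite ge_min lexx.
Qed.

Lemma nearm_box m a (r : env) : pos r -> nearm m a (fun e => inbox m r (fun i => e i - a i)).
Proof.
move=> /(min_rad m)[d d0 H]; exists d => // e He i im; exact: le_trans (He i im) (H i im).
Qed.

(** The box can be shrunk without harming the norm, so analyticity is a property of germs. *)
Lemma an_germ m a f : an m a f <-> exists (c : PSr m) (r : env) M,
  [/\ pos r, nrm r c M & nearm m a (fun e => f e = ev c (fun i => e i - a i))].
Proof.
split=> [[c [r [M [r0 h1 h2]]]]|[c [r [M [r0 h1 [d d0 h2]]]]]]; exists c.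
  by exists r, M; split=> //; apply: nearmW h2 (nearm_box m a r0).
exists (fun i => Num.min d (r i)), M; split.
- exact: pos_min.
- by apply: nrm_ext h1 => i im; rewrite min_bnd.
- move=> e /inbox_min[he he']; exact: h2.
Qed.

Lemma an_near m a f g : nearm m a (fun e => f e = g e) -> an m a f -> an m a g.
Proof.
move=> fg /an_germ[c [r [M [r0 h1 h2]]]]; apply/an_germ; exists c, r, M; split=> //.
by apply: nearmW (nearmI fg h2) => e [-> ->].
Qed.

Lemma anC m a (c : R) : an m a (fun=> c).
Proof.
have r0 : pos (fun=> 1 : R) by move=> i; exact: ltr01.
have [d h1 h2] := cst_ps m r0 (lexx `|c|).
by exists d, (fun=> 1), `|c|; split=> // e /h2.
Qed.

Lemma an2 m a f g : an m a f -> an m a g -> exists (c d : PSr m) (r : env) M N,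
  [/\ pos r, nrm r c M, nrm r d N & forall e, inbox m r (fun i => e i - a i) ->
     f e = ev c (fun i => e i - a i) /\ g e = ev d (fun i => e i - a i)].
Proof.
move=> [c [r [M [r0 h1 h2]]]] [d [s [N [s0 h3 h4]]]].
exists c, d, (fun i => Num.min (r i) (s i)), M, N; split.
- exact: pos_min.
- by apply: nrm_ext h1 => i im; rewrite min_bnd.
- by apply: nrm_ext h3 => i im; rewrite min_bnd.
- by move=> e /inbox_min[he he']; split; [exact: h2|exact: h4].
Qed.

Lemma anD m a f g : an m a f -> an m a g -> an m a (fun e => f e + g e).
Proof.
move=> hf hg; have [c [d [r [M [N [r0 h1 h2 h3]]]]]] := an2 hf hg.
exists (c + d), r, (M + N); split=> //; first exact: nrmD.
by move=> e he; have [-> ->] := h3 e he; rewrite (evD r0 h1 h2 he).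
Qed.

Lemma anM m a f g : an m a f -> an m a g -> an m a (fun e => f e * g e).
Proof.
move=> hf hg; have [c [d [r [M [N [r0 h1 h2 h3]]]]]] := an2 hf hg.
exists (c * d), r, (M * N); split=> //; first exact: nrmM.
by move=> e he; have [-> ->] := h3 e he; rewrite (evM r0 h1 h2 he).
Qed.

Lemma ev_var m i (im : (i < m)%N) (r : env) : pos r ->
  exists2 c : PSr m, nrm r c (r i) & forall e, inbox m r e -> ev c e = e i.
Proof.
move=> r0; elim: m im => [//|m IH]; rewrite ltnS leq_eqVlt => /orP[/eqP ->|/IH[c h1 h2]].
  exists (fpsX (PSr m) 1); last by move=> e _; rewrite evX expr1.
  by have := nrm_X r0 m 1; rewrite expr1.
exists (fpsC c); first exact: nrm_C.
by move=> e he; rewrite (evC h1 (inboxS he)) h2 //; apply: inboxS.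
Qed.

Lemma an_var m i (a : env) : (i < m)%N -> an m a (fun e => e i).
Proof.
move=> im; have r0 : pos (fun=> 1 : R) by move=> j; exact: ltr01.
have [c h1 h2] := ev_var im r0.
apply: (an_near (f := fun e => (e i - a i) + a i)).
  by apply: nearmT => e; rewrite subrK.
apply: anD; last exact: anC.
by exists c, (fun=> 1), 1; split=> // e he; rewrite h2.
Qed.

Lemma ev_last0 m (c : PSr m.+1) (e : env) : e m = 0 -> ev c e = ev (c 0%N : PSr m) e.
Proof.
move=> em; apply: has_sum_tsum.
have := @has_sum_finsupp R (fun k => ev (c k : PSr m) e * e m ^+ k) 1.
rewrite big_ord1 expr0 mulr1; apply => -[//|k] _.
by rewrite em exprS mul0r mulr0.
Qed.

(** On small polyradii the constant term carries nearly the whole norm: each term of positive degree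
    in the last variable gains a factor rho m / r m, and the coefficient of degree 0 is treated by
    induction. *)
Lemma nrm_small m (c : PSr m) (r : env) M : pos r -> nrm r c M ->
  forall eps : R, 0 < eps -> exists2 d : R, 0 < d &
  forall rho : env, pos rho -> (forall i, (i < m)%N -> rho i <= d) ->
    nrm rho c (`|ev c (fun=> 0)| + eps).
Proof.
move=> r0; elim: m c M => [|m IH] c M hc eps eps0.
  by exists 1 => // rho _ _ /=; rewrite lerDl ltW.
have [mu [h1 h2]] := nrmSP hc; have e20 : 0 < eps / 2 by lra.
have [d d0 Hd] := IH _ _ (h1 0%N) _ e20.
have M0 := nrm_ge0 hc; have M1 : 0 < M + 1 by lra.
have [dr dr0 Hdr] := min_rad m.+1 r0.
(* Makes (q / r m) * M, the bound on the terms of positive degree, at most eps / 2. *)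
pose q := r m * (eps / 2) / (M + 1).
have q0 : 0 < q by rewrite divr_gt0 ?mulr_gt0.
exists (Num.min (Num.min d dr) q) => [|rho rho0 Hrho]; first by rewrite !lt_min d0 dr0 q0.
have rhod i : (i < m.+1)%N -> rho i <= d.
  by move=> /Hrho h; apply: le_trans h _; rewrite !ge_min lexx.
have rhor i : (i < m.+1)%N -> rho i <= r i.
  by move=> im; apply: le_trans (Hdr i im); apply: le_trans (Hrho i im) _; rewrite !ge_min lexx orbT.
have rhoq : rho m <= q by apply: le_trans (Hrho m (ltnSn m)) _; rewrite !ge_min lexx orbT.
rewrite ev_last0 //.
have h3 : nrm rho (c 0%N : PSr m) (`|ev (c 0%N : PSr m) (fun=> 0)| + eps / 2).
  by apply: Hd => // i im; apply: rhod; apply: ltnW.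
set A := `|_| in h3 *.
exists (fun k => if k is 0%N then A + eps / 2 else mu k); split=> [[|k]//|K].
  apply: nrm_ext (h1 k.+1) => i im; rewrite (ltW (rho0 i)) /=; apply: rhor; exact: ltnW.
have A0 : 0 <= A by exact: normr_ge0.
case: K => [|K]; first by rewrite big_ord0; lra.
rewrite big_ord_recl /= mulr1.
suff : \sum_(i < K) mu i.+1 * rho m ^+ i.+1 <= eps / 2.
  by rewrite /bump /=; lra.
have x0 : 0 <= rho m / r m by rewrite divr_ge0 ?ltW.
have x1 : rho m / r m <= 1 by rewrite ler_pdivrMr // mul1r rhor.
apply: (@le_trans _ _ (\sum_(i < K) (rho m / r m) * (mu i.+1 * r m ^+ i.+1))).
  apply: ler_sum => i _; 
  have -> : rho m ^+ i.+1 = rho m / r m * (rho m / r m) ^+ i * r m ^+ i.+1.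
    by rewrite -exprS -exprMn divfK // gt_eqF.
  have m0 : 0 <= mu i.+1 * r m ^+ i.+1.
    by rewrite mulr_ge0 ?exprn_ge0 ?(ltW (r0 m)) //; exact: nrm_ge0 (h1 _).
  have xi : (rho m / r m) ^+ i <= 1 by apply: exprn_ile1.
  have -> : mu i.+1 * (rho m / r m * (rho m / r m) ^+ i * r m ^+ i.+1) =
    (rho m / r m * (mu i.+1 * r m ^+ i.+1)) * (rho m / r m) ^+ i by ring.
  by rewrite ler_piMr // mulr_ge0.
rewrite -mulr_sumr.
have s1 : \sum_(i < K) mu i.+1 * r m ^+ i.+1 <= M.
  apply: le_trans (h2 K.+1); rewrite big_ord_recl /= mulr1 lerDr.
  exact: nrm_ge0 (h1 0%N).
have s2 : 0 <= \sum_(i < K) mu i.+1 * r m ^+ i.+1.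
  apply: sumr_ge0 => i _.
  by rewrite mulr_ge0 ?exprn_ge0 ?(ltW (r0 m)) //; exact: nrm_ge0 (h1 _).
apply: (@le_trans _ _ ((q / r m) * M)).
  apply: ler_pM => //; rewrite ler_pM2r ?invr_gt0 //.
have -> : q / r m * M = (eps / 2) * (M / (M + 1)).
  rewrite /q; field; rewrite !gt_eqF //; exact: r0.
rewrite -[leRHS]mulr1; apply: ler_wpM2l; first exact: ltW.
by rewrite ler_pdivrMr // mul1r lerDl.
Qed.

Lemma an_small m a f : an m a f -> forall eps : R, 0 < eps -> exists (c : PSr m) (d : R), 0 < d /\
  forall rho, pos rho -> (forall i, (i < m)%N -> rho i <= d) -> nrm rho c eps /\
    forall e, inbox m rho (fun i => e i - a i) -> f e = f a + ev c (fun i => e i - a i).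
Proof.
move=> hf eps eps0.
have : an m a (fun e => f e - f a) by apply: anD => //; exact: anC.
move=> [c [r [M [r0 h1 h2]]]].
have c0 : ev c (fun=> 0) = 0.
  have e0 : ev c (fun i => a i - a i) = 0.
    by rewrite -h2 ?subrr // => i _; rewrite subrr normr0 ltW.
  by rewrite -[RHS]e0; apply: ev_ext => i _; rewrite subrr.
have [d d0 Hd] := nrm_small r0 h1 eps0.
have [dr dr0 Hdr] := min_rad m r0.
exists c, (Num.min d dr); split=> [|rho rho0 Hrho]; first by rewrite lt_min d0.
split.
  have := Hd rho rho0; rewrite c0 normr0 add0r; apply => i im.
  by apply: le_trans (Hrho i im) _; rewrite ge_min lexx.
move=> e he; rewrite -h2 1?addrC ?subrK // => i im; apply: le_trans (he i im) _.
apply: le_trans (Hdr i im).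
by apply: le_trans (Hrho i im) _; rewrite ge_min lexx orbT.
Qed.

Lemma an_cont m a f : an m a f -> forall eps : R, 0 < eps -> nearm m a (fun e => `|f e - f a| <= eps).
Proof.
move=> hf eps eps0; have [c [d [d0 Hd]]] := an_small hf eps0.
have [h1 h2] := Hd (fun=> d) (fun=> d0) (fun i _ => lexx d).
exists d => // e he; rewrite h2 // addrC addKr.
exact: (ev_bound (fun=> d0) h1).
Qed.

Lemma an_comp m k (a b : env) f (h : nat -> env -> R) : an m b f ->
  (forall i, (i < m)%N -> an k a (h i)) -> (forall i, (i < m)%N -> h i a = b i) ->
  an k a (fun e => f (fun i => h i e)).
Proof.
move=> [c [r [M [r0 h1 h2]]]] hh hb.
have /choice[H HH] : forall i, exists p : PSr k * R, (i < m)%N -> 0 < p.2 /\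
  forall rho, pos rho -> (forall j, (j < k)%N -> rho j <= p.2) -> nrm rho p.1 (r i) /\
    forall e, inbox k rho (fun j => e j - a j) -> h i e = b i + ev p.1 (fun j => e j - a j).
  move=> i; case: (ltnP i m) => im; last by exists (0, 0).
  have [ci [d Hd]] := an_small (hh i im) (r0 i).
  by exists (ci, d) => _; rewrite -hb.
have Hp : pos (fun i => if (i < m)%N then (H i).2 else 1).
  by move=> i; case: ifP => [/HH[]|].
have [d d0 Hd] := min_rad m Hp.
have dd i : (i < m)%N -> d <= (H i).2 by move=> im; have := Hd i im; rewrite im.
have Hrho i (im : (i < m)%N) := (HH i im).2 (fun=> d) (fun=> d0) (fun j _ => dd i im).
have [s s1 s2] := ev_comp r0 (fun=> d0) (fun i im => (Hrho i im).1) h1.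
exists s, (fun=> d), M; split=> // e he; rewrite s2 // h2.
  by apply: ev_ext => i im; rewrite (Hrho i im).2 // addrC addKr.
move=> i im; rewrite (Hrho i im).2 // addrC addKr.
exact: (ev_bound (fun=> d0) (Hrho i im).1).
Qed.

Lemma an_open m a f : an m a f -> nearm m a (fun a' => an m a' f).
Proof.
move=> [c [r [M [r0 h1 h2]]]].
have [d d0 Hd] := min_rad m r0.
exists (d / 2) => [|a' Ha']; first by lra.
have d20 : pos (fun=> d / 2 : R) by move=> i; lra.
have /choice[H HH] : forall i, exists c' : PSr m, (i < m)%N -> nrm (fun=> d / 2) c' (r i) /\
   forall e, inbox m (fun=> d / 2) e -> ev c' e = e i + (a' i - a i).
  move=> i; case: (ltnP i m) => im; last by exists 0.
  have [c1 q1 q2] := ev_var im d20.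
  have [c2 q3 q4] := cst_ps m d20 (Ha' i im).
  exists (c1 + c2) => _; split.
    by apply: nrm_le (nrmD q1 q3); have := Hd i im; lra.
  by move=> e he; rewrite (evD d20 q1 q3 he) q2 // q4.
have [s s1 s2] := ev_comp r0 d20 (fun i im => (HH i im).1) h1.
exists s, (fun=> d / 2), M; split=> // e he; rewrite s2 // h2.
  by apply: ev_ext => i im; rewrite (HH i im).2 //; lra.
move=> i im; have := Hd i im; have := he i im; have := Ha' i im.
have -> : e i - a i = (e i - a' i) + (a' i - a i) by ring.
by move=> q1 q2 q3; apply: le_trans (ler_normD _ _) _; lra.
Qed.

Lemma an_inv m a f : an m a f -> f a != 0 -> an m a (fun e => (f e)^-1).
Proof.
move=> hf fa.
(* [g] is the geometric series; it is evaluated at [h] = 1 - f / f a, which vanishes at the centre,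
   and 1 / f = (f a)^-1 / (1 - h). *)
pose g : PSr 1 := (fun=> 1 : R).
have h0 : pos (fun=> 2^-1 : R) by move=> i; rewrite invr_gt0.
have gs K : \sum_(k < K) 1 * (2^-1 : R) ^+ k <= 2.
  suff -> : \sum_(k < K) 1 * (2^-1 : R) ^+ k = 2 - 2 * 2^-1 ^+ K.
    by rewrite lerBlDr lerDl mulr_ge0 // exprn_ge0 // invr_ge0.
  elim: K => [|K IH]; first by rewrite big_ord0 expr0; ring.
  by rewrite big_ord_recr /= IH exprS; field.
have hg : nrm (fun=> 2^-1 : R) g 2.
  by exists (fun=> 1); split=> // k; rewrite /= normr1.
have evg e : `|e 0%N| <= 2^-1 -> ev g e = (1 - e 0%N)^-1.
  move=> he; set x := e 0%N in he *.
  have hx : x != 1.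
    by apply/eqP => x1; move: he; rewrite x1 normr1; lra.
  apply: has_sum_tsum; apply/has_sum_lim.
  rewrite (_ : (fun _ => _) = geometric 1 x) ?div1r.
    rewrite -[X in _ --> X]mul1r; apply: cvg_geometric_series.
    by apply: le_lt_trans he _; lra.
  by apply/funext.
pose h e := 1 - (f a)^-1 * f e.
have anh : an m a h.
  rewrite /h; apply: anD; first exact: anC.
  apply: (an_near (f := fun e => (- (f a)^-1) * f e)).
    by apply: nearmT => e; rewrite mulNr.
  by apply: anM => //; exact: anC.
have ha : h a = 0 by rewrite /h mulVf // subrr.
have ang : an 1 (fun=> 0) (ev g).
  by exists g, (fun=> 2^-1), 2; split=> // e _; apply: ev_ext => i _; rewrite subr0.
have anc := an_comp ang (h := fun=> h) (fun _ _ => anh) (fun _ _ => ha).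
apply: (an_near (f := fun e => (f a)^-1 * ev g (fun=> h e))); last first.
  by apply: anM => //; exact: anC.
have hp : 0 < (2^-1 : R) by rewrite invr_gt0.
apply: nearmW (an_cont anh hp) => e; rewrite ha subr0 => he.
by rewrite evg // /h opprB addrCA subrr addr0 -invfM mulrA mulfV // mul1r.
Qed.

Lemma anN m a f : an m a f -> an m a (fun e => - f e).
Proof.
move=> hf; apply: (an_near (f := fun e => (-1) * f e)).
  by apply: nearmT => e; rewrite mulN1r.
by apply: anM => //; exact: anC.
Qed.

Lemma anB m a f g : an m a f -> an m a g -> an m a (fun e => f e - g e).
Proof. by move=> hf hg; apply: anD => //; exact: anN. Qed.

Lemma anX m a f n : an m a f -> an m a (fun e => f e ^+ n).
Proof.
move=> hf; elim: n => [|n IH].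
  by apply: (an_near (f := fun=> 1)); [apply: nearmT => e; rewrite expr0|exact: anC].
apply: (an_near (f := fun e => f e * f e ^+ n)); last exact: anM.
by apply: nearmT => e; rewrite exprS.
Qed.

Lemma an_sum m a (I : Type) (s : seq I) (P : pred I) (f : I -> env -> R) :
  (forall i, P i -> an m a (f i)) -> an m a (fun e => \sum_(i <- s | P i) f i e).
Proof.
move=> hf; elim: s => [|i s IH].
  by apply: (an_near (f := fun=> 0)); [apply: nearmT => e; rewrite big_nil|exact: anC].
apply: (an_near (f := fun e => (if P i then f i e else 0) + \sum_(i <- s | P i) f i e)).
  by apply: nearmT => e; rewrite big_cons; case: ifP; rewrite ?add0r.
by apply: anD => //; case Pi: (P i); [exact: hf|exact: anC].
Qed.

Lemma an_widen m m' a f : (m <= m')%N -> an m a f -> an m' a f.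
Proof.
move=> mm' hf.
have hv : forall i : nat, (i < m)%N -> an m' a (fun e => e i).
  by move=> i im; apply: an_var; apply: leq_trans im mm'.
exact: (an_comp hf hv).
Qed.

End PowerSeries.

(** * Weierstrass division and the ring of convergent power series *)

Section Weierstrass.
Context {R : realType}.
Local Notation env := (nat -> R).
Local Notation PSr := (@PSr R).

Definition cv m (c : PSr m) := exists (r : env) (M : R), pos r /\ nrm r c M.

Lemma cv2 m m' (c : PSr m) (d : PSr m') : cv c -> cv d -> exists (r : env) (M N : R),
  [/\ pos r, nrm r c M & nrm r d N].
Proof.
move=> [r [M [r0 h]]] [s [N [s0 h']]].
exists (fun i => Num.min (r i) (s i)), M, N; split; first exact: pos_min.
- by apply: nrm_ext h => i im; rewrite min_bnd.
- by apply: nrm_ext h' => i im; rewrite min_bnd.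
Qed.

Lemma cv0 m : cv (0 : PSr m).
Proof. by exists (fun=> 1), 0; split; [move=> i; exact: ltr01 | exact: nrm0]. Qed.

Lemma cv1 m : cv (1 : PSr m).
Proof. by exists (fun=> 1), 1; split; [move=> i; exact: ltr01 | apply: nrm1 => i; exact: ltr01]. Qed.

Lemma cvD m (c d : PSr m) : cv c -> cv d -> cv (c + d).
Proof.
by move=> h h'; have [r [M [N [r0 h1 h2]]]] := cv2 h h'; exists r, (M + N); split=> //; apply: nrmD.
Qed.

Lemma cvN m (c : PSr m) : cv c -> cv (- c).
Proof. by move=> [r [M [r0 h]]]; exists r, M; split=> //; apply: nrmN. Qed.

Lemma cvM m (c d : PSr m) : cv c -> cv d -> cv (c * d).
Proof.
by move=> h h'; have [r [M [N [r0 h1 h2]]]] := cv2 h h'; exists r, (M * N); split=> //; apply: nrmM.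
Qed.

Lemma cv_coef m (c : PSr m.+1) k : cv c -> cv (c k : PSr m).
Proof. by move=> [r [M [r0 /nrmSP[mu [h1 h2]]]]]; exists r, (mu k). Qed.

Lemma cv_fpsC m (c : PSr m) : cv c -> cv (fpsC c : PSr m.+1).
Proof. by move=> [r [M [r0 h]]]; exists r, M; split=> //; apply: nrm_C. Qed.

Lemma cv_fpsX m n : cv (fpsX (PSr m) n : PSr m.+1).
Proof.
by exists (fun=> 1), (1 ^+ n); split; [move=> i; exact: ltr01 | apply: (@nrm_X R (fun=> 1)) => i; exact: ltr01].
Qed.

Lemma nrm_eq0 m (c : PSr m) (r : env) : pos r ->
  (forall eps : R, 0 < eps -> nrm r c eps) -> c = 0.
Proof.
move=> r0 H; apply: (ev_inj r0 r0 (H 1 ltr01) (nrm0 r m)) => e he.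
rewrite ev0; apply/eqP; rewrite -normr_eq0; apply/eqP/le_anti; rewrite normr_ge0 andbT.
by apply/ler_addgt0Pr => eps eps0; rewrite add0r; apply: (ev_bound r0 (H _ eps0) he).
Qed.

Definition high d m (c : PSr m.+1) : PSr m.+1 := fun k => c (k + d)%N.

Lemma nrm_high d m (c : PSr m.+1) (r : env) M : pos r -> nrm r c M ->
  nrm r (high d c) (M / r m ^+ d).
Proof.
move=> r0 /nrmSP[mu [h1 h2]]; exists (fun k => mu (k + d)%N); split=> [k|K]; first exact: h1.
have rd : 0 < r m ^+ d by rewrite exprn_gt0.
rewrite ler_pdivlMr // mulr_suml; apply: le_trans (h2 (d + K)%N).
rewrite big_split_ord /= -[leLHS]add0r; apply: lerD.
  by apply: sumr_ge0 => i _; rewrite mulr_ge0 ?exprn_ge0 ?(ltW (r0 m)) //; exact: nrm_ge0 (h1 i).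
by apply: ler_sum => i _; rewrite -mulrA -exprD addnC.
Qed.

Lemma highB d m (c c' : PSr m.+1) : high d (c - c') = high d c - high d c'.
Proof. by apply/funext. Qed.

Lemma highD d m (c c' : PSr m.+1) : high d (c + c') = high d c + high d c'.
Proof. by apply/funext. Qed.

Lemma high_XM d m (c : PSr m.+1) : high d (fpsX (PSr m) d * c) = c.
Proof. by apply/funext => k; rewrite /high fpsXM leq_addl addnK. Qed.

(* Regularity of order [d] in the last variable makes [F] a small perturbation of
   its [d]-th power once the radii, the last one first, are small. *)
Lemma regular_nrm m (F : PSr m.+1) d (r0 : env) M0 : pos r0 -> nrm r0 F M0 ->
  (forall k, (k < d)%N -> ev (F k : PSr m) (fun=> 0) = 0) ->
  ev (F d : PSr m) (fun=> 0) = 1 ->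
  forall b : R, 0 < b -> exists r : env, [/\ pos r, (forall i, (i < m.+1)%N -> r i <= b) &
     nrm r (F - fpsX (PSr m) d) (r m ^+ d / 2)].
Proof.
move=> r00 hF Fk Fd b b0; have [mu [h1 h2]] := nrmSP hF.
have M0p := nrm_ge0 hF.
have rp : 0 < r0 m ^+ d.+1 by exact: exprn_gt0.
(* The last bound on q, which becomes the radius of the last variable, keeps the total of the terms
   of degree above d below q ^+ d / 4. The number [eps] does the same for the d.+1 terms of lower
   degree. *)
pose q : R := Num.min (Num.min (Num.min 1 b) (r0 m)) (r0 m ^+ d.+1 / (4 * (M0 + 1))).
have M4 : 0 < 4 * (M0 + 1) by lra.
have q0 : 0 < q by rewrite !lt_min ltr01 b0 r00 /= divr_gt0.
have q1 : q <= 1 by rewrite !ge_min lexx.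
have qb : q <= b by rewrite !ge_min lexx !orbT.
have qr : q <= r0 m by rewrite !ge_min lexx !orbT.
have qM : q * (4 * (M0 + 1)) <= r0 m ^+ d.+1 by rewrite -ler_pdivlMr // ge_min lexx orbT.
have qd : 0 < q ^+ d by exact: exprn_gt0.
have d40 : 0 < 4 * d.+1%:R :> R by rewrite mulr_gt0.
pose eps : R := q ^+ d / (4 * d.+1%:R).
have eps0 : 0 < eps by rewrite divr_gt0.
pose E := F - fpsX (PSr m) d.
have cvE k : exists N, nrm r0 (E k : PSr m) N.
  rewrite /E fpsDE fpsNE /fpsX; exists (mu k + 1).
  by apply: nrmB => //; case: eqP => _; [exact: nrm1 | apply: nrm_le (nrm0 _ _)].
have /choice[delta Hdelta] : forall k, exists delta : R, (k <= d)%N -> 0 < delta /\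
   forall rho : env, pos rho -> (forall i, (i < m)%N -> rho i <= delta) ->
     nrm rho (E k : PSr m) eps.
  move=> k; case: (leqP k d) => kd; last by exists 0.
  have [N hN] := cvE k; have [dl dl0 Hdl] := nrm_small r00 hN eps0.
  exists dl => _; split=> // rho rho0 Hrho; have := Hdl rho rho0 Hrho.
  suff -> : ev (E k : PSr m) (fun=> 0) = 0 by rewrite normr0 add0r.
  have b0' : inbox m r0 (fun=> 0) by move=> i _; rewrite normr0 ltW.
  rewrite /E fpsDE fpsNE /fpsX (evB (N := 1) r00 (h1 k) _ b0'); last first.
    by case: eqP => _; [exact: nrm1 | apply: nrm_le (nrm0 _ _); exact: ler01].
  case: eqP => [->|/eqP kd']; first by rewrite Fd ev1 subrr.
  by rewrite ev0 Fk ?subr0 // ltn_neqAle kd'.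
have Hp : pos (fun k => if (k <= d)%N then delta k else 1).
  by move=> k; case: ifP => [/Hdelta[]|].
have [dl dl0 Hdl] := min_rad d.+1 Hp.
have [dr dr0 Hdr] := min_rad m r00.
(* The other radii are chosen after q, so small that every coefficient of [E] of degree at most d
   has norm at most [eps]; this uses that these coefficients vanish at the origin. *)
pose t := Num.min (Num.min dl dr) b.
have t0 : 0 < t by rewrite !lt_min dl0 dr0 b0.
pose r i := if i == m then q else t.
have rpos : pos r by move=> i; rewrite /r; case: ifP.
have rm : r m = q by rewrite /r eqxx.
have rt i : (i < m)%N -> r i = t by move=> im; rewrite /r ltn_eqF.
exists r; split=> //.
  by move=> i _; rewrite /r; case: ifP => // _; rewrite /t !ge_min lexx orbT.
exists (fun k => if (k <= d)%N then eps else mu k); split=> [k|K].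
  case: ifP => kd.
    apply: (Hdelta k kd).2 => // i im; rewrite (rt i im).
    have := Hdl k; rewrite ltnS kd => /(_ isT) h; apply: le_trans h.
    by rewrite /t !ge_min lexx.
  rewrite fpsDE fpsNE /fpsX (_ : k == d = false); last by apply/eqP => kd'; rewrite kd' leqnn in kd.
  rewrite subr0; apply: nrm_ext (h1 k) => i im; rewrite (ltW (rpos i)) /= (rt i im).
  by apply: le_trans (Hdr i im); rewrite /t !ge_min lexx orbT.
rewrite rm.
have u0 k : 0 <= (if (k <= d)%N then eps else mu k) * q ^+ k.
  by rewrite mulr_ge0 ?exprn_ge0 ?(ltW q0) //; case: ifP => // _; [exact: ltW | exact: nrm_ge0 (h1 k)].
apply: le_trans (sum_le_mono u0 (leq_addl d.+1 K)) _.
rewrite big_split_ord /=.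
have e1 : \sum_(i < d.+1) (if (i <= d)%N then eps else mu i) * q ^+ i <= q ^+ d / 4.
  apply: (@le_trans _ _ (\sum_(i < d.+1) eps)).
    apply: ler_sum => i _; rewrite -ltnS ltn_ord; rewrite -[leRHS]mulr1.
    apply: ler_wpM2l; first exact: ltW.
    by apply: exprn_ile1 => //; exact: ltW.
  rewrite sumr_const card_ord -mulr_natr /eps le_eqVlt; apply/orP; left; apply/eqP.
  have D0 : d.+1%:R != 0 :> R by rewrite pnatr_eq0.
  by move: D0; set D := d.+1%:R => D0; field.
have e2 : \sum_(i < K) (if (d.+1 + i <= d)%N then eps else mu (d.+1 + i)%N) * q ^+ (d.+1 + i)
   <= q ^+ d / 4.
  apply: (@le_trans _ _ (\sum_(i < K) (q ^+ d.+1 / r0 m ^+ d.+1) * (mu (d.+1 + i)%N * r0 m ^+ (d.+1 + i)))).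
    apply: ler_sum => i _; rewrite (_ : (d.+1 + i <= d)%N = false); last by rewrite addSn ltnNge leq_addr.
    have mu0 := nrm_ge0 (h1 (d.+1 + i)%N).
    have -> : q ^+ d.+1 / r0 m ^+ d.+1 * (mu (d.+1 + i)%N * r0 m ^+ (d.+1 + i))
      = mu (d.+1 + i)%N * (q ^+ d.+1 * r0 m ^+ i).
      by rewrite [r0 m ^+ (d.+1 + i)]exprD; set x := r0 m ^+ d.+1; field; rewrite gt_eqF.
    rewrite exprD; apply: ler_wpM2l => //; apply: ler_wpM2l; first by rewrite exprn_ge0 // ltW.
    by apply: Xle => //; exact: ltW.
  rewrite -mulr_sumr.
  have s1 : \sum_(i < K) mu (d.+1 + i)%N * r0 m ^+ (d.+1 + i) <= M0.
    apply: le_trans (h2 (d.+1 + K)%N); rewrite [leRHS]big_split_ord /= lerDr.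
    by apply: sumr_ge0 => i _; rewrite mulr_ge0 ?exprn_ge0 ?(ltW (r00 m)) //; exact: nrm_ge0 (h1 i).
  apply: (@le_trans _ _ (q ^+ d.+1 / r0 m ^+ d.+1 * M0)).
    by apply: ler_wpM2l => //; rewrite divr_ge0 ?exprn_ge0 // ltW.
  rewrite exprS; set x := r0 m ^+ d.+1 in rp qM *; set y := q ^+ d in qd *.
  have -> : q * y / x * M0 = y * (q * M0 / x) by field; rewrite gt_eqF.
  apply: ler_wpM2l; first exact: ltW.
  by rewrite ler_pdivrMr //; nra.
by lra.
Qed.

Fixpoint cstP m (x : R) : PSr m := if m is m'.+1 then fpsC (cstP m' x) else x.
Arguments cstP : simpl never.

Lemma nrm_cstP m x (r : env) : pos r -> nrm r (cstP m x) `|x|.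
Proof. by move=> r0; elim: m => [|m IH]; [exact: lexx | exact: nrm_C]. Qed.

Lemma cv_cstP m x : cv (cstP m x).
Proof.
have p1 : pos (fun=> 1 : R) by move=> i; exact: ltr01.
by exists (fun=> 1), `|x|; split=> //; exact: nrm_cstP.
Qed.

Lemma ev_cstP m x e : ev (cstP m x) e = x.
Proof.
elim: m => [//|m IH]; rewrite -[RHS]IH.
have rp : pos (fun i => `|e i| + 1) by move=> i; rewrite ltr_wpDl.
by apply: (evC (r := fun i => `|e i| + 1) (nrm_cstP m x rp)) => i _; rewrite lerDl.
Qed.

Definition regular m d (F : PSr m.+1) :=
  (forall k, (k < d)%N -> ev (F k : PSr m) (fun=> 0) = 0) /\
  ev (F d : PSr m) (fun=> 0) != 0.

(* Weierstrass division: [Q] is the fixed point of [Q = high G - high (Q (F - y^d))]. *)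
Lemma wdiv1 m (F G : PSr m.+1) d : cv F -> cv G ->
  (forall k, (k < d)%N -> ev (F k : PSr m) (fun=> 0) = 0) ->
  ev (F d : PSr m) (fun=> 0) = 1 ->
  exists Q S : PSr m.+1, [/\ cv Q, cv S, G = Q * F + S & forall k, (d <= k)%N -> S k = 0].
Proof.
move=> [r1 [M1 [r10 hF]]] [r2 [M2 [r20 hG]]] Fk Fd.
have [b b0 Hb] := min_rad m.+1 r20.
have [r [r0 rb hE]] := regular_nrm r10 hF Fk Fd b0.
set E := F - fpsX (PSr m) d in hE.
have hG' : nrm r G M2.
  by apply: nrm_ext hG => i im; rewrite (ltW (r0 i)) /=; apply: le_trans (Hb i im); apply: rb.
have rd : 0 < r m ^+ d by rewrite exprn_gt0.
(* Multiplication by [E] costs r m ^+ d / 2 and [high d] gains r m ^+ d, so each iteration halves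
   the norm and the iterates sum like a geometric series. *)
pose Q j : PSr m.+1 := iter j (fun q => - high d (q * E)) (high d G).
pose N0 := M2 / r m ^+ d.
have nQ j : nrm r (Q j) (N0 * 2^-1 ^+ j).
  elim: j => [|j IH]; first by rewrite expr0 mulr1; exact: nrm_high.
  rewrite /Q iterS -/(Q j); apply: nrmN.
  have := nrm_high d r0 (nrmM r0 IH hE); apply: nrm_le.
  by rewrite exprSr le_eqVlt; apply/orP; left; apply/eqP; field; rewrite gt_eqF.
have N00 : 0 <= N0 by have := nrm_ge0 (nQ 0%N); rewrite expr0 mulr1.
have geo J : \sum_(j < J) N0 * 2^-1 ^+ j = 2 * N0 - 2 * N0 * 2^-1 ^+ J.
  elim: J => [|J IH]; first by rewrite big_ord0 expr0; ring.
  by rewrite big_ord_recr /= IH exprS; field.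
have h0 J : 0 <= (2^-1 : R) ^+ J by rewrite exprn_ge0 // invr_ge0.
have geoB J : \sum_(j < J) N0 * 2^-1 ^+ j <= 2 * N0.
  by rewrite geo lerBlDr lerDl mulr_ge0 // mulr_ge0.
have [q Hq] := nrm_series r0 nQ geoB.
have cq : nrm r q (2 * N0) by have := Hq 0%N; rewrite !big_ord0 !subr0.
have nF : nrm r F (r m ^+ d / 2 + r m ^+ d).
  have -> : F = E + fpsX (PSr m) d by rewrite subrK.
  by apply: nrmD => //; exact: nrm_X.
pose S J := \sum_(j < J) Q j.
have tel J : high d G = S J.+1 + high d (S J * E).
  elim: J => [|J IH].
    rewrite /S big_ord_recr big_ord0 /= add0r mul0r (_ : high d 0 = 0) ?addr0 //.
  rewrite /S big_ord_recr -/(S J.+1) [in S J.+1 * E]/S big_ord_recr -/(S J) /= mulrDl highD.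
  by rewrite addrACA addNr addr0; exact: IH.
have fix_q : high d (q * F) = high d G.
  apply/subr0_eq/(nrm_eq0 r0) => eps eps0.
  have -> : q * F = fpsX (PSr m) d * q + q * E by rewrite /E mulrBr [fpsX _ _ * _]mulrC; ring.
  have eqJ J : high d (fpsX (PSr m) d * q + q * E) - high d G =
     (q - S J.+1) + high d ((q - S J) * E).
    by rewrite (tel J) highD high_XM mulrBl highB; ring.
  have [J HJ] : exists J, 4 * N0 * 2^-1 ^+ J <= eps.
    have c4 : 0 <= 4 * N0 by apply: mulr_ge0.
    have := @cvg_geometric R (4 * N0) 2^-1; rewrite ger0_norm ?invr_ge0 // => /(_ ltac:(lra)).
    move=> /cvgrPdist_le /(_ eps eps0) [J _ HJ]; exists J; have := HJ J (leqnn J).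
    by rewrite /= sub0r normrN ger0_norm // mulr_ge0.
  rewrite (eqJ J); apply: (nrm_le HJ).
  have n1 := Hq J.+1; have n2 := nrm_high d r0 (nrmM r0 (Hq J) hE).
  apply: nrm_le (nrmD n1 n2); rewrite !geo exprS.
  move: (rd) (mulr_ge0 N00 (h0 J)); set x := _ ^+ J; set y := r m ^+ d => y0 x0.
  rewrite [leLHS](_ : _ = 2 * (N0 * x)); first lra.
  by field; rewrite gt_eqF.
exists q, (G - q * F); split.
- by exists r, (2 * N0).
- by exists r, (M2 + 2 * N0 * (r m ^+ d / 2 + r m ^+ d)); split=> //; apply: nrmB => //; apply: nrmM.
- by rewrite addrC subrK.
- move=> k dk; have := congr1 (fun c => c (k - d)%N) fix_q; rewrite /high subnK // => H.
  by rewrite fpsDE fpsNE H subrr.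
Qed.

Lemma wdiv m (F G : PSr m.+1) d : cv F -> cv G -> regular d F ->
  exists Q S : PSr m.+1, [/\ cv Q, cv S, G = Q * F + S & forall k, (d <= k)%N -> S k = 0].
Proof.
move=> cF cG [Fk Fd]; set x := ev _ _ in Fd.
pose u : PSr m.+1 := cstP m.+1 x^-1.
have cu : cv u by exact: cv_cstP.
have [r [M [r0 hF]]] := cF; have [mu [h1 _]] := nrmSP hF.
have hb : inbox m r (fun=> 0) by move=> i _; rewrite normr0 ltW.
have evu k : ev ((u * F) k : PSr m) (fun=> 0) = x^-1 * ev (F k : PSr m) (fun=> 0).
  by rewrite fpsCM (evM r0 (nrm_cstP m _ r0) (h1 k) hb) ev_cstP.
have [||Q [S [cQ cS GE HS]]] := @wdiv1 m (u * F) G d (cvM cu cF) cG.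
- by move=> k kd; rewrite evu Fk // mulr0.
- by rewrite evu mulVf.
exists (Q * u), S; split=> //; first exact: cvM.
by rewrite -mulrA.
Qed.

Lemma cv_an m (c : PSr m) (a : env) : cv c -> an m a (fun e => ev c (fun i => e i - a i)).
Proof. by move=> [r [M [r0 h]]]; exists c, r, M. Qed.

Lemma cv_an0 m (c : PSr m) : cv c -> an m (fun=> 0) (ev c).
Proof.
move=> [r [M [r0 h]]]; exists c, r, M; split=> // e _.
by apply: ev_ext => i _; rewrite subr0.
Qed.

Lemma an_cv0 m f : an m (fun=> 0) f -> exists2 c : PSr m, cv c &
  nearm m (fun=> 0) (fun e => f e = ev c e).
Proof.
move=> /an_germ[c [r [M [r0 h1 h2]]]]; exists c; first by exists r, M.
by apply: nearmW h2 => e ->; apply: ev_ext => i _; rewrite subr0.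
Qed.

Lemma cv_inj m (c d : PSr m) : cv c -> cv d ->
  nearm m (fun=> 0) (fun e => ev c e = ev d e) -> c = d.
Proof.
move=> hc hd [b b0 H]; have [r [M [N [r0 h1 h2]]]] := cv2 hc hd.
apply: (ev_inj r0 (fun=> b0) h1 h2) => e he; apply: H => i im.
by rewrite subr0; exact: he.
Qed.

Lemma cv_evD m (c d : PSr m) : cv c -> cv d ->
  nearm m (fun=> 0) (fun e => ev (c + d) e = ev c e + ev d e).
Proof.
move=> hc hd; have [r [M [N [r0 h1 h2]]]] := cv2 hc hd.
apply: nearmW (nearm_box m (fun=> 0) r0) => e he; apply: (evD r0 h1 h2) => i im.
by have := he i im; rewrite subr0.
Qed.

Lemma cv_evM m (c d : PSr m) : cv c -> cv d ->
  nearm m (fun=> 0) (fun e => ev (c * d) e = ev c e * ev d e).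
Proof.
move=> hc hd; have [r [M [N [r0 h1 h2]]]] := cv2 hc hd.
apply: nearmW (nearm_box m (fun=> 0) r0) => e he; apply: (evM r0 h1 h2) => i im.
by have := he i im; rewrite subr0.
Qed.

Lemma cv_evM0 m (c d : PSr m) : cv c -> cv d ->
  ev (c * d) (fun=> 0) = ev c (fun=> 0) * ev d (fun=> 0).
Proof. by move=> hc hd; apply: (nearm_at (cv_evM hc hd)). Qed.

Lemma cv_evD0 m (c d : PSr m) : cv c -> cv d ->
  ev (c + d) (fun=> 0) = ev c (fun=> 0) + ev d (fun=> 0).
Proof. by move=> hc hd; apply: (nearm_at (cv_evD hc hd)). Qed.

Lemma cv_unit m (c : PSr m) : cv c -> ev c (fun=> 0) != 0 ->
  exists2 d : PSr m, cv d & c * d = 1.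
Proof.
move=> hc c0; have [d hd Hd] := an_cv0 (an_inv (cv_an0 hc) c0).
exists d => //; apply: cv_inj (cvM hc hd) (cv1 m) _.
pose nz : env -> Prop := fun e => ev c e != 0.
have hnz : nearm m (fun=> 0) nz.
  have e0 : 0 < `|ev c (fun=> 0)| / 2 by rewrite divr_gt0 ?normr_gt0.
  apply: nearmW (an_cont (cv_an0 hc) e0) => e; apply: contraTneq => ->.
  rewrite sub0r normrN -ltNge ltr_pdivrMr //; have : 0 < `|ev c (fun=> 0)| by rewrite normr_gt0.
  by lra.
apply: nearmW (nearmI (nearmI Hd (cv_evM hc hd)) hnz) => e [[h1 h2] h3].
by rewrite h2 -h1 ev1 mulfV.
Qed.

Lemma cv_evsum m (I : Type) (s : seq I) (c : I -> PSr m) : (forall i, cv (c i)) ->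
  ev (\sum_(i <- s) c i) (fun=> 0) = \sum_(i <- s) ev (c i) (fun=> 0).
Proof.
move=> hc; suff [h1 h2] : cv (\sum_(i <- s) c i) /\
  ev (\sum_(i <- s) c i) (fun=> 0) = \sum_(i <- s) ev (c i) (fun=> 0) by [].
elim: s => [|i s [h1 h2]]; first by rewrite !big_nil ev0; split; first exact: cv0.
by rewrite !big_cons; split; [exact: cvD | rewrite cv_evD0 // h2].
Qed.

(** Weierstrass preparation, obtained by dividing the d-th power of the last variable by [F].
    Comparing the coefficients of degree d at the origin, where the lower coefficients of [F]
    vanish, shows that the quotient [Q] is a unit. *)
Lemma wprep_ps m (F : PSr m.+1) d : cv F -> regular d F ->
  exists Q W : PSr m.+1, [/\ cv Q, cv W, ev Q (fun=> 0) != 0, Q * F = W & W d = 1 /\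
    forall k, (d < k)%N -> W k = 0].
Proof.
move=> cF rF; have [Q [S [cQ cS GE HS]]] := wdiv cF (cv_fpsX m d) rF.
exists Q, (fpsX (PSr m) d - S); split=> //.
- by apply: cvD; [exact: cv_fpsX | exact: cvN].
- have := congr1 (fun c : PSr m.+1 => ev (c d : PSr m) (fun=> 0)) GE.
  rewrite /= fpsDE HS // addr0 /fpsX eqxx ev1 fpsME /conv.
  rewrite cv_evsum; last by move=> i; apply: cvM; apply: cv_coef.
  rewrite big_ord_recl /= subn0 cv_evM0; [|exact: cv_coef|exact: cv_coef].
  rewrite big1 ?addr0; last first.
    move=> i _; rewrite cv_evM0; [|exact: cv_coef|exact: cv_coef].
    by rewrite rF.1 ?mulr0 // /bump /=; have := ltn_ord i; lia.
  move=> h1; change (ev Q (fun=> 0) != 0); rewrite ev_last0 //.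
  by apply: contra_eq_neq h1 => ->; rewrite mul0r oner_eq0.
- by rewrite GE addrK.
- split; first by rewrite fpsDE fpsNE HS // subr0 /fpsX eqxx.
  by move=> k dk; rewrite fpsDE fpsNE HS ?(ltnW dk) // subr0 /fpsX gtn_eqF.
Qed.

Lemma ev_line m (F : PSr m) (r p : env) M : pos r -> nrm r F M -> inbox m r p ->
  ev F p != 0 -> exists2 d : PSr 1, cv d /\ d <> 0 &
  forall t, `|t| <= 1 -> ev d (fun=> t) = ev F (fun i => t * p i).
Proof.
move=> r0 hF hp Fp.
have p1 : pos (fun=> 1 : R) by move=> i; exact: ltr01.
pose h i : PSr 1 := cstP 1 (p i) * fpsX (PSr 0) 1.
have hh i : (i < m)%N -> nrm (fun=> 1) (h i) (r i).
  move=> im; apply: nrm_le (nrmM p1 (nrm_cstP 1 (p i) p1) (@nrm_X _ _ p1 0 1)).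
  by rewrite expr1 mulr1; exact: hp.
have [d hd Hd] := ev_comp r0 p1 hh hF.
have evd t : `|t| <= 1 -> ev d (fun=> t) = ev F (fun i => t * p i).
  move=> ht; rewrite Hd; last by move=> i _.
  apply: ev_ext => i im; rewrite (evM p1 (nrm_cstP 1 (p i) p1) (@nrm_X _ _ p1 0 1)).
    by rewrite ev_cstP evX expr1 mulrC.
  by move=> j _.
exists d => //; split; first by exists (fun=> 1), M.
move=> d0; have := evd 1; rewrite normr1 lexx d0 ev0 => /(_ isT) E1.
by move: Fp; rewrite (_ : ev F p = 0) ?eqxx // E1; apply: ev_ext => i _; rewrite mul1r.
Qed.

Lemma cv_nonzero_pt m (F : PSr m) (b : R) : cv F -> F <> 0 -> 0 < b ->
  exists (r : env) M p, [/\ pos r, nrm r F M, inbox m r p, (forall i, (i < m)%N -> `|p i| <= b) & ev F p != 0].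
Proof.
move=> [r [M [r0 hF]]] F0 b0; apply: contrapT => H; apply: F0.
apply: (ev_inj r0 (fun i => ltac:(exact: (pos_min (fun=> b0) r0) i)) hF (nrm0 r m)) => e.
move=> /(inbox_min m (fun=> b) r)[h1 h2].
rewrite ev0; apply/eqP; apply: contrapT => /negP h3; apply: H.
by exists r, M, e.
Qed.

Lemma fps_neq0_ex m (F : PSr m.+1) : F <> 0 -> exists k, F k <> 0.
Proof.
by move=> F0; apply: contrapT => H; apply: F0; apply/funext => k; apply: contrapT => Fk; apply: H; exists k.
Qed.

Lemma fps_low m (F : PSr m.+1) : F <> 0 ->
  exists2 i, F i <> 0 & forall j, (j < i)%N -> F j = 0.
Proof.
move=> /fps_neq0_ex[k Fk].
have ex : exists k, `[< F k <> 0 >] by exists k; apply/asboolP.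
exists (ex_minn ex); case: ex_minnP => i /asboolP Fi mini // j ji.
by apply: contrapT => Fj; have /mini := asboolT Fj; rewrite leqNgt ji.
Qed.

Lemma ps_idomain m (F G : PSr m) : F * G = 0 -> F = 0 \/ G = 0.
Proof.
elim: m F G => [|m IH] F G FG.
  by have /eqP := FG; rewrite mulf_eq0 => /orP[/eqP|/eqP]; [left|right].
have [F0|F0] := pselect (F = 0); [by left | right; apply: contrapT => G0].
have [i Fi Fi'] := fps_low F0; have [j Gj Gj'] := fps_low G0.
have : (F * G) (i + j)%N = F i * G j.
  have ij : (i < (i + j).+1)%N by rewrite ltnS leq_addr.
  rewrite fpsME /conv (bigD1 (Ordinal ij)) //= addKn big1 ?addr0 // => k ki.
  have [ki'|ki'] := ltnP k i; first by rewrite Fi' ?mul0r.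
  rewrite Gj' ?mulr0 //; move: ki; rewrite -val_eqE /= => ki.
  by have := ltn_ord k; lia.
by rewrite FG fps0E => h; have [//|//] := IH _ _ (esym h).
Qed.

(* Shear along [lam]: it carries the line through [lam], [lam m = 1], to the last axis. *)
Definition shear m (lam : env) (e : env) : env :=
  fun i => if (i < m)%N then e i + lam i * e m else e i.

Lemma an_shear m (lam a : env) i : (i < m.+1)%N -> an m.+1 a (fun e => shear m lam e i).
Proof.
rewrite ltnS /shear => im; case: (i < m)%N; last first.
  by apply: an_var; rewrite ltnS.
apply: anD; first exact: an_var.
by apply: anM; [exact: anC | apply: an_var].
Qed.

Lemma shear0 m lam : shear m lam (fun=> 0) = fun=> 0.
Proof. by apply/funext => i; rewrite /shear mulr0 addr0; case: ifP. Qed.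

Lemma shearK m lam e : shear m lam (shear m (fun i => - lam i) e) = e.
Proof.
apply/funext => i; rewrite /shear ltnn; case: (i < m)%N => //.
by rewrite mulNr subrK.
Qed.

Lemma shear_comp m (lam : env) (F : PSr m.+1) : cv F -> exists2 F' : PSr m.+1, cv F' &
  nearm m.+1 (fun=> 0) (fun e => ev F (shear m lam e) = ev F' e).
Proof.
move=> cF; apply: an_cv0.
apply: (an_comp (b := fun=> 0) (h := fun i e => shear m lam e i)) (cv_an0 cF) _ _.
  by move=> i im; apply: an_shear.
by move=> i _; rewrite shear0.
Qed.

Definition axis m (s : R) : env := fun k => if k == m then s else 0.

(* Every nonzero series is nonzero along a generic line; one line serves finitely many
   series at once since their product is again nonzero. *)
Lemma generic_line m (I : finType) (F : I -> PSr m.+1) :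
  (forall i, cv (F i)) -> (forall i, F i <> 0) -> exists lam : env, forall i, forall b : R,
  0 < b -> exists2 s : R, `|s| <= b & ev (F i) (shear m lam (axis m s)) != 0.
Proof.
(* The extra factor, the last variable, forces p m to be nonzero at the point p found below, so that
   the direction p can be normalised to have last coordinate 1. *)
move=> cF F0; pose P : PSr m.+1 := fpsX (PSr m) 1 * \prod_i F i.
have cX : cv (fpsX (PSr m) 1 : PSr m.+1) by exact: cv_fpsX.
have cQ : cv (\prod_i F i).
  by apply: big_ind => //; [exact: cv1 | exact: cvM].
have cP : cv P by exact: cvM.
have Q0 : \prod_i F i <> 0.
  elim: (index_enum I) => [|i s IH]; first by rewrite big_nil; apply/eqP; exact: oner_neq0.
  by rewrite big_cons => h; case: (ps_idomain h) => // h'; exact: F0 h'.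
have P0 : P <> 0.
  move=> /ps_idomain[h|//].
  have := congr1 (fun c : PSr m.+1 => c 1%N) h; rewrite /fpsX eqxx => /eqP.
  by rewrite (negPf (oner_neq0 _)).
(* [p] lies in a box on which all the series involved converge *)
have [r [M [r0 hF]]] : exists (r : env) (M : I -> R), pos r /\ forall i, nrm r (F i) (M i).
  have /choice[r Hr] : forall i, exists r : env, exists M, pos r /\ nrm r (F i) M by exact: cF.
  have /choice[M HM] := Hr.
  pose rr k := \big[Num.min/1]_i r i k.
  have rr0 : pos rr.
    move=> k; rewrite /rr; apply: (big_ind (fun x : R => 0 < x)) => [|x y x0 y0|i _].
    - exact: ltr01.
    - by rewrite lt_min x0.
    - exact: (HM i).1.
  exists rr, M; split=> // i; apply: nrm_ext (HM i).2 => k _; rewrite ltW //=.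
  exact: bigmin_le_cond.
have [b b0 Hb] := min_rad m.+1 r0.
have [r' [M' [p [r'0 hP hp pb Pp]]]] := cv_nonzero_pt cP P0 b0.
have pr : inbox m.+1 r p by move=> i im; apply: le_trans (pb i im) (Hb i im).
have [nQ evQ] : (exists N, nrm r (\prod_i F i) N) /\
    ev (\prod_i F i) p = \prod_i ev (F i) p.
  elim: (index_enum I) => [|i s [[N IH1] IH2]].
    by rewrite !big_nil ev1; split=> //; exists 1; exact: nrm1.
  rewrite !big_cons; split; first by exists (M i * N); apply: nrmM.
  by rewrite (evM r0 (hF i) IH1 pr) IH2.
have [N hN] := nQ.
have evP : ev P p = p m * \prod_i ev (F i) p.
  by rewrite /P (evM r0 (@nrm_X _ _ r0 m 1) hN pr) evX expr1 evQ.
have pm : p m != 0 by apply: contraNneq Pp => pm; rewrite evP pm mul0r.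
have pF i : ev (F i) p != 0.
  apply: contraNneq Pp => Fip; rewrite evP.
  have -> : \prod_i ev (F i) p = 0 by apply/eqP/prodf_eq0; exists i => //; rewrite Fip.
  by rewrite mulr0.
exists (fun i => p i / p m) => i c c0; apply: contrapT => H.
have [d [cd d0] Hd] := ev_line r0 (hF i) pr (pF i).
apply: d0; apply: (cv_inj cd (cv0 1)).
exists (Num.min 1 (c / `|p m|)).
  by rewrite lt_min ltr01 divr_gt0 // normr_gt0.
move=> e /(_ 0%N isT); rewrite subr0 le_min => /andP[e1 ec].
rewrite ev0 (@ev_ext _ _ d e (fun=> e 0%N)); last by case.
rewrite Hd //; apply/eqP/negPn/negP => He; apply: H; exists (e 0%N * p m).
  by rewrite normrM -ler_pdivlMr ?normr_gt0.
move: He; congr (_ != 0); apply: ev_ext => k; rewrite ltnS /shear /axis eqxx leq_eqVlt.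
case/orP=> [/eqP ->|km]; first by rewrite ltnn eqxx.
by rewrite km (ltn_eqF km) add0r mulrCA mulrC divfK // mulrC.
Qed.

Lemma axis_regular m (F F' : PSr m.+1) lam : cv F' ->
  (forall b : R, 0 < b -> exists2 s : R, `|s| <= b & ev F (shear m lam (axis m s)) != 0) ->
  nearm m.+1 (fun=> 0) (fun e => ev F (shear m lam e) = ev F' e) -> exists d, regular d F'.
Proof.
move=> cF' H [c c0 Hc].
suff /existsNP[k0 /eqP k0P] : ~ forall k, ev (F' k : PSr m) (fun=> 0) = 0.
  have ex : exists k, ev (F' k : PSr m) (fun=> 0) != 0 by exists k0.
  exists (ex_minn ex); case: ex_minnP => k Fk mink; split=> // j jk.
  by apply/eqP; apply: contraTT jk => /mink; rewrite -leqNgt.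
move=> F'0; have [s sc /negP] := H c c0; apply; apply/eqP.
rewrite Hc; last by move=> k _; rewrite subr0 /axis; case: ifP => // _; rewrite normr0 ltW.
apply: has_sum_tsum; rewrite (_ : (fun _ => _) = fun=> 0).
  by move=> q q0; exists 0%N => K _; rewrite big1 // subrr normr0 ltW.
apply/funext => k; have ek : ev (F' k : PSr m) (axis m s) = 0.
  by rewrite -[RHS](F'0 k); apply: ev_ext => l lm; rewrite /axis ltn_eqF.
exact: (etrans (congr1 (fun z => z * axis m s m ^+ k) ek) (mul0r _)).
Qed.

End Weierstrass.

(** * Noetherian rings and Krull's intersection theorem *)

Section Noetherian.
Variable A : comNzRingType.

Definition ideal (J : A -> Prop) := [/\ J 0, forall x y, J x -> J y -> J (x + y) &
  forall a x, J x -> J (a * x)].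

Definition noetherian := forall J, ideal J -> exists s (g : 'I_s -> A),
  (forall i, J (g i)) /\ forall x, J x -> exists c : 'I_s -> A, x = \sum_i c i * g i.

Lemma ideal_sum (J : A -> Prop) (I : Type) (s : seq I) (c g : I -> A) : ideal J ->
  (forall i, J (g i)) -> J (\sum_(i <- s) c i * g i).
Proof.
move=> [J0 JD JM] Jg; apply: big_ind => // i _; exact: JM.
Qed.

Lemma ideal_sub (J : A -> Prop) x y : ideal J -> J x -> J y -> J (x - y).
Proof. by move=> [J0 JD JM] Jx Jy; apply: JD => //; rewrite -mulN1r; apply: JM. Qed.

(** Infinite sequences stand for vectors of any length, so that the induction on d in
    [noetherian_submod] needs no change of type; generation is claimed for the first d entries. *)
Definition submod (N : (nat -> A) -> Prop) := [/\ N (fun=> 0),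
  forall v w, N v -> N w -> N (fun k => v k + w k) & forall a v, N v -> N (fun k => a * v k)].

Lemma submod_sum N (I : Type) (s : seq I) (c : I -> A) (g : I -> nat -> A) : submod N ->
  (forall i, N (g i)) -> N (fun k => \sum_(i <- s) c i * g i k).
Proof.
move=> [N0 ND NM] Ng; elim: s => [|i s IH].
  by rewrite (_ : (fun _ => _) = fun=> 0) //; apply/funext => k; rewrite big_nil.
rewrite (_ : (fun _ => _) = fun k => (fun k => c i * g i k) k + (fun k => \sum_(i <- s) c i * g i k) k).
  by apply: ND => //; apply: NM.
by apply/funext => k; rewrite big_cons.
Qed.

Lemma noetherian_submod : noetherian -> forall d N, submod N -> exists s (g : 'I_s -> nat -> A),
  (forall i, N (g i)) /\ forall v, N v -> exists c : 'I_s -> A,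
     forall k, (k < d)%N -> v k = \sum_i c i * g i k.
Proof.
move=> noe; elim=> [|d IH] N hN.
  by exists 0%N, (fun=> fun=> 0); split=> [[]//|v _]; exists (fun=> 0).
have [N0 ND NM] := hN.
have idJ : ideal (fun a => exists2 v, N v & v d = a).
  split; first by exists (fun=> 0).
    by move=> x y [v Nv <-] [w Nw <-]; exists (fun k => v k + w k) => //; apply: ND.
  by move=> a x [v Nv <-]; exists (fun k => a * v k) => //; apply: NM.
have [s [g [Jg Hg]]] := noe _ idJ.
have /choice[w Hw] : forall i, exists v, N v /\ v d = g i.
  by move=> i; have [v ? ?] := Jg i; exists v.
have sN' : submod (fun v => N v /\ v d = 0).
  split=> //; first by move=> v v' [Nv v0] [Nv' v0']; split; [exact: ND|rewrite v0 v0' addr0].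
  by move=> a v [Nv v0]; split; [exact: NM|rewrite v0 mulr0].
have [t [h [Nh Hh]]] := IH _ sN'.
exists (s + t)%N, (fun i => match fintype.split i with inl j => w j | inr j => h j end).
split=> [i|v Nv]; first by case: fintype.split => j; [exact: (Hw j).1|exact: (Nh j).1].
have [c Hc] : exists c : 'I_s -> A, v d = \sum_i c i * g i by apply: Hg; exists v.
pose v' k := v k + (-1) * \sum_i c i * w i k.
have [|c' Hc'] := Hh v'.
  split; last first.
    rewrite /v' Hc mulN1r; apply/eqP; rewrite subr_eq0; apply/eqP.
    by apply: eq_bigr => i _; rewrite (Hw i).2.
  apply: ND => //; apply: (NM (-1) (fun k => \sum_i c i * w i k)).
  by apply: submod_sum => // i; exact: (Hw i).1.
exists (fun i => match fintype.split i with inl j => c j | inr j => c' j end) => k.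
rewrite big_split_ord /= => kd.
under eq_bigr => i _ do rewrite (unsplitK (inl i)).
under [X in _ = _ + X]eq_bigr => i _ do rewrite (unsplitK (inr i)).
move: kd; rewrite ltnS leq_eqVlt => /orP[/eqP ->|kd].
  rewrite [X in _ = _ + X]big1 ?addr0; last by move=> i _; rewrite (Nh i).2 mulr0.
  by rewrite Hc; apply: eq_bigr => i _; rewrite (Hw i).2.
by rewrite -(Hc' k kd) /v' mulN1r addrC subrK.
Qed.

Lemma noetherian_acc : noetherian -> forall J : nat -> A -> Prop, (forall n, ideal (J n)) ->
  (forall n x, J n x -> J n.+1 x) -> exists n, forall k x, J k x -> J n x.
Proof.
move=> noe J idJ Jinc.
have Jle n k x : (n <= k)%N -> J n x -> J k x.
  by move=> /subnKC <-; elim: (k - n)%N => [|l IH]; [rewrite addn0|rewrite addnS => /IH; exact: Jinc].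
have [|s [g [Jg Hg]]] := noe (fun x => exists n, J n x).
  split; first by exists 0%N; have [] := idJ 0%N.
    move=> x y [n Jx] [k Jy]; exists (maxn n k); have [_ JD _] := idJ (maxn n k).
    by apply: JD; [apply: Jle Jx; exact: leq_maxl | apply: Jle Jy; exact: leq_maxr].
  by move=> a x [n Jx]; exists n; have [_ _ JM] := idJ n; apply: JM.
have /choice[n Hn] := Jg.
exists (\max_i n i)%N => k x Jx; have [c ->] := Hg x (ex_intro _ k Jx).
apply: ideal_sum => // i; apply: Jle (Hn i); exact: leq_bigmax.
Qed.

(** Krull's theorem that ideals are closed in the y-adic topology; the hypothesis on y says that it
    lies in the Jacobson radical. Two ascending chains become stationary: the colon ideals of J by
    the powers of y, which makes y ^+ n * f d and y * (y ^+ n * f d.+1) congruent for d >= n, and J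
    enlarged by more and more of the [H i]. *)
Lemma krull (y : A) (J : A -> Prop) F : noetherian -> ideal J ->
  (forall c, exists u, (1 + y * c) * u = 1) ->
  (forall d, exists2 f, J (F - y ^+ d * f) & True) -> J F.
Proof.
move=> noe idJ yrad HF; have [J0 JD JM] := idJ.
have /choice[f Hf] : forall d, exists f, J (F - y ^+ d * f).
  by move=> d; have [f] := HF d; exists f.
have [||n Hn] := @noetherian_acc noe (fun n x => J (y ^+ n * x)).
  move=> n; split; first by rewrite mulr0.
    by move=> x x' h h'; rewrite mulrDr; apply: JD.
  by move=> a x h; rewrite mulrCA; apply: JM.
  by move=> n x h; rewrite exprS -mulrA; apply: JM.
have step d : (n <= d)%N -> J (y ^+ n * f d - y * (y ^+ n * f d.+1)).
  move=> nd; have : J (y ^+ d * (f d - y * f d.+1)).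
    rewrite mulrBr mulrA -exprSr.
    have := ideal_sub idJ (Hf d.+1) (Hf d).
    by have -> : F - y ^+ d.+1 * f d.+1 - (F - y ^+ d * f d) =
      y ^+ d * f d - y ^+ d.+1 * f d.+1 by ring.
  by move=> /Hn; rewrite mulrBr [y ^+ n * (y * _)]mulrCA.
pose H d := y ^+ n * f (n + d)%N.
have stepH d : J (H d - y * H d.+1) by rewrite /H addnS; apply: step; exact: leq_addr.
have [||e He] := @noetherian_acc noe (fun e x => exists c : nat -> A, J (x - \sum_(i < e) c i * H i)).
  move=> e; split; first by exists (fun=> 0); rewrite big1 ?subr0 // => i _; rewrite mul0r.
    move=> x x' [c h] [c' h']; exists (fun i => c i + c' i).
    by under eq_bigr do rewrite mulrDl; rewrite big_split opprD addrACA; apply: JD.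
  move=> a x [c h]; exists (fun i => a * c i).
  by under eq_bigr do rewrite -mulrA; rewrite -mulr_sumr -mulrBr; apply: JM.
  move=> e x [c h]; exists (fun i => if (i < e)%N then c i else 0).
  rewrite big_ord_recr /= ltnn mul0r addr0.
  by under eq_bigr do rewrite ltn_ord.
have [c Hc] : exists c : nat -> A, J (H e - \sum_(i < e) c i * H i).
  apply: (He e.+1); exists (fun i => (i == e)%:R).
  rewrite big_ord_recr /= eqxx mul1r big1 ?add0r ?subrr // => i _.
  by rewrite ltn_eqF ?mul0r.
have Hpow k i : J (H i - y ^+ k * H (i + k)%N).
  elim: k => [|k IH]; first by rewrite expr0 mul1r addn0 subrr.
  have -> : H i - y ^+ k.+1 * H (i + k.+1)%N =
    (H i - y ^+ k * H (i + k)%N) + y ^+ k * (H (i + k)%N - y * H (i + k).+1).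
    by rewrite addnS exprSr; ring.
  by apply: JD => //; apply: JM; exact: stepH.
(* Modulo J, each H i with i < e equals y ^+ (e - i) * H e, so the relation expressing H e becomes
   (1 - y * b) * H e in J, and the first factor is invertible. *)
pose b := \sum_(i < e) c i * y ^+ (e - i).-1.
have Jb : J ((1 + y * (- b)) * H e).
  have -> : (1 + y * - b) * H e = (H e - \sum_(i < e) c i * H i) +
      \sum_(i < e) c i * (H i - y ^+ (e - i) * H (i + (e - i))%N).
    rewrite mulrDl mul1r -addrA; congr (_ + _).
    under [X in _ = _ + X]eq_bigr do rewrite mulrBr.
    rewrite sumrB addKr mulrN mulNr /b mulr_sumr mulr_suml; congr (- _).
    apply: eq_bigr => i _; rewrite subnKC ?(ltnW (ltn_ord i)) //.
    have -> : y ^+ (e - i) = y * y ^+ (e - i).-1.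
      by rewrite -exprS prednK // subn_gt0.
    by ring.
  by apply: JD => //; apply: ideal_sum => // i; exact: Hpow.
have [u Hu] := yrad (- b).
have JHe : J (H e) by rewrite -[H e]mul1r -Hu mulrAC mulrC; apply: JM.
have := Hpow e 0%N; rewrite add0n => JH0.
have JH : J (H 0%N) by rewrite -[H 0%N](subrK (y ^+ e * H e)); apply: JD => //; apply: JM.
rewrite -[F](subrK (y ^+ n * f n)); apply: JD; first exact: Hf.
by move: JH; rewrite /H addn0.
Qed.

End Noetherian.

(** * The ring of convergent power series is Noetherian *)

Section ConvergentRing.
Context {R : realType}.
Local Notation env := (nat -> R).
Local Notation PSr := (@PSr R).

Definition cvp m : {pred PSr m} := [pred c | `[< cv c >]].
Arguments cvp m : clear implicits.

Lemma cvpP m (c : PSr m) : reflect (cv c) (c \in cvp m).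
Proof. by rewrite inE; apply: asboolP. Qed.

Fact cvp_subring m : subring_closed (cvp m).
Proof.
split=> [|c d /cvpP hc /cvpP hd|c d /cvpP hc /cvpP hd]; apply/cvpP.
- exact: cv1.
- by apply: cvD => //; exact: cvN.
- exact: cvM.
Qed.

HB.instance Definition _ m := GRing.isSubringClosed.Build (PSr m) (cvp m) (cvp_subring m).

Record O (m : nat) := MkO { oval : PSr m; _ : oval \in cvp m }.
HB.instance Definition _ m := [isSub for (@oval m)].
HB.instance Definition _ m := [Choice of O m by <:].
HB.instance Definition _ m := [SubChoice_isSubComNzRing of O m by <:].

Lemma ocv m (x : O m) : cv (val x).
Proof. by case: x => c /= /cvpP. Qed.

Definition mkO m (c : PSr m) (h : cv c) : O m := MkO (introT (cvpP c) h).

Lemma oval_sum m (I : Type) (s : seq I) (P : pred I) (F : I -> O m) :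
  val (\sum_(i <- s | P i) F i) = \sum_(i <- s | P i) val (F i).
Proof. by apply: big_morph. Qed.

Definition ocoef m (k : nat) (x : O m.+1) : O m := mkO (cv_coef k (ocv x)).
Definition oC m (x : O m) : O m.+1 := mkO (cv_fpsC (ocv x)).
Definition oX m (n : nat) : O m.+1 := mkO (cv_fpsX m n).

Lemma O_unit m (x : O m) : ev (val x) (fun=> 0) != 0 -> exists y, x * y = 1.
Proof.
move=> x0; have [d hd xd] := cv_unit (ocv x) x0.
by exists (mkO hd); apply/val_inj.
Qed.

Lemma nearm_shear m (lam : env) (P : env -> Prop) : nearm m.+1 (fun=> 0) P ->
  nearm m.+1 (fun=> 0) (fun e => P (shear m lam e)).
Proof.
move=> [d d0 H]; have rp : pos (fun i => d / (1 + `|lam i|)).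
  by move=> i; rewrite divr_gt0 // ltr_pwDl.
have [b b0 Hb] := min_rad m rp.
exists (Num.min b d) => [|e He]; first by rewrite lt_min b0.
apply: H => i im; rewrite subr0 /shear; have ei := He i im.
have em := He m (ltnSn m); rewrite !subr0 !le_min in ei em.
case: ifP => [im'|_]; last by have /andP[] := ei.
have := Hb i im'; rewrite ler_pdivlMr ?ltr_pwDl // mulrDr mulr1 => h.
have {ei} /andP[ei _] := ei; have {em} /andP[em _] := em.
apply: le_trans (ler_normD _ _) _; rewrite normrM.
have := ler_wpM2l (normr_ge0 (lam i)) em; lra.
Qed.

Lemma O_shear m (lam : env) : exists f : O m.+1 -> O m.+1, [/\ forall x,
  nearm m.+1 (fun=> 0) (fun e => ev (val x) (shear m lam e) = ev (val (f x)) e),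
  forall x y, f (x + y) = f x + f y & forall x y, f (x * y) = f x * f y].
Proof.
suff [f Hf] : exists f : O m.+1 -> O m.+1, forall x,
  nearm m.+1 (fun=> 0) (fun e => ev (val x) (shear m lam e) = ev (val (f x)) e).
  exists f; split=> // x y; apply/val_inj; apply: cv_inj.
  - exact: ocv.
  - exact: ocv (f x + f y).
  - have h1 := nearm_shear lam (cv_evD (ocv x) (ocv y)).
    have h2 := cv_evD (ocv (f x)) (ocv (f y)).
    apply: nearmW (nearmI (nearmI (Hf (x + y)) h1) (nearmI h2 (nearmI (Hf x) (Hf y)))).
    move=> e [[h7 h3] [h4 [h5 h6]]].
    by apply: etrans (esym h7) _; apply: etrans h3 _; rewrite h5 h6; exact: esym h4.
  - exact: ocv.
  - exact: ocv (f x * f y).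
  - have h1 := nearm_shear lam (cv_evM (ocv x) (ocv y)).
    have h2 := cv_evM (ocv (f x)) (ocv (f y)).
    apply: nearmW (nearmI (nearmI (Hf (x * y)) h1) (nearmI h2 (nearmI (Hf x) (Hf y)))).
    move=> e [[h7 h3] [h4 [h5 h6]]].
    by apply: etrans (esym h7) _; apply: etrans h3 _; rewrite h5 h6; exact: esym h4.
have /choice[f Hf] : forall x : O m.+1, exists y : O m.+1,
   nearm m.+1 (fun=> 0) (fun e => ev (val x) (shear m lam e) = ev (val y) e).
  by move=> x; have [F' h1 h2] := shear_comp lam (ocv x); exists (mkO h1).
by exists f.
Qed.

Lemma oCD m (x y : O m) : oC (x + y) = oC x + oC y.
Proof. by apply/val_inj/funext => -[|k] //; rewrite /= fpsDE addr0. Qed.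

Lemma oCM m (x y : O m) : oC (x * y) = oC x * oC y.
Proof. by apply/val_inj/funext => k; rewrite /= fpsCM; case: k => [|k] //; rewrite mulr0. Qed.

Lemma oC0 m : oC (0 : O m) = 0.
Proof. by apply/val_inj/funext => -[|k]. Qed.

Lemma oC_sum m (I : Type) (s : seq I) (P : pred I) (F : I -> O m) :
  oC (\sum_(i <- s | P i) F i) = \sum_(i <- s | P i) oC (F i).
Proof. by apply: (big_morph (@oC m)) => [x y|]; [exact: oCD|exact: oC0]. Qed.

Definition opoly m d (v : nat -> O m) : O m.+1 := \sum_(k < d) oC (v k) * oX m k.

Lemma val_opoly m d (v : nat -> O m) k : (val (opoly d v) : nat -> PSr m) k = if (k < d)%N then val (v k) else 0.
Proof.
rewrite /opoly oval_sum fps_sumE.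
have E (i : 'I_d) : (val (oC (v i) * oX m i) : fps _) k = if k == i then val (v i) else 0.
  by rewrite /= fpsCM /fpsX; case: eqP; rewrite ?mulr1 ?mulr0.
under eq_bigr do rewrite E.
case: ifP => kd; last first.
  by apply: big1 => i _; case: eqP => // ki; rewrite ki ltn_ord in kd.
rewrite (bigD1 (Ordinal kd)) //= eqxx big1 ?addr0 // => i ik.
by case: eqP => // ki; move: ik; rewrite -val_eqE /= ki eqxx.
Qed.

(** The basis theorem of Rückert. After a shear a nonzero ideal contains a regular series; division
    by it leaves remainders that are polynomials of degree below d, and their coefficient vectors
    form a submodule over the ring in one variable less. *)
Theorem O_noetherian m : noetherian (O m).
Proof.
elim: m => [|m IH] J idJ; have [J0 JD JM] := idJ.
  have [[x Jx x0]|H] := pselect (exists2 x, J x & x <> 0).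
    have [|y xy] := @O_unit 0 x.
      by apply/eqP => h; apply: x0; apply/val_inj.
    exists 1%N, (fun=> x); split=> // z _; exists (fun=> z * y).
    by rewrite big_ord1 -mulrA [y * x]mulrC xy mulr1.
  exists 0%N, (fun=> 0); split=> [[]//|z Jz]; exists (fun=> 0); rewrite big_ord0.
  by apply: contrapT => z0; apply: H; exists z.
have [[F JF F0]|H] := pselect (exists2 x, J x & x <> 0); last first.
  exists 0%N, (fun=> 0); split=> [[]//|z Jz]; exists (fun=> 0); rewrite big_ord0.
  by apply: contrapT => z0; apply: H; exists z.
have [lam Hlam] := @generic_line R m unit (fun=> val F) (fun=> ocv F)
  (fun _ h => F0 (@val_inj _ _ _ F 0 h)).
have [f [Hf fD fM]] := @O_shear m lam.
have [g [Hg gD gM]] := @O_shear m (fun i => - lam i).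
have gf x : g (f x) = x.
  apply/val_inj; apply: cv_inj (ocv _) (ocv _) _.
  apply: nearmW (nearmI (Hg (f x)) (nearm_shear (fun i => - lam i) (Hf x))) => e [<- <-].
  by rewrite shearK.
have [d rF] := axis_regular (ocv (f F)) (Hlam tt) (Hf F).
have g0 : g 0 = 0 by apply: (addrI (g 0)); rewrite -gD !addr0.
have g_sum (I : Type) (s : seq I) (G : I -> O m.+1) : g (\sum_(i <- s) G i) = \sum_(i <- s) g (G i).
  exact: (big_morph g gD g0).
have sN : submod (fun v => J (g (opoly d v))).
  split.
  - rewrite (_ : opoly d _ = 0) ?g0 //; apply: big1 => k _.
    by rewrite oC0 mul0r.
  - move=> v w Jv Jw; rewrite (_ : opoly d _ = opoly d v + opoly d w) ?gD; first exact: JD.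
    by rewrite /opoly -big_split; apply: eq_bigr => k _; rewrite oCD mulrDl.
  - move=> a v Jv; rewrite (_ : opoly d _ = oC a * opoly d v) ?gM; first exact: JM.
    by rewrite /opoly mulr_sumr; apply: eq_bigr => k _; rewrite oCM mulrA.
have [s [w [Nw Hw]]] := noetherian_submod IH d sN.
exists (1 + s)%N, (fun i => match fintype.split i with inl _ => F | inr j => g (opoly d (w j)) end).
split=> [i|x Jx]; first by case: fintype.split.
have [Q [S [cQ cS xE HS]]] := wdiv (ocv (f F)) (ocv (f x)) rF.
pose q := mkO cQ; pose v k : O m := mkO (cv_coef k cS).
have fxE : f x = q * f F + opoly d v.
  apply/val_inj; rewrite [LHS]xE; apply/funext => k.
  rewrite [RHS]fpsDE [LHS]fpsDE; congr (_ + _).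
  by rewrite val_opoly; case: ltnP => // /HS.
have xE' : x = g q * F + g (opoly d v) by rewrite -[LHS]gf fxE gD gM gf.
have Nv : J (g (opoly d v)).
  have -> : g (opoly d v) = x - g q * F by rewrite {1}xE' addrC addKr.
  by apply: ideal_sub => //; apply: JM.
have [c Hc] := Hw _ Nv.
exists (fun i => match fintype.split i with inl _ => g q | inr j => g (oC (c j)) end).
rewrite big_split_ord /= big_ord1 (unsplitK (inl ord0)) xE'; congr (_ + _).
have -> : opoly d v = \sum_i oC (c i) * opoly d (w i).
  rewrite /opoly; under [RHS]eq_bigr do rewrite mulr_sumr.
  rewrite exchange_big; apply: eq_bigr => k _.
  rewrite Hc // oC_sum mulr_suml; apply: eq_bigr => i _.
  by rewrite oCM mulrA.
rewrite g_sum; apply: eq_bigr => i _; rewrite (unsplitK (inr i)).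
by rewrite gM.
Qed.

End ConvergentRing.

(** * Content of a series with respect to the last n variables *)

Section Content.
Context {R : realType}.
Local Notation env := (nat -> R).
Local Notation PSr := (@PSr R).
Local Notation O := (@O R).

Lemma fpsX_pow (A : comNzRingType) n : fpsX A 1 ^+ n = fpsX A n.
Proof.
elim: n => [|n IH]; first by apply/funext => -[|k].
rewrite exprS IH; apply/funext => k; rewrite fpsXM /fpsX.
by case: k => [|k] //=; rewrite subn1 /= eqSS.
Qed.

Lemma oX_pow m n : oX m 1 ^+ n = oX m n :> O m.+1.
Proof.
apply/val_inj; rewrite -[RHS]/(fpsX (PSr m) n) -fpsX_pow.
by elim: n => [|n IH] //; rewrite !exprS -IH.
Qed.

Lemma ohigh_cv m d (x : O m.+1) : cv (high d (val x)).
Proof. by have [r [M [r0 h]]] := ocv x; exists r, (M / r m ^+ d); split=> //; exact: nrm_high. Qed.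

Lemma split_low m d (x : O m.+1) :
  x = opoly d (fun k => ocoef k x) + oX m d * mkO (ohigh_cv d x).
Proof.
apply/val_inj/funext => k.
rewrite -[RHS]/((val (opoly d (fun k => ocoef k x)) : fps _) k + (fpsX (PSr m) d * high d (val x)) k).
rewrite val_opoly fpsXM; case: ltnP => kd; first by rewrite addr0.
by rewrite add0r /high subnK.
Qed.

(* A series lies in the ideal generated by finitely many of its coefficients in the
   last variable: it does so modulo every power of that variable. *)
Lemma content1 m (x : O m.+1) : exists s (g : nat -> O m.+1),
  x = \sum_(k < s) oC (ocoef k x) * g k.
Proof.
pose J z := exists s (g : nat -> O m.+1), z = \sum_(k < s) oC (ocoef k x) * g k.
have Jwid s s' (g : nat -> O m.+1) : (s <= s')%N -> exists g' : nat -> O m.+1, \sum_(k < s) oC (ocoef k x) * g k =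
    \sum_(k < s') oC (ocoef k x) * g' k.
  move=> ss'; exists (fun k => if (k < s)%N then g k else 0).
  rewrite (big_ord_widen s' (fun k => oC (ocoef k x) * g k) ss') big_mkcond.
  by apply: eq_bigr => i _; case: ifP => // _; rewrite mulr0.
have idJ : ideal J.
  split; first by exists 0%N, (fun=> 0); rewrite big_ord0.
    move=> _ _ [s [g ->]] [s' [g' ->]].
    have [h ->] := Jwid s (maxn s s') g (leq_maxl _ _).
    have [h' ->] := Jwid s' (maxn s s') g' (leq_maxr _ _).
    exists (maxn s s'), (fun k => h k + h' k); rewrite -big_split.
    by apply: eq_bigr => i _; rewrite mulrDr.
  move=> a _ [s [g ->]]; exists s, (fun k => a * g k); rewrite mulr_sumr.
  by apply: eq_bigr => i _; rewrite mulrCA.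
apply: (krull (y := oX m 1) (@O_noetherian R m.+1) idJ) => [c|d].
  apply: O_unit; rewrite (cv_evD0 (ocv 1) (ocv (oX m 1 * c))) ev1.
  by rewrite (cv_evM0 (ocv (oX m 1)) (ocv c)) evX expr1 mul0r addr0 oner_eq0.
exists (mkO (ohigh_cv d x)) => //; rewrite oX_pow {1}(split_low d x) addrK.
by exists d, (fun k => oX m k).
Qed.

Fixpoint oCn n m (x : O m) : O (n + m) :=
  match n return O (n + m) with 0 => x | n'.+1 => oC (oCn n' x) end.

(** The coefficient of a monomial in the last n variables, the variable of index m + i having
    exponent al i; it is a series in the first m variables. *)
Fixpoint ocoefs n m (al : nat -> nat) : O (n + m) -> O m :=
  match n return O (n + m) -> O m with
  | 0 => fun x => x
  | n'.+1 => fun x => ocoefs al (ocoef (al n') (x : O (n' + m).+1))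
  end.

Lemma oCnD n m (x y : O m) : oCn n (x + y) = oCn n x + oCn n y.
Proof. by elim: n => //= n ->; rewrite oCD. Qed.
Lemma oCnM n m (x y : O m) : oCn n (x * y) = oCn n x * oCn n y.
Proof. by elim: n => //= n ->; rewrite oCM. Qed.
Lemma oCn0 n m : oCn n (0 : O m) = 0.
Proof. by elim: n => //= n ->; rewrite oC0. Qed.

Lemma ocoefD m k (x y : O m.+1) : ocoef k (x + y) = ocoef k x + ocoef k y.
Proof. exact/val_inj. Qed.
Lemma ocoefCM m k (b : O m) (x : O m.+1) : ocoef k (oC b * x) = b * ocoef k x.
Proof. by apply/val_inj; rewrite /= fpsCM. Qed.

Lemma ocoefsD n m al (x y : O (n + m)) : ocoefs al (x + y) = ocoefs al x + ocoefs al y.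
Proof. by elim: n x y => //= n IH x y; rewrite (ocoefD _ (x : O (n + m).+1)) IH. Qed.
Lemma ocoefs0 n m al : ocoefs al (0 : O (n + m)) = 0.
Proof. by apply: (addrI (ocoefs al (0 : O (n + m)))); rewrite -ocoefsD !addr0. Qed.
Lemma ocoefsCM n m al (b : O m) (x : O (n + m)) : ocoefs al (oCn n b * x) = b * ocoefs al x.
Proof. by elim: n x => //= n IH x; rewrite (ocoefCM _ _ (x : O (n + m).+1)) IH. Qed.
Lemma ocoefs_sum n m al (I : Type) (s : seq I) (P : pred I) (F : I -> O (n + m)) :
  ocoefs al (\sum_(i <- s | P i) F i) = \sum_(i <- s | P i) ocoefs al (F i).
Proof. exact: (big_morph (@ocoefs n m al) (@ocoefsD n m al) (@ocoefs0 n m al)). Qed.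

Definition contents n m (x : O (n + m)) s := exists (al : 'I_s -> nat -> nat) (g : 'I_s -> O (n + m)),
  x = \sum_i oCn n (ocoefs (al i) x) * g i.

Lemma content_ex n m (x : O (n + m)) : exists s, contents x s.
Proof.
elim: n x => [|n IH] x.
  by exists 1%N, (fun=> id), (fun=> 1); rewrite big_ord1 mulr1.
have [K [g xE]] := content1 (x : O (n + m).+1).
have /choice[s Hs] : forall k, exists s, contents (ocoef k (x : O (n + m).+1)) s by move=> k; apply: IH.
pose T := {k : 'I_K & 'I_(s k)}.
pose al k := sval (cid (Hs k)); pose h k := sval (cid (svalP (cid (Hs k)))).
have E k : ocoef k (x : O (n + m).+1) =
    \sum_i oCn n (ocoefs (al k i) (ocoef k (x : O (n + m).+1))) * h k i.
  exact: svalP (cid (svalP (cid (Hs k)))).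
pose be (u : T) : nat -> nat := fun j => if j == n then tag u : nat else al (tag u) (tagged u) j.
pose f (u : T) : O (n.+1 + m) := oC (h (tag u) (tagged u)) * g (tag u).
exists #|{: T}|, (fun i => be (enum_val i)), (fun i => f (enum_val i)).
rewrite -(big_enum_val (A := {: T}) (fun u => oCn n.+1 (ocoefs (be u) x) * f u)) /=.
rewrite {1}xE; transitivity (\sum_(k < K) \sum_(i < s k)
    oC (oCn n (ocoefs (al k i) (ocoef k (x : O (n + m).+1))) * h k i) * g k).
  by apply: eq_bigr => k _; rewrite {1}(E k) oC_sum mulr_suml.
rewrite sig_big_dep /=; apply: eq_bigr => u _.
rewrite oCM -mulrA; congr (oC (oCn n _) * _).
rewrite /be eqxx; set c := ocoef _ _.
suff H (b b' : nat -> nat) (z : O (n + m)) : (forall j, (j < n)%N -> b j = b' j) -> ocoefs b z = ocoefs b' z.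
  by apply: H => j jn; rewrite ltn_eqF.
elim: n b b' z {IH x xE s Hs T al h E be f u c g} => //= n IH b b' z H.
by rewrite H //; apply: IH => j jn; apply: H; apply: ltnW.
Qed.

Lemma oDE m (x y : O m) : val (x + y) = val x + val y.
Proof. by []. Qed.
Lemma oME m (x y : O m) : val (x * y) = val x * val y.
Proof. by []. Qed.

Lemma ocv0M m (x y : O m) : ev (val (x * y)) (fun=> 0) = ev (val x) (fun=> 0) * ev (val y) (fun=> 0).
Proof. exact: cv_evM0 (ocv x) (ocv y). Qed.
Lemma ocv0D m (x y : O m) : ev (val (x + y)) (fun=> 0) = ev (val x) (fun=> 0) + ev (val y) (fun=> 0).
Proof. exact: cv_evD0 (ocv x) (ocv y). Qed.

(* With the number of generators minimal, Nakayama's lemma makes the matrix of the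
   corresponding coefficients of the cofactors the identity at the origin. *)
Lemma content_min n m (x : O (n + m)) : exists s (al : 'I_s -> nat -> nat) (g : 'I_s -> O (n + m)),
  x = \sum_i oCn n (ocoefs (al i) x) * g i /\
  forall i j, ev (val (ocoefs (al i) (g j))) (fun=> 0) = (i == j)%:R.
Proof.
have [s0 hs0] := content_ex x.
have ex : exists s, `[< contents x s >] by exists s0; apply/asboolP.
case: (ex_minnP ex) => s /asboolP [al [g xE]] mins.
exists s, al, g; split=> // i j; apply: contrapT => /eqP Hij.
have [b bd] : exists b : 'I_s -> O m, forall i, b i = ocoefs (al i) x by exists (fun i => ocoefs (al i) x).
have bE l : b l = \sum_k b k * ocoefs (al l) (g k).
  rewrite {1}bd {1}xE ocoefs_sum; apply: eq_bigr => k _; rewrite bd; exact: ocoefsCM.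
case: s al g xE mins i j b bd bE Hij => [|s] al g xE mins i j b bd bE Hij; first by case: (i).
(* If this entry were a unit, the relation [bE] for index i would express b j through the other
   coefficients, one generator could be dropped, and s would not be minimal. *)
pose u := ocoefs (al i) (g j) - (i == j)%:R.
have [v uv] : exists v, u * v = 1.
  apply: O_unit; move: Hij; apply: contra_neq => u0.
  have : ev (val (u + (i == j)%:R)) (fun=> 0) = ev (val ((i == j)%:R : O m)) (fun=> 0).
    by rewrite ocv0D u0 add0r.
  rewrite /u subrK => ->; case: (i == j); [exact: ev1 | exact: ev0].
pose w k := (ocoefs (al i) (g k) - (i == k)%:R) * v.
have bj : b j = - \sum_(k < s) b (lift j k) * w (lift j k).
  have : \sum_k b k * (ocoefs (al i) (g k) - (i == k)%:R) = 0.
    under eq_bigr do rewrite mulrBr.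
    rewrite sumrB -bE (bigD1 i) //= eqxx mulr1 big1 ?addr0 ?subrr // => k ki.
    by rewrite eq_sym (negbTE ki) mulr0.
  rewrite (bigD1_ord j) //= -/u => /eqP; rewrite addr_eq0 => /eqP h.
  rewrite -[b j]mulr1 -uv mulrA h mulNr mulr_suml; congr (- _).
  by apply: eq_bigr => k _; rewrite /w mulrA.
have : contents x s.
  exists (fun k => al (lift j k)), (fun k => g (lift j k) - oCn n (w (lift j k)) * g j).
  rewrite {1}xE; under eq_bigr do rewrite -bd.
  under [in RHS]eq_bigr do rewrite -bd.
  rewrite (bigD1_ord j) //= bj.
  have -> : oCn n (- \sum_k b (lift j k) * w (lift j k)) = - \sum_k oCn n (b (lift j k)) * oCn n (w (lift j k)).
    have NE (y : O m) : oCn n (- y) = - oCn n y.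
      by apply: (addrI (oCn n y)); rewrite -oCnD !subrr oCn0.
    rewrite NE (big_morph (@oCn n m) (@oCnD n m) (@oCn0 n m)); congr (- _).
    by apply: eq_bigr => k _; rewrite oCnM.
  rewrite mulNr mulr_suml addrC -sumrB; apply: eq_bigr => k _.
  by rewrite mulrBr mulrA.
by move=> /asboolT /mins; rewrite ltnn.
Qed.

(** On the plane where the first m variables vanish, the restriction of x is a series in the
    remaining n whose coefficients are the values at 0 of the [ocoefs]. *)
Lemma ocoefs_plane0 n m al (x : O (n + m)) :
  nearm (n + m) (fun=> 0) (fun e => (forall i, (i < m)%N -> e i = 0) -> ev (val x) e = 0) ->
  ev (val (ocoefs al x)) (fun=> 0) = 0.
Proof.
elim: n x => [|n IH] x H; first by apply: (nearm_at H).
apply: IH; have [r [M [r0 h]]] := ocv x; have [mu [h1 h2]] := nrmSP h.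
have [d d0 Hd] := H; have [dr dr0 Hdr] := min_rad (n + m).+1 r0.
exists (Num.min d dr) => [|e He e0]; first by rewrite lt_min d0.
have hed i : (i < n + m)%N -> `|e i| <= d.
  by move=> im; have := He i im; rewrite subr0 le_min => /andP[].
have her i : (i < n + m)%N -> `|e i| <= r i.
  move=> im; have := He i im; rewrite subr0 le_min => /andP[_ h3].
  by apply: le_trans h3 (Hdr i _); apply: ltnW.
pose k0 := al n.
apply: (@ps_coef_zero R (fun k => ev (val x k : PSr (n + m)) e) mu (r (n + m)%N) M d) k0 => //.
  by move=> k; apply: (ev_bound r0 (h1 k)) => i im; apply: her.
move=> s /andP[s0 sd].
have := Hd (fun i => if i == (n + m)%N then s else e i).
have He' i : (i < (n + m).+1)%N -> `|(if i == (n + m)%N then s else e i) - 0| <= d.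
  rewrite subr0 ltnS leq_eqVlt; case: eqP => [_ _|_ /= im]; last exact: hed.
  by rewrite ger0_norm // ltW.
move=> /(_ He'); have zm i : (i < m)%N -> (if i == (n + m)%N then s else e i) = 0.
  by move=> im; rewrite ltn_eqF ?e0 // (leq_trans im) // leq_addl.
move=> /(_ zm) /= <-; rewrite eqxx; congr tsum; apply/funext => j; congr (_ * _).
by apply: ev_ext => i im; rewrite ltn_eqF.
Qed.

Definition splice m (a : env) (y : env) : env := fun i => if (i < m)%N then a i else y i.

(** The germ at a of h does not vanish identically on the fibre through a of the projection to the
    first m coordinates. This permits Weierstrass preparation after a shear that leaves the
    parameters alone. *)
Definition nonzero_fib m n (a : env) (h : env -> R) := forall d : R, 0 < d ->
  exists2 y : env, (forall i, (i < n + m)%N -> `|y i - a i| <= d) & h (splice m a y) != 0.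

Lemma oCn_ev n m (x : O m) : nearm (n + m) (fun=> 0) (fun e => ev (val (oCn n x)) e = ev (val x) e).
Proof.
elim: n => [|n [d d0 Hd]]; first by exists 1.
have [r [M [r0 h]]] := ocv (oCn n x); have [b b0 Hb] := min_rad (n + m) r0.
exists (Num.min d b) => [|e He]; first by rewrite lt_min d0.
rewrite -Hd; last by move=> i im; apply: le_trans (He i (ltnW im)) _; rewrite ge_min lexx.
apply: (evC h) => i im; apply: le_trans (Hb i im).
by have := He i (ltnW im); rewrite subr0 le_min => /andP[].
Qed.

Lemma nearm_widen m m' (a : env) P : (m <= m')%N -> nearm m a P -> nearm m' a P.
Proof.
by move=> mm' [d d0 H]; exists d => // e He; apply: H => i im; apply: He; apply: leq_trans im mm'.
Qed.

Lemma nearm_shift m (a : env) P : nearm m (fun=> 0) P -> nearm m a (fun e => P (fun i => e i - a i)).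
Proof. by move=> [d d0 H]; exists d => // e He; apply: H => i im; rewrite subr0; apply: He. Qed.

Lemma an_O m a f : an m a f -> exists x : O m, nearm m a (fun e => f e = ev (val x) (fun i => e i - a i)).
Proof.
by move=> /an_germ[c [r [M [r0 h H]]]]; exists (mkO (ex_intro _ r (ex_intro _ M (conj r0 h)))).
Qed.

(** The source of restricted quotients. Divided by the largest of the coefficients b i, which depend
    on the parameters only, f becomes a combination of the g i with coefficients v i in [-1, 1], one
    of them 1. The last clause says that no such combination vanishes on the central fibre. *)
Theorem content_an n m a f : an (n + m) a f -> exists s (b g : nat -> env -> R),
  [/\ forall i, (i < s)%N -> an m a (b i), forall i, (i < s)%N -> an (n + m) a (g i),
   nearm (n + m) a (fun e => f e = \sum_(i < s) b i e * g i e) &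
   forall (v : nat -> R) j, (j < s)%N -> v j = 1 ->
     nonzero_fib m n a (fun e => \sum_(i < s) v i * g i e)].
Proof.
move=> /an_O[x Hx]; have [s [al [g [xE Hg]]]] := content_min x.
pose B i e := if insub i is Some j then ev (val (ocoefs (al (j : 'I_s)) x)) (fun k => e k - a k) else 0.
pose G i e := if insub i is Some j then ev (val (g (j : 'I_s))) (fun k => e k - a k) else 0.
have BE (i : 'I_s) : B i = fun e => ev (val (ocoefs (al i) x)) (fun k => e k - a k).
  by apply/funext => e; rewrite /B valK.
have GE (i : 'I_s) : G i = fun e => ev (val (g i)) (fun k => e k - a k).
  by apply/funext => e; rewrite /G valK.
exists s, B, G; split.
- by move=> i im; rewrite (BE (Ordinal im)); apply: cv_an (ocv _).
- by move=> i im; rewrite (GE (Ordinal im)); apply: cv_an (ocv _).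
- have hs : nearm (n + m) (fun=> 0) (fun e => ev (val x) e =
     \sum_i ev (val (ocoefs (al i) x)) e * ev (val (g i)) e).
    rewrite {1}xE; elim: (index_enum _) => [|i t IH].
      by rewrite big_nil; apply: nearmT => e; rewrite big_nil ev0.
    rewrite big_cons.
    have h1 := cv_evD (ocv (oCn n (ocoefs (al i) x) * g i)) (ocv (\sum_(j <- t) oCn n (ocoefs (al j) x) * g j)).
    have h2 := cv_evM (ocv (oCn n (ocoefs (al i) x))) (ocv (g i)).
    apply: nearmW (nearmI (nearmI h1 h2) (nearmI IH (oCn_ev n (ocoefs (al i) x)))) => e.
    by move=> [[q1 q2] [q3 q4]]; rewrite big_cons -q3 -q4 -q2; exact: q1.
  apply: nearmW (nearmI Hx (nearm_shift a hs)) => e [-> ->].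
  by apply: eq_bigr => i _; rewrite BE GE.
- move=> v j js vj; pose h := \sum_(i < s) oCn n (mkO (cv_cstP m (v i))) * g i.
  have hE : nearm (n + m) (fun=> 0) (fun e => ev (val h) e = \sum_(i < s) v i * ev (val (g i)) e).
    rewrite /h; elim: (index_enum _) => [|i t IH].
      by rewrite big_nil; apply: nearmT => e; rewrite big_nil ev0.
    rewrite big_cons.
    have h1 := cv_evD (ocv (oCn n (mkO (cv_cstP m (v i))) * g i)) (ocv (\sum_(j <- t) oCn n (mkO (cv_cstP m (v j))) * g j)).
    have h2 := cv_evM (ocv (oCn n (mkO (cv_cstP m (v i))))) (ocv (g i)).
    apply: nearmW (nearmI (nearmI h1 h2) (nearmI IH (oCn_ev n (mkO (cv_cstP m (v i)))))) => e.
    move=> [[q1 q2] [q3 q4]]; rewrite big_cons oDE q1 oME q2 q3 q4.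
    by congr (_ * _ + _); exact: ev_cstP.
  move=> d d0; apply: contrapT => Hd.
  have : ev (val (ocoefs (al (Ordinal js)) h)) (fun=> 0) = 0.
    apply: ocoefs_plane0; have [d' d'0 Hd'] := hE.
    exists (Num.min d d') => [|e He e0]; first by rewrite lt_min d0.
    rewrite Hd'; last by move=> i im; apply: le_trans (He i im) _; rewrite ge_min lexx orbT.
    apply/eqP; apply: contrapT => /negP hne; apply: Hd; exists (fun i => e i + a i) => [i im|].
      by rewrite addrK -[e i]subr0; apply: le_trans (He i im) _; rewrite ge_min lexx.
    move: hne; congr (_ != 0); apply: eq_bigr => i _; rewrite GE; congr (_ * _).
    apply: ev_ext => k _; rewrite /splice; case: ifP => km; last by rewrite addrK.
    by rewrite subrr e0.
  have ->: ev (val (ocoefs (al (Ordinal js)) h)) (fun=> 0) = 1; last by move/eqP; rewrite oner_eq0.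
  rewrite /h ocoefs_sum.
  have evs (I : Type) (t : seq I) (F : I -> O m) : ev (val (\sum_(i <- t) F i)) (fun=> 0) = \sum_(i <- t) ev (val (F i)) (fun=> 0).
    elim: t => [|i t IH]; first by rewrite !big_nil ev0.
    by rewrite !big_cons ocv0D IH.
  rewrite evs; under eq_bigr do rewrite ocoefsCM ocv0M Hg /= ev_cstP.
  rewrite (bigD1 (Ordinal js)) //= eqxx mulr1 vj big1 ?addr0 // => i ij.
  by rewrite eq_sym (negbTE ij) mulr0.
Qed.

End Content.

(** * Elimination of quantifiers for restricted analytic conditions *)

Section RealInduction.
Context {R : realType}.

(** Real induction: one supremum argument that serves below wherever compactness or connectedness of
    a segment is needed. *)
Lemma real_ind (P : R -> Prop) (a b : R) : a <= b -> P a ->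
  (forall x, a <= x -> x < b -> P x -> exists2 y, x < y & forall z, x < z -> z <= y -> z <= b -> P z) ->
  (forall x, a < x -> x <= b -> (forall y, a <= y -> y < x -> P y) -> P x) -> P b.
Proof.
move=> ab Pa step lim.
pose S := [set x | a <= x <= b /\ forall y, a <= y -> y <= x -> P y].
have Sa : S a by split; [rewrite lexx ab | move=> y ay ya; have -> : y = a by lra].
have hS : has_sup S by split; [exists a | exists b => x [/andP[_ ?]]].
pose s := sup S.
have as_ : a <= s by apply: sup_ubound => //; exact: hS.2.
have sb : s <= b by apply: sup_le_ub; [exists a | move=> x [/andP[_ ?]]].
have below y : a <= y -> y < s -> P y.
  move=> ay ys; have ey : 0 < s - y by lra.
  have [x [/andP[ax xb] Hx] hx] := sup_adherent ey hS.
  by apply: Hx => //; move: hx; rewrite -/s; lra.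
have Ps : P s.
  have [as'|] := ltP a s; last by move=> sa; have -> : s = a by lra.
  by apply: lim => // y ay ys; apply: below.
have [sb'|bs] := ltP s b; last by have <- : s = b by lra.
have [y sy Hy] := step s as_ sb' Ps.
have : Num.min y b <= s.
  apply: sup_ubound; first exact: hS.2.
  split; first by rewrite ge_min lexx orbT andbT le_min ab andbT; lra.
  move=> z az; rewrite le_min => /andP[zy zb].
  have [zs|sz] := leP z s; last exact: Hy.
  have [zs'|] := ltP z s; first exact: below.
  by move=> sz; have -> : z = s by lra.
by rewrite leNgt lt_min sy sb'.
Qed.

Local Notation env := (nat -> R).

Lemma segment_cover (Q : R -> R -> Prop) (a b : R) :
  (forall t, a <= t <= b -> exists2 d : R, 0 < d & Q t d) ->
  exists s : seq (R * R), (forall p, p \in s -> [/\ 0 < p.2, a <= p.1 <= b & Q p.1 p.2]) /\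
    forall t, a <= t <= b -> exists2 p, p \in s & `|t - p.1| <= p.2.
Proof.
have [ab|ba] := leP a b; last first.
  by move=> _; exists [::]; split=> // t /andP[at_ tb]; lra.
move=> H.
pose C x := exists s : seq (R * R), (forall p, p \in s -> [/\ 0 < p.2, a <= p.1 <= b & Q p.1 p.2]) /\
    forall t, a <= t <= x -> exists2 p, p \in s & `|t - p.1| <= p.2.
have ext x y t d : a <= t <= b -> 0 < d -> Q t d -> C x -> (forall z, x < z -> z <= y -> `|z - t| <= d) -> C y.
  move=> tab d0 Qt [s [Hs Cs]] Hz; exists ((t, d) :: s); split.
    by move=> p; rewrite inE => /orP[/eqP ->//|/Hs].
  move=> z /andP[az zy]; have [zx|xz] := leP z x.
    by have [|p ps hp] := Cs z; [rewrite az | exists p => //; rewrite inE ps orbT].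
  by exists (t, d); [rewrite inE eqxx | exact: Hz].
have [d d0 Qd] := H a ltac:(by rewrite lexx ab).
apply: (real_ind ab (P := C)).
- exists [:: (a, d)]; split; first by move=> p; rewrite inE => /eqP ->; rewrite lexx ab.
  by move=> t /andP[at_ ta]; exists (a, d); rewrite ?inE // (_ : t = a) ?subrr ?normr0 ?ltW //; lra.
- move=> x ax xb Cx; have [e e0 Qe] := H x ltac:(by rewrite ax ltW).
  exists (x + e); first by lra.
  move=> z xz zx zb; apply: (ext x z x e) => //; first by rewrite ax ltW.
  by move=> w xw wz; rewrite ger0_norm; lra.
- move=> x ax xb Hx; have [e e0 Qe] := H x ltac:(by rewrite (ltW ax)).
  have m1 : a <= Num.max a (x - e) by rewrite le_max lexx.
  have m2 : Num.max a (x - e) < x by rewrite gt_max ax /=; lra.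
  apply: (ext (Num.max a (x - e)) x x e) => //; first by rewrite (ltW ax).
    exact: Hx.
  by move=> z; rewrite gt_max => /andP[az xz] zx; rewrite ler0_norm; lra.
Qed.

Definition upd (e : env) m (v : R) : env := fun i => if i == m then v else e i.

Lemma box_cover n (l u : env) (Q : env -> R -> Prop) :
  (forall b, (forall i, (i < n)%N -> l i <= b i <= u i) -> exists2 d : R, 0 < d & Q b d) ->
  exists s : seq (env * R), (forall p, List.In p s -> [/\ 0 < p.2,
      forall i, (i < n)%N -> l i <= p.1 i <= u i & Q p.1 p.2]) /\
    forall y, (forall i, (i < n)%N -> l i <= y i <= u i) ->
      exists2 p, List.In p s & forall i, (i < n)%N -> `|y i - p.1 i| <= p.2.
Proof.
elim: n Q => [|n IH] Q H.
  have [d d0 Qd] := H (fun=> 0) (fun i h => ltac:(by [])).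
  by exists [:: (fun=> 0, d)]; split=> [p [<-|[]]|y _] //; exists (fun=> 0, d) => //=; left.
have mincover (s : seq (env * R)) : (forall p, List.In p s -> 0 < p.2) ->
   exists2 d : R, 0 < d & forall p, List.In p s -> d <= p.2.
  elim: s => [|q s IHs] Hs; first by exists 1.
  have [|d d0 Hd] := IHs; first by move=> p ps; apply: Hs; right.
  exists (Num.min q.2 d); first by rewrite lt_min d0 andbT; apply: Hs; left.
  by move=> p [<-|/Hd h]; rewrite ge_min ?lexx // h orbT.
(* The tube lemma: a finite cover of the slice at t also covers the slices at distance at most d,
   provided that d is below all its radii. *)
pose Q1 t d := exists s : seq (env * R), (forall p, List.In p s -> [/\ 0 < p.2, d <= p.2,
      forall i, (i < n)%N -> l i <= p.1 i <= u i & Q (upd p.1 n t) p.2]) /\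
    forall y, (forall i, (i < n)%N -> l i <= y i <= u i) ->
      exists2 p, List.In p s & forall i, (i < n)%N -> `|y i - p.1 i| <= p.2.
have [|s [Hs Cs]] := @segment_cover Q1 (l n) (u n).
  move=> t tn; have [|s [Hs Cs]] := IH (fun b d => Q (upd b n t) d).
    move=> b Hb; apply: H => i; rewrite ltnS leq_eqVlt /upd; case: eqP => [->//|_ /= im].
    exact: Hb.
  have [|d d0 Hd] := mincover s; first by move=> p /Hs[].
  exists d => //; exists s; split=> // p ps; have [p0 pb pQ] := Hs p ps; split=> //; exact: Hd.
suff [S [HS CS]] : exists S : seq (env * R), (forall p, List.In p S -> [/\ 0 < p.2,
      forall i, (i < n.+1)%N -> l i <= p.1 i <= u i & Q p.1 p.2]) /\
    forall y t, (exists2 p, p \in s & `|t - p.1| <= p.2) -> (forall i, (i < n)%N -> l i <= y i <= u i) ->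
      exists2 p, List.In p S & forall i, (i < n.+1)%N -> `|upd y n t i - p.1 i| <= p.2.
  exists S; split=> // y Hy; have [||p pS Hp] := CS y (y n).
  - by apply: Cs; apply: Hy.
  - by move=> i im; apply: Hy; apply: ltnW.
  exists p => // i im; have := Hp i im; rewrite /upd; case: eqP => // -> //.
elim: s {Cs} Hs => [|q s IHs] Hs.
  by exists [::]; split=> // y t [p]; rewrite in_nil.
have [|S [HS CS]] := IHs; first by move=> p ps; apply: Hs; rewrite inE ps orbT.
have [q0 qb [sq [Hsq Csq]]] := Hs q (mem_head _ _).
exists ([seq (upd p.1 n q.1, p.2) | p <- sq] ++ S)%SEQ; split.
  move=> p /List.in_app_iff[|/HS//] /List.in_map_iff[p' [<- /Hsq[p'0 dp' pb pQ]]].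
  split=> // i; rewrite ltnS leq_eqVlt /upd /=; case: eqP => [->//|_ /= im]; exact: pb.
move=> y t [p]; rewrite inE => /orP[/eqP -> tq|ps tp] Hy; last first.
  have [||p' p'S Hp'] := CS y t => //; first by exists p.
  by exists p' => //; apply/List.in_app_iff; right.
have [p' /[dup] /Hsq[p'0 dp' pb pQ] p'sq Hp'] := Csq y Hy.
exists (upd p'.1 n q.1, p'.2).
  by apply/List.in_app_iff; left; apply/List.in_map_iff; exists p'.
move=> i; rewrite ltnS leq_eqVlt /upd /=; case: eqP => [_ _|_ /= im]; last exact: Hp'.
exact: le_trans tq dp'.
Qed.

End RealInduction.

(** * Classes of predicates closed under Boolean operations *)

Section BooleanClass.
Variables (E : Type) (K : (E -> Prop) -> Prop).

(** Instantiated by [sa], [qf], [sub] and [Def], so that the derived connectives and finite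
    quantifiers are treated once for all four. *)
Record boolclass := BoolClass {
  bc_iff : forall P Q : E -> Prop, (forall e, P e <-> Q e) -> K P -> K Q;
  bc_not : forall P, K P -> K (fun e => ~ P e);
  bc_and : forall P Q, K P -> K Q -> K (fun e => P e /\ Q e);
  bc_const : forall B : Prop, K (fun=> B) }.

Hypothesis bc : boolclass.

Lemma bc_or P Q : K P -> K Q -> K (fun e => P e \/ Q e).
Proof.
move=> hP hQ; apply: bc_iff (bc_not bc (bc_and bc (bc_not bc hP) (bc_not bc hQ))) => // e.
by rewrite not_andE !notK.
Qed.

Lemma bc_imp P Q : K P -> K Q -> K (fun e => P e -> Q e).
Proof.
move=> hP hQ; apply: bc_iff (bc_or (bc_not bc hP) hQ) => // e.
by split=> [[h /h//|h _ //]|h]; have [p|] := pselect (P e); [right; exact: h | left].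
Qed.

Lemma bc_eqv P Q : K P -> K Q -> K (fun e => P e <-> Q e).
Proof. by move=> hP hQ; apply: bc_and => //; apply: bc_imp. Qed.

Lemma bc_allseq (I : eqType) (s : seq I) (P : I -> E -> Prop) :
  (forall i, i \in s -> K (P i)) -> K (fun e => forall i, i \in s -> P i e).
Proof.
elim: s => [|i s IH] hP; first by apply: bc_iff (bc_const bc True).
have h1 : K (P i) by apply: hP; rewrite inE eqxx.
have h2 : K (fun e => forall j, j \in s -> P j e) by apply: IH => j js; apply: hP; rewrite inE js orbT.
apply: bc_iff (bc_and bc h1 h2) => // e; split=> [[h3 h4] j|h].
  by rewrite inE => /orP[/eqP ->|/h4].
by split=> [|j js]; apply: h; rewrite inE ?eqxx // js orbT.
Qed.

Lemma bc_all (I : finType) (P : I -> E -> Prop) : (forall i, K (P i)) ->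
  K (fun e => forall i, P i e).
Proof.
move=> hP; apply: bc_iff (bc_allseq (s := index_enum I) (fun i _ => hP i)) => // e.
by split=> h i; [apply: h; rewrite mem_index_enum | move=> _].
Qed.

Lemma bc_allnat n (P : nat -> E -> Prop) : (forall i, (i < n)%N -> K (P i)) ->
  K (fun e => forall i, (i < n)%N -> P i e).
Proof.
move=> hP; apply: bc_iff (bc_allseq (s := iota 0 n) (P := P) _) => // [e|i].
  by split=> h i; have := h i; rewrite mem_iota.
by rewrite mem_iota => /hP.
Qed.

Lemma bc_exnat n (P : nat -> E -> Prop) : (forall i, (i < n)%N -> K (P i)) ->
  K (fun e => exists2 i, (i < n)%N & P i e).
Proof.
move=> hP; apply: bc_iff (bc_not bc (bc_allnat (P := fun i e => ~ P i e) _)) => // [e|i /hP]; last exact: bc_not.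
split=> [h|[i im Pi] h]; last exact: h Pi.
by apply: contrapT => h'; apply: h => i im Pi; apply: h'; exists i.
Qed.

Lemma bc_ex (I : finType) (P : I -> E -> Prop) : (forall i, K (P i)) ->
  K (fun e => exists i, P i e).
Proof.
move=> hP; apply: bc_iff (bc_not bc (bc_all (fun i => bc_not bc (hP i)))) => // e.
by rewrite forallNE notK.
Qed.

Lemma bc_bool (I : finType) (P : I -> E -> Prop) (be : (I -> bool) -> Prop) :
  (forall i, K (P i)) -> K (fun e => be (fun i => `[< P i e >])).
Proof.
move=> hP; apply: (@bc_iff bc (fun e => exists s : {ffun I -> bool}, be s /\ forall i, P i e <-> s i)).
  move=> e; split=> [[s [bs Hs]]|h].
    by move: bs; congr be; apply/funext => i; apply/idP/asboolP => [/Hs|/Hs].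
  exists [ffun i => `[< P i e >]]; split=> [|i]; last by rewrite ffunE; split=> /asboolP.
  by move: h; congr be; apply/funext => i; rewrite ffunE.
apply: bc_ex => s; apply: bc_and => //; first exact: bc_const.
apply: bc_all => i; apply: bc_eqv => //; exact: bc_const.
Qed.

End BooleanClass.

(** * Semianalytic germs, quantifier-free germs, Weierstrass preparation of conditions *)

Section Semianalytic.
Context {R : realType}.
Local Notation env := (nat -> R).

Definition sa m (a : env) (P : env -> Prop) := exists l (f : 'I_l -> env -> R) (be : ('I_l -> bool) -> Prop),
  (forall i, an m a (f i)) /\ nearm m a (fun e => P e <-> be (fun i => 0 < f i e)).

Lemma sa_near m a P Q : nearm m a (fun e => P e <-> Q e) -> sa m a P -> sa m a Q.
Proof.
move=> PQ [l [f [be [hf h]]]]; exists l, f, be; split=> //.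
by apply: nearmW (nearmI PQ h) => e [h1 h2]; rewrite -h1.
Qed.

Lemma sa_iff m a (P Q : env -> Prop) : (forall e, P e <-> Q e) -> sa m a P -> sa m a Q.
Proof. by move=> PQ; apply: sa_near; apply: nearmT. Qed.

Lemma sa_pos m a f : an m a f -> sa m a (fun e => 0 < f e).
Proof.
move=> hf; exists 1%N, (fun=> f), (fun s => s ord0); split=> //.
by apply: nearmT.
Qed.

Lemma sa_not m a P : sa m a P -> sa m a (fun e => ~ P e).
Proof.
move=> [l [f [be [hf h]]]]; exists l, f, (fun s => ~ be s); split=> //.
by apply: nearmW h => e ->.
Qed.

Lemma sa_and m a P Q : sa m a P -> sa m a Q -> sa m a (fun e => P e /\ Q e).
Proof.
move=> [l [f [be [hf h]]]] [l' [f' [be' [hf' h']]]].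
exists (l + l')%N, (fun i => match fintype.split i with inl j => f j | inr j => f' j end),
  (fun s => be (fun i => s (lshift _ i)) /\ be' (fun i => s (rshift _ i))).
split=> [i|]; first by case: fintype.split.
apply: nearmW (nearmI h h') => e [-> ->].
suff [-> ->] : (fun i : 'I_l => 0 < (match fintype.split (lshift l' i) with inl j => f j | inr j => f' j end) e) = (fun i => 0 < f i e)
  /\ (fun i : 'I_l' => 0 < (match fintype.split (rshift l i) with inl j => f j | inr j => f' j end) e) = (fun i => 0 < f' i e) by [].
by split; apply/funext => i; rewrite ?(unsplitK (inl i)) ?(unsplitK (inr i)).
Qed.

Lemma sa_const m a (B : Prop) : sa m a (fun=> B).
Proof. by exists 0%N, (fun=> fun=> 0), (fun=> B); split=> [[]//|]; apply: nearmT. Qed.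

Lemma sa_bc m a : boolclass (sa m a).
Proof.
split; [exact: sa_iff | exact: sa_not | exact: sa_and | exact: sa_const].
Qed.
Hint Resolve sa_bc : core.

Lemma sa_lt m a f g : an m a f -> an m a g -> sa m a (fun e => f e < g e).
Proof. by move=> hf hg; apply: sa_iff (sa_pos (anB hg hf)) => e; rewrite subr_gt0. Qed.

Lemma sa_le m a f g : an m a f -> an m a g -> sa m a (fun e => f e <= g e).
Proof. by move=> hf hg; apply: sa_iff (sa_not (sa_lt hg hf)) => e; rewrite leNgt; split=> /negP. Qed.

Lemma sa_eq m a f g : an m a f -> an m a g -> sa m a (fun e => f e = g e).
Proof.
move=> hf hg; apply: sa_iff (sa_and (sa_le hf hg) (sa_le hg hf)) => e.
by split=> [[h1 h2]|->//]; apply/le_anti; rewrite h1.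
Qed.

Lemma sa_comp m k (a b : env) P (h : nat -> env -> R) : sa m b P ->
  (forall i, (i < m)%N -> an k a (h i)) -> (forall i, (i < m)%N -> h i a = b i) ->
  sa k a (fun e => P (fun i => h i e)).
Proof.
move=> [l [f [be [hf [d d0 H]]]]] hh hb.
exists l, (fun i e => f i (fun j => h j e)), be; split=> [i|]; first exact: an_comp (hf i) hh hb.
have [d' d'0 Hd'] : nearm k a (fun e => forall i, (i < m)%N -> `|h i e - b i| <= d).
  elim: m {f hf H be P} hh hb => [|m IH] hh hb; first by apply: nearmT.
  have [||d1 d10 H1] := IH; [by move=> i im; apply: hh; apply: ltnW|by move=> i im; apply: hb; apply: ltnW|].
  have := an_cont (hh m (ltnSn m)) d0; rewrite hb // => [[d2 d20 H2]].
  exists (Num.min d1 d2); first by rewrite lt_min d10.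
  move=> e He i; rewrite ltnS leq_eqVlt => /orP[/eqP ->|im].
    by apply: H2 => j jm; apply: le_trans (He j jm) _; rewrite ge_min lexx orbT.
  by apply: H1 im => j jm; apply: le_trans (He j jm) _; rewrite ge_min lexx.
by exists d' => // e He; apply: H => i im; apply: Hd' im.
Qed.

Lemma nearm_open m (a : env) P : nearm m a P -> nearm m a (fun a' => nearm m a' P).
Proof.
move=> [d d0 H]; exists (d / 2); first by lra.
move=> a' Ha'; exists (d / 2); first by lra.
move=> e He; apply: H => i im; have := Ha' i im; have := He i im.
have -> : e i - a i = (e i - a' i) + (a' i - a i) by ring.
by move=> h1 h2; apply: le_trans (ler_normD _ _) _; lra.
Qed.

Lemma sa_open m a P : sa m a P -> nearm m a (fun a' => sa m a' P).
Proof.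
move=> [l [f [be [hf h]]]].
have H : nearm m a (fun a' => forall i, i \in index_enum 'I_l -> an m a' (f i)).
  elim: (index_enum 'I_l) => [|i s IH]; first by apply: nearmT.
  apply: nearmW (nearmI (an_open (hf i)) IH) => e [h1 h2] j.
  by rewrite inE => /orP[/eqP ->|/h2].
apply: nearmW (nearmI H (nearm_open h)) => a' [h1 h2]; exists l, f, be; split=> // i.
by apply: h1; rewrite mem_index_enum.
Qed.

Lemma sa_formula m a (L : nat) (g : nat -> env -> R) (phi : qe_rcf.formula R) :
  (forall i, (i < L)%N -> an m a (g i)) ->
  sa m a (fun e => qe_rcf.qf_eval [seq g i e | i <- iota 0 L] phi).
Proof.
move=> hg.
have ht (t : qe_rcf.term R) : an m a (fun e => qe_rcf.eval [seq g i e | i <- iota 0 L] t).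
  elim: t => /= [i|c|n|t ht t' ht'|t ht|t ht n|t ht t' ht'|t ht n].
  - case: (ltnP i L) => iL.
      apply: (an_near _ (hg i iL)); apply: nearmT => e.
      by rewrite (nth_map 0%N) ?size_iota // nth_iota.
    apply: (an_near _ (anC m a 0)); apply: nearmT => e.
    by rewrite nth_default // size_map size_iota.
  - exact: anC.
  - exact: anC.
  - exact: anD.
  - exact: anN.
  - by apply: (an_near _ (anM ht (anC m a n%:R))); apply: nearmT => e; rewrite mulr_natr.
  - exact: anM.
  - exact: anX.
elim: phi => /= [b|t t'|t t'|t t'|p hp p' hp'|p hp p' hp'|p hp p' hp'|p hp].
- exact: sa_const.
- by apply: sa_iff (sa_eq (ht t) (ht t')) => e; split=> [->|/eqP].
- by apply: sa_lt.
- by apply: sa_le.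
- by apply: sa_iff (sa_and hp hp') => e; split=> /andP.
- by apply: sa_iff (bc_or (sa_bc m a) hp hp') => e; split=> /orP.
- by apply: sa_iff (bc_imp (sa_bc m a) hp hp') => e; split=> /implyP.
- by apply: sa_iff (sa_not hp) => e; split=> /negP.
Qed.

Definition cat m (e y : env) : env := fun i => if (i < m)%N then e i else y (i - m)%N.

(* Restricted division, as in the language of Denef and van den Dries. *)
Definition rdiv (u w : R) : R := if (`|u| <= `|w|) && (w != 0) then u / w else 0.

(* Quantifier-free germs: the values of restricted quotients become new variables, and the
   condition on these extra variables need only be definable near each value in the cube. *)
Inductive qf : nat -> env -> (env -> Prop) -> Prop :=
| qf_pos m a f : an m a f -> qf m a (fun e => 0 < f e)
| qf_not m a P : qf m a P -> qf m a (fun e => ~ P e)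
| qf_and m a P Q : qf m a P -> qf m a Q -> qf m a (fun e => P e /\ Q e)
| qf_near m a P Q : nearm m a (fun e => P e <-> Q e) -> qf m a P -> qf m a Q
| qf_ext m a s (f g : nat -> env -> R) S :
    (forall i, (i < s)%N -> an m a (f i)) -> (forall i, (i < s)%N -> an m a (g i)) ->
    (forall v, (forall i, (i < s)%N -> -1 <= v i <= 1) -> qf (s + m) (cat m a v) S) ->
    qf m a (fun e => S (cat m e (fun i => rdiv (f i e) (g i e)))).

Lemma qf_iff m a (P Q : env -> Prop) : (forall e, P e <-> Q e) -> qf m a P -> qf m a Q.
Proof. by move=> PQ; apply: qf_near; apply: nearmT. Qed.

Lemma qf_true m a : qf m a (fun=> True).
Proof.
apply: qf_iff (qf_pos (anC m a 1)) => e; split=> // _; exact: ltr01.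
Qed.

Lemma qf_bc m a : boolclass (qf m a).
Proof.
split; [exact: qf_iff | exact: qf_not | exact: qf_and | move=> B].
have [b|b] := pselect B; first by apply: qf_iff (qf_true m a).
by apply: qf_iff (qf_not (qf_true m a)) => e; split=> // h; exfalso; apply: h.
Qed.

(** The new variables v range over a compact box, so the neighbourhoods of the parameters can be
    chosen independently of v. *)
Lemma cat_unif s m (a : env) (l u : env) (Q : env -> Prop) :
  (forall v, (forall i, (i < s)%N -> l i <= v i <= u i) -> nearm (s + m) (cat m a v) Q) ->
  nearm m a (fun a' => forall v, (forall i, (i < s)%N -> l i <= v i <= u i) -> Q (cat m a' v)).
Proof.
move=> H; have [b Hb|S [HS CS]] := @box_cover R s l u (fun b d => forall e,
   (forall i, (i < s + m)%N -> `|e i - cat m a b i| <= d) -> Q e).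
  by have [d d0 Hd] := H b Hb; exists d.
have [d d0 Hd] : exists2 d : R, 0 < d & forall p, List.In p S -> d <= p.2.
  elim: S {CS} HS => [|q S IH] HS; first by exists 1.
  have [|d d0 Hd] := IH; first by move=> p ps; apply: HS; right.
  exists (Num.min q.2 d); first by rewrite lt_min d0 andbT; have [] := HS q (or_introl erefl).
  by move=> p [<-|/Hd h]; rewrite ge_min ?lexx // h orbT.
exists d => // a' Ha' v Hv; have [p pS Hp] := CS v Hv.
have [_ _] := HS p pS; apply => i im; rewrite /cat; case: ifP => im'.
  exact: le_trans (Ha' i im') (Hd p pS).
apply: Hp; move: im im'; lia.
Qed.

Lemma nearm_all m (a : env) s (P : nat -> env -> Prop) : (forall i, (i < s)%N -> nearm m a (P i)) ->
  nearm m a (fun e => forall i, (i < s)%N -> P i e).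
Proof.
elim: s => [|s IH] H; first exact: nearmT.
have h1 := IH (fun i is_ => H i (ltnW is_)).
apply: nearmW (nearmI h1 (H s (ltnSn s))) => e [h2 h3] i.
by rewrite ltnS leq_eqVlt => /orP[/eqP ->|/h2].
Qed.

Lemma an_supp m (a : env) f : an m a f -> nearm m a (fun e => forall e', (forall i, (i < m)%N -> e i = e' i) -> f e = f e').
Proof.
move=> [c [r [M [r0 _ H]]]]; apply: nearmW (nearm_box m a r0) => e he e' ee'.
rewrite !H //; first by apply: ev_ext => i im; rewrite ee'.
by move=> i im; rewrite -ee' //; exact: he.
Qed.

Lemma sa_supp m a P : sa m a P -> nearm m a (fun e => forall e', (forall i, (i < m)%N -> e i = e' i) -> (P e <-> P e')).
Proof.
move=> [l [f [be [hf [d d0 H]]]]].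
have h : nearm m a (fun e => forall i : nat, (i < l)%N -> forall (il : (i < l)%N) e', (forall j, (j < m)%N -> e j = e' j) -> f (Ordinal il) e = f (Ordinal il) e').
  apply: nearm_all => i im; apply: nearmW (an_supp (hf (Ordinal im))) => e he il e' ee'.
  by rewrite (bool_irrelevance il im); exact: he.
have [d' d'0 Hd'] := h; exists (Num.min d d'); first by rewrite lt_min d0.
move=> e He e' ee'.
have H1 i : (i < m)%N -> `|e i - a i| <= d by move=> /He; rewrite le_min => /andP[].
have H2 i : (i < m)%N -> `|e i - a i| <= d' by move=> /He; rewrite le_min => /andP[].
rewrite H // H; last by move=> i im; rewrite -ee' //; exact: H1.
suff -> : (fun i => 0 < f i e) = (fun i => 0 < f i e') by [].
apply/funext => -[i im]; congr (0 < _); exact: (Hd' e H2 i im im e' ee').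
Qed.

Lemma sa_qf m a P : sa m a P -> qf m a P.
Proof.
move=> [l [f [be [hf h]]]].
apply: (qf_near _ (bc_bool (qf_bc m a) be (fun i => qf_pos (hf i)))).
apply: nearmW h => e ->.
suff -> : (fun i => `[< 0 < f i e >]) = (fun i => 0 < f i e) by [].
by apply/funext => i; apply/asboolP/idP.
Qed.

Definition exbox n m (l u : env) (P : env -> Prop) : env -> Prop :=
  fun e => exists2 y : env, (forall i, (i < n)%N -> l i <= y i <= u i) & P (cat m e y).

Lemma exbox0 m a l u P : sa m a P -> qf m a (exbox 0 m l u P).
Proof.
move=> hP; apply: (qf_near _ (sa_qf hP)); apply: nearmW (sa_supp hP) => e he.
have catE y : P e <-> P (cat m e y) by apply: he => i im; rewrite /cat im.
split=> [|[y _]]; last by rewrite -catE.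
by exists (fun=> 0) => //; rewrite -catE.
Qed.

(** Tarski's theorem for polynomials in t whose coefficients are analytic. A sign pattern [tau] has
    the values 0, 1, 2 for positive, zero and negative; for each of the finitely many patterns
    [CcountGt0] decides from the coefficients whether some t realises it. *)
Lemma tarski_sa M (c : env) L D (w : nat -> nat -> env -> R) (be : ('I_L -> bool) -> Prop) :
  (forall i k, (i < L)%N -> (k < D)%N -> an M c (w i k)) ->
  sa M c (fun e => exists t : R, be (fun i => 0 < \sum_(k < D) w i k e * t ^+ k)).
Proof.
move=> hw.
pose g j := w (j %/ D)%N (j %% D)%N.
pose cs e := [seq g j e | j <- iota 0 (L * D)].
pose pol (i : 'I_L) : seq (qe_rcf.term R) := [seq qe_rcf.Var R (i * D + k) | k <- iota 0 D].
pose npol (i : 'I_L) : seq (qe_rcf.term R) := [seq qe_rcf.Opp (qe_rcf.Var R (i * D + k)) | k <- iota 0 D].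
have csE e (i : 'I_L) k : (k < D)%N -> (cs e)`_(i * D + k) = w i k e.
  move=> kD; have iL := ltn_ord i.
  have lt : (i * D + k < L * D)%N.
    apply: (@leq_trans (i * D + D)); first by rewrite ltn_add2l.
    by rewrite addnC -mulSn leq_mul2r ltn_ord orbT.
  rewrite (nth_map 0%N) ?size_iota // nth_iota // add0n /g.
  by rewrite divnMDl ?(leq_ltn_trans _ kD) // divn_small // addn0 modnMDl modn_small.
have polE e i t : (qe_rcf.eval_poly (cs e) (pol i)).[t] = \sum_(k < D) w i k e * t ^+ k.
  rewrite qe_rcf.eval_polyP (horner_coef_wide (n := D)); last first.
    by apply: leq_trans (size_Poly _) _; rewrite !size_map size_iota.
  apply: eq_bigr => k _; rewrite coef_Poly (nth_map (qe_rcf.Const 0)) ?size_map ?size_iota //.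
  by rewrite (nth_map 0%N) ?size_iota // nth_iota // add0n /= csE.
have npolE e i t : (qe_rcf.eval_poly (cs e) (npol i)).[t] = - \sum_(k < D) w i k e * t ^+ k.
  rewrite qe_rcf.eval_polyP (horner_coef_wide (n := D)); last first.
    by apply: leq_trans (size_Poly _) _; rewrite !size_map size_iota.
  rewrite -sumrN; apply: eq_bigr => k _; rewrite coef_Poly (nth_map (qe_rcf.Const 0)) ?size_map ?size_iota //.
  by rewrite (nth_map 0%N) ?size_iota // nth_iota // add0n /= csE // mulNr.
pose sp (tau : {ffun 'I_L -> 'I_3}) := [seq pol i | i <- enum 'I_L & tau i == 1 :> nat].
pose sq (tau : {ffun 'I_L -> 'I_3}) := ([seq pol i | i <- enum 'I_L & tau i == 0 :> nat] ++
  [seq npol i | i <- enum 'I_L & tau i == 2 :> nat])%SEQ.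
pose val_ i e t := \sum_(k < D) w i k e * t ^+ k.
have QE (tau : {ffun 'I_L -> 'I_3}) e : qe_rcf.qf_eval (cs e) (qe_rcf.CcountGt0 (sp tau) (sq tau)) <->
    exists t, forall i : 'I_L, [/\ tau i == 0 :> nat -> 0 < val_ i e t, tau i == 1 :> nat -> val_ i e t = 0
      & tau i == 2 :> nat -> val_ i e t < 0].
  rewrite qe_rcf.eval_CcountGt0; split=> [/qe_rcf_th.ccount_gt0P[t]|[t Ht]].
    rewrite !big_all !all_map all_cat !all_map => /andP[/allP h1 /andP[/allP h2 /allP h3]].
    exists t => i; split=> ti.
    - by have := h2 i; rewrite mem_filter ti mem_enum /= polE => /(_ isT).
    - by have := h1 i; rewrite mem_filter ti mem_enum /= polE => /(_ isT)/eqP.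
    - by have := h3 i; rewrite mem_filter ti mem_enum /= npolE oppr_gt0 => /(_ isT).
  apply/qe_rcf_th.ccount_gt0P; exists t.
  rewrite !big_all !all_map all_cat !all_map; apply/and3P; split; apply/allP => i; rewrite mem_filter => /andP[ti _] /=.
  - by rewrite polE; apply/eqP; have [_ h _] := Ht i; exact: h.
  - by rewrite polE; have [h _ _] := Ht i; exact: h.
  - by rewrite npolE oppr_gt0; have [_ _ h] := Ht i; exact: h.
have hg j : (j < L * D)%N -> an M c (g j).
  move=> jLD; have D0 : (0 < D)%N by case: (D) jLD; rewrite ?muln0.
  by apply: hw; rewrite ?ltn_mod // ltn_divLR.
have H (tau : {ffun 'I_L -> 'I_3}) := sa_formula (qe_rcf.CcountGt0 (sp tau) (sq tau)) hg.
apply: (@sa_iff _ _ (fun e => exists tau : {ffun 'I_L -> 'I_3}, be (fun i => tau i == 0 :> nat) /\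
   qe_rcf.qf_eval (cs e) (qe_rcf.CcountGt0 (sp tau) (sq tau)))); last first.
  by apply: bc_ex => // tau; apply: sa_and; [exact: sa_const | exact: H].
move=> e; split=> [[tau [b /QE[t Ht]]]|[t b]].
  exists t; move: b; congr be; apply/funext => i; have [h0 h1 h2] := Ht i.
  apply/idP/idP => [/h0//|].
  case: (tau i) h0 h1 h2 => -[|[|[|//]]] //= _ _ h1 h2.
    by rewrite -/(val_ i e t) h1 // ltxx.
  by rewrite -/(val_ i e t) ltNge ltW // h2.
exists [ffun i : 'I_L => (if 0 < val_ i e t then inord 0 else if val_ i e t == 0 then inord 1 else inord 2) : 'I_3].
split.
  move: b; congr be; apply/funext => i; rewrite ffunE -/(val_ i e t).
  by case: ifP => _; [|case: ifP => _]; rewrite inordK.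
apply/QE; exists t => i; rewrite ffunE; case: (ltgtP (val_ i e t) 0) => [h|h|h]; rewrite inordK //; by split.
Qed.

(** Only the sign of f matters, so the unit of Weierstrass preparation can be replaced by its
    constant sign [sg], which is absorbed in the coefficients. *)
Lemma wprep_an M (c : env) f : an M.+1 c f ->
  (forall b : R, 0 < b -> exists2 s : R, `|s| <= b & f (upd c M (c M + s)) != 0) ->
  exists d (w : nat -> env -> R) (sg : R), [/\ forall k, (k < d)%N -> an M c (w k),
    forall k e e', (forall i, (i < M)%N -> e i = e' i) -> w k e = w k e', sg != 0 &
    nearm M.+1 c (fun e => (0 < f e) = (0 < \sum_(k < d) w k e * (e M - c M) ^+ k))].
Proof.
move=> /an_O[x Hx] Hf.
have [x' Hx'] : exists x' : O M.+1, nearm M.+1 (fun=> 0) (fun e => ev (val x) (shear M (fun=> 0) e) = ev (val x') e).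
  by exists x; apply: nearmT => e; apply: ev_ext => i _; rewrite /shear mul0r addr0; case: ifP.
have [|d rx] := @axis_regular R M (val x) (val x') (fun=> 0) (ocv x') _ Hx'.
  have [d0 d00 H0] := Hx => b b0.
  have [|s sb fs] := Hf (Num.min b d0); first by rewrite lt_min b0.
  exists s; first by apply: le_trans sb _; rewrite ge_min lexx.
  move: fs; rewrite H0.
    congr (_ != 0); apply: ev_ext => i im; rewrite /shear /upd /axis mul0r addr0.
    by case: eqP => [->|_]; [rewrite ltnn addrAC subrr add0r | rewrite subrr; case: (i < M)%N].
  move=> i _; rewrite /upd; case: eqP => [->|_]; last by rewrite subrr normr0 ltW.
  by rewrite addrAC subrr add0r; apply: le_trans sb _; rewrite ge_min lexx orbT.
have xx' : nearm M.+1 (fun=> 0) (fun e => ev (val x) e = ev (val x') e).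
  apply: nearmW Hx' => e <-; apply: ev_ext => i _; rewrite /shear mul0r addr0; by case: ifP.
have [Q [W [cQ cW Q0 QW [Wd Wk]]]] := wprep_ps (ocv x') rx.
pose sg := Num.sg (ev Q (fun=> 0)).
have sg0 : sg != 0 by rewrite sgr_eq0.
pose w k e := sg * ev (W k : PSr M) (fun i => e i - c i).
exists d.+1, w, sg; split=> // [k kd|k e e' ee'|].
- by apply: anM; [exact: anC | apply: cv_an; exact: cv_coef].
- by congr (_ * _); apply: ev_ext => i im; rewrite ee'.
have Qsg : nearm M.+1 (fun=> 0) (fun e => 0 < sg * ev Q e).
  have q20 : 0 < `|ev Q (fun=> 0)| / 2 by rewrite divr_gt0 // normr_gt0.
  apply: nearmW (an_cont (cv_an0 cQ) q20) => e; rewrite /sg.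
  case: (ltgtP (ev Q (fun=> 0)) 0) Q0 => // h _.
    by rewrite (ltr0_sg h) (ltr0_norm h) ler_norml => /andP[h1 h2]; lra.
  by rewrite (gtr0_sg h) (gtr0_norm h) ler_norml => /andP[h1 h2]; lra.
have [r [N [r0 hW]]] := cW.
have hb := nearm_box M.+1 (fun=> 0) r0.
have := nearmI (nearmI (cv_evM cQ (ocv x')) Qsg) (nearmI xx' hb).
move=> /(nearm_shift c) h; apply: nearmW (nearmI Hx h) => e [-> [[h1 h2] [h3 h4]]].
have evW : ev W (fun i => e i - c i) = \sum_(k < d.+1) ev (W k : PSr M) (fun i => e i - c i) * (e M - c M) ^+ k.
  apply: has_sum_tsum.
  apply: (@has_sum_finsupp R (fun k => ev (W k : PSr M) (fun i => e i - c i) * (e M - c M) ^+ k)) => k kd.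
  by rewrite Wk // ev0 mul0r.
have -> : \sum_(k < d.+1) w k e * (e M - c M) ^+ k = (sg * ev Q (fun i => e i - c i)) * ev (val x) (fun i => e i - c i).
  rewrite h3 -mulrA -h1 QW evW mulr_sumr; apply: eq_bigr => k _.
  by rewrite /w mulrA.
by rewrite pmulr_rgt0.
Qed.

(* The elimination statement near [cat m a b], uniformly in the centre and in small boxes. *)
Definition ST n m (a b : env) l (f : 'I_l -> env -> R) (be : ('I_l -> bool) -> Prop) :=
  exists2 rho : R, 0 < rho & forall a', (forall i, (i < m)%N -> `|a' i - a i| <= rho) ->
    forall d, 0 < d -> d <= rho ->
    qf m a' (exbox n m (fun i => b i - d) (fun i => b i + d) (fun e => be (fun i => 0 < f i e))).

Definition QEn n := forall m a l u P,
  (forall b, (forall i, (i < n)%N -> l i <= b i <= u i) -> sa (n + m) (cat m a b) P) ->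
  qf m a (exbox n m l u P).

(* shear of the variables of index [m .. n+m-1] along the last one, centred at [c] *)
Definition vshear n m (lam c e : env) : env := fun k =>
  if (k < m)%N then e k else if (k < n + m)%N then e k + lam (k - m)%N * (e (n + m)%N - c (n + m)%N) else e k.

Lemma an_vshear n m lam c (a : env) k : (k < (n + m).+1)%N -> an (n + m).+1 a (fun e => vshear n m lam c e k).
Proof.
move=> km; rewrite /vshear; case: (k < m)%N; first exact: an_var.
case: (k < n + m)%N; last exact: an_var.
apply: anD; first exact: an_var.
apply: anM; first exact: anC.
by apply: anB; [exact: an_var | exact: anC].
Qed.

Lemma vshear_c n m lam c : vshear n m lam c c = c.
Proof. by apply/funext => k; rewrite /vshear subrr mulr0 addr0; case: ifP => // _; case: ifP. Qed.

Lemma generic_vline n m (c : env) l (f : 'I_l -> env -> R) :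
  (forall i, an (n.+1 + m) c (f i)) -> (forall i, nonzero_fib m n.+1 c (f i)) ->
  exists lam : env, forall i (b : R), 0 < b -> exists2 s : R, `|s| <= b &
    f i (vshear n m lam c (upd c (n + m) (c (n + m)%N + s))) != 0.
Proof.
move=> hf hn.
pose phi i (w : env) := f i (fun k => if (k < m)%N then c k else c k + w (k - m)%N).
have hphi i : an n.+1 (fun=> 0) (phi i).
  apply: (an_comp (b := c) (h := fun k (w : env) => if (k < m)%N then c k else c k + w (k - m)%N) (hf i)).
    move=> k km; case: ltnP => h; first exact: anC.
    apply: anD; first exact: anC.
    by apply: an_var; rewrite ltn_subLR // addnC.
  by move=> k km; case: ifP => //; rewrite addr0.
have /choice[x Hx] : forall i, exists x : O n.+1, nearm n.+1 (fun=> 0) (fun e => phi i e = ev (val x) e).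
  by move=> i; have [C cC HC] := an_cv0 (hphi i); exists (mkO cC).
have x0 i : (val (x i) : PSr n.+1) <> 0.
  move=> xi0; have [d d0 Hd] := Hx i; have [y Hy] := hn i d d0.
  suff -> : f i (splice m c y) = phi i (fun k => y (k + m)%N - c (k + m)%N).
    by rewrite Hd ?xi0 ?ev0 ?eqxx // => k km; rewrite subr0; apply: Hy; rewrite ltn_add2r.
  rewrite /phi; congr (f i); apply/funext => k; rewrite /splice; case: ltnP => // km.
  by rewrite subnK // addrC subrK.
have [lam Hlam] := @generic_line R n 'I_l (fun i => val (x i)) (fun i => ocv (x i)) x0.
exists lam => i b b0; have [d d0 Hd] := Hx i.
have [lb lb0 Hlb] := @min_rad R n (fun k => d / (1 + `|lam k|)) (fun k => divr_gt0 d0 (ltr_pwDl ltr01 (normr_ge0 _))).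
have [|s sb Hs] := Hlam i (Num.min b (Num.min d lb)); first by rewrite !lt_min b0 d0.
move: sb; rewrite !le_min => /and3P[sb sd slb].
exists s => //; move: Hs; rewrite -Hd.
  congr (_ != 0); rewrite /phi; congr (f i); apply/funext => k.
  rewrite /vshear /upd !eqxx addrAC subrr add0r; case: ltnP => km.
    by rewrite ltn_eqF // (leq_trans km) // leq_addl.
  rewrite /shear /axis eqxx -(ltn_add2r m) subnK //; case: ltnP => knm.
    by rewrite !ltn_eqF ?add0r // ltn_subLR // addnC.
  have E : (k - m == n)%N = (k == (n + m)%N) by move: km; lia.
  by rewrite E; case: eqP => [->|_] //; rewrite addr0.
move=> k; rewrite subr0 ltnS leq_eqVlt /shear /axis eqxx => /orP[/eqP ->|kn]; first by rewrite ltnn eqxx.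
rewrite kn (ltn_eqF kn) add0r normrM; have := Hlb k kn.
rewrite ler_pdivlMr ?ltr_pwDl // mulrDr mulr1 => h.
have := ler_wpM2l (normr_ge0 (lam k)) slb; have := normr_ge0 s; have := ltW lb0; lra.
Qed.

End Semianalytic.

(** * Elimination of bounded existential quantifiers *)

Section QuantifierElimination.
Context {R : realType}.
Local Notation env := (nat -> R).

Lemma tarski_fin (I : finType) M (c : env) D (w : I -> nat -> env -> R) (be : (I -> bool) -> Prop) :
  (forall i k, (k < D)%N -> an M c (w i k)) ->
  sa M c (fun e => exists t : R, be (fun i => 0 < \sum_(k < D) w i k e * t ^+ k)).
Proof.
move=> hw.
pose w' (i k : nat) e := (if insub i is Some j then w (enum_val (j : 'I_#|I|)) k e else 0) : R.
have h := @tarski_sa R M c #|I| D w' (fun s => be (fun i => s (enum_rank i))).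
apply: sa_iff (h _) => [e|i k im kD].
  have E t (i : I) : \sum_(k < D) w' (enum_rank i) k e * t ^+ k = \sum_(k < D) w i k e * t ^+ k.
    by apply: eq_bigr => k _; rewrite /w' valK enum_rankK.
  by split=> -[t b]; exists t; move: b; congr be; apply/funext => i; rewrite E.
have -> : w' i k = w (enum_val (Ordinal im)) k by apply/funext => e; rewrite /w' insubT.
exact: hw.
Qed.

Lemma nearm_fin (I : finType) m (a : env) (P : I -> env -> Prop) : (forall i, nearm m a (P i)) ->
  nearm m a (fun e => forall i, P i e).
Proof.
move=> H; have := @nearm_all R m a #|I| (fun k e => forall i, enum_rank i = k :> nat -> P i e).
case=> [k kI|d d0 Hd].
  apply: nearmW (H (enum_val (Ordinal kI))) => e h i ik.
  have -> : i = enum_val (Ordinal kI) by rewrite -(enum_rankK i); congr enum_val; apply: val_inj.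
  exact: h.
by exists d => // e /Hd h i; apply: (h (enum_rank i)).
Qed.

Lemma cat_shift m (e y : env) j : cat m e y (j + m)%N = y j.
Proof. by rewrite /cat ltnNge leq_addl addnK. Qed.

Lemma sub_last n m k : (k < (n + m).+1)%N -> (m <= k)%N -> (n <= k - m)%N -> (k - m = n)%N.
Proof. lia. Qed.

(** No function vanishes on the central fibre, so one generic shear of the fibre variables makes all
    of them regular in the last one. Preparation turns the conditions into polynomial ones in this
    variable, [tarski_fin] removes it, and the hypothesis on n removes the others. *)
Lemma ST_regular n m (a b : env) l (f : 'I_l -> env -> R) be : @QEn R n ->
  (forall i, an (n.+1 + m) (cat m a b) (f i)) -> (forall i, nonzero_fib m n.+1 (cat m a b) (f i)) ->
  ST n.+1 m a b f be.
Proof.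
move=> IH hf hn; set c := cat m a b; have [lam Hlam] := generic_vline hf hn.
pose F i e := f i (vshear n m lam c e).
have hF i : an (n + m).+1 c (F i).
  apply: (an_comp (hf i)); first by move=> k; exact: an_vshear.
  by move=> k _; exact: (congr1 (@^~ k) (vshear_c n m lam c)).
have /choice[d /choice[w /choice[sg Hw]]] := fun i => wprep_an (hF i) (Hlam i).
pose D0 := \max_(i < l) d i; pose D := D0.+2.
pose W i k e := if (k < d i)%N then w i k e else 0.
have hW i k : an (n + m) c (W i k).
  rewrite /W; case: ltnP => kd; last exact: anC.
  by have [h _ _ _] := Hw i; exact: h.
have W_ext i k e e' : (forall j, (j < n + m)%N -> e j = e' j) -> W i k e = W i k e'.
  by move=> ee'; rewrite /W; case: ifP => // _; have [_ h _ _] := Hw i; exact: h.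
have [rho0 rho00 Hrho0] : nearm (n + m).+1 c (fun e => forall i, (0 < F i e) = (0 < \sum_(k < D) W i k e * (e (n + m)%N - c (n + m)%N) ^+ k)).
  apply: nearm_fin => i; have [_ _ _ h] := Hw i; apply: nearmW h => e ->; congr (0 < _).
  have dD : (d i <= D)%N by rewrite /D /D0; apply: leq_trans (leq_bigmax i) _; do 2 apply: leqW.
  rewrite (big_ord_widen D (fun k => w i k e * (e (n + m)%N - c (n + m)%N) ^+ k)) // big_mkcond /=.
  by apply: eq_bigr => k _; rewrite /W; case: ifP => // _; rewrite mul0r.
have [rho1 rho10 Hrho1] : nearm (n + m) c (fun c' => forall i (k : 'I_D), an (n + m) c' (W i k)).
  by apply: nearm_fin => i; apply: nearm_fin => k; apply: an_open.
pose Lam := 1 + \sum_(j < n) `|lam j|.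
have Lam1 j : (j < n)%N -> 1 + `|lam j| <= Lam.
  by move=> jn; rewrite lerD2l (bigD1 (Ordinal jn)) //= lerDl sumr_ge0.
have Lam0 : 1 <= Lam by rewrite lerDl sumr_ge0.
pose rho := Num.min rho0 rho1 / (2 * Lam).
have rho_pos : 0 < rho by rewrite divr_gt0 // ?lt_min ?rho00 // mulr_gt0 //; lra.
have rhoL : rho * Lam * 2 <= rho0 /\ rho * Lam * 2 <= rho1.
  have -> : rho * Lam * 2 = Num.min rho0 rho1 by rewrite /rho; field; lra.
  by rewrite !ge_min !lexx orbT.
have rho2 : rho + rho <= rho0 /\ rho + rho <= rho1.
  have : rho * 1 <= rho * Lam by rewrite ler_pM2l.
  lra.
exists rho => // a' Ha' dd dd0 ddrho.
have ddL : dd * Lam <= rho0 /\ dd * Lam + rho * Lam <= rho1.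
  have : dd * Lam <= rho * Lam by rewrite ler_pM2r //; lra.
  have : 0 < rho * Lam by rewrite mulr_gt0 //; lra.
  by clear - rhoL; case: rhoL; lra.
(* The right summand encodes the box: in sheared coordinates the bounds are polynomial conditions of
   degree at most 1 in t, one for each sign and coordinate, the index n standing for the last
   coordinate. *)
pose I := ('I_l + bool * 'I_n.+1)%type.
pose w' (i : I) (k : nat) (e : env) : R := match i with
  | inl i => W i k e
  | inr (s, j) => if k == 0%N then (if (j < n)%N then (-1) ^+ (s : nat) * (e (j + m)%N - b j) - dd else - dd)
                  else if k == 1%N then (-1) ^+ (s : nat) * (if (j < n)%N then lam j else 1) else 0 end.
pose be' (s : I -> bool) := be (fun i => s (inl i)) /\ forall q, ~~ s (inr q).
pose P e := exists t : R, be' (fun i => 0 < \sum_(k < D) w' i k e * t ^+ k).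
have w'E s j e t : \sum_(k < D) w' (inr (s, j)) k e * t ^+ k = (-1) ^+ (s : nat) *
    (if (j < n)%N then (e (j + m)%N - b j) + lam j * t else t) - dd.
  rewrite /D big_ord_recl big_ord_recl big1 ?addr0; last by move=> k _; rewrite /w' !lift0 mul0r.
  rewrite /w' lift0 /=; rewrite expr0 expr1; case: (j < n)%N; ring.
have condE t e : (forall q, ~~ (0 < \sum_(k < D) w' (inr q) k e * t ^+ k)) <->
    (`|t| <= dd /\ forall j, (j < n)%N -> `|e (j + m)%N - b j + lam j * t| <= dd).
  split=> [H|[H1 H2] [s j]].
    have H' s j (jn : (j < n.+1)%N) := H (s, Ordinal jn).
    split=> [|j jn].
      have := H' false n (ltnSn n); have := H' true n (ltnSn n); rewrite !w'E /= ltnn expr0 expr1 -!leNgt.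
      by rewrite ler_norml; lra.
    have := H' false j (leqW jn); have := H' true j (leqW jn); rewrite !w'E /= jn expr0 expr1 -!leNgt.
    by rewrite ler_norml; lra.
  rewrite w'E -leNgt; case: ifP => jn.
    by have := H2 _ jn; rewrite ler_norml; clear; case: s; rewrite ?expr0 ?expr1; lra.
  by move: H1; rewrite ler_norml; clear; case: s; rewrite ?expr0 ?expr1; lra.
have saP b' : (forall i, (i < n)%N -> b i - dd * Lam <= b' i <= b i + dd * Lam) -> sa (n + m) (cat m a' b') P.
  move=> Hb'; apply: tarski_fin => -[i|[s j]] k kD; last first.
    rewrite /w'; case: (k == 0%N); [|exact: anC].
    case: ltnP => jn; last exact: anC.
    apply: anB; last exact: anC.
    apply: anM; first exact: anC.
    by apply: anB; [apply: an_var; rewrite ltn_add2r | exact: anC].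
  apply: (Hrho1 _ _ i (Ordinal kD)) => q qm; rewrite /c /cat; case: ltnP => qm'.
    by apply: le_trans (Ha' q qm') _; move: rho2; lra.
  have /Hb' : (q - m < n)%N by rewrite ltn_subLR // addnC.
    rewrite -ler_distl => /le_trans; apply; apply: le_trans ddL.2.
  by rewrite lerDl mulr_ge0 // ltW // (lt_le_trans ltr01).
(* Undoing the shear moves the coordinate j by at most [|lam j| * dd]; hence the larger radius dd *
   Lam for the remaining coordinates. *)
have hb0 := IH m a' (fun i => b i - dd * Lam) (fun i => b i + dd * Lam) P saP.
apply: qf_near hb0; exists rho => // e He.
have ee k : (k < m)%N -> `|e k - a k| <= rho0.
  move=> km; have -> : e k - a k = (e k - a' k) + (a' k - a k) by ring.
  by apply: le_trans (ler_normD _ _) _; have := He k km; have := Ha' k km; lra.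
have keyid (z : env) : `|z n - b n| <= dd -> (forall j, (j < n)%N -> `|z j - b j| <= dd * Lam) ->
   forall i, (0 < F i (cat m e z)) = (0 < \sum_(k < D) w' (inl i) k (cat m e z) * (z n - b n) ^+ k).
  move=> zn zj i; rewrite (Hrho0 (cat m e z)) /c ?(cat_shift) //.
  move=> k km; rewrite /cat; case: ltnP => km'; first exact: ee.
  
  case: (ltnP (k - m) n) => kn; first exact: le_trans (zj _ kn) ddL.1.
  rewrite (sub_last km km' kn).
  by apply: le_trans zn _; lra.
split=> [[z Hz [t [b1 /condE[tdd jdd]]]]|[y Hy b1]].
  pose z' := upd z n (b n + t).
  have z'n : z' n = b n + t by rewrite /z' /upd eqxx.
  have z'j j : (j < n)%N -> z' j = z j by move=> jn; rewrite /z' /upd ltn_eqF.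
  pose y := fun j => if (j < n)%N then z j + lam j * t else z' j.
  have yE i : F i (cat m e z') = f i (cat m e y).
    congr (f i); apply/funext => k; rewrite /vshear /c !cat_shift z'n /cat.
    case: ltnP => km //; case: ltnP => kn; last by rewrite /y ltnNge leq_subRL ?kn // addnC kn.
    have kn' : (k - m < n)%N by rewrite ltn_subLR // addnC.
    by rewrite /y kn' z'j // addrAC subrr add0r.
  exists y; last first.
    move: b1; congr be; apply/funext => i; rewrite -yE keyid.
    - congr (0 < _); apply: eq_bigr => k _; rewrite z'n addrAC subrr add0r; congr (_ * _).
      apply: W_ext => q qm; rewrite /cat; case: ltnP => // qm'; rewrite z'j //.
      by rewrite ltn_subLR // addnC.
    - by rewrite z'n addrAC subrr add0r.
    - by move=> j jn; rewrite z'j // ler_distl; exact: Hz.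
  move=> i; rewrite ltnS leq_eqVlt => /orP[/eqP ->|jn].
    by rewrite /y ltnn z'n -ler_distl addrAC subrr add0r.
  by rewrite /y jn -ler_distl addrAC; have := jdd i jn; rewrite cat_shift.
pose t := y n - b n; pose z j := if (j < n)%N then y j - lam j * t else y j.
have zn : z n = y n by rewrite /z ltnn.
have tdd : `|t| <= dd by rewrite /t ler_distl; exact: Hy.
have zj j : (j < n)%N -> `|z j - b j| <= dd * Lam.
  move=> jn; rewrite /z jn.
  have -> : y j - lam j * t - b j = (y j - b j) - lam j * t by ring.
  apply: le_trans (ler_normB _ _) _; rewrite normrM.
  have h1 : `|y j - b j| <= dd by rewrite ler_distl; exact: Hy (leqW jn).
  have h2 : `|lam j| * `|t| <= `|lam j| * dd by rewrite ler_wpM2l.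
  have h3 : dd * (1 + `|lam j|) <= dd * Lam by rewrite ler_pM2l // Lam1.
  lra.
have yE i : F i (cat m e z) = f i (cat m e y).
  congr (f i); apply/funext => k; rewrite /vshear /c !cat_shift zn /cat.
  case: ltnP => km //; rewrite /z; case: ltnP => kn; last by rewrite ltnNge leq_subRL ?kn // addnC kn.
  by rewrite ltn_subLR // addnC kn -/t subrK.
exists z; first by move=> j jn; rewrite -ler_distl; exact: zj.
exists t; split.
  move: b1; congr be; apply/funext => i; rewrite -yE keyid ?zn //.
apply/condE; split=> // j jn; rewrite cat_shift /z jn.
have -> : y j - lam j * t - b j + lam j * t = y j - b j by ring.
by rewrite ler_distl; exact: Hy (leqW jn).
Qed.

End QuantifierElimination.

Section QuantifierElimination.
Context {R : realType}.
Local Notation env := (nat -> R).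

Lemma an_ctr m (a b : env) f : (forall i, (i < m)%N -> a i = b i) -> an m a f -> an m b f.
Proof.
move=> ab [c [r [M [r0 h1 h2]]]]; exists c, r, M; split=> // e he; rewrite h2.
  by apply: ev_ext => i im; rewrite ab.
by move=> i im; rewrite ab //; exact: he.
Qed.

Lemma nearm_ctr m (a b : env) P : (forall i, (i < m)%N -> a i = b i) -> nearm m a P -> nearm m b P.
Proof. by move=> ab [d d0 H]; exists d => // e He; apply: H => i im; rewrite ab //; exact: He. Qed.

Lemma sa_ctr m (a b : env) P : (forall i, (i < m)%N -> a i = b i) -> sa m a P -> sa m b P.
Proof.
move=> ab [l [f [be [hf h]]]]; exists l, f, be; split=> [i|]; first exact: an_ctr (hf i).
exact: nearm_ctr h.
Qed.

Lemma qf_exlist m (a : env) (T : Type) (S : seq T) (P : T -> env -> Prop) :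
  (forall p, List.In p S -> qf m a (P p)) -> qf m a (fun e => exists2 p, List.In p S & P p e).
Proof.
elim: S => [|q S IH] H.
  by apply: (bc_iff (qf_bc m a) _ (bc_const (qf_bc m a) False)) => e; split=> // -[].
have h1 := H q (or_introl erefl); have h2 := IH (fun p pS => H p (or_intror pS)).
apply: (bc_iff (qf_bc m a) _ (bc_or (qf_bc m a) h1 h2)) => e.
by split=> [[h|[p pS h]]|[p [<-|pS] h]]; [exists q => //; left|exists p => //; right|left|right; exists p].
Qed.

Lemma fin_min (I : finType) (r : I -> R) : (forall i, 0 < r i) -> exists2 d : R, 0 < d & forall i, d <= r i.
Proof.
move=> r0; have := @nearm_fin R I 1 (fun=> 0) (fun i e => e 0%N <= r i).
case=> [i|d d0 H].
  exists (r i) => // e /(_ 0%N isT); rewrite subr0; apply: le_trans; exact: ler_norm.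
exists d => // i; have := H (fun=> d); apply => j _; by rewrite subr0 gtr0_norm.
Qed.

Lemma argmaxn s (B : nat -> R) : (0 < s)%N -> exists2 j, (j < s)%N & forall i, (i < s)%N -> B i <= B j.
Proof.
elim: s => // s IH _; case: (posnP s) => [->|s0]; first by exists 0%N => // -[].
have [j js Hj] := IH s0; case: (leP (B s) (B j)) => h.
  exists j; first exact: ltnW.
  by move=> i; rewrite ltnS leq_eqVlt => /orP[/eqP ->|/Hj].
exists s => // i; rewrite ltnS leq_eqVlt => /orP[/eqP ->|/Hj h'] //; exact: le_trans h' (ltW h).
Qed.

Lemma ST_unif n s m (a b : env) l (f : 'I_l -> env -> R) be :
  (forall v, (forall i, (i < s)%N -> -1 <= v i <= 1) -> ST n (s + m) (cat m a v) b f be) ->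
  exists2 rho : R, 0 < rho & forall a', (forall i, (i < m)%N -> `|a' i - a i| <= rho) ->
    forall d, 0 < d -> d <= rho -> forall v, (forall i, (i < s)%N -> -1 <= v i <= 1) ->
    qf (s + m) (cat m a' v) (exbox n (s + m) (fun i => b i - d) (fun i => b i + d) (fun e => be (fun i => 0 < f i e))).
Proof.
move=> H; have [v Hv|S [HS CS]] := @box_cover R s (fun=> -1) (fun=> 1) (fun v rho =>
  forall a', (forall i, (i < s + m)%N -> `|a' i - cat m a v i| <= rho) ->
    forall d, 0 < d -> d <= rho ->
    qf (s + m) a' (exbox n (s + m) (fun i => b i - d) (fun i => b i + d) (fun e => be (fun i => 0 < f i e)))).
  by have [rho ? ?] := H v Hv; exists rho.
have [rho r0 Hr] : exists2 d : R, 0 < d & forall p, List.In p S -> d <= p.2.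
  elim: S {CS} HS => [|q S IH] HS; first by exists 1.
  have [|d d0 Hd] := IH; first by move=> p ps; apply: HS; right.
  exists (Num.min q.2 d); first by rewrite lt_min d0 andbT; have [] := HS q (or_introl erefl).
  by move=> p [<-|/Hd h]; rewrite ge_min ?lexx // h orbT.
exists rho => // a' Ha' d d0 dr v Hv; have [p pS Hp] := CS v Hv.
have [_ _] := HS p pS; apply => // [i im|]; last exact: le_trans dr (Hr p pS).
rewrite /cat; case: ltnP => im'; first exact: le_trans (Ha' i im') (Hr p pS).
by apply: Hp; rewrite ltn_subLR // addnC.
Qed.

Definition dropv m s (E : env) : env := fun q => if (q < m)%N then E q else E (q + s)%N.

Lemma dropv_cat m s (a v b : env) : dropv m s (cat (s + m) (cat m a v) b) = cat m a b.
Proof.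
apply/funext => q; rewrite /dropv /cat; case: ltnP => qm; first by rewrite (leq_trans qm) // leq_addl.
by rewrite addnC ltn_add2l ltnNge qm /= subnDl.
Qed.

Lemma an_dropv n s m (a v b : env) f : an (n + m) (cat m a b) f ->
  an (n + (s + m)) (cat (s + m) (cat m a v) b) (fun E => f (dropv m s E)).
Proof.
move=> hf; apply: (an_comp (h := fun q E => dropv m s E q) hf); last by move=> q _; rewrite dropv_cat.
move=> q qm; rewrite /dropv; case: ltnP => _; apply: an_var; first by apply: leq_trans qm _; rewrite addnCA leq_addl.
by rewrite addnCA addnC ltn_add2l.
Qed.

Lemma nonzero_dropv n s m (a v b : env) (h : env -> R) h' : nonzero_fib m n (cat m a b) h ->
  (forall E, (forall q, (q < s)%N -> E (q + m)%N = v q) -> h' E = h (dropv m s E)) ->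
  nonzero_fib (s + m) n (cat (s + m) (cat m a v) b) h'.
Proof.
move=> H hh d d0; have [y Hy hy] := H d d0.
exists (fun q => if (q < s + m)%N then cat m a v q else y (q - s)%N).
  move=> q qm; rewrite /cat; case: ltnP => qsm; first by rewrite subrr normr0 ltW.
  have := Hy (q - s)%N; rewrite /cat.
  have -> : (q - s < m)%N = false by apply/negbTE; rewrite -leqNgt leq_subRL ?addn0 // (leq_trans _ qsm) // leq_addr.
  by rewrite subnDA; apply; rewrite ltn_subLR ?(leq_trans _ qsm) ?leq_addr // addnCA.
rewrite hh; last first.
  move=> q qs; rewrite /splice addnC [(m + q)%N]addnC ltn_add2r qs /cat.
  by rewrite (ltn_add2r m q s) qs ltnNge leq_addl addnK.
suff -> : dropv m s (splice (s + m) (cat (s + m) (cat m a v) b)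
   (fun q => if (q < s + m)%N then cat m a v q else y (q - s)%N)) = splice m (cat m a b) y by [].
apply/funext => q; rewrite /dropv /splice; case: ltnP => qm.
  by rewrite (leq_trans qm) ?leq_addl // /cat (leq_trans qm) ?leq_addl // qm.
by rewrite addnC ltn_add2l ltnNge qm /= addnC addnK.
Qed.

Lemma rdiv_bnd (u w : R) : -1 <= rdiv u w <= 1.
Proof.
rewrite /rdiv; case: ifP => [/andP[uw w0]|_]; last by rewrite lerN10 ler01.
by rewrite -ler_norml normrM normfV ler_pdivrMr ?normr_gt0 // mul1r.
Qed.

Lemma sqr_le_norm (u w : R) : (u * u <= w * w) = (`|u| <= `|w|).
Proof. by rewrite -[u * u]expr2 -[w * w]expr2 -[u ^+ 2]real_normK ?num_real // -[w ^+ 2]real_normK ?num_real // ler_sqr ?nnegrE. Qed.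

(** Induction on j, the functions of index at least j being nonzero on the central fibre. For the
    function of index j, [content_an] gives coefficients [B]; one distinguishes whether they all
    vanish, or else which one is largest in absolute value and with which sign. In each case this
    function is replaced by one that is nonzero on the fibre, at the price of new parameters. *)
Lemma ST_general n : @QEn R n -> forall j m (a b : env) l (f : 'I_l -> env -> R) be,
  (forall i, an (n.+1 + m) (cat m a b) (f i)) ->
  (forall i : 'I_l, (j <= i)%N -> nonzero_fib m n.+1 (cat m a b) (f i)) ->
  ST n.+1 m a b f be.
Proof.
move=> QE; elim=> [|j IH] m a b l f be hf hn.
  by apply: ST_regular => // i; exact: hn.
case: (ltnP j l) => jl; last first.
  by apply: IH => // i ji; have := leq_trans jl ji; rewrite leqNgt ltn_ord.
pose k := Ordinal jl.
have gtk (i : 'I_l) : (j <= i)%N -> i != k -> (j < i)%N.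
  by move=> ji ik; rewrite ltn_neqAle ji andbT; apply: contra ik => /eqP ji'; apply/eqP/val_inj.
have [s [B [g [hB' hg fE hnz]]]] := content_an (hf k).
have hB i : (i < s)%N -> an m a (B i).
  by move=> si; apply: an_ctr (hB' i si) => q qm; rewrite /cat qm.
(* The case where all [B] vanish: f k is then 0, and the constant -1 is just as little positive
   while vanishing nowhere. *)
have [r0 r00 Hr0] : ST n.+1 m a b (fun i => if i == k then fun=> -1 else f i) be.
  apply: IH => i; first by case: eqP => // _; exact: anC.
  move=> ji; case: eqP => [_|/eqP ik]; last exact: hn (gtk i ji ik).
  move=> d d0; exists (cat m a b); last by rewrite oppr_eq0 oner_eq0.
  by move=> q _; rewrite subrr normr0 ltW.
(* The case where B j0 is largest: the quotients B q / B j0 are new parameters, read at the entries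
   q + m, except that the one of j0 is fixed to 1. The Boolean in js below records the sign of B
   j0. *)
pose vv j0 (E : env) q := if q == j0 then 1 else E (q + m)%N.
pose f' (js : 'I_s * bool) i := if i == k then
    (fun E => (-1) ^+ (js.2 : nat) * \sum_(q < s) vv js.1 E q * g q (dropv m s E))
  else (fun E => f i (dropv m s E)).
have /choice[r1 Hr1] : forall js : 'I_s * bool, exists rho : R, 0 < rho /\
    forall a', (forall i, (i < m)%N -> `|a' i - a i| <= rho) ->
    forall d, 0 < d -> d <= rho -> forall v, (forall i, (i < s)%N -> -1 <= v i <= 1) ->
    qf (s + m) (cat m a' v) (exbox n.+1 (s + m) (fun i => b i - d) (fun i => b i + d) (fun e => be (fun i => 0 < f' js i e))).
  move=> [j0 sg]; have [|rho h1 h2] := @ST_unif n.+1 s m a b l (f' (j0, sg)) be; last by exists rho.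
  move=> v Hv; apply: IH => i.
    rewrite /f'; case: eqP => _; last exact: an_dropv.
    apply: anM; first exact: anC.
    apply: an_sum => q _; apply: anM; last by apply: an_dropv; exact: hg.
    rewrite /vv; case: eqP => _; first exact: anC.
    by apply: an_var; apply: (@leq_trans (s + m)); [rewrite ltn_add2r | rewrite leq_addl].
  move=> ji; rewrite /f'; case: eqP => [_|/eqP ik]; last first.
    by apply: nonzero_dropv (hn i (gtk i ji ik)) _ => E _.
  pose w q := (-1) ^+ (sg : nat) * (if q == j0 :> nat then 1 else v q).
  have h : nonzero_fib m n.+1 (cat m a b) (fun e => (-1) ^+ (sg : nat) * \sum_(q < s) (if q == j0 :> nat then 1 else v q) * g q e).
    move=> d d0; have [|y hy1 hy2] := hnz (fun q => if q == j0 :> nat then 1 else v q) j0 (ltn_ord j0) _ d d0.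
      by rewrite eqxx.
    by exists y => //; rewrite mulf_neq0 // signr_eq0.
  apply: nonzero_dropv h _ => E HE; congr (_ * _); apply: eq_bigr => q _; congr (_ * _).
  by rewrite /vv; case: eqP => // _; rewrite HE.
have [r2 r20 Hr2] := @fin_min _ r1 (fun js => proj1 (Hr1 js)).
have [r3 r30 Hr3] : nearm m a (fun e => forall i, (i < s)%N -> an m e (B i) /\
    forall e', (forall q, (q < m)%N -> e q = e' q) -> B i e = B i e').
  by apply: nearm_all => i si; apply: nearmI; [apply: an_open; exact: hB | apply: an_supp; exact: hB].
have [r4 r40 Hr4] := fE.
pose rho := Num.min (Num.min r0 r2) (Num.min r3 r4) / 2.
have rho_pos : 0 < rho by rewrite /rho divr_gt0 // !lt_min r00 r20 r30.
have [[rr0 rr2] [rr3 rr4]] : ((rho <= r0) /\ (rho <= r2)) /\ ((rho + rho <= r3) /\ (rho + rho <= r4)).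
  have -> : rho + rho = Num.min (Num.min r0 r2) (Num.min r3 r4) by rewrite /rho; field.
  have le x : rho + rho <= x -> rho <= x by move: rho_pos; lra.
  have -> : rho <= r0.
    by apply: le; rewrite /rho -splitr !ge_min lexx.
  have -> : rho <= r2.
    by apply: le; rewrite /rho -splitr !ge_min lexx orbT.
  by rewrite !ge_min !lexx !orbT.
exists rho => // a' Ha' d d0 dr.
have near_a' r : rho + rho <= r -> forall e, (forall i, (i < m)%N -> `|e i - a' i| <= rho) -> forall i, (i < m)%N -> `|e i - a i| <= r.
  move=> rr e He i im; have -> : e i - a i = (e i - a' i) + (a' i - a i) by ring.
  by apply: le_trans (ler_normD _ _) _; have := He i im; have := Ha' i im; lra.
have hBa' i : (i < s)%N -> an m a' (B i).
  move=> si; have [] := Hr3 a' _ i si => // q qm; have := near_a' _ rr3 a'.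
  by apply=> // q' _; rewrite subrr normr0 ltW.
pose S0 := exbox n.+1 m (fun i => b i - d) (fun i => b i + d) (fun e => be (fun i => 0 < (if i == k then fun=> -1 else f i) e)).
pose S1 js := exbox n.+1 (s + m) (fun i => b i - d) (fun i => b i + d) (fun e => be (fun i => 0 < f' js i e)).
have q0 : qf m a' (fun e => (forall i, (i < s)%N -> B i e = 0) /\ S0 e).
  apply: (bc_and (qf_bc m a')); last first.
    by apply: Hr0 => //; [move=> i im; apply: le_trans (Ha' i im) _ | exact: le_trans dr _].
  by apply: (bc_allnat (qf_bc m a') (P := fun i e => B i e = 0)) => i si; apply: sa_qf; apply: sa_eq; [exact: hBa' | exact: anC].
have q1 (js : 'I_s * bool) : qf m a' (fun e => (forall i, (i < s)%N -> B i e * B i e <= B js.1 e * B js.1 e) /\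
     (0 < (-1) ^+ (js.2 : nat) * B js.1 e /\ S1 js (cat m e (fun i => rdiv (B i e) (B js.1 e))))).
  have hj := hBa' js.1 (ltn_ord _).
  apply: (bc_and (qf_bc m a')).
    apply: (bc_allnat (qf_bc m a') (P := fun i e => B i e * B i e <= B js.1 e * B js.1 e)) => i si; apply: sa_qf; apply: sa_le; last exact: anM.
    by apply: anM; exact: hBa'.
  apply: (bc_and (qf_bc m a')); first by apply: qf_pos; apply: anM => //; exact: anC.
  apply: (@qf_ext R m a' s (fun i => B i) (fun i => B js.1)) => //.
  move=> v Hv; have [_ h] := Hr1 js; apply: h => //.
    by move=> i im; apply: le_trans (Ha' i im) (le_trans rr2 (Hr2 js)).
  exact: le_trans dr (le_trans rr2 (Hr2 js)).
apply: qf_near (bc_or (qf_bc m a') q0 (bc_ex (qf_bc m a') q1)).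
exists rho => // e He.
have fkE (y : env) : (forall i, (i < n.+1)%N -> b i - d <= y i <= b i + d) ->
    f k (cat m e y) = \sum_(i < s) B i e * g i (cat m e y).
  move=> Hy; rewrite Hr4.
    apply: eq_bigr => i _; congr (_ * _); have [_ h] := Hr3 e (near_a' _ rr3 e He) i (ltn_ord i).
    by apply/esym/h => q qm; rewrite /cat qm.
  move=> i im; rewrite /cat; case: ltnP => im'; first exact: (near_a' _ rr4 e He).
  have := Hy (i - m)%N; rewrite ltn_subLR // addnC => /(_ im).
  by move=> h; rewrite ler_norml; lra.
have S1E (js : 'I_s * bool) : (forall i, (i < s)%N -> B i e * B i e <= B js.1 e * B js.1 e) -> 0 < (-1) ^+ (js.2 : nat) * B js.1 e ->
   S1 js (cat m e (fun i => rdiv (B i e) (B js.1 e))) <->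
   exbox n.+1 m (fun i => b i - d) (fun i => b i + d) (fun e => be (fun i => 0 < f i e)) e.
  move=> Bmax B0.
  have B00 : B js.1 e != 0 by apply: contraTneq B0 => ->; rewrite mulr0 ltxx.
  suff yE (y : env) : (forall i, (i < n.+1)%N -> b i - d <= y i <= b i + d) ->
     (fun i => 0 < f' js i (cat (s + m) (cat m e (fun i => rdiv (B i e) (B js.1 e))) y)) = (fun i => 0 < f i (cat m e y)).
    by split=> -[y Hy h]; exists y => //; move: h; rewrite yE.
  move=> Hy; apply/funext => i; rewrite /f'; case: eqP => [->|_]; last by rewrite dropv_cat.
  rewrite dropv_cat fkE //.
  have -> : \sum_(q < s) B q e * g q (cat m e y) = B js.1 e * \sum_(q < s)
      vv js.1 (cat (s + m) (cat m e (fun i => rdiv (B i e) (B js.1 e))) y) q * g q (cat m e y).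
    rewrite mulr_sumr; apply: eq_bigr => q _; rewrite mulrA; congr (_ * _).
    rewrite /vv; case: eqP => [->|_]; first by rewrite mulr1.
    rewrite /cat ltn_add2r ltn_ord ltnNge leq_addl addnK /rdiv -sqr_le_norm Bmax // B00.
    by rewrite mulrCA divff // mulr1.
  set X := \sum_(q < s) _; move: B0; case: (js.2) => /=; rewrite ?expr0 ?expr1 ?mul1r ?mulN1r => B0.
    by rewrite -[B _ e]opprK mulNr oppr_gt0 oppr_gt0 pmulr_rlt0.
  by rewrite pmulr_rgt0.
split=> [[[B0 [y Hy h]]|[js [Bmax [B0 h]]]]|H]; last first.
- have [s0|s0] := posnP s.
    left; split=> [i|]; first by rewrite s0.
    have [y Hy h] := H; exists y => //; move: h; congr be; apply/funext => i.
    by case: eqP => [->|//]; rewrite fkE // big1 ?ltxx ?ltr0N1 // => -[q]; rewrite s0.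
  have [j0 j0s Hj0] := argmaxn (fun i => B i e * B i e) s0.
  have [Bz|Bz] := eqVneq (B j0 e) 0.
    have Bz' i : (i < s)%N -> B i e = 0.
      move=> si; apply/eqP; have := Hj0 i si; rewrite Bz mulr0 -expr2 => h.
      by rewrite -sqrf_eq0 eq_le h sqr_ge0.
    left; split=> //; have [y Hy h] := H; exists y => //; move: h; congr be; apply/funext => i.
    case: eqP => [->|//]; rewrite fkE // big1 ?ltxx ?ltr0N1 // => q _; by rewrite Bz' // mul0r.
  right; exists (Ordinal j0s, B j0 e < 0).
  have Bsg : 0 < (-1) ^+ ((B j0 e < 0)%R : nat) * B j0 e.
    case: (ltP (B j0 e) 0) => [h|h]; first by rewrite expr1 mulN1r oppr_gt0.
    by rewrite expr0 mul1r lt_def Bz.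
  by split=> //; split=> //; apply/S1E.
- exact: (proj1 (S1E js Bmax B0) h).
exists y => //; move: h; congr be; apply/funext => i.
by case: eqP => [->|//]; rewrite fkE // big1 ?ltxx ?ltr0N1 // => q _; rewrite B0 // mul0r.
Qed.

Theorem QE_all n : @QEn R n.
Proof.
elim: n => [|n IH] m a l u P hP.
  by apply: exbox0; apply: sa_ctr (hP l _) => // i im; rewrite /cat im.
(* The cubes of the cover may stick out of the original box, so its bounds become part of the
   condition. *)
pose P' e := P e /\ forall i, (i < n.+1)%N -> l i <= e (i + m)%N <= u i.
have [b Hb|S [HS CS]] := @box_cover R n.+1 l u (fun b rho =>
  forall a', (forall i, (i < m)%N -> `|a' i - a i| <= rho) ->
    qf m a' (exbox n.+1 m (fun i => b i - rho) (fun i => b i + rho) P')).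
  have [k [f [be [hf h]]]] : sa (n.+1 + m) (cat m a b) P'.
    apply: sa_and; first exact: hP.
    apply: (bc_allnat (sa_bc _ _) (P := fun i e => is_true (l i <= e (i + m)%N <= u i))) => i im.
    have hv : an (n.+1 + m) (cat m a b) (fun e => e (i + m)%N) by apply: an_var; rewrite ltn_add2r.
    apply: (sa_iff _ (sa_and (sa_le (anC _ _ (l i)) hv) (sa_le hv (anC _ _ (u i))))) => e.
    by split=> [[-> ->]|/andP].
  have [r1 r10 Hr1] := @ST_general n IH k m a b k f be hf (fun i ki => ltac:(by move: ki; rewrite leqNgt ltn_ord)).
  have [r2 r20 Hr2] := h.
  pose rho := Num.min r1 r2 / 2.
  have rho_pos : 0 < rho by rewrite divr_gt0 // lt_min r10.
  have [rr1 rr2] : rho <= r1 /\ rho + rho <= r2.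
    have h0 : rho + rho = Num.min r1 r2 by rewrite /rho; field.
    rewrite h0 ge_min lexx orbT; split=> //; apply: (@le_trans _ _ (rho + rho)); first by rewrite lerDl ltW.
    by rewrite h0 ge_min lexx.
  exists rho => // a' Ha'; apply: qf_near (Hr1 a' _ rho rho_pos rr1).
    exists rho => // e He.
    suff PE y : (forall i, (i < n.+1)%N -> b i - rho <= y i <= b i + rho) -> (P' (cat m e y) <-> be (fun i => 0 < f i (cat m e y))).
      by split=> -[y Hy h']; exists y => //; apply/PE.
    move=> Hy; apply: Hr2 => i im; rewrite /cat; case: ltnP => im'.
      have -> : e i - a i = (e i - a' i) + (a' i - a i) by ring.
      by apply: le_trans (ler_normD _ _) _; have := He i im'; have := Ha' i im'; lra.
    have := Hy (i - m)%N; rewrite ltn_subLR // addnC => /(_ im).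
    by move=> h'; rewrite ler_norml; lra.
  by move=> i im; exact: le_trans (Ha' i im) rr1.
have hq p : List.In p S -> qf m a (exbox n.+1 m (fun i => p.1 i - p.2) (fun i => p.1 i + p.2) P').
  move=> pS; have [p0 _ h] := HS p pS; apply: h => i im; by rewrite subrr normr0 ltW.
apply: qf_iff (qf_exlist hq) => e; split=> [[p _ [y _ [h1 h2]]]|[y Hy h]].
  by exists y => // i im; have := h2 i im; rewrite cat_shift.
have [p pS Hp] := CS y Hy; exists p => //; exists y.
  by move=> i im; have := Hp i im; rewrite ler_norml; lra.
by split=> // i im; rewrite cat_shift; exact: Hy.
Qed.

End QuantifierElimination.

(** * Globally subanalytic sets *)

Section Subanalytic.
Context {R : realType}.
Local Notation env := (nat -> R).
Local Notation I1 n y := (forall i, (i < n)%N -> -1 <= (y : env) i <= 1).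

Definition suppd m (P : env -> Prop) := forall e e', (forall i, (i < m)%N -> e i = e' i) -> P e -> P e'.

(** Germs at a of projections. The set T has to be semianalytic at every point of the cube over a,
    not at one point only: this is the compactness in the definition of subanalytic sets. *)
Definition sub m (a : env) (P : env -> Prop) := exists n T, [/\ suppd (n + m) T,
  forall b : env, I1 n b -> sa (n + m) (cat m a b) T &
  nearm m a (fun e => P e <-> exbox n m (fun=> -1) (fun=> 1) T e)].

Lemma sub_near m a P Q : nearm m a (fun e => P e <-> Q e) -> sub m a P -> sub m a Q.
Proof.
move=> PQ [n [T [h1 h2 h3]]]; exists n, T; split=> //.
by apply: nearmW (nearmI PQ h3) => e [q1 q2]; rewrite -q1.
Qed.

Lemma sub_iff m a (P Q : env -> Prop) : (forall e, P e <-> Q e) -> sub m a P -> sub m a Q.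
Proof. by move=> PQ; apply: sub_near; apply: nearmT. Qed.

Lemma sa_widen m m' (a : env) P : (m <= m')%N -> sa m a P -> sa m' a P.
Proof.
move=> mm' h; apply: (sa_comp (h := fun i e => e i) h) => // i im.
by apply: an_var; apply: leq_trans im mm'.
Qed.

Lemma sub_sa m a P : sa m a P -> sub m a P.
Proof.
move=> hP; pose T (E : env) := P (fun i => if (i < m)%N then E i else 0).
exists 0%N, T; split=> [e e' ee'|b _|].
- rewrite /T; congr P; apply/funext => i; case: ifP => // im; exact: ee'.
- apply: (@sa_comp R m m _ a P (fun i E => if (i < m)%N then E i else 0) hP) => i im; rewrite im.
    exact: an_var.
  by rewrite /cat im.
apply: nearmW (sa_supp hP) => e he; split=> [Pe|[y _]].
  by exists (fun=> 0) => //; apply: (proj1 (he _ _) Pe) => i im; rewrite im /cat im.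
by move=> h; apply: (proj2 (he _ _) h) => i im; rewrite im /cat im.
Qed.

Lemma sub_const m a B : sub m a (fun=> B).
Proof. by apply: sub_sa; exact: sa_const. Qed.

(** The fibre variables of the two projections are put side by side, so that witnesses for the two
    can be chosen independently and combined by [mix]. *)
Lemma sub_two m a P P' : sub m a P -> sub m a P' -> exists n (T T' : env -> Prop),
  [/\ [/\ suppd (n + m) T, suppd (n + m) T', forall b : env, I1 n b -> sa (n + m) (cat m a b) T
       & forall b : env, I1 n b -> sa (n + m) (cat m a b) T'],
   nearm m a (fun e => P e <-> exbox n m (fun=> -1) (fun=> 1) T e),
   nearm m a (fun e => P' e <-> exbox n m (fun=> -1) (fun=> 1) T' e) &
   forall e, exbox n m (fun=> -1) (fun=> 1) T e -> exbox n m (fun=> -1) (fun=> 1) T' e ->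
     exbox n m (fun=> -1) (fun=> 1) (fun E => T E /\ T' E) e].
Proof.
move=> [n [T [sT saT PT]]] [n' [T' [sT' saT' PT']]].
have I0 : (-1 : R) <= (0 : R) <= (1 : R) by apply/andP; split; [exact: lerN10 | exact: ler01].
pose sh (E : env) q := if (q < m)%N then E q else E (q + n)%N.
have shE e y : sh (cat m e y) = cat m e (fun i => y (i + n)%N).
  apply/funext => q; rewrite /sh /cat; case: ltnP => // qm.
  by rewrite ltnNge (leq_trans qm) ?leq_addr //= addnBAC.
have catT e y y' : (forall i, (i < n)%N -> y i = y' i) -> T (cat m e y) -> T (cat m e y').
  move=> yy'; apply: sT => i im; rewrite /cat; case: ltnP => // mi; apply: yy'.
  by rewrite ltn_subLR // addnC.
have catT' e y y' : (forall i, (i < n')%N -> y i = y' i) -> T' (cat m e y) -> T' (cat m e y').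
  move=> yy'; apply: sT' => i im; rewrite /cat; case: ltnP => // mi; apply: yy'.
  by rewrite ltn_subLR // addnC.
pose mix (y1 y2 : env) i := if (i < n)%N then y1 i else if (i - n < n')%N then y2 (i - n)%N else 0.
have mixI y1 y2 : I1 n y1 -> I1 n' y2 -> I1 (n + n') (mix y1 y2).
  move=> h1 h2 i im; rewrite /mix; case: ltnP => i1; first exact: h1.
  by case: ltnP => i2 //; exact: h2.
have mix2 y1 y2 i : (i < n')%N -> mix y1 y2 (i + n)%N = y2 i.
  by move=> im; rewrite /mix ltnNge leq_addl addnK im.
have mix1 y1 y2 i : (i < n)%N -> mix y1 y2 i = y1 i by move=> im; rewrite /mix im.
exists (n + n')%N, T, (fun E => T' (sh E)); split.
- split.
  + by move=> e e' ee'; apply: sT => i im; apply: ee'; apply: leq_trans im _; rewrite leq_add2r leq_addr.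
  + move=> e e' ee'; apply: sT' => i im; rewrite /sh; case: ltnP => mi; apply: ee'.
      by apply: leq_trans mi _; rewrite leq_addl.
    by rewrite [(_ + n)%N]addnC -addnA ltn_add2l.
  + move=> b hb; apply: (@sa_widen (n + m)%N); first by rewrite leq_add2r leq_addr.
    by apply: saT => i im; apply: hb; rewrite (leq_trans im) // leq_addr.
  + move=> b hb; apply: (sa_comp (h := fun q E => sh E q) (saT' (fun i => b (i + n)%N) _)).
    * by move=> i im; apply: hb; rewrite addnC ltn_add2l.
    * move=> q qm; rewrite /sh; case: ltnP => mq; apply: an_var.
        by apply: leq_trans mq _; rewrite leq_addl.
      by rewrite [(_ + n)%N]addnC -addnA ltn_add2l.
    * by move=> q _; rewrite shE.
- apply: nearmW PT => e ->; split=> -[y hy h].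
    by exists (mix y (fun=> 0)); [apply: mixI | apply: catT h => i im; rewrite mix1].
  by exists y => // i im; apply: hy; rewrite (leq_trans im) // leq_addr.
- apply: nearmW PT' => e ->; split=> -[y hy h].
    exists (mix (fun=> 0) y); first exact: mixI.
    by rewrite shE; apply: catT' h => i im; rewrite mix2.
  exists (fun i => y (i + n)%N); last by rewrite -shE.
  by move=> i im; apply: hy; rewrite addnC ltn_add2l.
move=> e [y1 h1 q1] [y2 h2 q2]; exists (mix y1 (fun i => y2 (i + n)%N)).
  by apply: mixI => i im; [apply: h1; rewrite (leq_trans im) ?leq_addr | apply: h2; rewrite addnC ltn_add2l].
split; first by apply: catT q1 => i im; rewrite mix1.
rewrite shE; rewrite shE in q2; apply: catT' q2 => i im; by rewrite mix2.
Qed.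

Lemma sub_or m a P P' : sub m a P -> sub m a P' -> sub m a (fun e => P e \/ P' e).
Proof.
move=> h h'; have [n [T [T' [[h1 h2 h3 h4] q1 q2 _]]]] := sub_two h h'.
exists n, (fun E => T E \/ T' E); split.
- by move=> e e' ee' [/(h1 _ _ ee')|/(h2 _ _ ee')]; [left|right].
- by move=> b hb; exact: (bc_or (sa_bc _ _) (h3 b hb) (h4 b hb)).
apply: nearmW (nearmI q1 q2) => e [-> ->]; split=> [[[y hy h5]|[y hy h5]]|[y hy [h5|h5]]].
- by exists y => //; left.
- by exists y => //; right.
- by left; exists y.
- by right; exists y.
Qed.

Lemma sub_and m a P P' : sub m a P -> sub m a P' -> sub m a (fun e => P e /\ P' e).
Proof.
move=> h h'; have [n [T [T' [[h1 h2 h3 h4] q1 q2 q3]]]] := sub_two h h'.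
exists n, (fun E => T E /\ T' E); split.
- by move=> e e' ee' [/(h1 _ _ ee') ? /(h2 _ _ ee')].
- by move=> b hb; apply: sa_and (h3 b hb) (h4 b hb).
apply: nearmW (nearmI q1 q2) => e [-> ->]; split=> [[]|[y hy [h5 h6]]]; first exact: q3.
by split; exists y.
Qed.

Lemma sub_exlist m (a : env) (A : Type) (S : seq A) (P : A -> env -> Prop) :
  (forall p, List.In p S -> sub m a (P p)) -> sub m a (fun e => exists2 p, List.In p S & P p e).
Proof.
elim: S => [|q S IH] H.
  by apply: sub_iff (sub_const m a False) => e; split=> // -[].
have h1 := H q (or_introl erefl); have h2 := IH (fun p pS => H p (or_intror pS)).
apply: sub_iff (sub_or h1 h2) => e.
by split=> [[h|[p pS h]]|[p [<-|pS] h]]; [exists q => //; left|exists p => //; right|left|right; exists p].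
Qed.

Lemma sub_comp m k (a b : env) P (h : nat -> env -> R) : sub m b P ->
  (forall i, (i < m)%N -> an k a (h i)) -> (forall i, (i < m)%N -> h i a = b i) ->
  (forall i e e', (i < m)%N -> (forall j, (j < k)%N -> e j = e' j) -> h i e = h i e') ->
  sub k a (fun e => P (fun i => h i e)).
Proof.
move=> [n [T [sT saT PT]]] hh hb hs.
pose H q E := if (q < m)%N then h q E else E (q - m + k)%N.
have HE e y : (fun q => H q (cat k e y)) = cat m (fun i => h i e) y.
  apply/funext => q; rewrite /H; case: ltnP => qm; last by rewrite cat_shift /cat ltnNge qm.
  by rewrite /cat qm; apply: hs => // j jk; rewrite jk.
have Hlt q : (q < n + m)%N -> (m <= q)%N -> (q - m + k < n + k)%N.
  by move=> q1 q2; rewrite ltn_add2r ltn_subLR // addnC.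
have Hnear : nearm k a (fun e => forall i, (i < m)%N -> forall d, d \in [::] -> `|h i e - b i| <= d) by apply: nearmT.
exists n, (fun E => T (fun q => H q E)); split.
- move=> e e' ee'; apply: sT => q qm; rewrite /H; case: ltnP => mq; last exact/ee'/Hlt.
  by apply: hs => // j jk; apply: ee'; apply: leq_trans jk _; rewrite leq_addl.
- move=> y hy; apply: (sa_comp (h := H) (saT y hy)) => q qm; rewrite /H; case: ltnP => mq.
  + apply: (@an_widen R k); first by rewrite leq_addl.
    apply: an_ctr (hh q mq) => i im; by rewrite /cat im.
  + exact/an_var/Hlt.
  + rewrite [cat m b y q]/cat mq -hb //; apply: hs => // j jk; by rewrite /cat jk.
  + by rewrite cat_shift /cat ltnNge mq.
have [d d0 Hd] := PT.
have hc : nearm k a (fun e => forall i, (i < m)%N -> `|h i e - b i| <= d).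
  by apply: nearm_all => i im; rewrite -hb //; apply: an_cont => //; exact: hh.
apply: nearmW hc => e he; rewrite Hd //.
by split=> -[y hy h']; exists y => //; move: h'; rewrite HE.
Qed.

(** Finitely many local descriptions suffice over the compact box. Each piece is rescaled by [h] to
    the unit cube and the variables of its own description are adjoined, so that two successive
    projections become one. *)
Lemma sub_exbox n m a l u P :
  (forall b, (forall i, (i < n)%N -> l i <= b i <= u i) -> sub (n + m) (cat m a b) P) ->
  sub m a (exbox n m l u P).
Proof.
move=> hP.
pose Q (b : env) (d : R) := exists k T, [/\ suppd (k + (n + m)) T,
   forall E, (forall i, (i < n + m)%N -> `|E i - cat m a b i| <= d) -> forall z, I1 k z -> sa (k + (n + m)) (cat (n + m) E z) T &
   forall E, (forall i, (i < n + m)%N -> `|E i - cat m a b i| <= d) ->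
     (P E <-> exbox k (n + m) (fun=> -1) (fun=> 1) T E)].
have [b hb|S [HS CS]] := @box_cover R n l u Q.
  have [k [T [sT saT PT]]] := hP b hb.
  have h := cat_unif (l := fun=> -1) (u := fun=> 1) (Q := fun E => sa (k + (n + m)) E T) (fun v hv => sa_open (saT v hv)).
  have [d d0 Hd] := nearmI PT h.
  by exists d => //; exists k, T; split=> // E hE; have [] := Hd E hE.
pose piece (p : env * R) e := exists2 y : env, (forall i, (i < n)%N -> l i <= y i <= u i) /\ (forall i, (i < n)%N -> `|y i - p.1 i| <= p.2) & P (cat m e y).
have [d0 d00 Hd0] : exists2 d : R, 0 < d & forall p, List.In p S -> d <= p.2.
  elim: S {CS} HS => [|q S IH] HS; first by exists 1.
  have [|d d0 Hd] := IH; first by move=> p ps; apply: HS; right.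
  exists (Num.min q.2 d); first by rewrite lt_min d0 andbT; have [] := HS q (or_introl erefl).
  by move=> p [<-|/Hd h]; rewrite ge_min ?lexx // h orbT.
suff hp p : List.In p S -> sub m a (fun e => exists2 y : env, (forall i, (i < n)%N -> l i <= y i <= u i) /\ (forall i, (i < n)%N -> `|y i - p.1 i| <= p.2) & P (cat m e y)).
  apply: sub_near (sub_exlist hp); exists d0 => // e he; split=> [[p pS [y [h1 _] h2]]|[y hy h]]; first by exists y.
  by have [p pS Hp] := CS y hy; exists p => //; exists y.
move=> pS; have [p20 pb [k [T [sT saT PT]]]] := HS p pS.
move: p20 pb saT PT (Hd0 p pS) => {HS CS pS}; case: p => b d /= p20 pb saT PT d0d.
pose h q (E : env) := if (q < m)%N then E q else if (q < n + m)%N then b (q - m)%N + d * E q else E q.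
have hcat e w : (fun q => h q (cat m e w)) = cat (n + m) (cat m e (fun i => b i + d * w i)) (fun i => w (i + n)%N).
  apply/funext => q; rewrite /h /cat; case: ltnP => qm; first by rewrite (leq_trans qm) // leq_addl.
  case: ltnP => qnm //; congr w; rewrite subnDA subnAC subnK //.
  by rewrite leq_subRL // addnC.
have hwide E w : (forall i, (i < m)%N -> `|E i - a i| <= d) -> I1 n w ->
    forall i, (i < n + m)%N -> `|cat m E (fun i => b i + d * w i) i - cat m a b i| <= d.
  move=> hE hw i im; rewrite /cat; case: ltnP => im'; first exact: hE.
  rewrite addrAC subrr add0r normrM gtr0_norm // ler_piMr //; first exact: ltW.
  by rewrite ler_norml; apply: hw; rewrite ltn_subLR // addnC.
exists (k + n)%N, (fun E => T (fun q => h q E) /\ forall i, (i < n)%N -> l i <= b i + d * E (i + m)%N <= u i); split.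
- move=> e e' ee' [h1 h2]; split=> [|i im]; last by rewrite -ee' ?h2 // ltn_add2r (leq_trans im) // leq_addl.
  by apply: sT h1 => q qm; rewrite addnA in qm; rewrite /h ee'.
- move=> w hw; have wn : I1 n w by move=> i im; apply: hw; rewrite (leq_trans im) // leq_addl.
  have wk : I1 k (fun i => w (i + n)%N) by move=> i im; apply: hw; rewrite ltn_add2r.
  apply: sa_and.
    have sa0 := saT (cat m a (fun i => b i + d * w i)) (hwide a w (fun i _ => ltac:(by rewrite subrr normr0 ltW)) wn) _ wk.
    apply: (sa_comp (h := h) sa0) => q; rewrite addnA => qm.
      rewrite /h; case: (_ < m)%N; first exact: an_var.
      case: (_ < n + m)%N; last exact: an_var.
      by apply: anD; [exact: anC | apply: anM; [exact: anC | exact: an_var]].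
    by have := congr1 (@^~ q) (hcat a w).
  apply: (bc_allnat (sa_bc _ _) (P := fun i (E : env) => is_true (l i <= b i + d * E (i + m)%N <= u i))) => i im.
  have hv : an (k + n + m) (cat m a w) (fun E => b i + d * E (i + m)%N).
    apply: anD; first exact: anC.
    by apply: anM; [exact: anC | apply: an_var; rewrite ltn_add2r (leq_trans im) // leq_addl].
  apply: sa_iff (sa_and (sa_le (anC _ _ (l i)) hv) (sa_le hv (anC _ _ (u i)))) => E.
  by split=> [[-> ->]|/andP].
exists d0 => // e he; have hed i : (i < m)%N -> `|e i - a i| <= d by move=> /he h1; apply: le_trans h1 d0d.
split=> [[y [h1 h2] /PT]|[w hw [h1 h2]]].
  case=> [i im|z hz hT].
    rewrite /cat; case: ltnP => mi; first exact: hed.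
    by apply: h2; rewrite ltn_subLR // addnC.
  exists (fun i => if (i < n)%N then (y i - b i) / d else z (i - n)%N) => [i im|].
    case: ltnP => i1; last by apply: hz; rewrite ltn_subLR // addnC.
    by rewrite -ler_norml normrM normfV (gtr0_norm p20) ler_pdivrMr // mul1r h2.
  have dE i : (i < n)%N -> b i + d * ((if (i < n)%N then (y i - b i) / d else z (i - n)%N)) = y i.
    by move=> ->; rewrite mulrC divfK ?gt_eqF // addrC subrK.
  split=> [|i im]; last by rewrite cat_shift dE ?h1.
  rewrite hcat; apply: sT hT => q qm; rewrite /cat; case: ltnP => q1.
    case: ltnP => q2 //; rewrite dE // ltn_subLR // addnC //.
  by rewrite ltnNge leq_addl /= addnK.
have wn : I1 n w by move=> i im; apply: hw; rewrite (leq_trans im) // leq_addl.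
exists (fun i => b i + d * w i); first split.
- by move=> i im; have := h2 i im; rewrite cat_shift.
- move=> i im; rewrite addrAC subrr add0r normrM gtr0_norm // ler_piMr //; first exact: ltW.
  by rewrite ler_norml; apply: wn.
apply/(PT _ (hwide e w hed wn)); exists (fun i => w (i + n)%N); last by rewrite -hcat.
by move=> i im; apply: hw; rewrite ltn_add2r.
Qed.

Lemma sub_supp m (a : env) P : sub m a P ->
  nearm m a (fun e => forall e', (forall i, (i < m)%N -> e i = e' i) -> (P e <-> P e')).
Proof.
move=> [n [T [sT _ [d d0 Hd]]]]; exists d => // e he e' ee'.
have he' i : (i < m)%N -> `|e' i - a i| <= d by move=> im; rewrite -ee' // he.
rewrite !Hd //; split=> -[y hy h]; exists y => //; apply: sT h => q qm; rewrite /cat; case: ltnP => // mq.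
  exact: ee'.
by rewrite ee'.
Qed.

Lemma rdivP (u w v : R) : v = rdiv u w <-> ((u * u <= w * w /\ w <> 0) /\ v * w = u) \/ (~ (u * u <= w * w /\ w <> 0) /\ v = 0).
Proof.
rewrite sqr_le_norm /rdiv; case: ifP => [/andP[uw w0]|uw].
  split=> [->|[[_ <-]|[[]]]]; [left | by rewrite mulfK | by split=> //; apply/eqP].
  by split; [split=> //; apply/eqP | rewrite divfK].
have nuw : ~ (`|u| <= `|w| /\ w <> 0) by move=> [h1 /eqP h2]; rewrite h1 h2 in uw.
by split=> [->|[[//]|[_ ->//]]]; right.
Qed.

(** Set and complement go through the induction together, as [qf_not] exchanges them. In the case
    [qf_ext] the restricted quotients lie in [-1, 1] and have a semianalytic graph by [rdivP], so
    their values can be quantified over a cube, both for S and for its negation. *)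
Lemma qf_sub m a P : qf m a P -> sub m a P /\ sub m a (fun e => ~ P e).
Proof.
elim=> {m a P} [m a f hf|m a P _ [h1 h2]|m a P Q _ [h1 h2] _ [h3 h4]|m a P Q PQ _ [h1 h2]|m a s f g S hf hg _ hS].
- by split; apply: sub_sa; [|apply: sa_not]; apply: sa_pos.
- by split=> //; apply: sub_iff h1 => e; rewrite notK.
- split; first exact: sub_and.
  by apply: sub_iff (sub_or h2 h4) => e; rewrite not_andE.
- by split; [apply: sub_near h1 | apply: sub_near h2; apply: nearmW PQ => e ->].
pose v (e : env) i := rdiv (f i e) (g i e).
pose Gam (E : env) := forall i, (i < s)%N -> E (i + m)%N = rdiv (f i E) (g i E).
have saG (y : env) : sa (s + m) (cat m a y) Gam.
  apply: (bc_allnat (sa_bc _ _) (P := fun i (E : env) => E (i + m)%N = rdiv (f i E) (g i E))) => i im.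
  have wid F : an m a F -> an (s + m) (cat m a y) F.
    move=> hF; apply: (@an_widen R m); first by rewrite leq_addl.
    by apply: an_ctr hF => q qm; rewrite /cat qm.
  have hv : an (s + m) (cat m a y) (fun E => E (i + m)%N) by apply: an_var; rewrite ltn_add2r.
  have Hf := wid _ (hf i im); have Hg := wid _ (hg i im).
  have h0 := anC (s + m) (cat m a y) 0.
  have hC := sa_and (sa_le (anM Hf Hf) (anM Hg Hg)) (sa_not (sa_eq Hg h0)).
  apply: sa_iff (bc_or (sa_bc _ _) (sa_and hC (sa_eq (anM hv Hg) Hf)) (sa_and (sa_not hC) (sa_eq hv h0))) => E.
  exact: iff_sym (rdivP _ _ _).
have fg : nearm m a (fun e => forall i, (i < s)%N -> forall y, f i (cat m e y) = f i e /\ g i (cat m e y) = g i e).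
  apply: nearm_all => i im; apply: nearmW (nearmI (an_supp (hf i im)) (an_supp (hg i im))) => e [h1 h2] y.
  by split; apply/esym; [apply: h1|apply: h2] => q qm; rewrite /cat qm.
have key (Q : env -> Prop) : (forall y : env, I1 s y -> sub (s + m) (cat m a y) Q) -> sub m a (fun e => Q (cat m e (v e))).
  move=> hQ; have hQs := cat_unif (l := fun=> -1) (u := fun=> 1)
     (Q := fun E => forall E', (forall i, (i < s + m)%N -> E i = E' i) -> Q E <-> Q E') (fun y hy => sub_supp (hQ y hy)).
  have hG := sub_exbox (fun y hy => sub_and (hQ y hy) (sub_sa (saG y))).
  apply: sub_near hG; apply: nearmW (nearmI fg hQs) => e [fge Qe].
  have ve y i : (i < s)%N -> rdiv (f i (cat m e y)) (g i (cat m e y)) = v e i.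
    by move=> im; have [-> ->] := fge i im y.
  split=> [[y hy [h1 h2]]|h].
    apply: (proj1 (Qe y hy _ _) h1) => q qm; rewrite /cat; case: ltnP => // mq.
    have im : (q - m < s)%N by rewrite ltn_subLR // addnC.
    by have := h2 _ im; rewrite cat_shift ve.
  exists (v e) => [i _|]; first exact: rdiv_bnd.
  by split=> // i im; rewrite cat_shift ve.
by split; [apply: (key S) | apply: (key (fun E => ~ S E))] => y hy; have [] := hS y hy.
Qed.

Lemma sub_qf m (a : env) P : sub m a P -> qf m a P.
Proof.
move=> [n [T [_ h1 h2]]]; apply: qf_near (QE_all (l := fun=> -1) (u := fun=> 1) h1).
by apply: nearmW h2 => e ->.
Qed.

(** Gabrielov's theorem of the complement: by elimination, subanalytic germs and quantifier-free
    germs are the same. *)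
Lemma sub_not m (a : env) P : sub m a P -> sub m a (fun e => ~ P e).
Proof. by move=> /sub_qf/qf_sub[]. Qed.

Lemma sub_bc m (a : env) : boolclass (sub m a).
Proof. split; [exact: sub_iff | exact: sub_not | exact: sub_and | exact: sub_const]. Qed.

End Subanalytic.

(** * Tameness along analytic arcs *)

Section Arcs.
Context {R : realType}.
Local Notation env := (nat -> R).

Definition evt (Q : R -> Prop) := exists2 d : R, 0 < d & forall s : R, 0 < s -> s < d -> Q s.

Lemma evtW (P Q : R -> Prop) : (forall s, 0 < s -> P s -> Q s) -> evt P -> evt Q.
Proof. by move=> PQ [d d0 H]; exists d => // s s0 sd; apply: PQ => //; apply: H. Qed.

Lemma evtI (P Q : R -> Prop) : evt P -> evt Q -> evt (fun s => P s /\ Q s).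
Proof.
move=> [d d0 H] [d' d'0 H']; exists (Num.min d d'); first by rewrite lt_min d0.
by move=> s s0; rewrite lt_min => /andP[? ?]; split; [exact: H|exact: H'].
Qed.

Lemma evtT (P : R -> Prop) : (forall s, P s) -> evt P.
Proof. by exists 1. Qed.

Lemma evt_ex (P : R -> Prop) : evt P -> exists2 s, 0 < s & P s.
Proof. by move=> [d d0 H]; exists (d / 2); [lra | apply: H; lra]. Qed.

Lemma evt_lt (b : R) : 0 < b -> evt (fun s => s < b).
Proof. by move=> b0; exists b. Qed.

Lemma evt_all n (P : nat -> R -> Prop) : (forall i, (i < n)%N -> evt (P i)) ->
  evt (fun s => forall i, (i < n)%N -> P i s).
Proof.
elim: n => [|n IH] H; first exact: evtT.
apply: evtW (evtI (IH (fun i im => H i (ltnW im))) (H n (ltnSn n))) => s _ [h1 h2] i.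
by rewrite ltnS leq_eqVlt => /orP[/eqP ->|/h1].
Qed.

Lemma nearm_evt P : nearm 1 (fun=> 0 : R) P -> evt (fun s => P (fun=> s)).
Proof.
move=> [d d0 H]; exists d => // s s0 sd; apply: H => i _.
by rewrite subr0 gtr0_norm // ltW.
Qed.

Local Notation z0 := (fun=> 0 : R).

Lemma an_factor (f : env -> R) : an 1 z0 f -> nearm 1 z0 (fun e => f e = 0) \/
  exists d U, [/\ an 1 z0 U, U z0 != 0 & nearm 1 z0 (fun e => f e = e 0%N ^+ d * U e)].
Proof.
move=> /an_cv0[c cc Hc]; have [c0|c0] := pselect (exists k, (c : nat -> R) k != 0); last first.
  left; apply: nearmW Hc => e ->; suff -> : c = 0 by rewrite ev0.
  apply/funext => k; apply/eqP; apply: contrapT => /negP h; apply: c0; by exists k.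
right; have [d cd dmin] := ex_minnP c0.
exists d, (ev (high d c)); have ch : cv (high d c) by have [r [M [r0 h]]] := cc; exists r, (M / r 0%N ^+ d); split=> //; exact: nrm_high.
have cE : c = fpsX (PSr 0) d * high d c.
  apply/funext => k; rewrite fpsXM; case: leqP => dk; first by rewrite /high subnK.
  by apply/eqP; apply: contraTT dk => /dmin; rewrite -leqNgt.
split; first exact: cv_an0.
  by rewrite (_ : ev _ _ = (c : nat -> R) d) //; apply: (etrans (ev_last0 _ _)).
have hM := cv_evM (@cv_fpsX R 0 d) ch; have := nearmI Hc hM; apply: nearmW => e [-> h].
by rewrite {1}cE h evX.
Qed.

Lemma an_sign (U : env -> R) : an 1 z0 U -> U z0 != 0 -> (0 < U z0 /\ evt (fun s => 0 < U (fun=> s))) \/ (U z0 < 0 /\ evt (fun s => U (fun=> s) < 0)).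
Proof.
move=> hU; rewrite neq_lt => /orP[h|h]; [right|left]; split=> //.
  have e0 : 0 < - U z0 / 2 by lra.
  by apply: evtW (nearm_evt (an_cont hU e0)) => s _; rewrite ler_norml; lra.
have e0 : 0 < U z0 / 2 by lra.
by apply: evtW (nearm_evt (an_cont hU e0)) => s _; rewrite ler_norml; lra.
Qed.

Lemma an_tri (f : env -> R) : an 1 z0 f ->
  [\/ evt (fun s => f (fun=> s) = 0), evt (fun s => 0 < f (fun=> s)) | evt (fun s => f (fun=> s) < 0)].
Proof.
move=> /an_factor[/nearm_evt h|[d [U [hU U0 /nearm_evt h]]]]; first exact: Or31.
have [[_ h']|[_ h']] := an_sign hU U0; [apply: Or32|apply: Or33];
  apply: evtW (evtI h h') => s s0 [-> q]; first by rewrite mulr_gt0 // exprn_gt0.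
by rewrite pmulr_rlt0 // exprn_gt0.
Qed.

Lemma an_le0 (f : env -> R) : an 1 z0 f -> evt (fun s => 0 <= f (fun=> s)) -> 0 <= f z0.
Proof.
move=> hf h; rewrite leNgt; apply/negP => f0.
have [[]|[_ h']] := an_sign hf (ltr0_neq0 f0); first by rewrite ltNge ltW.
by have [s _ []] := evt_ex (evtI h h'); rewrite leNgt => /negP.
Qed.

(** Write f and g as a power of s times a unit, with exponents a and b. Either the comparison of
    absolute values fails for small s and the quotient is eventually 0, or it holds; then b <= a and
    the quotient is analytic, since a < b would make g much smaller than f. *)
Lemma an_rdiv (f g : env -> R) : an 1 z0 f -> an 1 z0 g ->
  exists V, [/\ an 1 z0 V, -1 <= V z0 <= 1 & evt (fun s => rdiv (f (fun=> s)) (g (fun=> s)) = V (fun=> s))].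
Proof.
move=> hf hg.
have triv : evt (fun s => rdiv (f (fun=> s)) (g (fun=> s)) = 0) -> exists V, [/\ an 1 z0 V, -1 <= V z0 <= 1 & evt (fun s => rdiv (f (fun=> s)) (g (fun=> s)) = V (fun=> s))].
  by move=> h; exists z0; split; [exact: anC| lra | exact: h].
have [/nearm_evt h|[b [W [hW W0 /nearm_evt gE]]]] := an_factor hg.
  by apply: triv; apply: evtW h => s _ ->; rewrite /rdiv eqxx andbF.
have [/nearm_evt h|[a [U [hU U0 /nearm_evt fE]]]] := an_factor hf.
  by apply: triv; apply: evtW h => s _ ->; rewrite /rdiv mul0r; case: ifP.
have gn0 : evt (fun s => g (fun=> s) != 0).
  have [[_ h']|[_ h']] := an_sign hW W0; apply: evtW (evtI gE h') => s s0 [-> q].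
    by rewrite mulf_neq0 ?expf_neq0 // gt_eqF.
  by rewrite mulf_neq0 ?expf_neq0 ?(gt_eqF s0) // lt_eqF.
have le_or : evt (fun s => `|f (fun=> s)| <= `|g (fun=> s)|) \/ evt (fun s => ~~ (`|f (fun=> s)| <= `|g (fun=> s)|)).
  have /an_tri[] : an 1 z0 (fun e => g e * g e - f e * f e) by apply: anB; apply: anM.
  - by left; apply: evtW p => s _ /eqP; rewrite subr_eq0 => /eqP q; rewrite -sqr_le_norm q.
  - by left; apply: evtW p => s _; rewrite subr_gt0 => q; rewrite -sqr_le_norm ltW.
  - by right; apply: evtW p => s _; rewrite subr_lt0 => q; rewrite -sqr_le_norm -ltNge.
case: le_or => hle; last first.
  by apply: triv; apply: evtW hle => s _ /negbTE q; rewrite /rdiv q.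
have rE : evt (fun s => rdiv (f (fun=> s)) (g (fun=> s)) = f (fun=> s) / g (fun=> s)).
  by apply: evtW (evtI hle gn0) => s _ [h1 h2]; rewrite /rdiv h1 h2.
have Wn0 : evt (fun s => W (fun=> s) != 0).
  by apply: evtW (evtI gE gn0) => s _ [-> h]; move: h; rewrite mulf_eq0 negb_or => /andP[].
have hX k : an 1 z0 (fun e : env => e 0%N ^+ k) by apply: anX; apply: an_var.
case: (leqP b a) => ab.
  pose V e := e 0%N ^+ (a - b) * (U e * (W e)^-1).
  have hV : an 1 z0 V by apply: anM => //; apply: anM => //; apply: an_inv.
  have VE : evt (fun s => f (fun=> s) / g (fun=> s) = V (fun=> s)).
    apply: evtW (evtI fE (evtI gE Wn0)) => s s0 [-> [-> w0]].
    rewrite /V -{1}(subnK ab) exprD; field; by rewrite w0 expf_neq0 ?gt_eqF.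
  have Vb : evt (fun s => `|V (fun=> s)| <= 1).
    apply: evtW (evtI VE (evtI hle gn0)) => s _ [<- [h1 h2]].
    by rewrite normrM normfV ler_pdivrMr ?normr_gt0 // mul1r.
  exists V; split=> //; last by apply: evtW (evtI rE VE) => s _ [-> ->].
  apply/andP; split.
    rewrite -subr_ge0; apply: (@an_le0 (fun e => V e - -1)); first by apply: anB => //; exact: anC.
    by apply: evtW Vb => s _; rewrite ler_norml; lra.
  rewrite -subr_ge0; apply: (@an_le0 (fun e => 1 - V e)); first by apply: anB => //; exact: anC.
  by apply: evtW Vb => s _; rewrite ler_norml; lra.
have hD : an 1 z0 (fun e => e 0%N ^+ (b - a) * W e * (e 0%N ^+ (b - a) * W e) - U e * U e).
  by apply: anB; apply: anM => //; apply: anM.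
have := an_le0 hD; rewrite expr0n subn_eq0 leqNgt ab /= !mul0r sub0r oppr_ge0 => h.
have : U z0 * U z0 <= 0.
  apply: h; apply: evtW (evtI hle (evtI fE gE)) => s s0 [h [h1 h2]]; move: h.
  have sa0 : 0 < s ^+ a by rewrite exprn_gt0.
  rewrite h1 h2 -sqr_le_norm -[in X in _ <= X](subnK (ltnW ab)) exprD.
  set x := s ^+ (b - a); set y := s ^+ a => h; rewrite subr_ge0.
  rewrite -(ler_pM2l (mulr_gt0 sa0 sa0)); move: h; congr (_ <= _); rewrite /y; ring.
by rewrite -expr2 le_eqVlt ltNge sqr_ge0 orbF sqrf_eq0 (negbTE U0).
Qed.

Definition arc m (a : env) (x : nat -> R -> R) := forall i, (i < m)%N -> exists X,
  [/\ an 1 z0 X, X z0 = a i & evt (fun s => x i s = X (fun=> s))].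

Lemma arc_an m a f x : an m a f -> arc m a x -> exists F,
  [/\ an 1 z0 F, F z0 = f a & evt (fun s => f (x ^~ s) = F (fun=> s))].
Proof.
move=> hf hx.
have /choice[X HX] : forall i, exists X, (i < m)%N -> [/\ an 1 z0 X, X z0 = a i & evt (fun s => x i s = X (fun=> s))].
  move=> i; case: (ltnP i m) => im; last by exists z0.
  by have [X hX] := hx i im; exists X.
have hX i : (i < m)%N -> an 1 z0 (X i) by move=> /HX[].
have X0 i : (i < m)%N -> X i z0 = a i by move=> /HX[].
have [d d0 Hd] := an_supp hf.
have faE : f (X ^~ z0) = f a.
  by apply/esym/Hd => i im; rewrite ?subrr ?normr0 ?ltW // X0.
exists (fun e => f (fun i => X i e)); split=> //; first exact: (an_comp hf hX).
have h1 : evt (fun s => forall i, (i < m)%N -> x i s = X i (fun=> s)).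
  by apply: evt_all => i im; have [] := HX i im.
have h2 : evt (fun s => forall i, (i < m)%N -> `|X i (fun=> s) - a i| <= d).
  by apply: evt_all => i im; apply: (nearm_evt (P := fun e => `|X i e - a i| <= d)); rewrite -X0 //; apply: an_cont => //; exact: hX.
by apply: evtW (evtI h1 h2) => s _ [q1 q2]; apply/esym/Hd => // i im; rewrite q1.
Qed.

(** The source of o-minimality. In the case [qf_ext] the arc extended by the restricted quotients is
    again analytic by [an_rdiv], with limit in the cube where the hypothesis on S is available. *)
Lemma qf_tame m a P : qf m a P -> forall x, arc m a x -> evt (fun s => P (x ^~ s)) \/ evt (fun s => ~ P (x ^~ s)).
Proof.
elim=> {m a P} [m a f hf|m a P _ IH|m a P Q _ IH _ IH'|m a P Q [d d0 PQ] _ IH|m a s f g S hf hg _ IH] x hx.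
- have [F [/an_tri hF _ FE]] := arc_an hf hx.
  case: hF => h; [right|left|right]; apply: evtW (evtI FE h) => r _ [-> q] //.
    by rewrite q ltxx.
  by apply/negP; rewrite -leNgt ltW.
- by have [h|h] := IH x hx; [right|left] => //; apply: evtW h => r _ h1 h2.
- have [h|h] := IH x hx; last by right; apply: evtW h => r _ h1 [].
  have [h'|h'] := IH' x hx; last by right; apply: evtW h' => r _ h1 [].
  by left; apply: evtI.
- have hd : evt (fun s => forall i, (i < m)%N -> `|x i s - a i| <= d).
    apply: evt_all => i im; have [X [hX X0 XE]] := hx i im.
    have h := nearm_evt (an_cont hX d0); apply: evtW (evtI XE h) => r _ [-> q]; by rewrite -X0.
  by have [h|h] := IH x hx; [left|right]; apply: evtW (evtI hd h) => r _ [/PQ q1 q2]; rewrite -q1.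
have hV i : exists V, (i < s)%N -> [/\ an 1 z0 V, -1 <= V z0 <= 1 & evt (fun r => rdiv (f i (x ^~ r)) (g i (x ^~ r)) = V (fun=> r))].
  case: (ltnP i s) => im; last by exists z0.
  have [F [hF _ FE]] := arc_an (hf i im) hx; have [G [hG _ GE]] := arc_an (hg i im) hx.
  have [V [h1 h2 h3]] := an_rdiv hF hG; exists V; split=> //.
  by apply: evtW (evtI FE (evtI GE h3)) => r _ [-> [-> ->]].
have /choice[V HV] := hV.
apply: (IH (fun i => V i z0) _ (fun q r => cat m (x ^~ r) (fun i => rdiv (f i (x ^~ r)) (g i (x ^~ r))) q)).
  by move=> i im; have [] := HV i im.
move=> q qm; rewrite /cat; case: ltnP => mq; first exact: hx.
have im : (q - m < s)%N by rewrite ltn_subLR // addnC.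
by have [h1 h2 h3] := HV _ im; exists (V (q - m)%N).
Qed.

End Arcs.

(** * Definable sets and functions *)

Section Definable.
Context {R : realType}.
Local Notation env := (nat -> R).

Definition tl (e : env) : env := fun i => e i.+1.
Definition cons (v : R) (e : env) : env := fun i => if i is j.+1 then e j else v.
Definition drop n (e : env) : env := fun i => e (i + n)%N.

Lemma consE (e : env) : cons (e 0%N) (tl e) = e.
Proof. by apply/funext; case. Qed.

Definition suppf m (f : env -> R) := forall e e', (forall i, (i < m)%N -> e i = e' i) -> f e = f e'.

(* A point of the definable world is a sequence; a bound variable becomes the new entry of index 0. *)
Definition Def (P : env -> Prop) := exists m, suppd m P /\ forall a, sub m a P.

Definition An (f : env -> R) := exists m, suppf m f /\ forall a, an m a f.

(** Local boundedness is required besides a definable graph because only bounded quantifiers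
    preserve definability: it is what allows the value of an inner function to be quantified over in
    [Def_app]. *)
Definition DFun (f : env -> R) :=
  (exists m, suppf m f /\ forall a, exists B : R, nearm m a (fun e => `|f e| <= B)) /\
  Def (fun e => e 0%N = f (tl e)).

Lemma suppd_widen m m' (P : env -> Prop) : (m <= m')%N -> suppd m P -> suppd m' P.
Proof. by move=> mm' h e e' ee'; apply: h => i im; apply: ee'; apply: leq_trans im mm'. Qed.

Lemma sub_widen m m' (P : env -> Prop) : (m <= m')%N -> suppd m P -> (forall a, sub m a P) -> forall a, sub m' a P.
Proof.
move=> mm' sP hP a; apply: (sub_comp (h := fun i e => e i) (hP a)) => // i.
  by move=> im; apply: an_var; apply: leq_trans im mm'.
by move=> e e' im; apply; apply: leq_trans im mm'.
Qed.

Lemma Def_iff (P Q : env -> Prop) : (forall e, P e <-> Q e) -> Def P -> Def Q.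
Proof.
move=> PQ [m [sP hP]]; exists m; split=> [e e' ee' /PQ h|a].
  by apply/PQ; apply: sP h.
exact: sub_iff (hP a).
Qed.

Lemma Def_not (P : env -> Prop) : Def P -> Def (fun e => ~ P e).
Proof.
move=> [m [sP hP]]; exists m; split=> [e e' ee' h h'|a]; last exact: sub_not.
by apply: h; apply: sP h' => i im; rewrite ee'.
Qed.

Lemma Def_and (P Q : env -> Prop) : Def P -> Def Q -> Def (fun e => P e /\ Q e).
Proof.
move=> [m [sP hP]] [m' [sQ hQ]]; exists (m + m')%N; split=> [e e' ee' [h h']|a].
  split; first by apply: sP h => i im; apply: ee'; rewrite ltn_addr.
  by apply: sQ h' => i im; apply: ee'; rewrite ltn_addl.
apply: sub_and; first by apply: sub_widen sP hP a; exact: leq_addr.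
by apply: sub_widen sQ hQ a; exact: leq_addl.
Qed.

Lemma Def_const (B : Prop) : Def (fun=> B).
Proof. by exists 0%N; split=> // a; exact: sub_const. Qed.

Lemma Def_bc : boolclass Def.
Proof. split; [exact: Def_iff | exact: Def_not | exact: Def_and | exact: Def_const]. Qed.

Definition Def_or := bc_or Def_bc.
Definition Def_imp := bc_imp Def_bc.
Definition Def_eqv := bc_eqv Def_bc.
Definition Def_alln := bc_allnat Def_bc.
Definition Def_somen := bc_exnat Def_bc.

Lemma An_DFun f : An f -> DFun f.
Proof.
move=> [m [sf hf]]; split.
  exists m; split=> // a; exists (`|f a| + 1).
  apply: nearmW (an_cont (hf a) ltr01) => e h.
  have -> : f e = f a + (f e - f a) by ring.
  by apply: le_trans (ler_normD _ _) _; rewrite lerD2l.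
exists m.+1; split=> [e e' ee' h|a].
  by rewrite -ee' // h; apply: sf => i im; apply: ee'.
apply: sub_sa; apply: sa_eq; first exact: an_var.
apply: (an_comp (h := fun i e => tl e i) (hf (tl a))) => // i im; exact: an_var.
Qed.

(** Near each point the condition says that some y in a cube satisfies P and has the values h i e as
    coordinates; the side of the cube is a local bound for the finitely many h i on which P
    depends. *)
Lemma Def_app P (h : nat -> env -> R) : Def P -> (forall i, DFun (h i)) -> Def (fun e => P (fun i => h i e)).
Proof.
move=> [m [sP hP]] hh.
have [M [sM [bM gM]]] : exists M, (forall i, (i < m)%N -> suppf M (h i)) /\
   (forall i, (i < m)%N -> forall a, exists B : R, nearm M a (fun e => `|h i e| <= B)) /\
   (forall i, (i < m)%N -> suppd M.+1 (fun e => e 0%N = h i (tl e)) /\ forall a, sub M.+1 a (fun e => e 0%N = h i (tl e))).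
  elim: m {sP hP} => [|m [M [s1 [b1 g1]]]]; first by exists 0%N.
  have [[M1 [s2 b2]] [M2 [s3 g2]]] := hh m.
  have le0 : (M <= M + (M1 + M2))%N by rewrite leq_addr.
  have le1 : (M1 <= M + (M1 + M2))%N by rewrite addnCA leq_addr.
  have le2 : (M2 <= (M + (M1 + M2)).+1)%N by rewrite addnA leqW // leq_addl.
  have sw k f : (k <= M + (M1 + M2))%N -> suppf k f -> suppf (M + (M1 + M2)) f.
    by move=> le sf e e' ee'; apply: sf => j jk; apply: ee'; apply: leq_trans jk le.
  exists (M + (M1 + M2))%N; split; last split.
  - move=> i; rewrite ltnS leq_eqVlt => /orP[/eqP ->|im]; first exact: sw s2.
    exact: sw (s1 i im).
  - move=> i; rewrite ltnS leq_eqVlt => /orP[/eqP ->|im] a.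
      by have [B hB] := b2 a; exists B; apply: nearm_widen hB.
    by have [B hB] := b1 i im a; exists B; apply: nearm_widen hB.
  - move=> i; rewrite ltnS leq_eqVlt => /orP[/eqP ->|im].
      by split; [apply: suppd_widen s3 | apply: sub_widen s3 g2].
    have [s4 g4] := g1 i im; split; first by apply: suppd_widen s4.
    by apply: sub_widen s4 g4.
exists M; split=> [e e' ee'|a].
  by apply: sP => i im; apply: sM.
have [B HB] : exists B : R, nearm M a (fun e => forall i, (i < m)%N -> `|h i e| <= B).
  elim: m {sP hP sM gM} bM => [|m IH] bM; first by exists 0; apply: nearmT.
  have [B HB] := IH (fun i im => bM i (ltnW im)); have [B' HB'] := bM m (ltnSn m) a.
  exists (Num.max B B'); apply: nearmW (nearmI HB HB') => e [h1 h2] i.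
  rewrite ltnS leq_eqVlt le_max => /orP[/eqP ->|im]; first by rewrite h2 orbT.
  by rewrite h1.
have hQ b : sub (m + M) (cat M a b) (fun E => P (fun i => E (i + M)%N) /\ forall i, (i < m)%N -> E (i + M)%N = h i E).
  apply: sub_and.
    apply: (sub_comp (h := fun i E => E (i + M)%N) (hP b)) => i.
    + by move=> im; apply: an_var; rewrite ltn_add2r.
    + by move=> im; rewrite cat_shift.
    + by move=> e e' im; apply; rewrite ltn_add2r.
  apply: (bc_allnat (sub_bc _ _) (P := fun i (E : env) => E (i + M)%N = h i E)) => i im.
  have [_ g] := gM i im.
  apply: (sub_comp (h := fun q E => if q is j.+1 then E j else E (i + M)%N) (g (cons (b i) (cat M a b)))) => -[|q] //.
  + by move=> _; apply: an_var; rewrite ltn_add2r.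
  + by rewrite ltnS => qM; apply: an_var; apply: leq_trans qM _; rewrite leq_addl.
  + by rewrite cat_shift.
  + by move=> e e' _; apply; rewrite ltn_add2r.
  + by move=> e e'; rewrite ltnS => qM; apply; apply: leq_trans qM _; rewrite leq_addl.
have hcat e y i : (i < m)%N -> h i (cat M e y) = h i e.
  by move=> im; apply: sM => // j jM; rewrite /cat jM.
apply: sub_near (sub_exbox (l := fun=> - B) (u := fun=> B) (fun b _ => hQ b)).
apply: nearmW HB => e hB; split=> [[y hy [h1 h2]]|Ph].
  apply: sP h1 => i im; rewrite h2 // hcat //.
exists (fun i => h i e) => [i im|]; first by rewrite -ler_norml hB.
split=> [|i im]; last by rewrite cat_shift hcat.
by apply: sP Ph => i im; rewrite cat_shift.
Qed.

Lemma An_var i : An (fun e => e i).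
Proof. by exists i.+1; split=> [e e' -> //|a]; exact: an_var. Qed.

Lemma Def_pull P (k : nat -> nat) : Def P -> Def (fun e => P (fun i => e (k i))).
Proof. by move=> hP; apply: (Def_app (h := fun i e => e (k i)) hP) => i; apply/An_DFun/An_var. Qed.

Lemma Def_exn n (Q : env -> env -> Prop) (l u : R) :
  (forall y y' e, (forall i, (i < n)%N -> y i = y' i) -> Q y e -> Q y' e) ->
  Def (fun e => Q e (drop n e)) ->
  Def (fun e => exists2 y, (forall i, (i < n)%N -> l <= y i <= u) & Q y e).
Proof.
move=> sQ [m0 [s0 h0]]; pose m := m0; pose Bd e := Q e (drop n e).
have [sB hB] : suppd (n + m) Bd /\ forall a, sub (n + m) a Bd.
  have le : (m0 <= n + m)%N by rewrite leq_addl.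
  by split; [apply: suppd_widen s0 | apply: sub_widen s0 h0].
have key (e y : env) : Q y e <-> Bd (fun q => if (q < n)%N then y q else e (q - n)%N).
  rewrite /Bd; have -> : drop n (fun q => if (q < n)%N then y q else e (q - n)%N) = e.
    by apply/funext => i; rewrite /drop ltnNge leq_addl addnK.
  by split; apply: sQ => i ->.
exists m; split=> [e e' ee' [y hy h]|a].
  exists y => //; apply/key; move/key: h; apply: sB => q qm; case: ltnP => // nq.
  by apply: ee'; rewrite ltn_subLR.
pose f q (E : env) := if (q < n)%N then E (q + m)%N else E (q - n)%N.
have hf b : sub (n + m) (cat m a b) (fun E => Bd (fun q => f q E)).
  apply: (sub_comp (hB (fun q => f q (cat m a b)))) => // [q qm|q e e' qm ee'].
    rewrite /f; case: ltnP => nq; apply: an_var; first by rewrite ltn_add2r.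
    by rewrite (leq_trans _ (leq_addl _ _)) // ltn_subLR.
  rewrite /f; case: ltnP => nq; apply: ee'; first by rewrite ltn_add2r.
  by rewrite (leq_trans _ (leq_addl _ _)) // ltn_subLR.
apply: sub_iff (sub_exbox (l := fun=> l) (u := fun=> u) (fun b _ => hf b)) => e.
suff E y : Bd (fun q => f q (cat m e y)) <-> Q y e.
  by split=> -[y hy h]; exists y => //; apply/E.
rewrite key; change (Bd (fun q => f q (cat m e y)) <-> Bd (fun q => if (q < n)%N then y q else e (q - n)%N)).
by split; apply: sB => q qm; rewrite /f; case: ltnP => nq; rewrite ?cat_shift // /cat ltn_subLR // qm.
Qed.

Lemma Def_ex (Q : R -> env -> Prop) (l u : R) : Def (fun e => Q (e 0%N) (tl e)) ->
  Def (fun e => exists2 v, l <= v <= u & Q v e).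
Proof.
move=> hQ; have := @Def_exn 1 (fun y e => Q (y 0%N) e) l u.
have -> : (fun e => Q (e 0%N) (drop 1 e)) = (fun e => Q (e 0%N) (tl e)).
  by apply/funext => e; congr (Q _ _); apply/funext => i; rewrite /drop addn1.
move=> /(_ _ hQ) h; apply: Def_iff (h _) => [e|y y' e <- //].
by split=> [[y hy q]|[v hv q]]; [exists (y 0%N) => //; exact: hy | exists (fun=> v) => // -[]].
Qed.

Lemma Def_all (Q : R -> env -> Prop) (l u : R) : Def (fun e => Q (e 0%N) (tl e)) ->
  Def (fun e => forall v, l <= v <= u -> Q v e).
Proof.
move=> hQ; apply: Def_iff (Def_not (Def_ex (Q := fun v e => ~ Q v e) l u (Def_not hQ))) => e.
split=> [h v hv|h [v hv q]]; last exact/q/h.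
by apply: contrapT => q; apply: h; exists v.
Qed.

Lemma DFun_bnd (f : env -> R) m (B : R) : DFun f -> exists B', forall e, (forall i, (i < m)%N -> `|e i| <= B) ->
  (forall i, (m <= i)%N -> e i = 0) -> `|f e| <= B'.
Proof.
move=> [[k [sf bf]] _].
have [b _|S [HS CS]] := @box_cover R k (fun=> - `|B|) (fun=> `|B|) (fun b d => exists B' : R, forall e, (forall i, (i < k)%N -> `|e i - b i| <= d) -> `|f e| <= B').
  by have [B' [d d0 Hd]] := bf b; exists d => //; exists B'.
have [B' HB'] : exists B' : R, forall p, List.In p S -> forall e, (forall i, (i < k)%N -> `|e i - p.1 i| <= p.2) -> `|f e| <= B'.
  elim: S {CS} HS => [|q S IH] HS; first by exists 0.
  have [|B1 H1] := IH; first by move=> p ps; apply: HS; right.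
  have [_ _ [B2 H2]] := HS q (or_introl erefl).
  exists (Num.max B1 B2) => p [<-|pS] e he; rewrite le_max; first by rewrite (H2 e he) orbT.
  by rewrite (H1 p pS e he).
exists B' => e h1 h2; have [i ik|p pS Hp] := CS e; last exact: HB' pS _ Hp.
rewrite -ler_norml; case: (ltnP i m) => im; first exact: le_trans (h1 i im) (ler_norm _).
by rewrite h2 // normr0.
Qed.

Lemma DFun_tl f : DFun f -> DFun (fun e => f (tl e)).
Proof.
move=> [[m [sf bf]] hf]; split.
  exists m.+1; split=> [e e' ee'|a]; first by apply: sf => i im; apply: ee'.
  have [B [d d0 HB]] := bf (tl a); exists B; exists d => // e he; apply: HB => i im; exact: he.
exact: (@Def_pull _ (fun i => if i is j.+1 then j.+2 else 0%N) hf).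
Qed.

Lemma DFun_comp f (h : nat -> env -> R) : DFun f -> (forall i, DFun (h i)) -> DFun (fun e => f (fun i => h i e)).
Proof.
move=> hf hh; have [[m [sf bf]] gf] := hf; split.
  have [M [sM bM]] : exists M, (forall i, (i < m)%N -> suppf M (h i)) /\
     (forall a, exists B : R, nearm M a (fun e => forall i, (i < m)%N -> `|h i e| <= B)).
    elim: m {sf bf} => [|m [M [s1 b1]]]; first by exists 0%N; split=> // a; exists 0; apply: nearmT.
    have [[M1 [s2 b2]] _] := hh m; exists (M + M1)%N; split.
      move=> i; rewrite ltnS leq_eqVlt => /orP[/eqP ->|im] e e' ee'.
        by apply: s2 => j jM; apply: ee'; rewrite ltn_addl.
      by apply: (s1 i im) => j jM; apply: ee'; rewrite ltn_addr.
    move=> a; have [B HB] := b1 a; have [B' HB'] := b2 a.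
    have HB1 := nearm_widen (leq_addr M1 M) HB; have HB2 := nearm_widen (leq_addl M M1) HB'.
    exists (Num.max B B'); apply: nearmW (nearmI HB1 HB2) => e [h1 h2] i.
    by rewrite ltnS leq_eqVlt le_max => /orP[/eqP ->|im]; rewrite ?h2 ?orbT // h1.
  exists M; split=> [e e' ee'|a]; first by apply: sf => i im; apply: sM.
  have [B HB] := bM a; have [B' HB'] := DFun_bnd m B hf; exists B'.
  apply: nearmW HB => e he.
  rewrite (sf _ (fun i => if (i < m)%N then h i e else 0)); last by move=> i ->.
  by apply: HB' => i im; [rewrite im he | rewrite ltnNge im].
apply: (Def_app (P := fun e => e 0%N = f (tl e)) (h := fun i e => if i is j.+1 then h j (tl e) else e 0%N) gf).
by case=> [|j]; [apply/An_DFun/An_var | apply/DFun_tl].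
Qed.

Lemma DFun_var i : DFun (fun e => e i). Proof. exact/An_DFun/An_var. Qed.

Lemma DFun_const x : DFun (fun=> x).
Proof. by apply: An_DFun; exists 0%N; split=> // a; exact: anC. Qed.

Lemma DFun_add f g : DFun f -> DFun g -> DFun (fun e => f e + g e).
Proof.
move=> hf hg; apply: (DFun_comp (f := fun e => e 0%N + e 1%N) (h := fun i e => if i is _.+1 then g e else f e)); last by case.
apply: An_DFun; exists 2%N; split=> [e e' ee'|a]; first by rewrite !ee'.
by apply: anD; apply: an_var.
Qed.

Lemma DFun_mul f g : DFun f -> DFun g -> DFun (fun e => f e * g e).
Proof.
move=> hf hg; apply: (DFun_comp (f := fun e => e 0%N * e 1%N) (h := fun i e => if i is _.+1 then g e else f e)); last by case.
apply: An_DFun; exists 2%N; split=> [e e' ee'|a]; first by rewrite !ee'.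
by apply: anM; apply: an_var.
Qed.

Lemma DFun_opp f : DFun f -> DFun (fun e => - f e).
Proof. by move=> hf; under eq_fun do rewrite -mulN1r; apply: DFun_mul => //; exact: DFun_const. Qed.

Lemma DFun_sub f g : DFun f -> DFun g -> DFun (fun e => f e - g e).
Proof. by move=> hf hg; apply: DFun_add => //; exact: DFun_opp. Qed.

Lemma DFun_sum n (f : nat -> env -> R) : (forall i, DFun (f i)) -> DFun (fun e => \sum_(i < n) f i e).
Proof.
move=> hf; elim: n => [|n IH].
  by have -> : (fun e => \sum_(i < 0) f i e) = (fun=> 0); [apply/funext => e; rewrite big_ord0 | exact: DFun_const].
have -> : (fun e => \sum_(i < n.+1) f i e) = (fun e => \sum_(i < n) f i e + f n e).
  by apply/funext => e; rewrite big_ord_recr.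
exact: DFun_add.
Qed.

Lemma Def_lt f g : DFun f -> DFun g -> Def (fun e => f e < g e).
Proof.
move=> hf hg; apply: (Def_app (P := fun e => is_true (e 0%N < e 1%N)) (h := fun i e => if i is _.+1 then g e else f e)); last by case.
exists 2%N; split=> [e e' ee'|a]; first by rewrite !ee'.
by apply: sub_sa; apply: sa_lt; apply: an_var.
Qed.

Lemma Def_le f g : DFun f -> DFun g -> Def (fun e => f e <= g e).
Proof. by move=> hf hg; apply: Def_iff (Def_not (Def_lt hg hf)) => e; rewrite leNgt; split=> /negP. Qed.

Lemma Def_eq f g : DFun f -> DFun g -> Def (fun e => f e = g e).
Proof.
move=> hf hg; apply: Def_iff (Def_and (Def_le hf hg) (Def_le hg hf)) => e.
by split=> [[h1 h2]|->//]; apply/le_anti; rewrite h1.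
Qed.

Lemma DFun_pull f (k : nat -> nat) : DFun f -> DFun (fun e => f (fun i => e (k i))).
Proof. by move=> hf; apply: (DFun_comp hf) => i; exact: DFun_var. Qed.

Lemma DFun_cons g f : DFun g -> DFun f -> DFun (fun e => g (cons (f e) e)).
Proof.
move=> hg hf; apply: (DFun_comp (h := fun i e => cons (f e) e i) hg) => -[|i] //; exact: DFun_var.
Qed.

Lemma Def_tame P (x : nat -> R -> R) : Def P ->
  (forall i, exists X, an 1 (fun=> 0 : R) X /\ evt (fun s => x i s = X (fun=> s))) ->
  evt (fun s => P (x ^~ s)) \/ evt (fun s => ~ P (x ^~ s)).
Proof.
move=> [m [_ hP]] /choice[X HX].
apply: (qf_tame (sub_qf (hP (fun i => X i (fun=> 0))))) => i _.
by have [h1 h2] := HX i; exists (X i).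
Qed.

Lemma tame_line P (e : env) (a sg : R) : Def P ->
  evt (fun s => P (cons (a + sg * s) e)) \/ evt (fun s => ~ P (cons (a + sg * s) e)).
Proof.
move=> hP; apply: (Def_tame (x := fun i s => cons (a + sg * s) e i) hP) => -[|i].
  exists (fun e => a + sg * e 0%N); split; last exact: evtT.
  by apply: anD; [exact: anC | apply: anM; [exact: anC | exact: an_var]].
by exists (fun=> e i); split; [exact: anC | exact: evtT].
Qed.

End Definable.

(** Syntax-directed proofs of definability: [dfn] treats terms whose variables are entries of the
    sequence, [dfp] formulas with bounded quantifiers. Unrecognised atoms are left as goals. *)
Ltac dfn := first [ assumption | apply: DFun_const | exact (DFun_var 0) | exact (DFun_var 1) | exact (DFun_var 2)
  | exact (DFun_var 3) | exact (DFun_var 4) | exact (DFun_var 5) | exact (DFun_var 6)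
  | apply: DFun_opp; dfn | apply: DFun_add; dfn | apply: DFun_mul; dfn | idtac ].
Ltac dfp := cbv beta; lazymatch goal with
  | |- Def (fun e => ~ _) => apply: Def_not; dfp
  | |- Def (fun e => _ /\ _) => apply: Def_and; dfp
  | |- Def (fun e => _ \/ _) => apply: Def_or; dfp
  | |- Def (fun e => ex2 _ _) => apply: Def_ex; dfp
  | |- Def (fun e => @?P e -> @?Q e) => apply: Def_imp; dfp
  | |- Def (fun e => forall v, _) => apply: Def_all; dfp
  | |- Def (fun e => is_true (_ < _)) => apply: Def_lt; dfn
  | |- Def (fun e => is_true (_ <= _)) => apply: Def_le; dfn
  | |- Def (fun e => _ = _) => apply: Def_eq; dfn
  | |- _ => try assumption
  end.

(** * Definable functions of one variable *)

Section OneVariable.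
Context {R : realType}.
Local Notation env := (nat -> R).
Local Notation Def1 A := (Def (fun e : env => A (e 0%N) (tl e))).

Lemma Def_at (A : R -> env -> Prop) t n : Def1 A -> DFun t -> Def (fun e => A (t e) (fun q => e (n + q)%N)).
Proof.
move=> hA ht; apply: (Def_app (h := fun i e => if i is j.+1 then e (n + j)%N else t e) hA) => -[|j]; first exact: ht.
exact: DFun_var.
Qed.

Lemma DFun_at f (t : env -> R) n : DFun f -> DFun t -> DFun (fun e => f (cons (t e) (fun q => e (n + q)%N))).
Proof.
move=> hf ht; apply: (DFun_comp (h := fun i e => if i is j.+1 then e (n + j)%N else t e) hf) => -[|j]; first exact: ht.
exact: DFun_var.
Qed.

Lemma add_sub (x y : R) : x + (y - x) = y.
Proof. by rewrite addrC subrK. Qed.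

Lemma norm1 (sg : R) : `|sg| = 1 -> sg = 1 \/ sg = -1.
Proof. by case: (ltP sg 0) => h; [rewrite ltr0_norm|rewrite ger0_norm] => // h'; [right|left]; lra. Qed.

Lemma tri_line (f g : env -> R) e a sg : DFun f -> DFun g ->
  [\/ evt (fun s => f (cons (a + sg * s) e) < g (cons (a + sg * s) e)),
      evt (fun s => f (cons (a + sg * s) e) = g (cons (a + sg * s) e)) |
      evt (fun s => g (cons (a + sg * s) e) < f (cons (a + sg * s) e))].
Proof.
move=> hf hg; have [h|h] := tame_line e a sg (Def_lt hf hg); first exact: Or31.
have [h'|h'] := tame_line e a sg (Def_lt hg hf); first exact: Or33.
apply: Or32; apply: evtW (evtI h h') => s _ [/negP q1 /negP q2].
by apply/le_anti; rewrite leNgt q2 leNgt q1.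
Qed.

(** The limit is the supremum of the numbers that are eventually below f; by tameness any larger
    number is eventually above f. *)
Lemma limit_line (f : env -> R) e a sg : DFun f ->
  exists L : R, forall eps : R, 0 < eps -> evt (fun s => `|f (cons (a + sg * s) e) - L| <= eps).
Proof.
move=> hf; have [[m [sf bf]] _] := hf.
have [B [d d0 HB]] := bf (cons a e).
have bd : evt (fun s => `|f (cons (a + sg * s) e)| <= B).
  have d1 : 0 < d / (1 + `|sg|) by rewrite divr_gt0 // ltr_pwDl.
  exists (d / (1 + `|sg|)) => // s s0; rewrite ltr_pdivlMr ?ltr_pwDl // => sd.
  apply: HB => -[|i] _ /=; last by rewrite subrr normr0 ltW.
  rewrite addrAC subrr add0r normrM (gtr0_norm s0); have := normr_ge0 sg; nra.
pose S := [set c | evt (fun s => c <= f (cons (a + sg * s) e))].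
have hS : has_sup S.
  split; first by exists (- B); apply: evtW bd => s _; rewrite ler_norml => /andP[].
  exists B => c hc; have [s _ [h1 h2]] := evt_ex (evtI hc bd).
  by apply: le_trans h1 (le_trans (ler_norm _) h2).
exists (sup S) => eps eps0.
have [c hc lc] := sup_adherent eps0 hS.
have h2 : evt (fun s => f (cons (a + sg * s) e) < sup S + eps).
  have [h|h] := tame_line e a sg (Def_le (DFun_const (sup S + eps)) hf).
    by have := @sup_ubound _ S hS.2 _ h; lra.
  by apply: evtW h => s _ /negP; rewrite -ltNge.
apply: evtW (evtI hc h2) => s _ [q1 q2]; rewrite ler_norml; lra.
Qed.

Definition cont (f : R -> R) x := forall eps : R, 0 < eps -> exists2 d : R, 0 < d & forall y, `|y - x| <= d -> `|f y - f x| <= eps.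

(** A right limit at the midpoint of an interval yields a smaller interval, to the right of that
    midpoint, on which f oscillates little. Nesting such intervals strictly inside one another
    produces a point of continuity. *)
Lemma baire_point (f : R -> R) (p q : R) : p < q ->
  (forall a, exists L : R, forall eps : R, 0 < eps -> evt (fun s => `|f (a + s) - L| <= eps)) ->
  exists2 x, p < x < q & cont f x.
Proof.
move=> pq H.
pose good n (v : R * R) := forall y y', v.1 <= y <= v.2 -> v.1 <= y' <= v.2 -> `|f y - f y'| <= 2 / n.+1%:R.
have step (nu : nat * (R * R)) : exists v : R * R, nu.2.1 < nu.2.2 -> [/\ nu.2.1 < v.1, v.1 < v.2, v.2 < nu.2.2 & good nu.1 v].
  case: nu => n [a b] /=; have [ab|] := ltP a b; last by exists (0, 0).
  have n0 : 0 < (n.+1%:R : R)^-1 by rewrite invr_gt0 ltr0n.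
  have [L /(_ _ n0)[d d0 Hd]] := H ((a + b) / 2).
  pose d' := Num.min d ((b - a) / 2).
  have d'0 : 0 < d' by rewrite lt_min d0; lra.
  have d'd : d' <= d by rewrite ge_min lexx.
  have d'b : d' <= (b - a) / 2 by rewrite ge_min lexx orbT.
  exists ((a + b) / 2 + d' / 3, (a + b) / 2 + d' * 2 / 3) => _ /=; split; [lra|lra|lra|].
  have h z : (a + b) / 2 + d' / 3 <= z <= (a + b) / 2 + d' * 2 / 3 -> `|f z - L| <= (n.+1%:R)^-1.
    by move=> hz; have := Hd (z - (a + b) / 2); rewrite add_sub; apply; lra.
  move=> y y' /h h1 /h; rewrite distrC => h2; have -> : f y - f y' = (f y - L) + (L - f y') by ring.
  by apply: le_trans (ler_normD _ _) _; move: h1 h2; set z := _^-1; lra.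
have [st Hst] := choice step.
pose u := fix u n := if n is n'.+1 then st (n', u n') else (p, q).
have hu n : (u n).1 < (u n).2 by elim: n => [//|n IH]; have [] := Hst (n, u n) IH.
have hs n : [/\ (u n).1 < (u n.+1).1, (u n.+1).2 < (u n).2 & good n (u n.+1)].
  by have [] := Hst (n, u n) (hu n).
have mono (n k : nat) : (u n).1 <= (u (n + k)%N).1 /\ (u (n + k)%N).2 <= (u n).2.
  elim: k => [|k [h1 h2]]; first by rewrite addn0 !lexx.
  by rewrite addnS; have [h3 h4 _] := hs (n + k)%N; split; [apply: le_trans h1 (ltW h3) | apply: le_trans (ltW h4) h2].
have cross (n k : nat) : (u n).1 < (u k).2.
  case: (leqP n k) => nk.
    by have [h _] := mono n (k - n)%N; rewrite subnKC // in h; exact: le_lt_trans h (hu k).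
  by have [_ h] := mono k (n - k)%N; rewrite (subnKC (ltnW nk)) in h; exact: lt_le_trans (hu n) h.
pose S := [set (u n).1 | n in [set: nat]].
have hS : has_sup S by split; [exists (u 0%N).1, 0%N | exists q => _ [n _ <-]; apply/ltW/(cross n 0%N)].
pose x := sup S.
have x1 n : (u n).1 < x.
  by have [h _ _] := hs n; apply: lt_le_trans h _; apply: sup_ubound; [exact: hS.2 | exists n.+1].
have x2 n : x < (u n).2.
  have [_ h _] := hs n; apply: le_lt_trans h; apply: sup_le_ub; first exact: hS.1.
  by move=> _ [k _ <-]; apply/ltW/cross.
exists x; first by rewrite (x1 0%N) (x2 0%N).
move=> eps eps0; have [n Hn] : exists n : nat, 2 / n.+1%:R <= eps.
  exists (Num.bound (2 / eps)); rewrite ler_pdivrMr ?ltr0n // -ler_pdivrMl // mulrC.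
  have h : 2 / eps < (Num.bound (2 / eps))%:R by apply: archi_boundP; apply: divr_ge0 => //; exact: ltW.
  by apply: le_trans (ltW h) _; rewrite ler_nat.
exists (Num.min (x - (u n.+1).1) ((u n.+1).2 - x)); first by rewrite lt_min !subr_gt0 x1 x2.
move=> y; rewrite le_min !ler_norml => /andP[/andP[h1 _] /andP[_ h2]].
have [_ _ g] := hs n; rewrite -ler_norml; apply: (@le_trans _ _ (2 / n.+1%:R)) => //; apply: g; first by lra.
by apply/andP; split; apply/ltW.
Qed.

(** Continuity with all quantifiers bounded, hence definable in x and the parameters. *)
Definition contF (f : env -> R) (x : R) (e : env) := forall eps : R, 0 <= eps <= 1 -> 0 < eps -> exists2 d : R, 0 <= d <= 1 &
  0 < d /\ forall w : R, -1 <= w <= 1 -> - d <= w -> w <= d ->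
   f (cons (x + w) e) - f (cons x e) <= eps /\ - eps <= f (cons (x + w) e) - f (cons x e).

Lemma contFP f x e : contF f x e <-> cont (fun t => f (cons t e)) x.
Proof.
split=> h eps.
  move=> eps0; have [||d /andP[_ d1] [d0 Hd]] := h (Num.min eps 1).
  - by rewrite le_min ltW //= ler01 ge_min lexx orbT.
  - by rewrite lt_min eps0 ltr01.
  exists d => // y; rewrite ler_norml => hy.
  have [|||h1 h2] := Hd (y - x); [lra|lra|lra|]; rewrite add_sub in h1 h2.
  have e1 : Num.min eps 1 <= eps by rewrite ge_min lexx.
  by rewrite ler_norml; lra.
move=> _ eps0; have [d d0 Hd] := h eps eps0.
have d1 : 0 < Num.min d 1 by rewrite lt_min d0 ltr01.
exists (Num.min d 1); first by rewrite ltW //= ge_min lexx orbT.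
split=> // w _ w1 w2; have md : Num.min d 1 <= d by rewrite ge_min lexx.
have := Hd (x + w); rewrite addrAC subrr add0r !ler_norml => /(_ _)/andP[|-> ->] //; lra.
Qed.

Lemma Def_contF f : DFun f -> Def1 (contF f).
Proof.
move=> hf; rewrite /contF; dfp.
- by apply: (@DFun_at f _ 4 hf); dfn.
- by apply: (@DFun_at f (fun e => e 3%N) 4 hf); dfn.
- by apply: (@DFun_at f _ 4 hf); dfn.
- by apply: (@DFun_at f (fun e => e 3%N) 4 hf); dfn.
Qed.

(** By tameness the only alternative is discontinuity throughout an interval next to a, which
    [baire_point] excludes since one-sided limits exist. *)
Lemma cont_evt f e a sg : DFun f -> `|sg| = 1 -> evt (fun s => cont (fun t => f (cons t e)) (a + sg * s)).
Proof.
move=> hf sg1; have [h|[d d0 h]] := tame_line e a sg (Def_contF hf).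
  by apply: evtW h => s _ /= /contFP.
exfalso; have lim t : exists L : R, forall eps : R, 0 < eps -> evt (fun s => `|f (cons (t + s) e) - L| <= eps).
  have [L HL] := limit_line e t 1 hf; exists L => eps eps0.
  by apply: evtW (HL eps eps0) => s _; rewrite mul1r.
have [sE|sE] := norm1 sg1; rewrite {}sE in h.
  have [|x hx cx] := @baire_point (fun t => f (cons t e)) a (a + d) _ lim; first by lra.
  by apply: (h (x - a)); rewrite /= ?mul1r ?add_sub; [lra|lra|apply/contFP].
have [|x hx cx] := @baire_point (fun t => f (cons t e)) (a - d) a _ lim; first by lra.
by apply: (h (a - x)); rewrite /= ?mulN1r ?opprB ?add_sub; [lra|lra|apply/contFP].
Qed.

Lemma loc_const (P : R -> Prop) (p q : R) :
  (forall x, p < x < q -> exists2 d : R, 0 < d & forall y, `|y - x| <= d -> (P y <-> P x)) ->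
  forall x y, p < x < q -> p < y < q -> P x -> P y.
Proof.
move=> H.
have up x y : p < x < q -> p < y < q -> x <= y -> (P x <-> P y).
  move=> hx hy xy; apply: (@real_ind R (fun z => P x <-> P z) x y) => // [z xz zy Pz|z xz zy Pz].
    have [|d d0 Hd] := H z; first by lra.
    exists (z + d); first by lra.
    move=> w zw wd _; have hw : `|w - z| <= d by rewrite ler_norml; lra.
  exact: (iff_trans Pz (iff_sym (Hd w hw))).
  have [|d d0 Hd] := H z; first by lra.
  have m1 : Num.max x (z - d) < z by rewrite gt_max xz; lra.
  rewrite (Pz (Num.max x (z - d))) ?le_max ?lexx //.
  have m2 : z - d <= Num.max x (z - d) by rewrite le_max lexx orbT.
  by apply: Hd; rewrite ler_norml; lra.
move=> x y hx hy Px; have [xy|yx] := leP x y; first exact/(up x y).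
by apply/(up y x) => //; exact: ltW.
Qed.

Lemma right_mono (g : R -> R) (p q : R) : (forall x, p < x < q -> cont g x) ->
  (forall x, p < x < q -> exists2 d : R, 0 < d & forall w : R, 0 < w -> w <= d -> g x <= g (x + w)) ->
  forall x y, p < x -> x <= y -> y < q -> g x <= g y.
Proof.
move=> cg H x y px xy yq; apply: (@real_ind R (fun z => g x <= g z) x y) => // [z xz zy gz|z xz zy gz].
  have [|d d0 Hd] := H z; first by lra.
  exists (z + d); first by lra.
  move=> w zw wd _; apply: le_trans gz _.
  by have := Hd (w - z); rewrite add_sub; apply; lra.
rewrite leNgt; apply/negP => lt; have pz : p < z < q by lra.
have [|d d0 Hd] := cg z pz ((g x - g z) / 2); first by lra.
have m1 : Num.max x (z - d) < z by rewrite gt_max xz; lra.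
have m2 : z - d <= Num.max x (z - d) by rewrite le_max lexx orbT.
have := gz (Num.max x (z - d)); rewrite le_max lexx => /(_ isT m1).
have := Hd (Num.max x (z - d)); rewrite ler_norml => /(_ _); rewrite ler_norml => h.
by have /andP[] := h ltac:(lra); lra.
Qed.

(** In [rtype], where u is a value slightly to the right of x and v the value at x, the codes 0, 1,
    2 mean that f rises, stays or falls. *)
Definition cmp3 (k : nat) (u v : R) := match k with 0 => v < u : Prop | 1 => u = v | _ => u < v end.

Definition rtype f k (x : R) (e : env) := exists2 d : R, 0 <= d <= 1 & 0 < d /\ forall w : R, 0 <= w <= 1 -> 0 < w -> w <= d ->
  cmp3 k (f (cons (x + w) e)) (f (cons x e)).

Lemma Def_rtype f k : DFun f -> Def1 (rtype f k).
Proof.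
move=> hf; rewrite /rtype; dfp.
have h1 := @DFun_at f (fun e => e 2%N + e 0%N) 3 hf (DFun_add (DFun_var 2) (DFun_var 0)).
have h2 := @DFun_at f (fun e => e 2%N) 3 hf (DFun_var 2).
by case: k => [|[|k]]; [apply: Def_lt | apply: Def_eq | apply: Def_lt].
Qed.

Lemma rtypeP f k x e : rtype f k x e <-> evt (fun w => cmp3 k (f (cons (x + w) e)) (f (cons x e))).
Proof.
split=> [[d _ [d0 Hd]]|[d d0 Hd]].
  exists (Num.min d 1); first by rewrite lt_min d0 ltr01.
  by move=> s s0; rewrite lt_min => /andP[sd s1]; apply: Hd; rewrite ?ltW // s0.
have m0 : 0 < Num.min (d / 2) 1 by rewrite lt_min ltr01 andbT; lra.
exists (Num.min (d / 2) 1); first by rewrite ltW //= ge_min lexx orbT.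
split=> // w _ w0; rewrite le_min => /andP[wd _]; apply: Hd => //; lra.
Qed.

Lemma rtype_ex f x e : DFun f -> [\/ rtype f 0 x e, rtype f 1 x e | rtype f 2 x e].
Proof.
move=> hf; have [] := @tri_line f (fun=> f (cons x e)) e x 1 hf (DFun_const _) => h.
- by apply: Or33; apply/rtypeP; apply: evtW h => s _; rewrite mul1r.
- by apply: Or32; apply/rtypeP; apply: evtW h => s _; rewrite mul1r.
- by apply: Or31; apply/rtypeP; apply: evtW h => s _; rewrite mul1r.
Qed.

Lemma rtype_uniq f x e j k : (j < 3)%N -> (k < 3)%N -> rtype f j x e -> rtype f k x e -> j = k.
Proof.
move=> j3 k3 /rtypeP h /rtypeP h'; have [s _ []] := evt_ex (evtI h h').
by case: j j3 {h} => [|[|[|//]]] _; case: k k3 {h'} => [|[|[|//]]] _ //= q1 q2; exfalso; lra.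
Qed.

Definition nice f (x : R) (e : env) := exists2 d : R, 0 <= d <= 1 & 0 < d /\ exists2 k, (k < 3)%N &
  forall w : R, -1 <= w <= 1 -> - d <= w -> w <= d -> contF f (x + w) e /\ rtype f k (x + w) e.

Lemma Def_nice f : DFun f -> Def1 (nice f).
Proof.
move=> hf; apply: Def_ex; apply: Def_and; first by dfp.
apply: (Def_somen (n := 3) (P := fun k e => forall w : R, -1 <= w <= 1 -> - e 0%N <= w -> w <= e 0%N ->
  contF f (e 1%N + w) (tl (tl e)) /\ rtype f k (e 1%N + w) (tl (tl e)))) => k _.
dfp; first by apply: (Def_at (t := fun e => e 2%N + e 0%N) 3 (Def_contF hf)); dfn.
by apply: (Def_at (t := fun e => e 2%N + e 0%N) 3 (Def_rtype k hf)); dfn.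
Qed.

Lemma nice_evt f e a sg : DFun f -> `|sg| = 1 -> evt (fun s => nice f (a + sg * s) e).
Proof.
move=> hf sg1.
have sgsg : sg * sg = 1 by have [->|->] := norm1 sg1; ring.
have [k k3 hk] : exists2 k, (k < 3)%N & evt (fun s => rtype f k (a + sg * s) e).
  have [h|h] := tame_line e a sg (Def_rtype 0 hf); first by exists 0%N.
  have [h'|h'] := tame_line e a sg (Def_rtype 1 hf); first by exists 1%N.
  exists 2%N => //; apply: evtW (evtI h h') => s _ [q1 q2].
  by have [] := rtype_ex (a + sg * s) e hf.
have [d d0 H] := evtI (cont_evt e a hf sg1) hk.
exists d => // s s0 sd; pose dd := Num.min (Num.min (s / 2) ((d - s) / 2)) 1.
have dd0 : 0 < dd by rewrite !lt_min ltr01 andbT; apply/andP; split; lra.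
have [dds ddd] : dd <= s / 2 /\ dd <= (d - s) / 2 by rewrite !ge_min !lexx !orbT.
exists dd; first by rewrite ltW //= ge_min lexx orbT.
split=> //; exists k => // w _ w1 w2.
have wE : a + sg * s + w = a + sg * (s + sg * w) by rewrite mulrDr mulrA sgsg mul1r addrA.
have sw : - dd <= sg * w <= dd by rewrite -ler_norml normrM sg1 mul1r ler_norml w1.
have [||h1 h2] := H (s + sg * w); [lra|lra|].
by rewrite wE; split=> //; apply/contFP.
Qed.

(** With [nice_evt] this is the monotonicity theorem. The code [rtype] is locally constant, hence
    constant on the interval, and continuity turns the local comparison to the right into a global
    one by [right_mono]. *)
Lemma nice_mono f e (p q : R) : DFun f -> (forall x, p < x < q -> nice f x e) ->
  (forall x, p < x < q -> cont (fun t => f (cons t e)) x) /\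
  ((forall x y, p < x -> x <= y -> y < q -> f (cons x e) <= f (cons y e)) \/
   (forall x y, p < x -> x <= y -> y < q -> f (cons y e) <= f (cons x e))).
Proof.
move=> hf H.
have cf x : p < x < q -> cont (fun t => f (cons t e)) x.
  move=> /H[d /andP[_ d1] [d0 [k _ Hk]]]; have [||| /contFP] := Hk 0; rewrite ?addr0 //; lra.
split=> //; have [pq|qp] := ltP p q; last by left => x y h1 h2 h3; lra.
have hm : p < (p + q) / 2 < q by lra.
have same k x : (k < 3)%N -> rtype f k ((p + q) / 2) e -> p < x < q -> rtype f k x e.
  move=> k3 h hx; apply: (@loc_const (fun x => rtype f k x e) p q) h => // y hy.
  have [d /andP[_ d1] [d0 [j j3 Hj]]] := H y hy; exists d => // z; rewrite ler_norml => hz.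
  have hj w : - d <= w <= d -> rtype f j (y + w) e by move=> hw; have [||| _ //] := Hj w; lra.
  have jz : rtype f j z e by have := hj (z - y); rewrite add_sub; apply; lra.
  have jy : rtype f j y e by have := hj 0; rewrite addr0; apply; lra.
  by split=> h'; [rewrite (rtype_uniq k3 j3 h' jz) | rewrite (rtype_uniq k3 j3 h' jy)].
have rd k x : (k < 3)%N -> rtype f k ((p + q) / 2) e -> p < x < q ->
    exists2 d : R, 0 < d & forall w : R, 0 < w -> w <= d -> cmp3 k (f (cons (x + w) e)) (f (cons x e)).
  move=> k3 h hx; have /rtypeP[d d0 Hd] := same k x k3 h hx.
  by exists (d / 2); [lra | move=> w w0 wd; apply: Hd => //; lra].
have [h|h|h] := rtype_ex ((p + q) / 2) e hf.
- left; apply: (right_mono cf) => x hx; have [d d0 Hd] := rd 0%N x isT h hx.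
  by exists d => // w w0 wd; apply/ltW/Hd.
- left; apply: (right_mono cf) => x hx; have [d d0 Hd] := rd 1%N x isT h hx.
  by exists d => // w w0 wd; rewrite -(Hd w w0 wd).
right=> x y px xy yq; rewrite -lerN2.
apply: (@right_mono (fun t => - f (cons t e)) p q) => // z hz.
  move=> eps eps0; have [d d0 Hd] := cf z hz eps eps0; exists d => // w /Hd.
  by rewrite -opprD normrN.
have [d d0 Hd] := rd 2%N z isT h hz.
by exists d => // w w0 wd; rewrite lerN2; apply/ltW/Hd.
Qed.

(* [f + 2 s] and [f - 2 s] are monotone near 0, and the bound on [f] excludes that the former decreases
   or the latter increases. *)
Lemma Lip_germ f e : DFun f -> evt (fun s => `|f (cons s e)| <= s) ->
  exists2 d : R, 0 < d & forall s s', 0 < s < d -> 0 < s' < d -> `|f (cons s e) - f (cons s' e)| <= 2 * `|s - s'|.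
Proof.
move=> hf [d0 d00 H0].
have key (g : env -> R) c : DFun g -> (forall s, g (cons s e) = f (cons s e) + c * s) -> `|c| = 2 ->
  exists2 d : R, 0 < d & (forall x y, 0 < x -> x <= y -> y < d -> 0 <= c * (g (cons y e) - g (cons x e))).
  move=> hg gE c2; have [d d1 Hd] := nice_evt e 0 hg (normr1 R).
  have [x|_ hm] := @nice_mono g e 0 d hg; first by move=> /andP[x0 xd]; have := Hd x x0 xd; rewrite add0r mul1r.
  pose dd := Num.min d d0; have dd0 : 0 < dd by rewrite lt_min d1.
  have [ddd ddd0] : dd <= d /\ dd <= d0 by rewrite !ge_min !lexx orbT.
  have cc : c = 2 \/ c = -2.
    by move: c2; case: (ltP c 0) => h; [rewrite ltr0_norm|rewrite ger0_norm] => // h'; [right|left]; clear -h'; lra.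
  have bd s : 0 < s < dd -> - s <= f (cons s e) <= s.
    by move=> /andP[s0 sd]; rewrite -ler_norml; apply: H0 => //; lra.
  (* a monotone function of the wrong direction would keep away from its limit 0 *)
  exists dd => // x y x0 xy yd.
  have [s1 s2 s3] : [/\ 0 < dd / 16, dd / 16 <= dd / 2 & dd / 2 < dd] by clear - dd0; split; lra.
  case: cc => cE; rewrite cE; case: hm => hm.
  - by have := hm x y x0 xy ltac:(lra); lra.
  - exfalso; have q1 := bd (dd / 2) ltac:(lra).
    have q2 := bd (dd / 16) ltac:(lra).
    have := hm (dd / 16) (dd / 2) s1 s2 (lt_le_trans s3 ddd); rewrite !gE cE; clear - q1 q2 dd0; lra.
  - exfalso; have q1 := bd (dd / 2) ltac:(lra).
    have q2 := bd (dd / 16) ltac:(lra).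
    have := hm (dd / 16) (dd / 2) s1 s2 (lt_le_trans s3 ddd); rewrite !gE cE; clear - q1 q2 dd0; lra.
  - by have := hm x y x0 xy ltac:(lra); lra.
have [|s||d1 d10 H1] := @key (fun e => f e + 2 * e 0%N) 2; [by dfn|by []|by rewrite ger0_norm|].
have [|s||d2 d20 H2] := @key (fun e => f e + (-2) * e 0%N) (-2); [by dfn|by []|by rewrite normrN ger0_norm|].
exists (Num.min d1 d2); first by rewrite lt_min d10.
have main x y : 0 < x < Num.min d1 d2 -> 0 < y < Num.min d1 d2 -> x <= y -> `|f (cons x e) - f (cons y e)| <= 2 * `|x - y|.
  rewrite !lt_min => /and3P[x0 xd1 xd2] /and3P[y0 yd1 yd2] xy.
  have := H1 x y x0 xy yd1; have := H2 x y x0 xy yd2; rewrite /= => q1 q2.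
  by rewrite (ler0_norm (_ : x - y <= 0)) ?ler_norml; lra.
move=> s s' hs hs'; have [ss'|ss'] := leP s s'; first exact: main.
by rewrite distrC [`|s - s'|]distrC; apply: main => //; exact: ltW.
Qed.

Definition isol (P : R -> Prop) b := exists2 d : R, 0 < d & forall w : R, 0 < `|w| -> `|w| <= d -> ~ P (b + w).

Lemma isol_or A e b : Def1 A -> isol (fun t => A t e) b \/ exists2 sg : R, `|sg| = 1 & evt (fun s => A (b + sg * s) e).
Proof.
move=> hA; have [h|h1] := tame_line e b 1 hA; first by right; exists 1; rewrite ?normr1.
have [h|h2] := tame_line e b (-1) hA; first by right; exists (-1); rewrite ?normrN1.
left; have [d d0 Hd] := evtI h1 h2; exists (d / 2); first by lra.
move=> w w0 wd; case: (ltP w 0) => hw.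
  have [||_ q] := Hd (- w); [lra| by rewrite ltr0_norm in wd; lra|].
  by move: q; rewrite mulrN mulN1r opprK.
have w0' : 0 < w by rewrite lt_def hw andbT -normr_gt0.
have [||q _] := Hd w; [lra| by rewrite gtr0_norm in wd; lra|].
by move: q; rewrite mul1r.
Qed.

Lemma isol_finite (P : R -> Prop) (l u : R) : (forall b, l <= b <= u -> isol P b) ->
  exists s : seq R, forall y, l <= y <= u -> P y -> y \in s.
Proof.
move=> H; have [t ht|S [_ CS]] := @segment_cover R (fun t d => forall w : R, 0 < `|w| -> `|w| <= d -> ~ P (t + w)) l u.
  by have [d d0 Hd] := H t ht; exists d.
have [t ht|S' [HS CS']] := @segment_cover R (fun t d => forall w : R, 0 < `|w| -> `|w| <= d -> ~ P (t + w)) l u.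
  by have [d d0 Hd] := H t ht; exists d.
exists [seq p.1 | p <- S'] => y hy Py; have [p pS hp] := CS' y hy.
have [_ _ Hp] := HS p pS; apply/mapP; exists p => //.
apply/eqP; rewrite -subr_eq0; apply/negPn/negP => yp.
by apply: (Hp (y - p.1)); rewrite ?normr_gt0 ?add_sub.
Qed.

Lemma DFun_graph (G : R -> env -> Prop) (B : R) : Def1 G ->
  (forall e y, G y e -> `|y| <= B) -> (forall e y y', G y e -> G y' e -> y = y') ->
  DFun (fun e => xget 0 [set y | G y e]).
Proof.
move=> hG bG uG.
have gE e y : y = xget 0 [set y | G y e] <-> G y e \/ (~ (exists2 v, - B <= v <= B & G v e) /\ y = 0).
  have [[v Gv]|none] := pselect (exists v, G v e).
    have Gf := @xgetPex _ 0 [set y | G y e] (ex_intro _ v Gv); split=> [->|[Gy|[q]]]; [by left | exact: uG Gy Gf | ].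
    by exfalso; apply: q; exists v => //; rewrite -ler_norml; exact: bG Gv.
  rewrite xgetPN; last by move=> v Gv; apply: none; exists v.
  split=> [->|[Gy|[]//]]; last by exfalso; apply: none; exists y.
  by right; split=> // -[v _ Gv]; apply: none; exists v.
have hD : Def (fun e => e 0%N = xget 0 [set y | G y (tl e)]).
  apply: (Def_iff (P := fun e => G (e 0%N) (tl e) \/ (~ (exists2 v, - B <= v <= B & G v (tl e)) /\ e 0%N = 0))).
    by move=> e; rewrite gE.
  dfp.
  by apply: (Def_at (t := fun e => e 0%N) 2 hG); dfn.
split=> //; have [m [sG _]] := hG.
exists m; split=> [e e' ee'|a].
  congr (xget 0 _); apply/seteqP; split=> y /= h.
    by apply: (sG (cons y e) (cons y e')) h => -[|i] //= im; apply: ee'; apply: ltnW.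
  by apply: (sG (cons y e') (cons y e)) h => -[|i] //= im; rewrite ee' // ltnW.
exists (Num.max B 0); apply: nearmT => e; case: xgetP => [v -> /bG h|_]; first by rewrite le_max h.
by rewrite normr0 le_max lexx orbT.
Qed.

Section Selection.
Variable A : R -> env -> Prop.
Hypothesis hA : Def1 A.

Definition isinf (x : R) (e : env) := (forall y, -1 <= y <= 1 -> A y e -> x <= y) /\
  forall d, 0 <= d <= 1 -> 0 < d -> exists2 y, -1 <= y <= 1 & A y e /\ y < x + d.

Definition gapW (d x : R) (e : env) := forall w, 0 <= w <= 2 -> 0 < w -> w <= d -> x + w <= 1 /\ A (x + w) e.

Definition isgap (d x : R) (e : env) := forall w, 0 <= w <= 2 -> 0 < w -> (w < d -> gapW w x e) /\ (d < w -> ~ gapW w x e).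

(** The selected point is the infimum x of the fibre if it belongs to it, and otherwise the midpoint
    of the interval of the fibre that starts at x, whose length d is described by [isgap]. Tameness
    ensures that such an interval exists. *)
Definition Gsel (y : R) (e : env) := exists2 x, -1 <= x <= 1 & isinf x e /\
  ((A x e /\ y = x) \/ (~ A x e /\ exists2 d, 0 <= d <= 2 & isgap d x e /\ y = x + d * (1 / 2))).

Lemma Def_isinf : Def1 isinf.
Proof.
rewrite /isinf; dfp.
- by apply: (Def_at (t := fun e => e 0%N) 2 hA); dfn.
- by apply: (Def_at (t := fun e => e 0%N) 3 hA); dfn.
Qed.

Lemma Def_G : Def1 Gsel.
Proof.
rewrite /Gsel; dfp.
- by apply: (Def_at (t := fun e => e 0%N) 2 Def_isinf); dfn.
- by apply: (Def_at (t := fun e => e 0%N) 2 hA); dfn.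
- by apply: (Def_at (t := fun e => e 0%N) 2 hA); dfn.
- by rewrite /isgap /gapW; dfp; apply: (Def_at (t := fun e => e 3%N + e 0%N) 5 hA); dfn.
Qed.

Lemma isinf_uniq e x x' : isinf x e -> isinf x' e -> x = x'.
Proof.
move=> [h1 h2] [h1' h2']; apply/eqP; rewrite eq_le; apply/andP; split; rewrite leNgt; apply/negP => lt.
  have m0 : 0 < Num.min (x - x') 1 by rewrite lt_min ltr01 andbT; lra.
  have [|y hy [Ay yx]] := h2' (Num.min (x - x') 1) _ m0; first by rewrite ltW //= ge_min lexx orbT.
  have m1 : Num.min (x - x') 1 <= x - x' by rewrite ge_min lexx.
  by have := h1 y hy Ay; lra.
have m0 : 0 < Num.min (x' - x) 1 by rewrite lt_min ltr01 andbT; lra.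
have [|y hy [Ay yx]] := h2 (Num.min (x' - x) 1) _ m0; first by rewrite ltW //= ge_min lexx orbT.
have m1 : Num.min (x' - x) 1 <= x' - x by rewrite ge_min lexx.
by have := h1' y hy Ay; lra.
Qed.

Lemma isgap_uniq e x d d' : 0 <= d <= 2 -> 0 <= d' <= 2 -> isgap d x e -> isgap d' x e -> d = d'.
Proof.
move=> hd hd' h h'; apply/eqP; rewrite eq_le; apply/andP; split; rewrite leNgt; apply/negP => lt.
  have [||q _] := h ((d + d') / 2); [lra|lra|].
  have [||_ q'] := h' ((d + d') / 2); [lra|lra|].
  by apply: q'; [lra | apply: q; lra].
have [||_ q] := h ((d + d') / 2); [lra|lra|].
have [||q' _] := h' ((d + d') / 2); [lra|lra|].
by apply: q; [lra | apply: q'; lra].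
Qed.

Lemma G_uniq e y y' : Gsel y e -> Gsel y' e -> y = y'.
Proof.
move=> [x _ [ix hx]] [x' _ [ix' hx']]; have xx := isinf_uniq ix ix'; rewrite -{x' ix'}xx in hx' *.
case: hx => [[Ax ->]|[nA [d hd [gd ->]]]]; case: hx' => [[Ax' ->]|[nA' [d' hd' [gd' ->]]]] //.
by rewrite (isgap_uniq hd hd' gd gd').
Qed.

Definition sel (e : env) : R := xget 0 [set y | Gsel y e].

Lemma DFun_sel : DFun sel.
Proof.
apply: (@DFun_graph Gsel 2) Def_G _ G_uniq => e y [x hx [_ [[_ ->]|[_ [d hd [_ ->]]]]]]; rewrite ler_norml; lra.
Qed.

Lemma selP e : (exists2 y, -1 <= y <= 1 & A y e) -> -1 <= sel e <= 1 /\ A (sel e) e.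
Proof.
move=> [y0 hy0 Ay0].
pose S := [set y : R | -1 <= y <= 1 /\ A y e].
have iS : has_inf S by split; [exists y0 | exists (-1) => y [/andP[]]].
pose x := inf S.
have x1 : -1 <= x by apply: lb_le_inf; [exists y0 | move=> y [/andP[]]].
have x0 : x <= y0 by apply: ge_inf; [exact: iS.2 | ].
have infx : isinf x e.
  split=> [y hy Ay|d _ d0]; first by apply: ge_inf; [exact: iS.2 | ].
  by have [y [hy Ay] yx] := inf_adherent d0 iS; exists y.
have hx : -1 <= x <= 1 by lra.
have [Ax|nAx] := pselect (A x e).
  have Gx : Gsel x e by exists x => //; split=> //; left.
  by rewrite /sel; case: xgetP => [v -> /(G_uniq Gx) <-|/(_ x Gx)].
have right_in : evt (fun s => A (x + s) e).
  have [h|h] := tame_line e x 1 hA; first by apply: evtW h => s _; rewrite mul1r.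
  exfalso; have [d d0 Hd] := h; have [||y hy [Ay yx]] := infx.2 (Num.min d 1).
  - by rewrite le_min ltW //= ler01 ge_min lexx orbT.
  - by rewrite lt_min d0 ltr01.
  have xy : x < y by rewrite lt_def (infx.1 y hy Ay) andbT; apply: contra_notN nAx => /eqP <-.
  have md : Num.min d 1 <= d by rewrite ge_min lexx.
  by have := Hd (y - x); rewrite mul1r add_sub; apply => //; lra.
have xlt1 : x < 1 by rewrite lt_def; apply/andP; split; [apply: contra_notN nAx => /eqP x1' ; have -> : x = y0 by lra | lra].
pose D := [set d : R | 0 < d <= 2 /\ gapW d x e].
have [d0 d00 Hd0] := right_in.
pose d1 := Num.min (d0 / 2) (1 - x).
have d10 : 0 < d1 by rewrite lt_min; apply/andP; split; lra.
have [d11 d12] : d1 <= d0 / 2 /\ d1 <= 1 - x by rewrite !ge_min !lexx orbT.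
have D1 : D d1.
  by split; [lra | move=> w _ w0 wd; split; [lra | apply: Hd0; lra]].
have sD : has_sup D by split; [exists d1 | exists 2 => d [/andP[]]].
pose d := sup D.
have dd1 : d1 <= d by apply: sup_ubound => //; exact: sD.2.
have d2 : d <= 2 by apply: sup_le_ub; [exists d1 | move=> z [/andP[]]].
have Wlt w : 0 < w -> w < d -> gapW w x e.
  move=> w0 wd; have dw0 : 0 < d - w by lra.
  have [z [hz Wz] wz] := sup_adherent dw0 sD; rewrite -/d in wz.
  by move=> v v1 v2 vw; apply: Wz => //; lra.
have gd : isgap d x e.
  move=> w hw w0; split=> [wd|dw Ww]; first exact: Wlt.
  have : w <= d by apply: sup_ubound; [exact: sD.2 | split=> //; lra].
  lra.
have Gy : Gsel (x + d * (1 / 2)) e.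
  exists x => //; split=> //; right; split=> //; exists d => //; lra.
have [|||||h1 h2] := Wlt (d * (1 / 2)) _ _ (d * (1 / 2)); [lra|lra|lra|lra|lra|].
rewrite /sel; case: xgetP => [v -> /(G_uniq Gy) <-|/(_ _ Gy) //]; split=> //; lra.
Qed.

End Selection.

End OneVariable.

(** * Uniform finiteness with definable choice *)

Section FiniteSelection.
Context {R : realType}.
Local Notation env := (nat -> R).
Local Notation Def1 A := (Def (fun e : env => A (e 0%N) (tl e))).

(** The entries from m on are 0, so that a point is determined by its m coordinates. *)
Definition cube m (e : env) := forall i, if (i < m)%N then is_true (-1 <= e i <= 1) else e i = 0.

Lemma cube_cons m (a : R) (e : env) : -1 <= a <= 1 -> cube m e -> cube m.+1 (cons a e).
Proof. by move=> ha he [|i] //=; exact: he. Qed.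

Lemma cube_inv m (e : env) : cube m.+1 e -> exists a e', [/\ e = cons a e', -1 <= a <= 1 & cube m e'].
Proof.
move=> he; exists (e 0%N), (tl e); split; [by rewrite consE | exact: (he 0%N) | ].
by move=> i; exact: (he i.+1).
Qed.

Lemma Def_at2 (A : R -> env -> Prop) (t u : env -> R) n : Def1 A -> DFun t -> DFun u ->
  Def (fun e => A (t e) (cons (u e) (fun q => e (n + q)%N))).
Proof.
move=> hA ht hu; apply: (Def_app (h := fun i e => if i is j.+1 then (if j is l.+1 then e (n + l)%N else u e) else t e) hA).
by move=> -[|[|j]] //; exact: DFun_var.
Qed.

Section Normal.
Variable A : R -> env -> Prop.
Hypothesis hA : Def1 A.

(** The notion of normal point from the usual proof of uniform finiteness: near (b, a) the set A is
    either empty, or over every a' near a it has exactly one point at distance at most d0 from b,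
    and this point tends to b as a' tends to a. *)
Definition normal (b a : R) (e : env) :=
  (~ A b (cons a e) /\ exists2 d : R, 0 <= d <= 1 & 0 < d /\ forall w : R, -1 <= w <= 1 -> - d <= w -> w <= d ->
     forall v : R, -1 <= v <= 1 -> - d <= v -> v <= d -> ~ A (b + v) (cons (a + w) e)) \/
  (A b (cons a e) /\ exists2 d0 : R, 0 <= d0 <= 1 & 0 < d0 /\ forall d : R, 0 <= d <= 1 -> 0 < d -> d <= d0 ->
     exists2 r : R, 0 <= r <= 1 & 0 < r /\ forall w : R, -1 <= w <= 1 -> - r <= w -> w <= r ->
     exists2 v : R, -1 <= v <= 1 & (- d <= v /\ v <= d) /\ A (b + v) (cons (a + w) e) /\
       forall v' : R, -1 <= v' <= 1 -> - d0 <= v' -> v' <= d0 -> A (b + v') (cons (a + w) e) -> v' = v).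

Lemma Def_normal : Def (fun e => normal (e 0%N) (e 1%N) (tl (tl e))).
Proof.
rewrite /normal; dfp.
- by apply: (Def_at2 (t := fun e => e 0%N) (u := fun e => e 1%N) 2 hA); dfn.
- by apply: (Def_at2 (t := fun e => e 3%N + e 0%N) (u := fun e => e 4%N + e 1%N) 5 hA); dfn.
- by apply: (Def_at2 (t := fun e => e 0%N) (u := fun e => e 1%N) 2 hA); dfn.
- by apply: (Def_at2 (t := fun e => e 5%N + e 0%N) (u := fun e => e 6%N + e 1%N) 7 hA); dfn.
- by apply: (Def_at2 (t := fun e => e 6%N + e 0%N) (u := fun e => e 7%N + e 2%N) 8 hA); dfn; exact (DFun_var 7).
Qed.

Definition abnormal (a : R) (e : env) := (-1 <= a /\ a <= 1) /\ exists2 b, -1 <= b <= 1 & ~ normal b a e.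

Lemma Def_abnormal : Def1 abnormal.
Proof.
rewrite /abnormal; dfp; exact: (Def_pull (fun i => if i is j.+1 then j.+1 else 0%N) Def_normal).
Qed.

(* At an abnormal parameter the chosen abnormal value [beta] and the size [gamma] of a gap around it in the
   fibre are generically continuous, which makes them normal. *)
Lemma abnormal_isol e : (forall a b, -1 <= a <= 1 -> isol (fun t => A t (cons a e)) b) ->
  forall a, isol (fun t => abnormal t e) a.
Proof.
move=> isoA a0; have [//|[sg sg1 Hab]] := isol_or e a0 Def_abnormal; exfalso.
pose nb b (E : env) := ~ normal b (E 0%N) (tl E).
have hnb : Def1 nb by apply: Def_not; exact: Def_normal.
pose beta := sel nb; have hb : DFun beta by exact: DFun_sel.
pose gp (g : R) (E : env) := 0 < g /\ forall v : R, -1 <= v <= 1 -> ~ (v = 0) -> - g <= v -> v <= g -> ~ A (beta E + v) E.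
have hgp : Def1 gp.
  rewrite /gp; dfp.
  apply: (Def_at (t := fun e => beta (fun q => e (2 + q)%N) + e 0%N) 2 hA).
  by apply: DFun_add; [exact: DFun_pull | exact: DFun_var].
pose gam := sel gp; have hg : DFun gam by exact: DFun_sel.
have hchi : Def (fun E => A (beta E) E) by apply: (Def_at (t := beta) 0 hA).
have [chi Hchi] : exists chi : Prop, evt (fun s => A (beta (cons (a0 + sg * s) e)) (cons (a0 + sg * s) e) <-> chi).
  have [h|h] := tame_line e a0 sg hchi; [exists True | exists False]; apply: evtW h => s _ q; split=> //.
have [d d0 H] := evtI Hab (evtI (cont_evt e a0 hb sg1) (evtI (cont_evt e a0 hg sg1) Hchi)).
pose a1 := a0 + sg * (d / 2).
have near_a1 a : `|a - a1| <= d / 4 -> exists s, [/\ 0 < s, s < d & a = a0 + sg * s].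
  move=> ha; exists (d / 2 + sg * (a - a1)).
  have : `|sg * (a - a1)| <= d / 4 by rewrite normrM sg1 mul1r.
  rewrite ler_norml => hs; split; [lra|lra|].
  by rewrite /a1; have [->|->] := norm1 sg1; ring.
have Hprop a : `|a - a1| <= d / 4 -> [/\ -1 <= beta (cons a e) <= 1 /\ ~ normal (beta (cons a e)) a e,
    (A (beta (cons a e)) (cons a e) <-> chi), 0 < gam (cons a e) <= 1,
    cont (fun t => beta (cons t e)) a /\ cont (fun t => gam (cons t e)) a &
    forall v : R, `|v| <= gam (cons a e) -> A (beta (cons a e) + v) (cons a e) -> v = 0].
  move=> /near_a1[s [s0 sd ->]]; have [[[h1 h2] hbad] [cb [cg h3]]] := H s s0 sd.
  move: h1 h2 hbad cb cg h3; move: (a0 + sg * s) => a2 h1 h2 hbad cb cg h3; have ha : -1 <= a2 <= 1 by rewrite h1 h2.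
  have [hb1 hb2] := selP hnb (e := cons a2 e) hbad; rewrite -/beta in hb1 hb2.
  have [|g1 g2] := @selP _ _ hgp (cons a2 e).
    have [g g0 Hg] := isoA a2 (beta (cons a2 e)) ha.
    have mg : Num.min g 1 <= g by rewrite ge_min lexx.
    have m1 : Num.min g 1 <= 1 by rewrite ge_min lexx orbT.
    have m0 : 0 < Num.min g 1 by rewrite lt_min g0 ltr01.
    exists (Num.min g 1); first by lra.
    split=> // v hv v0 v1 v2; apply: Hg; first by rewrite normr_gt0; apply/eqP.
    by rewrite ler_norml; lra.
  rewrite -/gam in g1 g2; have [g3 g4] := g2; split=> //; first by lra.
  move=> v vg Av; apply: contrapT => v0; move: vg; rewrite ler_norml => vg.
  by apply: (g4 v _ v0 _ _ Av); lra.
have a10 : `|a1 - a1| <= d / 4 by rewrite subrr normr0; lra.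
have [[hb1 nn] hc /andP[gm0 gm1] [cb cg] gpp] := Hprop a1 a10.
set b := beta (cons a1 e) in hb1 nn hc cb gpp *; set g := gam (cons a1 e) in gm0 gm1 gpp *.
have [|r1 r10 Hr1] := cb (g / 4); first by lra.
have [|r2 r20 Hr2] := cg (g / 4); first by lra.
pose r := Num.min (Num.min r1 r2) (Num.min (d / 4) (g / 4)).
have r0 : 0 < r by rewrite !lt_min r10 r20 /=; apply/andP; split; lra.
have [[rr1 rr2] [rd rg]] : (r <= r1 /\ r <= r2) /\ (r <= d / 4 /\ r <= g / 4) by rewrite !ge_min !lexx !orbT.
have box w v : - r <= w -> w <= r -> - (g / 4) <= v -> v <= g / 4 -> A (b + v) (cons (a1 + w) e) -> b + v = beta (cons (a1 + w) e).
  move=> w1 w2 v1 v2 Av; have hw : `|w| <= r by rewrite ler_norml w1.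
  have [|_ _ _ _ gw] := Hprop (a1 + w); first by rewrite addrAC subrr add0r; apply: le_trans hw rd.
  have q1 := Hr1 (a1 + w); rewrite addrAC subrr add0r in q1; have := q1 (le_trans hw rr1).
  have q2 := Hr2 (a1 + w); rewrite addrAC subrr add0r in q2; have := q2 (le_trans hw rr2).
  rewrite -/b -/g !ler_norml => p2 p1.
  have := gw (b + v - beta (cons (a1 + w) e)); rewrite add_sub => h.
  apply/eqP; rewrite -subr_eq0; apply/eqP/h => //; move: p1 p2; clear - v1 v2.
  by rewrite ler_norml => /andP[? ?] /andP[? ?]; apply/andP; split; lra.
have chiw w : - r <= w -> w <= r -> A (beta (cons (a1 + w) e)) (cons (a1 + w) e) <-> chi.
  move=> w1 w2; have hw : `|w| <= r by rewrite ler_norml w1.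
  by have [|_ ->] := Hprop (a1 + w); first by rewrite addrAC subrr add0r; apply: le_trans hw rd.
apply: nn; have [c|nc] := pselect chi; last first.
  left; split; first by rewrite hc.
  exists r; first by lra.
  split=> // w _ w1 w2 v _ v1 v2 Av; apply: nc; apply/(chiw w w1 w2).
  have [v3 v4] : - (g / 4) <= v /\ v <= g / 4 by clear - v1 v2 rg; split; lra.
  by rewrite -(box w v w1 w2 v3 v4 Av).
right; split; first exact/hc.
exists r; first by lra.
split=> // dd _ dd0 ddr; have [r3 r30 Hr3] := cb dd dd0.
pose r' := Num.min r r3; have r'0 : 0 < r' by rewrite lt_min r0.
have [r'r r'3] : r' <= r /\ r' <= r3 by split; rewrite ge_min lexx ?orbT.
exists r'; first by lra.
split=> // w _ w1 w2; have := Hr3 (a1 + w); rewrite addrAC subrr add0r !ler_norml => /(_ _)/andP[|q1 q2]; first by lra.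
have [q3 q4] : - dd <= beta (cons (a1 + w) e) - b /\ beta (cons (a1 + w) e) - b <= dd.
  by move: q1 q2; rewrite -/b; clear; lra.
have [w3 w4] : - r <= w /\ w <= r by clear - w1 w2 r'r; split; lra.
exists (beta (cons (a1 + w) e) - b); first by clear - q3 q4 ddr rg gm1; apply/andP; split; lra.
split; first by split.
rewrite add_sub; split; first exact/chiw.
move=> v' _ v1 v2 Av; have [v3 v4] : - (g / 4) <= v' /\ v' <= g / 4 by clear - v1 v2 ddr rg; split; lra.
by rewrite -(box w v' w3 w4 v3 v4 Av) addrC addKr.
Qed.

Definition card_ge N (a : R) (e : env) := exists s : seq R, [/\ uniq s, size s = N & forall y, y \in s -> A y (cons a e)].

(** Normality lets each of the finitely many given points persist, at distance at most a third of
    their mutual distances, so they remain distinct. Conversely, compactness of [-1, 1] prevents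
    nearby fibres from having more points. *)
Lemma normal_card N (a : R) (e : env) : (forall a y, A y (cons a e) -> -1 <= y <= 1) ->
  (forall b, -1 <= b <= 1 -> normal b a e) ->
  exists2 d : R, 0 < d & forall a', `|a' - a| <= d -> (card_ge N a' e <-> card_ge N a e).
Proof.
move=> bA nor.
have [d1 d10 H1] : exists2 d : R, 0 < d & forall a', `|a' - a| <= d -> card_ge N a e -> card_ge N a' e.
  have [[s [us ss As]]|no] := pselect (card_ge N a e); last by exists 1.
  have [eta eta0 Heta] : exists2 eta : R, 0 < eta & forall y z, y \in s -> z \in s -> y != z -> eta <= `|y - z|.
    have [|eta eta0 Heta] := @fin_min R ('I_(size s) * 'I_(size s))%type (fun p => if s`_p.1 == s`_p.2 then 1 else `|s`_p.1 - s`_p.2|).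
      by move=> p; case: eqP => // /eqP; rewrite normr_gt0 subr_eq0.
    exists eta => // y z ys zs yz.
    have iy : (index y s < size s)%N by rewrite index_mem.
    have iz : (index z s < size s)%N by rewrite index_mem.
    by have := Heta (Ordinal iy, Ordinal iz); rewrite /= !nth_index // (negbTE yz).
  have key (y : R) : exists r : R, 0 < r /\ (y \in s -> forall a', `|a' - a| <= r -> exists2 y', `|y' - y| <= eta / 3 & A y' (cons a' e)).
    have [ys|] := boolP (y \in s); last by exists 1.
    have [[nA]|[_ [d0 /andP[_ d01] [d00 Hd0]]]] := nor y (bA _ _ (As y ys)); first by have := As y ys.
    pose dd := Num.min d0 (eta / 3); have dd0 : 0 < dd by rewrite lt_min d00; lra.
    have [dd1 dd2] : dd <= d0 /\ dd <= eta / 3 by rewrite !ge_min !lexx orbT.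
    have [|r /andP[_ r1] [r0 Hr]] := Hd0 dd _ dd0 dd1; first by lra.
    exists r; split=> // _ a'; rewrite ler_norml => ha'.
    have [|||v _ [hv [Av _]]] := Hr (a' - a); [lra|lra|lra|].
    by rewrite add_sub in Av; exists (y + v) => //; rewrite addrAC subrr add0r ler_norml; lra.
  have [r Hr] := choice key.
  have [d d0 Hd] := @fin_min R 'I_(size s) (fun i => r s`_i) (fun i => proj1 (Hr _)).
  exists d => // a' ha' _.
  have /choice[f Hf] : forall y, exists y', y \in s -> `|y' - y| <= eta / 3 /\ A y' (cons a' e).
    move=> y; have [ys|] := boolP (y \in s); last by exists 0.
    have iy : (index y s < size s)%N by rewrite index_mem.
    have := Hd (Ordinal iy); rewrite /= nth_index // => dr.
    by have [_ /(_ ys a' (le_trans ha' dr))[y' h1 h2]] := Hr y; exists y'.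
  exists [seq f y | y <- s]; split; last by move=> _ /mapP[y /Hf[_ h] ->].
    rewrite map_inj_in_uniq // => y z ys zs fyz; apply/eqP/negPn/negP => yz.
    have := Heta y z ys zs yz; have [hy _] := Hf y ys; have [hz _] := Hf z zs; rewrite fyz in hy.
    have -> : y - z = (f z - z) - (f z - y) by ring.
    by have := ler_normB (f z - z) (f z - y); move: hy hz; lra.
  by rewrite size_map.
(* A piece of this cover contains at most one point of a nearby fibre, and if it contains one, then
   its centre lies in the fibre over a. Sending points to the centres of their pieces is therefore
   injective. *)
have [b hb|S [HS CS]] := @segment_cover R (fun b d => forall w : R, `|w| <= d -> forall v v' : R, `|v| <= d -> `|v'| <= d ->
    A (b + v) (cons (a + w) e) -> A b (cons a e) /\ (A (b + v') (cons (a + w) e) -> v' = v)) (-1) 1.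
  have [[nA [d _ [d0 Hd]]]|[Ab [d0 /andP[_ d01] [d00 Hd0]]]] := nor b hb.
    exists (Num.min d 1); first by rewrite lt_min d0 ltr01.
    have [m1 m2] : Num.min d 1 <= d /\ Num.min d 1 <= 1 by rewrite !ge_min !lexx orbT.
    by move=> w; rewrite ler_norml => hw v v'; rewrite !ler_norml => hv _ Av; exfalso; apply: (Hd w _ _ _ v _ _ _ Av); lra.
  have [|r /andP[_ r1] [r0 Hr]] := Hd0 d0 _ d00 (lexx _); first by lra.
  exists (Num.min r d0); first by rewrite lt_min r0.
  have [m1 m2] : Num.min r d0 <= r /\ Num.min r d0 <= d0 by rewrite !ge_min !lexx orbT.
  move=> w; rewrite ler_norml => hw v v'; rewrite !ler_norml => hv hv' Av; split=> // Av'.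
  have [|||u _ [hu [Au Hu]]] := Hr w; [lra|lra|lra|].
  have q z : - Num.min r d0 <= z <= Num.min r d0 -> A (b + z) (cons (a + w) e) -> z = u by move=> hz; apply: Hu; lra.
  by rewrite (q v' hv' Av') (q v hv Av).
have [d2 d20 Hd2] : exists2 d : R, 0 < d & forall p, p \in S -> d <= p.2.
  elim: S {CS} HS => [|q S IH] HS; first by exists 1.
  have [|d d0 Hd] := IH; first by move=> p ps; apply: HS; rewrite inE ps orbT.
  exists (Num.min q.2 d); first by rewrite lt_min d0 andbT; have [] := HS q (mem_head _ _).
  by move=> p; rewrite inE ge_min => /orP[/eqP ->|/Hd ->]; rewrite ?lexx ?orbT.
exists (Num.min d1 d2); first by rewrite lt_min d10.
move=> a'; rewrite le_min => /andP[ha1 ha2]; split; last exact: H1.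
move=> [s [us ss As]].
have /choice[g Hg] : forall y, exists p, y \in s -> p \in S /\ `|y - p.1| <= p.2.
  move=> y; have [ys|] := boolP (y \in s); last by exists (0, 0).
  by have [p pS hp] := CS y (bA _ _ (As y ys)); exists p.
have AE y z : y \in s -> z \in s -> (g z).2 <= (g y).2 -> A (g y).1 (cons a e) /\ ((g y).1 = (g z).1 -> z = y).
  move=> ys zs le; have [yS hy] := Hg y ys; have [_ _ Q] := HS _ yS.
  have hw : `|a' - a| <= (g y).2 by apply: le_trans ha2 (Hd2 _ yS).
  have [zS hz] := Hg z zs.
  have Ay : A ((g y).1 + (y - (g y).1)) (cons (a + (a' - a)) e) by rewrite !add_sub; exact: As.
  split=> [|E].
    by have [] := Q _ hw _ _ hy hy Ay.
  have hz' : `|z - (g y).1| <= (g y).2 by rewrite E; apply: le_trans hz le.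
  have [_ h] := Q _ hw _ _ hy hz' Ay.
  have /h : A ((g y).1 + (z - (g y).1)) (cons (a + (a' - a)) e) by rewrite !add_sub; exact: As.
  by move/eqP; rewrite subr_eq addrAC addrK => /eqP -> //; rewrite subrK.
exists [seq (g y).1 | y <- s]; split.
- rewrite map_inj_in_uniq // => y z ys zs E; case: (leP (g z).2 (g y).2) => le.
    by have [_ /(_ E) ->] := AE y z ys zs le.
  by have [_ /(_ (esym E)) ->] := AE z y zs ys (ltW le).
- by rewrite size_map.
by move=> _ /mapP[y ys ->]; have [] := AE y y ys ys (lexx _).
Qed.

End Normal.

Lemma inmapP (T U : Type) (f : T -> U) (s : seq T) y : List.In y [seq f x | x <- s] <-> exists2 x, List.In x s & y = f x.
Proof.
elim: s => [|a s IH]; first by split=> // -[].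
split=> [[<-|/IH[x h ->]]|[x [<-|h] yE]]; [by exists a; [left|]|by exists x; [right|]|by left|].
by right; apply/IH; exists x.
Qed.

Lemma in_In (T : eqType) (s : seq T) x : x \in s -> List.In x s.
Proof. by elim: s => // z s IH; rewrite inE => /orP[/eqP ->|/IH]; [left|right]. Qed.

Definition endp (C : seq (env -> R)) : seq (env -> R) := (fun=> -1) :: (fun=> 1) :: C.

Definition midf (c c' : env -> R) : env -> R := fun e => (c e + c' e) * (1 / 2).

(** Sample functions: the midpoints of all pairs among the critical values and the ends of [-1, 1].
    Pairs of equal members give the critical values themselves. *)
Definition mids (C : seq (env -> R)) : seq (env -> R) :=
  List.flat_map (fun c => List.map (midf c) (endp C)) (endp C).

Lemma midsP C c : List.In c (mids C) <-> exists c1 c2, [/\ List.In c1 (endp C), List.In c2 (endp C) & c = midf c1 c2].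
Proof.
rewrite List.in_flat_map; split=> [[c1 [h1]]|[c1 [c2 [h1 h2 ->]]]].
  by rewrite List.in_map_iff => -[c2 [<- h2]]; exists c1, c2.
by exists c1; split=> //; rewrite List.in_map_iff; exists c2.
Qed.

Lemma DFun_mids C : (forall c, List.In c C -> DFun c) -> forall c, List.In c (mids C) -> DFun c.
Proof.
move=> hC c /midsP[c1 [c2 [h1 h2 ->]]].
have h c' : List.In c' (endp C) -> DFun c' by move=> [<-|[<-|/hC //]]; exact: DFun_const.
by apply: DFun_mul; [apply: DFun_add; exact: h | exact: DFun_const].
Qed.

Lemma list_max (P : R -> Prop) (C : seq (env -> R)) e c0 : List.In c0 C -> P (c0 e) ->
  exists2 c, List.In c C & P (c e) /\ forall c', List.In c' C -> P (c' e) -> c' e <= c e.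
Proof.
elim: C c0 => [//|c C IH] c0 h0 P0.
have [[c1 [h1 P1]]|no] := pselect (exists c1, List.In c1 C /\ P (c1 e)); last first.
  have Pc : P (c e) by move: h0 P0 => [<- //|h0 P0]; exfalso; apply: no; exists c0.
  exists c; [by left | split=> // c' [<- //|h' P']]; by exfalso; apply: no; exists c'.
have [c2 h2 [P2 m2]] := IH c1 h1 P1.
have [[Pc lt]|no] := pselect (P (c e) /\ c2 e < c e).
  exists c; [by left | split=> // c' [<- //|h' P']]; exact: le_trans (m2 c' h' P') (ltW lt).
exists c2; [by right | split=> // c' [<- P'|h' P']; last exact: m2].
by rewrite leNgt; apply/negP => lt; apply: no.
Qed.

Lemma mids_between (C : seq (env -> R)) e a : -1 <= a <= 1 ->
  (exists2 c, List.In c (mids C) & a = c e) \/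
  exists p q, [/\ -1 <= p, p < a, a < q, q <= 1 & forall x, p < x < q -> forall c, List.In c C -> x <> c e] /\
    exists2 c, List.In c (mids C) & p < c e < q.
Proof.
move=> ha; pose C' := endp C.
have mid c c' : List.In c C' -> List.In c' C' -> List.In (midf c c') (mids C).
  by move=> h h'; apply/midsP; exists c, c'.
have [[c [hc ac]]|no] := pselect (exists c, List.In c C' /\ a = c e).
  by left; exists (midf c c); [exact: mid | rewrite /midf ac; field].
right; have no' c : List.In c C' -> a <> c e by move=> hc ac; apply: no; exists c.
have [|c1 h1 [a1 m1]] := @list_max (fun x => is_true (x < a)) C' e (fun=> -1) (or_introl erefl).
  by rewrite lt_def; apply/andP; split; [apply/eqP/(no' (fun=> -1)); left | lra].
have [|c2 h2 [a2 m2]] := @list_max (fun x => is_true (- x > a)) [seq (fun e => - c e) | c <- C'] e (fun=> - 1) (or_intror (or_introl erefl)).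
  rewrite opprK lt_def; apply/andP; split; last by lra.
  by apply/eqP => h; apply: (no' (fun=> 1)); [right; left | ].
move: h2 => /inmapP[c3 h3 cE]; rewrite {}cE in a2 m2.
have m3 c : List.In c C' -> a < c e -> c3 e <= c e.
  by move=> hc ac; have := m2 (fun e => - c e); rewrite lerN2 opprK; apply => //; apply/inmapP; exists c.
rewrite opprK in a2.
exists (c1 e), (c3 e); split; last by exists (midf c1 c3); [exact: mid | rewrite /midf; lra].
split=> //.
- by apply: (m1 (fun=> -1)); [left | rewrite lt_def; apply/andP; split; [apply/eqP/(no' (fun=> -1)); left | lra]].
- by apply: (m3 (fun=> 1)); [right; left | rewrite lt_def; apply/andP; split; [apply/eqP => h; apply: (no' (fun=> 1)); [right; left | ] | lra]].
move=> x /andP[px xq] c hc xc; have hc' : List.In c C' by right; right.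
case: (ltgtP (c e) a) => h; last by apply: (no' c hc').
  by have := m1 c hc' h; rewrite -xc leNgt px.
by have := m3 c hc' h; rewrite -xc leNgt xq.
Qed.

(** By the case m of the induction, finitely many definable functions describe the abnormal first
    coordinates of the parameter. Between them the cardinality of the fibre is constant by
    [normal_card], so it suffices to bound it at the sample points; then the points are enumerated
    by repeated selection. *)
Theorem finsel m : forall A, Def1 A -> (forall e y, A y e -> -1 <= y <= 1) ->
  (forall e, cube m e -> forall b, isol (fun t => A t e) b) ->
  exists C : seq (env -> R), (forall c, List.In c C -> DFun c) /\
    forall e, cube m e -> forall y, A y e -> exists2 c, List.In c C & y = c e.
Proof.
elim: m => [|m IH] A hA bA isoA.
  have e0 e : cube 0 e -> e = fun=> 0 by move=> he; apply/funext => i; exact: (he i).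
  have c0 : cube 0 (fun=> 0) by [].
  have [s Hs] := @isol_finite R (fun t => A t (fun=> 0)) (-1) 1 (fun b _ => isoA _ c0 b).
  exists [seq (fun=> y) | y <- s]; split=> [c /inmapP[y _ ->]|e /e0 -> y Ay]; first exact: DFun_const.
  exists (fun=> y) => //; apply/inmapP; exists y => //.
  exact: in_In (Hs y (bA _ _ Ay) Ay).
have iso_ab e : cube m e -> forall a, isol (fun t => abnormal A t e) a.
  by move=> he; apply: abnormal_isol => // a b ha; apply: isoA; exact: cube_cons.
have [C [hC HC]] := IH (abnormal A) (Def_abnormal hA) (fun e y h => ltac:(by case: h => [[h1 h2] _]; rewrite h1 h2)) iso_ab.
(* The fibre over the sample point c e depends on the m coordinates of e only, so the induction
   hypothesis also bounds its cardinality. *)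
have card_le c : DFun c -> exists K, forall e, cube m e -> -1 <= c e <= 1 -> forall N, card_ge A N (c e) e -> (N <= K)%N.
  move=> hc; pose B y e := (-1 <= c e /\ c e <= 1) /\ A y (cons (c e) e).
  have hB : Def1 B.
    rewrite /B; dfp; [exact: DFun_tl | exact: DFun_tl | ].
    apply: (Def_at2 (t := fun e => e 0%N) (u := fun e => c (tl e)) 1 hA); dfn; exact: DFun_tl.
  have [|e he b|D [_ HD]] := IH B hB.
  - by move=> e y [_ /bA].
  - have [[h1 h2]|no] := pselect (-1 <= c e /\ c e <= 1).
      have hce : cube m.+1 (cons (c e) e) by apply: cube_cons; rewrite ?h1.
      by have [d d0 Hd] := isoA _ hce b; exists d => // w w0 wd [_]; exact: Hd.
    by exists 1 => // w _ _ [].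
  exists (size D) => e he /andP[h1 h2] N [s [us <- As]].
  have ss y : y \in s -> y \in [seq c' e | c' <- D].
    move=> ys; have [c' hc' ->] := HD e he y (conj (conj h1 h2) (As y ys)).
    elim: (D) hc' => //= d D' IHD [->|/IHD h]; rewrite inE ?eqxx // h orbT //.
  by have := uniq_leq_size us ss; rewrite size_map.
have [K HK] : exists K, forall e, cube m e -> forall c, List.In c (mids C) -> -1 <= c e <= 1 -> forall N, card_ge A N (c e) e -> (N <= K)%N.
  elim: (mids C) (DFun_mids hC) => [_|c D IHD hD]; first by exists 0%N.
  have [|K1 H1] := IHD; first by move=> c' h; apply: hD; right.
  have [K2 H2] := card_le c (hD c (or_introl erefl)).
  by exists (maxn K1 K2) => e he c' [<- h N /(H2 e he h)|h1 h2 N /(H1 e he _ h1 h2)] q; rewrite leq_max q ?orbT.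
have bound e : cube m.+1 e -> forall s : seq R, uniq s -> (forall y, y \in s -> A y e) -> (size s <= K)%N.
  move=> /cube_inv[a [e' [-> ha he']]] s us As.
  have cs : card_ge A (size s) a e' by exists s.
  have [[c hc ac]|[p [q [[p1 pa aq q1 noC] [c hc cpq]]]]] := @mids_between C e' a ha.
    by rewrite ac in ha cs; exact: (HK e' he' c hc ha).
  apply: (HK e' he' c hc); first by lra.
  apply: (@loc_const R (fun x => card_ge A (size s) x e') p q) cs => //; last by rewrite pa.
  move=> x hx; apply: normal_card => [a' y /bA //|b hb]; apply: contrapT => nn.
  have [|c' hc' xc] := HC e' he' x; last exact: noC hx c' hc' xc.
  by split; [split; lra | exists b].
(* The selected point is removed at each stage. A point never selected in K.+1 stages would leave
   K.+1 distinct selected points in one fibre, against the bound K. *)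
pose fix Ak (k : nat) : R -> env -> Prop := if k is k'.+1 then (fun y e => Ak k' y e /\ ~ (y = sel (Ak k') e)) else A.
have hAk k : Def1 (Ak k).
  elim: k => [//|k IHk] /=; apply: Def_and => //; apply: Def_not; apply: Def_eq; first exact: DFun_var.
  exact/DFun_tl/DFun_sel.
have AkA k y e : Ak k y e -> A y e by elim: k => [//|k IHk] /= [/IHk].
have AkS j k y e : (j <= k)%N -> Ak k y e -> Ak j y e.
  move=> jk; rewrite -(subnK jk); elim: (k - j)%N => [//|i IHi]; rewrite addSn => -[h _]; exact: IHi.
exists [seq sel (Ak k) | k <- iota 0 K.+1]; split=> [c /inmapP[k _ ->]|e he y Ay]; first exact/DFun_sel.
apply: contrapT => no.
have Ay' k : (k <= K.+1)%N -> Ak k y e.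
  elim: k => [//|k IHk] kK; split; first exact/IHk/ltnW.
  move=> yE; apply: no; exists (sel (Ak k)) => //; apply/inmapP; exists k => //.
  by apply: in_In; rewrite mem_iota.
have selk k : (k <= K.+1)%N -> Ak k (sel (Ak k) e) e.
  move=> kK; have [|//] := selP (hAk k) (e := e); exists y; [exact: bA Ay | exact: Ay'].
suff : (size [seq sel (Ak k) e | k <- iota 0 K.+1] <= K)%N by rewrite size_map size_iota ltnn.
apply: (bound e he).
  rewrite map_inj_in_uniq ?iota_uniq // => j k; rewrite !mem_iota /= !add0n => jK kK E.
  have lt i i' : (i' < K.+1)%N -> (i < i')%N -> sel (Ak i) e = sel (Ak i') e -> False.
    by move=> iK ii' Ei; have := AkS _ _ _ _ ii' (selk i' (ltnW iK)) => -[_]; rewrite Ei.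
  by case: (ltngtP j k) => // h; [case: (lt j k) | case: (lt k j)].
move=> z /mapP[k]; rewrite mem_iota /= add0n => kK ->; exact: AkA (selk k (ltnW kK)).
Qed.

End FiniteSelection.

(** * Chains in definable families *)

Section Chains.
Context {R : realType}.

Inductive chn (T : Type) (d : T -> T -> R) (Z : T -> Prop) (delta : R) (x : T) : R -> T -> Prop :=
| chn0 : Z x -> chn d Z delta x 0 x
| chnS L y z : chn d Z delta x L y -> Z z -> d y z <= delta -> chn d Z delta x (L + d y z) z.

(** The substitute for a path of length at most M in Z: chains of total length at most M with
    arbitrarily small steps. In closed bounded Euclidean sets [conn_path] recovers the path. *)
Definition conn (T : Type) (d : T -> T -> R) (Z : T -> Prop) (M : R) (x y : T) :=
  forall delta : R, 0 < delta -> exists2 L, L <= M & chn d Z delta x L y.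

Section Theory.
Variables (T : Type) (d : T -> T -> R).
Hypothesis (dC : forall x y, d x y = d y x) (d0 : forall x y, 0 <= d x y).
Implicit Types (Z : T -> Prop) (x y z : T).

Lemma chn_trans Z delta x y z L L' : chn d Z delta x L y -> chn d Z delta y L' z -> chn d Z delta x (L + L') z.
Proof.
move=> h; elim=> [_|L1 y1 z1 _ IH Zz le]; first by rewrite addr0.
by rewrite addrA; apply: chnS.
Qed.

Lemma chn_in Z delta x y L : chn d Z delta x L y -> [/\ Z x, Z y & 0 <= L].
Proof. by elim=> [Zx|L1 y1 z1 _ [Zx Zy L0] Zz _]; split=> //; rewrite addr_ge0. Qed.

Lemma chn_sym Z delta x y L : chn d Z delta x L y -> chn d Z delta y L x.
Proof.
elim=> [Zx|L1 y1 z1 h IH Zz le]; first exact: chn0.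
have h1 : chn d Z delta z1 (0 + d z1 y1) y1.
  by apply: chnS; [exact: chn0 | have [] := chn_in h | rewrite dC].
by rewrite addrC dC -[d z1 y1]add0r; exact: chn_trans h1 IH.
Qed.

Lemma chn_mono Z Z' delta delta' x y L : (forall z, Z z -> Z' z) -> delta <= delta' ->
  chn d Z delta x L y -> chn d Z' delta' x L y.
Proof.
move=> ZZ' dd'; elim=> [Zx|L1 y1 z1 _ IH Zz le]; first by apply: chn0; exact: ZZ'.
by apply: chnS => //; [exact: ZZ' | exact: le_trans le dd'].
Qed.

Lemma conn_refl Z M x : Z x -> 0 <= M -> conn d Z M x x.
Proof. by move=> Zx M0 delta _; exists 0 => //; exact: chn0. Qed.

Lemma conn_trans Z M M' x y z : conn d Z M x y -> conn d Z M' y z -> conn d Z (M + M') x z.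
Proof.
move=> h h' delta delta0; have [L LM c] := h _ delta0; have [L' LM' c'] := h' _ delta0.
by exists (L + L'); [exact: lerD | exact: chn_trans c c'].
Qed.

Lemma conn_sym Z M x y : conn d Z M x y -> conn d Z M y x.
Proof. by move=> h delta delta0; have [L LM c] := h _ delta0; exists L => //; exact: chn_sym. Qed.

Lemma conn_mono Z Z' M M' x y : (forall z, Z z -> Z' z) -> M <= M' -> conn d Z M x y -> conn d Z' M' x y.
Proof.
move=> ZZ' MM' h delta delta0; have [L LM c] := h _ delta0.
by exists L; [exact: le_trans LM MM' | exact: chn_mono c].
Qed.

Lemma conn_in Z M x y : conn d Z M x y -> Z x /\ Z y.
Proof. by move=> /(_ 1 ltr01)[L _ /chn_in[]]. Qed.

End Theory.

Lemma conn_map (T T' : Type) (d : T -> T -> R) (d' : T' -> T' -> R) (f : T -> T') (c : R) (Z : T -> Prop) (Z' : T' -> Prop) M x y :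
  0 <= c -> (forall x y, 0 <= d x y) -> (forall x, Z x -> Z' (f x)) -> (forall x y, Z x -> Z y -> d' (f x) (f y) <= c * d x y) ->
  conn d Z M x y -> conn d' Z' (c * M) (f x) (f y).
Proof.
move=> c0 d0 ZZ' dd h delta delta0.
have c1 : 0 < c + 1 by rewrite ltr_wpDl.
have [L LM ch] := h (delta / (c + 1)) (divr_gt0 delta0 c1).
suff [L' LL' ch'] : exists2 L', L' <= c * L & chn d' Z' delta (f x) L' (f y).
  by exists L' => //; apply: le_trans LL' _; rewrite ler_wpM2l.
elim: ch => [Zx|L1 y1 z1 h1 [L' LL' ch'] Zz le]; first by exists 0; rewrite ?mulr0 //; apply: chn0; exact: ZZ'.
have [_ Zy1 _] := chn_in d0 h1; have := dd _ _ Zy1 Zz => le'.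
exists (L' + d' (f y1) (f z1)); first by rewrite mulrDr lerD.
apply: chnS => //; first exact: ZZ'.
apply: le_trans le' _; have := ler_wpM2l c0 le; move: le; rewrite ler_pdivlMr // => le.
have := d0 y1 z1; nra.
Qed.

Local Notation env := (nat -> R).
Local Notation Def1 A := (Def (fun e : env => A (e 0%N) (tl e))).

(** Preferred here to the Euclidean distance because it is exactly additive along curves with
    monotone coordinates. *)
Definition l1 n (x y : env) : R := \sum_(i < n) `|x i - y i|.

Lemma l1C n x y : l1 n x y = l1 n y x.
Proof. by apply: eq_bigr => i _; rewrite distrC. Qed.

Lemma l1_ge0 n x y : 0 <= l1 n x y.
Proof. exact: sumr_ge0. Qed.

Lemma l1_cons n (a : R) x y : l1 n.+1 (cons a x) (cons a y) = l1 n x y.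
Proof. by rewrite /l1 big_ord_recl /= subrr normr0 add0r. Qed.

Lemma l1_small n (x y : env) (r : R) : (forall i, (i < n)%N -> `|x i - y i| <= r) -> l1 n x y <= n%:R * r.
Proof.
move=> h; apply: le_trans (_ : \sum_(i < n) r <= _); first by apply: ler_sum => i _; exact: h.
by rewrite sumr_const card_ord mulr_natl.
Qed.

(* Each coordinate is monotone, so the lengths of the steps add up. *)
Lemma mono_conn n (Z : env -> Prop) (f : R -> env) (p q : R) :
  (forall x, p < x < q -> Z (f x)) ->
  (forall i, (i < n)%N -> forall x, p < x < q -> cont (fun t => f t i) x) ->
  (forall i, (i < n)%N -> (forall x y, p < x -> x <= y -> y < q -> f x i <= f y i) \/
                          (forall x y, p < x -> x <= y -> y < q -> f y i <= f x i)) ->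
  forall a b, p < a < q -> p < b < q -> conn (l1 n) Z (l1 n (f a) (f b)) (f a) (f b).
Proof.
move=> Zf cf mf.
have add x y z : p < x -> x <= y -> y <= z -> z < q -> l1 n (f x) (f y) + l1 n (f y) (f z) = l1 n (f x) (f z).
  move=> px xy yz zq; rewrite /l1 -big_split /=; apply: eq_bigr => i _.
  have [m|m] := mf i (ltn_ord i); have h1 := m x y px xy (le_lt_trans yz zq);
    have h2 := m y z (lt_le_trans px xy) yz zq.
    by rewrite !ler0_norm ?subr_le0 //; [ring | exact: le_trans h1 h2].
  by rewrite !ger0_norm ?subr_ge0 //; [ring | exact: le_trans h2 h1].
have near x delta : p < x < q -> 0 < delta -> exists2 r : R, 0 < r & forall y, `|y - x| <= r -> l1 n (f y) (f x) <= delta.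
  move=> hx delta0.
  have /choice[r Hr] : forall i : 'I_n, exists r : R, 0 < r /\ forall y, `|y - x| <= r -> `|f y i - f x i| <= delta / n.+1%:R.
    by move=> i; have [|r r0 Hr] := cf i (ltn_ord i) x hx (delta / n.+1%:R); [rewrite divr_gt0 // ltr0n | exists r].
  have [r0 r00 Hr0] := fin_min (fun i => proj1 (Hr i)).
  exists r0 => // y hy; apply: le_trans (l1_small (r := delta / n.+1%:R) _) _.
    by move=> i im; have [_] := Hr (Ordinal im); apply; exact: le_trans hy (Hr0 _).
  by rewrite mulrC mulrAC ler_pdivrMr ?ltr0n // ler_pM2l // ler_nat.
have up a b : p < a -> a <= b -> b < q -> conn (l1 n) Z (l1 n (f a) (f b)) (f a) (f b).
  move=> pa ab bq delta delta0; exists (l1 n (f a) (f b)) => //.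
  apply: (@real_ind R (fun t => chn (l1 n) Z delta (f a) (l1 n (f a) (f t)) (f t)) a b) => //.
  - have -> : l1 n (f a) (f a) = 0 by rewrite /l1 big1 // => i _; rewrite subrr normr0.
    by apply: chn0; apply: Zf; rewrite pa (le_lt_trans ab).
  - move=> x ax xb ch; have hx : p < x < q by rewrite (lt_le_trans pa) // (lt_trans xb).
    have [r r0 Hr] := near x delta hx delta0; exists (x + r); first by rewrite ltrDl.
    move=> z xz zr zb; have zq := le_lt_trans zb bq.
    rewrite -(add a x z pa ax (ltW xz) zq).
    apply: chnS => //; first by apply: Zf; rewrite zq andbT (lt_trans _ xz) //; case/andP: hx.
    by rewrite l1C; apply: Hr; rewrite ger0_norm; lra.
  move=> x ax xb H; have hx : p < x < q by rewrite (lt_trans pa) // (le_lt_trans xb).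
  have [r r0 Hr] := near x delta hx delta0.
  pose y := Num.max a (x - r).
  have yx : y < x by rewrite gt_max ax; lra.
  have ay : a <= y by rewrite le_max lexx.
  have yr : x - r <= y by rewrite le_max lexx orbT.
  rewrite -(add a y x pa ay (ltW yx) (proj2 (andP hx))).
  apply: chnS; [exact: H | exact: Zf | apply: Hr; rewrite ler0_norm; lra].
move=> a b /andP[pa aq] /andP[pb bq]; case: (leP a b) => ab; first exact: up.
by rewrite l1C; apply: conn_sym; [exact: l1C | exact: l1_ge0 | apply: up => //; exact: ltW].
Qed.

Definition vec n (g : nat -> env -> R) (e : env) : env := fun i => if (i < n)%N then g i e else 0.

Definition fib n (P : env -> Prop) (e y : env) := cube n y /\ P (cat n y e).

(** The reindexing that turns the first fibre coordinate into a parameter, on which the inductions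
    on the fibre dimension rest. *)
Lemma cat_cons n (a : R) (y e : env) :
  cat n.+1 (cons a y) e = (fun i => cat n y (cons a e) (if i is j.+1 then (if (j < n)%N then j else j.+1) else n)).
Proof.
apply/funext => -[|i]; first by rewrite /cat /= ltnn subnn.
rewrite /cat ltnS; case: (ltnP i n) => h /=; first by rewrite h.
by rewrite ltnNge leqW //= subSS subSn.
Qed.

Lemma evt_loc (Q : R -> Prop) (a sg : R) : `|sg| = 1 -> evt (fun s => Q (a + sg * s)) ->
  evt (fun s => exists2 d : R, 0 <= d <= 1 & 0 < d /\ forall w : R, -1 <= w <= 1 -> - d <= w -> w <= d -> Q (a + sg * s + w)).
Proof.
move=> sg1 [d d0 H]; exists d => // s s0 sd; pose dd := Num.min (Num.min (s / 2) ((d - s) / 2)) 1.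
have dd0 : 0 < dd by rewrite !lt_min ltr01 andbT; apply/andP; split; lra.
have [[dds ddd] dd1] : (dd <= s / 2 /\ dd <= (d - s) / 2) /\ dd <= 1 by rewrite !ge_min !lexx !orbT.
exists dd; first by rewrite ltW.
split=> // w _ w1 w2.
have -> : a + sg * s + w = a + sg * (s + sg * w) by have [->|->] := norm1 sg1; ring.
have sw : - dd <= sg * w <= dd by rewrite -ler_norml normrM sg1 mul1r ler_norml w1.
by apply: H; lra.
Qed.

Lemma evt_all_In (T : Type) (s : seq T) (P : T -> R -> Prop) : (forall t, List.In t s -> evt (P t)) ->
  evt (fun r => forall t, List.In t s -> P t r).
Proof.
elim: s => [|t s IH] H; first by apply: evtT.
have h := IH (fun t' h => H t' (or_intror h)).
by apply: evtW (evtI (H t (or_introl erefl)) h) => r _ [h1 h2] t' [<-//|/h2].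
Qed.

Lemma Def_all_In (T : Type) (s : seq T) (P : T -> env -> Prop) : (forall t, List.In t s -> Def (P t)) ->
  Def (fun e => forall t, List.In t s -> P t e).
Proof.
elim: s => [|t s IH] H; first by apply: Def_iff (Def_const True) => e; split.
have h := IH (fun t' h => H t' (or_intror h)).
apply: Def_iff (Def_and (H t (or_introl erefl)) h) => e.
by split=> [[h1 h2] t' [<-//|/h2 //]|h']; split=> [|t' ht']; apply: h'; by [left|right].
Qed.

(* Every point of a fibre is joined inside the fibre, by chains of uniformly bounded length, to one of
   finitely many definable points.  One slices along the first coordinate, and moves the points found in the
   slices along the intervals on which they are continuous and monotone. *)
Theorem fibre_conn n : forall m P, Def P -> exists (G : seq (nat -> env -> R)) (M : R),
  [/\ 0 <= M, forall g, List.In g G -> forall i, DFun (g i) &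
  forall e, cube m e -> forall y, fib n P e y -> exists2 g, List.In g G & conn (l1 n) (fib n P e) M y (vec n g e)].
Proof.
elim: n => [|n IH] m P hP.
  exists [:: fun _ _ => 0], 0; split=> // [g [<- i|//]|e he y hy]; first exact: DFun_const.
  exists (fun _ _ => 0); first by left.
  have -> : vec 0 (fun _ _ => 0) e = y by apply/funext => i; have [h _] := hy; rewrite (h i).
  exact: conn_refl.
pose P' E := P (fun i => E (if i is j.+1 then (if (j < n)%N then j else j.+1) else n)).
have hP' : Def P' by exact: Def_pull.
have fibE a y e : -1 <= a <= 1 -> fib n P' (cons a e) y -> fib n.+1 P e (cons a y).
  by move=> ha [hy h]; split; [exact: cube_cons | rewrite cat_cons].
have [G [M [M0 hG HG]]] := IH m.+1 P' hP'.
pose Zf (g : nat -> env -> R) (E : env) := fib n P' E (vec n g E).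
have hZ g : List.In g G -> Def (Zf g).
  move=> gG; apply: Def_and.
    apply: (Def_iff (P := fun E => forall i, (i < n)%N -> -1 <= g i E /\ g i E <= 1)) => [E|].
      split=> h i; last by move=> im; have := h i; rewrite /vec im => /andP.
      by rewrite /vec; case: ltnP => // im; have [h1 h2] := h i im; rewrite h1.
    apply: (Def_alln (P := fun i E => -1 <= g i E /\ g i E <= 1)) => i _.
    by apply: Def_and; apply: Def_le; try exact: DFun_const; exact: hG.
  apply: (Def_iff (P := fun E => P' (fun i => if (i < n)%N then g i E else E (i - n)%N))) => [E|].
    suff -> : cat n (vec n g E) E = (fun i => if (i < n)%N then g i E else E (i - n)%N) by [].
    by apply/funext => i; rewrite /cat /vec; case: ltnP.
  apply: (Def_app (h := fun i E => if (i < n)%N then g i E else E (i - n)%N) hP') => i.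
  by case: (i < n)%N; [exact: hG | exact: DFun_var].
pose lc g a e := exists2 d : R, 0 <= d <= 1 & 0 < d /\ forall w : R, -1 <= w <= 1 -> - d <= w -> w <= d ->
  (Zf g (cons (a + w) e) <-> Zf g (cons a e)).
pose good g a e := (forall i, (i < n)%N -> nice (g i) a e) /\ lc g a e.
pose Crit a e := (-1 <= a /\ a <= 1) /\ ~ (forall g, List.In g G -> good g a e).
have hCrit : Def1 Crit.
  rewrite /Crit; apply: Def_and; first by dfp.
  apply: Def_not; apply: Def_all_In => g gG; apply: Def_and.
    by apply: (Def_alln (P := fun i E => nice (g i) (E 0%N) (tl E))) => i _; apply: Def_nice; exact: hG.
  have hZ' t k : DFun t -> Def (fun e => Zf g (cons (t e) (fun q => e (k + q)%N))).
    move=> ht; apply: (Def_app (h := fun i e => if i is j.+1 then e (k + j)%N else t e) (hZ g gG)) => -[|j] //; exact: DFun_var.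
  apply: Def_ex; apply: Def_and; first by dfp.
  apply: Def_all; apply: Def_imp; first by dfp.
  apply: Def_imp; first by dfp.
  apply: Def_eqv; [apply: (hZ' (fun e => e 2%N + e 0%N) 3%N) | apply: (hZ' (fun e => e 2%N) 3%N)]; dfn.
have isoC e a : isol (fun t => Crit t e) a.
  have [//|[sg sg1 h]] := isol_or e a hCrit; exfalso.
  suff h' : evt (fun s => forall g, List.In g G -> good g (a + sg * s) e).
    by have [s _ [[_ q] q']] := evt_ex (evtI h h').
  apply: evt_all_In => g gG; apply: evtI.
    by apply: evt_all => i _; apply: nice_evt => //; exact: hG.
  have [B hB] : exists B : Prop, evt (fun s => Zf g (cons (a + sg * s) e) <-> B).
    have [q|q] := tame_line e a sg (hZ g gG); [exists True | exists False]; apply: evtW q => s _ q; split=> //.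
  apply: evtW (evtI hB (evt_loc (Q := fun t => Zf g (cons t e) <-> B) sg1 hB)) => s _ [hs [d hd [d0 Hd]]].
  by exists d => //; split=> // w w1 w2 w3; rewrite hs; exact: Hd.
have [C [hC HC]] := finsel hCrit (fun e y h => ltac:(by case: h => [[h1 h2] _]; rewrite h1 h2)) (fun e _ => isoC e) (m := m).
pose newg (c : env -> R) (g : nat -> env -> R) : nat -> env -> R := fun i e => if i is j.+1 then g j (cons (c e) e) else c e.
have newgE c g e : vec n.+1 (newg c g) e = cons (c e) (vec n g (cons (c e) e)).
  by apply/funext => -[|i].
(* To the bound M inside a slice is added the cost of moving along a monotone curve in the cube, at
   most 2 for each of the n.+1 coordinates. *)
exists (List.flat_map (fun c => List.map (newg c) G) (mids C)), (M + n.+1%:R * 2); split.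
- by rewrite addr_ge0 // mulr_ge0.
- move=> g /List.in_flat_map[c [hc /List.in_map_iff[g1 [<- hg1]]]] [|i]; first exact: DFun_mids hC _ hc.
  by apply: DFun_cons; [exact: hG | exact: DFun_mids hC _ hc].
move=> e he y [/cube_inv[a [y' [-> ha hy']]] hy].
have hcons := cube_cons ha he.
have fy' : fib n P' (cons a e) y' by split=> //; rewrite cat_cons in hy.
have [g gG hconn] := HG _ hcons _ fy'.
have Za : Zf g (cons a e) by have [] := conn_in (l1_ge0 n) hconn.
have h1 : conn (l1 n.+1) (fib n.+1 P e) M (cons a y') (cons a (vec n g (cons a e))).
  rewrite -[M]mul1r; apply: (conn_map (d := l1 n) (Z := fib n P' (cons a e)) (f := cons a)) => //; first exact: l1_ge0.
    by move=> x; exact: fibE.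
  by move=> x z _ _; rewrite l1_cons mul1r.
have inG c : List.In c (mids C) -> List.In (newg c g) (List.flat_map (fun c => List.map (newg c) G) (mids C)).
  by move=> hc; apply/List.in_flat_map; exists c; split=> //; apply/List.in_map_iff; exists g.
have [[c hc ac]|[p [q [[p1 pa aq q1 noC] [c hc cpq]]]]] := @mids_between R C e a ha.
  exists (newg c g); first exact: inG.
  rewrite newgE -ac; apply: conn_mono h1 => //; by rewrite lerDl mulr_ge0.
exists (newg c g); first exact: inG.
have gd x : p < x < q -> forall g, List.In g G -> good g x e.
  move=> hx; apply: contrapT => nn; have [|c' hc' xc] := HC e he x; last exact: noC hx c' hc' xc.
  by split=> //; split; lra.
have Zx x : p < x < q -> Zf g (cons x e).
  move=> hx; apply: (@loc_const R (fun t => Zf g (cons t e)) p q _ a x) => //; last by rewrite pa.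
  move=> z hz; have [_ [d /andP[_ d1] [d0 Hd]]] := gd z hz g gG; exists d => // w; rewrite ler_norml => hw.
  by rewrite -{1}(add_sub z w); apply: Hd; lra.
pose f t := cons t (vec n g (cons t e)).
have nm i : (i < n)%N -> _ := fun im => @nice_mono R (g i) e p q (hG g gG i) (fun x hx => (proj1 (gd x hx g gG)) i im).
have h2 : conn (l1 n.+1) (fib n.+1 P e) (l1 n.+1 (f a) (f (c e))) (f a) (f (c e)).
  apply: (@mono_conn n.+1 (fib n.+1 P e) f p q) => //; last by rewrite pa.
  - by move=> x hx; apply: fibE; [lra | exact: Zx].
  - move=> [|i] im x hx.
      by move=> eps eps0; exists eps => // z; rewrite /f.
    by rewrite /f /cons /vec ltnS in im *; rewrite im; have [h _] := nm i im; exact: h.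
  - move=> [|i] im; first by left.
    by rewrite /f /cons /vec ltnS in im *; rewrite im; have [_] := nm i im.
rewrite newgE; apply: conn_mono (conn_trans h1 h2) => //.
rewrite lerD2l; apply: l1_small => i im.
have cf t : p < t < q -> cube n.+1 (f t) by move=> ht; have [] := fibE t _ e _ (Zx t ht); first by lra.
have := cf a; rewrite pa aq => /(_ isT i); have := cf _ cpq i; rewrite im ler_norml; lra.
Qed.

End Chains.

(** * Uniform bounds on the inner diameter of fibres *)

Section FibreChains.
Context {R : realType}.
Local Notation env := (nat -> R).
Local Notation Def1 A := (Def (fun e : env => A (e 0%N) (tl e))).

Section Labels.
Variables (T : Type) (d : T -> T -> R) (Z : T -> Prop) (M delta : R).
Hypothesis (dC : forall x y, d x y = d y x) (d0 : forall x y, 0 <= d x y) (delta0 : 0 < delta) (delta1 : delta <= 1).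

Let lab (P : seq T) z := Z z /\ exists2 p, List.In p P & conn d Z M z p.

(** The two outer parts of a chain avoid one label and are counted with k' labels; the steps into
    and out of the middle part cost at most 1 each, and the middle part is replaced by a detour
    through the label, of length M + M. *)
Fixpoint lab_len (k : nat) : R := if k is k'.+1 then lab_len k' + (1 + (M + M)) + (1 + lab_len k') else 0.

(* Cut out the part of the chain between the first and the last visit to the label [p]. *)
Lemma label_chn (P : seq T) x y L : 0 <= M -> chn d (lab P) delta x L y ->
  exists2 L', L' <= lab_len (size P) & chn d Z delta x L' y.
Proof.
move=> M0; have len0 k : 0 <= lab_len k by elim: k => [|k IH] //=; lra.
elim: P x y L => [|p P IH] x y L h; first by have [[_ [p []]]] := chn_in d0 h.
have step1 u v : d u v <= delta -> Z u -> Z v -> chn d Z delta u (0 + d u v) v.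
  by move=> duv Zu Zv; apply: chnS => //; exact: chn0.
pose before u := u = x \/ exists L u', chn d (lab P) delta x L u' /\ d u' u <= delta.
pose after v z := v = z \/ exists L v', chn d (lab P) delta v' L z /\ d v v' <= delta.
have [[L' h']|[u [v [cu cv bu av]]]] : (exists L', chn d (lab P) delta x L' y) \/
    exists u v, [/\ conn d Z M u p, conn d Z M v p, before u & after v y].
  have labP z : lab (p :: P) z -> conn d Z M z p \/ lab P z.
    by move=> [Zz [q [<-|qP] c]]; [left | right; split=> //; exists q].
  elim: h => [/labP[c|l]|L1 y1 z1 h1 IH1 /labP[c|l] le].
  - by right; exists x, x; split=> //; left.
  - by left; exists 0; exact: chn0.
  - right; case: IH1 => [[L' h']|[u [v [cu cv bu av]]]]; last by exists u, z1; split=> //; left.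
    by exists z1, z1; split=> //; [right; exists L', y1 | left].
  - case: IH1 => [[L' h']|[u [v [cu cv bu av]]]]; first by left; exists (L' + d y1 z1); exact: chnS.
    right; exists u, v; split=> //; case: av => [->|[L' [v' [h' dv]]]].
      by right; exists 0, z1; split=> //; exact: chn0.
    by right; exists (L' + d y1 z1), v'; split=> //; exact: chnS.
  have [L1 l1 c1] := IH _ _ _ h'; exists L1 => //=; have := len0 (size P); lra.
have cuv := conn_trans cu (conn_sym dC d0 cv); have [Zu Zv] := conn_in d0 cuv.
have [L2 l2 c2] := cuv _ delta0.
have [L1 l1 c1] : exists2 L1, L1 <= lab_len (size P) + 1 & chn d Z delta x L1 u.
  case: bu => [<-|[L1 [u' [/IH[L3 l3 c3] du]]]]; first by exists 0; [have := len0 (size P); lra | exact: chn0].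
  by exists (L3 + d u' u); [exact: lerD l3 (le_trans du delta1) | apply: chnS].
have [L3 l3 c3] : exists2 L1, L1 <= lab_len (size P) + 1 & chn d Z delta v L1 y.
  case: av => [<-|[L3 [v' [/IH[L4 l4 c4] dv]]]]; first by exists 0; [have := len0 (size P); lra | exact: chn0].
  have [Zv' _ _] := chn_in d0 c4.
  by exists ((0 + d v v') + L4); [rewrite add0r addrC; exact: lerD l4 (le_trans dv delta1) | apply: chn_trans c4; exact: step1].
exists (L1 + L2 + L3); last exact: chn_trans (chn_trans c1 c2) c3.
rewrite /=; lra.
Qed.

End Labels.

Definition cc (T : Type) (d : T -> T -> R) (Z : T -> Prop) x y := forall delta : R, 0 < delta -> exists L, chn d Z delta x L y.

Lemma conn_cc (T : Type) (d : T -> T -> R) (Z : T -> Prop) M x y : conn d Z M x y -> cc d Z x y.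
Proof. by move=> h delta /h[L _]; exists L. Qed.

Lemma cc_trans (T : Type) (d : T -> T -> R) (Z : T -> Prop) x y z : cc d Z x y -> cc d Z y z -> cc d Z x z.
Proof.
move=> h h' delta delta0; have [L c] := h _ delta0; have [L' c'] := h' _ delta0.
by exists (L + L'); exact: chn_trans c c'.
Qed.

Lemma cc_sym (T : Type) (d : T -> T -> R) (dC : forall x y, d x y = d y x) (d0 : forall x y, 0 <= d x y) (Z : T -> Prop) x y :
  cc d Z x y -> cc d Z y x.
Proof. by move=> h delta /h[L c]; exists L; exact: chn_sym c. Qed.

(** The number of labels, namely the points given by [fibre_conn], does not depend on the parameter;
    therefore neither does the length to which [label_chn] shortens a chain. *)
Theorem fibre_diam n m P : Def P -> exists2 M : R, 0 <= M &
  forall e, cube m e -> forall x y, cc (l1 n) (fib n P e) x y -> conn (l1 n) (fib n P e) M x y.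
Proof.
move=> hP; have [G [M [M0 _ HG]]] := @fibre_conn R n m P hP.
exists (lab_len M (size G)) => [|e he x y h delta delta0].
  by elim: (size G) => //= k IH; lra.
(* Steps are also kept below 1, since [lab_len] charges 1 for each step between two parts. *)
have m0 : 0 < Num.min delta 1 by rewrite lt_min delta0 ltr01.
have [L c] := h _ m0.
pose Q := [seq vec n g e | g <- G].
have c' : chn (l1 n) (fun z => fib n P e z /\ exists2 p, List.In p Q & conn (l1 n) (fib n P e) M z p) (Num.min delta 1) x L y.
  apply: chn_mono c => // z hz; split=> //; have [g gG hc] := HG e he z hz.
  by exists (vec n g e) => //; apply/inmapP; exists g.
have [|L' l' c2] := label_chn (@l1C R n) (@l1_ge0 R n) m0 _ M0 c'; first by rewrite ge_min lexx orbT.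
exists L'; first by move: l'; rewrite size_map.
by apply: chn_mono c2; rewrite // ge_min lexx.
Qed.

Lemma selvec n : forall P, Def P -> exists g : nat -> env -> R, (forall i, DFun (g i)) /\
  forall e, (exists2 y, cube n y & P (cat n y e)) -> cube n (vec n g e) /\ P (cat n (vec n g e) e).
Proof.
elim: n => [|n IH] P hP.
  exists (fun _ _ => 0); split=> [i|e [y hy h]]; first exact: DFun_const.
  have -> : vec 0 (fun _ _ => 0) e = y by apply/funext => i; rewrite (hy i).
  by [].
pose P' E := P (fun i => E (if i is j.+1 then (if (j < n)%N then j else j.+1) else n)).
have hP' : Def P' by exact: Def_pull.
have P'E a y e : P (cat n.+1 (cons a y) e) <-> P' (cat n y (cons a e)) by rewrite cat_cons.
have [g [hg Hg]] := IH P' hP'.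
pose A a e := P' (cat n (vec n g (cons a e)) (cons a e)) /\ cube n (vec n g (cons a e)).
have hA : Def1 A.
  apply: Def_and.
    apply: (Def_iff (P := fun E => P' (fun i => if (i < n)%N then g i E else E (i - n)%N))) => [E|].
      suff -> : cat n (vec n g (cons (E 0%N) (tl E))) (cons (E 0%N) (tl E)) = (fun i => if (i < n)%N then g i E else E (i - n)%N) by [].
      by rewrite consE; apply/funext => i; rewrite /cat /vec; case: ltnP.
    apply: (Def_app (h := fun i E => if (i < n)%N then g i E else E (i - n)%N) hP') => i.
    by case: (i < n)%N; [exact: hg | exact: DFun_var].
  apply: (Def_iff (P := fun E => forall i, (i < n)%N -> -1 <= g i E /\ g i E <= 1)) => [E|].
    rewrite consE; split=> h i; last by move=> im; have := h i; rewrite /vec im => /andP.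
    by rewrite /vec; case: ltnP => // im; have [h1 h2] := h i im; rewrite h1.
  apply: (Def_alln (P := fun i E => -1 <= g i E /\ g i E <= 1)) => i _.
  by apply: Def_and; apply: Def_le; try exact: DFun_const; exact: hg.
exists (fun i e => if i is j.+1 then g j (cons (sel A e) e) else sel A e); split=> [[|i]|e [y hy Py]].
- exact: DFun_sel.
- by apply: DFun_cons; [exact: hg | exact: DFun_sel].
have -> : vec n.+1 (fun i e => if i is j.+1 then g j (cons (sel A e) e) else sel A e) e = cons (sel A e) (vec n g (cons (sel A e) e)).
  by apply/funext => -[|i].
have [a [y' [yE ha hy']]] := cube_inv hy.
have [|h1 [h2 h3]] := selP hA (e := e).
  exists a => //; have [|h1 h2] := Hg (cons a e); last by split.
  by exists y' => //; apply/P'E; rewrite -yE.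
by split; [exact: cube_cons | apply/P'E].
Qed.

End FibreChains.

(** * Paths and chains in Euclidean space *)

Section EuclideanPaths.
Context {R : realType} {N : nat}.
Local Notation V := ('rV[R]_N).
Implicit Types (x y z : V) (Z : set V).

Definition dist x y : R := enorm (x - y).

Lemma enorm_ge0 x : 0 <= enorm x.
Proof. exact: sqrtr_ge0. Qed.

Lemma sumsq_ge0 (I : finType) (a : I -> R) : 0 <= \sum_i a i ^+ 2.
Proof. by apply: sumr_ge0 => i _; exact: sqr_ge0. Qed.

Lemma enorm_sq x : enorm x ^+ 2 = \sum_i x 0 i ^+ 2.
Proof. by rewrite sqr_sqrtr // sumsq_ge0. Qed.

Lemma cauchy_schwarz (I : finType) (a b : I -> R) :
  (\sum_i a i * b i) ^+ 2 <= (\sum_i a i ^+ 2) * (\sum_i b i ^+ 2).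
Proof.
set S := \sum_i a i * b i; set A := \sum_i a i ^+ 2; set B := \sum_i b i ^+ 2.
have B0 : 0 <= B := sumsq_ge0 b.
have [Bz|Bp] := eqVneq B 0.
  suff -> : S = 0 by rewrite Bz mulr0 expr0n.
  apply: big1 => i _; have /psumr_eq0P := Bz => /(_ (fun i _ => sqr_ge0 _) i isT)/eqP.
  by rewrite sqrf_eq0 => /eqP ->; rewrite mulr0.
have : 0 <= \sum_i (a i * B - b i * S) ^+ 2 := sumsq_ge0 _.
have -> : \sum_i (a i * B - b i * S) ^+ 2 = B * (A * B - S ^+ 2).
  transitivity (\sum_i (B ^+ 2 * a i ^+ 2 - 2 * B * S * (a i * b i) + S ^+ 2 * b i ^+ 2)).
    by apply: eq_bigr => i _; ring.
  by rewrite big_split /= sumrB -!mulr_sumr -/A -/B -/S; ring.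
by rewrite pmulr_rge0 ?lt_def ?Bp // subr_ge0.
Qed.

Lemma enormD x y : enorm (x + y) <= enorm x + enorm y.
Proof.
rewrite -(@ler_pXn2r _ 2) ?nnegrE ?addr_ge0 ?enorm_ge0 // sqrrD !enorm_sq.
have -> : \sum_i (x + y) 0 i ^+ 2 = \sum_i x 0 i ^+ 2 + 2 * (\sum_i x 0 i * y 0 i) + \sum_i y 0 i ^+ 2.
  by rewrite mulr_sumr -!big_split /=; apply: eq_bigr => i _; rewrite mxE; ring.
rewrite lerD2r lerD2l -mulr_natl.
suff h : \sum_i x 0 i * y 0 i <= enorm x * enorm y by lra.
apply: le_trans (ler_norm _) _; rewrite -(@ler_pXn2r _ 2) ?nnegrE ?mulr_ge0 ?enorm_ge0 //.
by rewrite real_normK ?num_real // exprMn !enorm_sq; exact: cauchy_schwarz.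
Qed.

Lemma enormN x : enorm (- x) = enorm x.
Proof. by rewrite /enorm; congr Num.sqrt; apply: eq_bigr => i _; rewrite mxE sqrrN. Qed.

Lemma enorm0 : enorm (0 : V) = 0.
Proof. by rewrite /enorm big1 ?sqrtr0 // => i _; rewrite mxE expr0n. Qed.

Lemma enorm_coord x i : `|x 0 i| <= enorm x.
Proof.
rewrite -(@ler_pXn2r _ 2) ?nnegrE ?enorm_ge0 // real_normK ?num_real // enorm_sq.
by rewrite (bigD1 i) //= lerDl sumr_ge0 // => j _; exact: sqr_ge0.
Qed.

Lemma enorm_eq0 x : enorm x = 0 -> x = 0.
Proof.
move=> x0; apply/rowP => i; rewrite mxE; apply/eqP; rewrite -normr_eq0 eq_le normr_ge0 andbT.
by rewrite -x0; exact: enorm_coord.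
Qed.

Lemma enorm_le_sum x : enorm x <= \sum_i `|x 0 i|.
Proof.
have s0 (s : seq 'I_N) : 0 <= \sum_(i <- s) `|x 0 i| by exact: sumr_ge0.
rewrite -(@ler_pXn2r _ 2) ?nnegrE ?enorm_ge0 ?s0 // enorm_sq.
elim: (index_enum _) => [|i s IH]; first by rewrite !big_nil expr0n.
rewrite !big_cons sqrrD real_normK ?num_real //.
by have := mulr_ge0 (normr_ge0 (x 0 i)) (s0 s); rewrite mulr2n; lra.
Qed.

Lemma enormZ (a : R) x : enorm (a *: x) = `|a| * enorm x.
Proof.
rewrite /enorm -sqrtr_sqr -sqrtrM ?sqr_ge0 //; congr Num.sqrt.
by rewrite mulr_sumr; apply: eq_bigr => i _; rewrite mxE exprMn.
Qed.

Lemma distC x y : dist x y = dist y x.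
Proof. by rewrite /dist -enormN opprB. Qed.

Lemma dist_ge0 x y : 0 <= dist x y.
Proof. exact: enorm_ge0. Qed.

Lemma distxx x : dist x x = 0.
Proof. by rewrite /dist subrr enorm0. Qed.

Lemma dist_eq0 x y : dist x y = 0 -> x = y.
Proof. by move=> /enorm_eq0/eqP; rewrite subr_eq0 => /eqP. Qed.

Lemma dist_tri x y z : dist x z <= dist x y + dist y z.
Proof. by rewrite /dist; apply: le_trans _ (enormD _ _); rewrite addrA subrK. Qed.

Lemma dist_enorm x y : `|enorm x - enorm y| <= dist x y.
Proof.
have h u v : enorm u - enorm v <= dist u v.
  by have := enormD (u - v) v; rewrite subrK /dist; lra.
rewrite ler_norml; have := h x y; have := h y x; rewrite distC; lra.
Qed.

Lemma sum_frac (r : R) : 0 < r -> \sum_(i < N) r / N.+1%:R < r.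
Proof.
move=> r0; rewrite sumr_const card_ord -[_ *+ N]mulr_natr -mulrA gtr_pMr //.
by rewrite mulrC ltr_pdivrMr ?ltr0n // mul1r ltr_nat.
Qed.

Lemma nbhs_enorm x (B : set V) : nbhs x B <-> exists2 r : R, 0 < r & forall y, dist y x < r -> B y.
Proof.
split=> [/nbhs_ballP[e /= e0 H]|[r r0 H]].
  exists e => // y yx; apply: H; split=> // i j; rewrite /ball /= ord1 distrC.
  apply: le_lt_trans yx; have := enorm_coord (y - x) j; rewrite !mxE //.
have n0 : 0 < (N.+1%:R : R) by rewrite ltr0n.
apply/nbhs_ballP; exists (r / N.+1%:R); first by rewrite /= divr_gt0.
move=> y [_ h]; apply: H; apply: le_lt_trans (enorm_le_sum _) _.
have h' i : `|(y - x) 0 i| <= r / N.+1%:R.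
  by have := h 0 i; rewrite /ball /= !mxE distrC => /ltW.
apply: le_lt_trans (_ : \sum_(i < N) r / N.+1%:R < _); first by apply: ler_sum => i _; exact: h'.
exact: sum_frac.
Qed.

Lemma closed_enorm Z : closed Z -> forall x, (forall r : R, 0 < r -> exists2 z, Z z & dist z x < r) -> Z x.
Proof.
move=> cZ x H; apply: cZ => B /nbhs_enorm[r r0 HB].
by have [z Zz zx] := H r r0; exists z; split=> //; exact: HB.
Qed.

Lemma closure_enorm Z x : closure Z x <-> forall r : R, 0 < r -> exists2 z, Z z & dist z x < r.
Proof.
split=> [cl r r0|H B /nbhs_enorm[r r0 HB]]; last first.
  by have [z Zz zx] := H r r0; exists z; split=> //; exact: HB.
have [|z [Zz zx]] := cl [set z | dist z x < r]; last by exists z.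
by apply/nbhs_enorm; exists r.
Qed.

Lemma connected_loc_const (C : set V) (P : V -> Prop) : connected C ->
  (forall w, C w -> exists2 r : R, 0 < r & forall w', C w' -> dist w' w < r -> (P w' <-> P w)) ->
  forall x y, C x -> C y -> P x -> P y.
Proof.
move=> cC H x y Cx Cy Px.
pose O (Q : V -> Prop) := [set z | exists w, [/\ C w, Q w & exists2 r : R, 0 < r &
   (forall w', C w' -> dist w' w < r -> (P w' <-> P w)) /\ dist z w < r]].
have oO Q : open (O Q).
  rewrite openE => z [w [Cw Qw [r r0 [h zw]]]]; apply/nbhs_enorm; exists (r - dist z w); first by rewrite subr_gt0.
  move=> y' yz; exists w; split=> //; exists r => //; split=> //.
  by apply: le_lt_trans (dist_tri _ z _) _; lra.
have OP z : C z -> O P z <-> P z.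
  move=> Cz; split=> [[w [Cw Pw [r r0 [h zw]]]]|Pz]; first exact/h.
  by exists z; split=> //; have [r r0 h] := H z Cz; exists r => //; rewrite distxx.
have OnP z : C z -> O (fun z => ~ P z) z <-> ~ P z.
  move=> Cz; split=> [[w [Cw Pw [r r0 [h zw]]]]|Pz]; first by move=> Pz; apply: Pw; apply/(h z).
  by exists z; split=> //; have [r r0 h] := H z Cz; exists r => //; rewrite distxx.
suff E : [set z | C z /\ P z] = C by have : C y by []; rewrite -{1}E => -[].
apply: cC; first by exists x.
  by exists (O P); [exact: oO | apply/seteqP; split=> z [Cz q]; split=> //; apply/OP].
exists (~` (O (fun z => ~ P z))); first by apply: open_closedC; exact: oO.
apply/seteqP; split=> z [Cz q]; split=> //; first by move=> /OnP; apply.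
by apply: contrapT => nP; apply: q; apply/OnP.
Qed.

Lemma path_cont (g : R -> V) : {within `[(0 : R), 1], continuous g} <->
  forall t : R, 0 <= t <= 1 -> forall eps : R, 0 < eps -> exists2 d : R, 0 < d &
    forall s : R, 0 <= s <= 1 -> `|s - t| < d -> dist (g s) (g t) < eps.
Proof.
rewrite subspace_continuousP; split=> H t.
  move=> ht eps eps0; have := H t; rewrite /= in_itv /= => /(_ ht) h.
  have /h : nbhs (g t) [set z | dist z (g t) < eps] by apply/nbhs_enorm; exists eps.
  rewrite /= /within /= => /nbhs_ballP[d /= d0 hd]; exists d => // s hs st.
  by apply: (hd s); [rewrite /ball /= distrC | rewrite in_itv].
rewrite /= in_itv /= => ht B /nbhs_enorm[r r0 HB]; have [d d0 hd] := H t ht r r0.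
rewrite /= /within /=; apply/nbhs_ballP; exists d => //= s; rewrite /ball /= distrC => st.
by rewrite in_itv /= => hs; apply: HB; exact: hd.
Qed.

Lemma path_in_mono Z Z' x y g : path_in Z x y g -> Z `<=` Z' -> path_in Z' x y g.
Proof. by move=> [h1 h2 h3 h4] ZZ; split=> // t /h4/ZZ. Qed.

Lemma path_chn Z x y (g : R -> V) delta : path_in Z x y g -> 0 < delta ->
  exists2 L : R, (L%:E <= path_length g)%E & chn dist Z delta x L y.
Proof.
move=> [/path_cont cg g0 g1 Zg] delta0.
pose len (s : seq R) := \sum_(0 <= k < size s) enorm (g (nth 1 (0 :: s) k.+1) - g (nth 1 (0 :: s) k)).
have len_rcons (s : seq R) (z : R) : len (rcons s z) = len s + dist (g (last 0 s)) (g z).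
  rewrite /len size_rcons big_nat_recr //=; congr (_ + _).
    apply: eq_big_nat => k /andP[_ ks]; rewrite -rcons_cons !nth_rcons /= ks.
    by rewrite (leq_trans ks (leqnSn _)).
  by rewrite -rcons_cons !nth_rcons /= ltnn eqxx ltnSn -[0 :: s]/(0 :: s) nth_last /= distC.
suff [s [sp sl ch]] : exists s : seq R, [/\ path <%R 0 s, last 0 s = 1 & chn dist Z delta x (len s) (g 1)].
  exists (len s); last by rewrite -g1.
  by apply: ereal_sup_ubound; exists s => //; split=> //; rewrite sl.
pose Q (t : R) := exists s : seq R, [/\ path <%R 0 s, last 0 s = t & chn dist Z delta x (len s) (g t)].
have Zg' t : 0 <= t <= 1 -> Z (g t) by move=> ht; apply: Zg; rewrite in_itv.
have ext (t z : R) : 0 <= z <= 1 -> t < z -> dist (g t) (g z) <= delta -> Q t -> Q z.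
  move=> hz tz dz [s [sp sl ch]]; exists (rcons s z); split; first by rewrite rcons_path sp sl.
    by rewrite last_rcons.
  by rewrite len_rcons sl; apply: chnS => //; exact: Zg'.
apply: (@real_ind R Q 0 1) => //.
- exists [::]; split=> //; rewrite /len big_geq // g0; apply: chn0; rewrite -g0; apply: Zg'.
  by rewrite lexx ler01.
- move=> t t0 t1 Qt; have [|d d0 hd] := cg t _ delta delta0; first by rewrite t0 ltW.
  exists (t + d / 2); first by lra.
  move=> z tz zd z1; apply: (ext t) => //; first by rewrite z1 andbT; lra.
  by rewrite distC; apply/ltW/hd; [lra | rewrite gtr0_norm; lra].
move=> t t0 t1 H; have [|d d0 hd] := cg t _ delta delta0; first by rewrite t1 ltW.
pose y' := Num.max 0 (t - d / 2).
have y't : y' < t by rewrite gt_max t0; lra.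
have y'0 : 0 <= y' by rewrite le_max lexx.
have y'd : t - d / 2 <= y' by rewrite le_max lexx orbT.
apply: (ext y') => //; [by rewrite t1 ltW | | exact: H].
by apply/ltW/hd; [lra | rewrite ltr0_norm; lra].
Qed.

Lemma path_conn Z x y (g : R -> V) (M : R) : path_in Z x y g -> (path_length g <= M%:E)%E -> conn dist Z M x y.
Proof.
move=> hg gM delta delta0; have [L hL c] := path_chn hg delta0.
by exists L => //; rewrite -lee_fin; apply: le_trans hL gM.
Qed.

(** The step function that parametrises the chain by its length is 1-Lipschitz up to an error of one
    step. *)
Lemma chn_param Z delta x L y : 0 <= delta -> chn dist Z delta x L y -> exists f : R -> V, [/\ f 0 = x, f L = y,
  forall s, Z (f s) & forall s s', s <= s' -> dist (f s) (f s') <= (s' - s) + delta].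
Proof.
move=> delta0.
suff H : chn dist Z delta x L y -> 0 <= L /\ exists f : R -> V, [/\ f 0 = x, forall s, L <= s -> f s = y,
  forall s, Z (f s) & forall s s', s <= s' -> dist (f s) (f s') <= (s' - s) + delta].
  by move=> /H[_ [f [h1 h2 h3 h4]]]; exists f; split=> //; exact: h2.
elim=> [Zx|L1 y1 z1 h1 [L0 [f [f0 fL Zf ff]]] Zz le].
  by split=> //; exists (fun=> x); split=> // s s' ss'; rewrite distxx; lra.
have [dz|dnz] := eqVneq (dist y1 z1) 0.
  by rewrite dz addr0; split=> //; exists f; split=> // s Ls; rewrite fL //; exact: dist_eq0.
have dp : 0 < dist y1 z1 by rewrite lt_def dnz dist_ge0.
split; first by lra.
exists (fun s => if s < L1 + dist y1 z1 then f s else z1); split.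
- by rewrite ifT //; lra.
- by move=> s Ls; rewrite ltNge Ls.
- by move=> s; case: ifP.
move=> s s' ss'; case: (ltP s) => hs; case: (ltP s') => hs'; [exact: ff| |lra|by rewrite distxx; lra].
have [sL|Ls] := leP s L1; last by rewrite fL ?ltW //; lra.
by apply: le_trans (dist_tri _ (f L1) _) _; have := ff s L1 sL; rewrite (fL L1) //; lra.
Qed.

(** A fixed ultrafilter gives limits at all parameter values at once, where subsequences would
    require a diagonal argument. *)
Lemma ulim (U : set_system nat) (u : nat -> R) (B : R) : UltraFilter U -> (forall n, `|u n| <= B) ->
  exists l : R, forall eps : R, 0 < eps -> U [set n | `|u n - l| <= eps].
Proof.
move=> uU uB; have pU : ProperFilter U by exact: ultra_proper.
pose S := [set c : R | U [set n | c <= u n]].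
have UT : U setT by exact: filterT.
have hS : has_sup S.
  split.
    by exists (- B); apply: filterS UT => n _ /=; have := uB n; rewrite ler_norml => /andP[].
  exists B => c hc; have [n /= h] := @filter_ex _ _ pU _ hc.
  by apply: le_trans h (le_trans (ler_norm _) (uB n)).
exists (sup S) => eps eps0; have [c hc lc] := sup_adherent eps0 hS.
have h2 : U (~` [set n | sup S + eps <= u n]).
  have [h|//] := in_ultra_setVsetC [set n | sup S + eps <= u n] uU.
  by have := @sup_ubound _ S hS.2 _ h; lra.
apply: filterS (filterI hc h2) => n [/= q1 /negP]; rewrite -ltNge => q2.
by rewrite ler_norml; lra.
Qed.

Lemma ulim_vec (U : set_system nat) (u : nat -> V) (B : R) : UltraFilter U -> (forall n, enorm (u n) <= B) ->
  exists l : V, forall eps : R, 0 < eps -> U [set n | dist (u n) l <= eps].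
Proof.
move=> uU uB; have pU : ProperFilter U by exact: ultra_proper.
have /choice[l Hl] : forall i, exists l : R, forall eps : R, 0 < eps -> U [set n | `|u n 0 i - l| <= eps].
  by move=> i; apply: (ulim (B := B) uU) => n; apply: le_trans (enorm_coord _ i) _.
exists (\row_i l i) => eps eps0.
have h : U [set n | forall i, `|u n 0 i - l i| <= eps / N.+1%:R].
  by apply: filter_forall => i; apply: Hl; rewrite divr_gt0.
apply: filterS h => n /= h; apply: le_trans (enorm_le_sum _) _.
apply: le_trans (_ : \sum_(i < N) eps / N.+1%:R <= _); last exact/ltW/sum_frac.
by apply: ler_sum => i _; rewrite !mxE; exact: h.
Qed.

(** An Arzelà-Ascoli argument: chains rescaled to [0, 1] are M-Lipschitz up to 1 / n.+1, and their
    pointwise limit along an ultrafilter is M-Lipschitz, hence continuous and of length at most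
    M. *)
Theorem conn_path Z M x y : closed Z -> (exists B : R, forall z, Z z -> enorm z <= B) -> 0 <= M ->
  conn dist Z M x y -> exists2 g, path_in Z x y g & (path_length g <= M%:E)%E.
Proof.
move=> cZ [B ZB] M0 hc.
have /choice[f Hf] : forall n : nat, exists f : R -> V, [/\ f 0 = x, f 1 = y, forall s, Z (f s) &
    forall s s', s <= s' -> dist (f s) (f s') <= M * (s' - s) + n.+1%:R^-1].
  move=> n; have n0 : 0 < (n.+1%:R^-1 : R) by rewrite invr_gt0 ltr0n.
  have [L LM ch] := hc _ n0; have [_ _ L0] := chn_in dist_ge0 ch.
  have [h [h0 hL Zh hh]] := chn_param (ltW n0) ch.
  exists (fun s => h (L * s)); split=> [|||s s' ss']; rewrite ?mulr0 ?mulr1 //.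
  apply: le_trans (hh _ _ _) _; first by rewrite ler_wpM2l.
  by rewrite lerD2r -mulrBr ler_wpM2r // subr_ge0.
have [U [uU Uoo]] := ultraFilterLemma (F := eventually) _.
have pU : ProperFilter U by exact: ultra_proper.
have /choice[g Hg] : forall s, exists l : V, forall eps : R, 0 < eps -> U [set n | dist (f n s) l <= eps].
  by move=> s; apply: (ulim_vec (B := B)) => // n; apply: ZB; have [_ _ h _] := Hf n.
have eqlim s (z : V) : (forall n, f n s = z) -> g s = z.
  move=> fz; apply/esym/dist_eq0/le_anti; rewrite dist_ge0 andbT; apply/ler_addgt0Pr => eps eps0.
  by have [n /=] := filter_ex (Hg s eps eps0); rewrite fz add0r.
have lip s s' : s <= s' -> dist (g s) (g s') <= M * (s' - s).
  move=> ss'; apply/ler_addgt0Pr => eps eps0.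
  have e3 : 0 < eps / 3 by lra.
  have h3 : U [set n | (n.+1%:R^-1 : R) <= eps / 3].
    apply: Uoo; exists (Num.bound (3 / eps)) => // n /= hn.
    have b : 3 / eps < (Num.bound (3 / eps))%:R by apply: archi_boundP; apply: divr_ge0 => //; exact: ltW.
    rewrite -[leRHS]invrK lef_pV2 ?posrE ?ltr0n ?invr_gt0 // invf_div; apply: le_trans (ltW b) _.
    by rewrite ler_nat; apply: leqW.
  have [n [[/= q1 q2] q3]] := filter_ex (filterI (filterI (Hg s _ e3) (Hg s' _ e3)) h3).
  have [_ _ _ /(_ s s' ss') q4] := Hf n; rewrite /= in q3.
  have := dist_tri (g s) (f n s) (g s'); have := dist_tri (f n s) (f n s') (g s').
  rewrite (distC (g s) (f n s)); move: (n.+1%:R^-1) q3 q4 => w q3 q4; lra.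
exists g.
  split.
  - apply/path_cont => t ht eps eps0; have M1 : 0 < M + 1 by lra.
    exists (eps / (M + 1)); first by rewrite divr_gt0.
    move=> s hs; rewrite ltr_pdivlMr // => st.
    have [ts|ts] := leP t s.
      by rewrite distC; apply: le_lt_trans (lip _ _ ts) _; move: st; rewrite ger0_norm ?subr_ge0 //; nra.
    by apply: le_lt_trans (lip _ _ (ltW ts)) _; move: st; rewrite ltr0_norm ?subr_lt0 // opprB; nra.
  - by apply: eqlim => n; have [] := Hf n.
  - by apply: eqlim => n; have [] := Hf n.
  move=> t _; apply: (closed_enorm cZ) => r r0; have r2 : 0 < r / 2 by lra.
  have [n /= h] := filter_ex (Hg t _ r2); exists (f n t); first by have [] := Hf n.
  lra.
apply: ge_ereal_sup => _ [s [sp /eqP sl] <-]; rewrite lee_fin.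
have H : \sum_(0 <= k < size s) enorm (g (nth 1 (0 :: s) k.+1) - g (nth 1 (0 :: s) k)) <=
   \sum_(0 <= k < size s) M * (nth 1 (0 :: s) k.+1 - nth 1 (0 :: s) k).
  apply: ler_sum_nat => k /andP[_ ks]; rewrite -/(dist _ _) distC; apply: lip; apply: ltW.
  by have /pathP := sp => /(_ 1 k ks).
apply: le_trans H _; rewrite -mulr_sumr telescope_sumr //.
by rewrite -[size s]/((size (0 :: s)).-1) nth_last /= sl subr0 mulr1.
Qed.

End EuclideanPaths.

(** * Subanalytic sets are definable *)

Section PowerSeriesOfFamily.
Context {R : realType}.
Local Notation env := (nat -> R).
Implicit Types (e r : env) (F : seq nat -> R).

Fixpoint mkPS m F : PSr (R := R) m :=
  if m is m'.+1 return PSr m then fun k => mkPS m' (fun al => F (k :: al)) else F [::].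

(* The head of an exponent list is the exponent of the last variable. *)
Fixpoint mon m e (al : seq nat) : R :=
  if m is m'.+1 then mon m' e (behead al) * e m' ^+ head 0%N al else 1.

Definition bd m F r (M : R) := forall S : seq (seq nat), uniq S ->
  (forall al, al \in S -> size al = m) -> \sum_(al <- S) `|F al| * mon m r al <= M.

Definition off (S : seq (seq nat)) F al : R := if al \in S then 0 else F al.

Lemma mon_ge0 m r al : pos r -> 0 <= mon m r al.
Proof.
by move=> r0; elim: m al => [|m IH] al //=; rewrite mulr_ge0 // exprn_ge0 // ltW.
Qed.

(** The norm of the k-th coefficient is the supremum of the finite sums in [E k]. The claim [key]
    replaces finite sums by these suprema one coefficient at a time, the total staying at most M. *)
Lemma nrm_mk m F r M : pos r -> bd m F r M -> nrm r (mkPS m F) M.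
Proof.
move=> r0; elim: m F M => [|m IH] F M h /=.
  by have := h [:: [::]] isT; rewrite big_seq1 /= mulr1; apply=> al; rewrite inE => /eqP->.
pose E k := [set s : R | exists S : seq (seq nat), [/\ uniq S,
  forall al, al \in S -> size al = m & s = \sum_(al <- S) `|F (k :: al)| * mon m r al]].
have E0 k : E k !=set0 by exists 0, [::]; split=> //; rewrite big_nil.
have comb K (S S' : seq (seq nat)) : uniq S -> uniq S' ->
    (forall al, al \in S -> size al = m.+1 /\ (K.+1 <= head 0%N al)%N) ->
    (forall al, al \in S' -> size al = m) ->
    let S2 := [seq K :: be | be <- S'] ++ S in
    [/\ uniq S2, forall al, al \in S2 -> size al = m.+1 /\ (K <= head 0%N al)%N &
     \sum_(al <- S2) `|F al| * mon m.+1 r al =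
     (\sum_(al <- S') `|F (K :: al)| * mon m r al) * r m ^+ K +
     \sum_(al <- S) `|F al| * mon m.+1 r al].
  move=> uS uS' hS hS'; split.
  - rewrite cat_uniq map_inj_uniq ?uS' ?uS ?andbT; last by move=> x y [].
    apply/hasPn => al /hS[_ h1]; apply/mapP => -[be _ E1].
    by move: h1; rewrite E1 /= ltnn.
  - move=> al; rewrite mem_cat => /orP[/mapP[be /hS' <- ->] //|/hS[-> /ltnW]//].
  - rewrite big_cat big_map /=; congr (_ + _); rewrite big_distrl /=.
    by apply: eq_bigr => al _; rewrite mulrA.
have key K : (forall k, (k < K)%N -> has_ubound (E k)) /\ forall S, uniq S ->
    (forall al, al \in S -> size al = m.+1 /\ (K <= head 0%N al)%N) ->
    \sum_(k < K) sup (E k) * r m ^+ k + \sum_(al <- S) `|F al| * mon m.+1 r al <= M.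
  elim: K => [|K [IH1 IH2]].
    by split=> // S uS hS; rewrite big_ord0 add0r; apply: h => // al /hS[].
  have rK : 0 < r m ^+ K by rewrite exprn_gt0.
  have ub S : uniq S -> (forall al, al \in S -> size al = m.+1 /\ (K.+1 <= head 0%N al)%N) ->
      ubound (E K) ((M - \sum_(k < K) sup (E k) * r m ^+ k -
        \sum_(al <- S) `|F al| * mon m.+1 r al) / r m ^+ K).
    move=> uS hS _ [S' [uS' hS' ->]]; rewrite ler_pdivlMr //.
    have [a b c] := comb K S S' uS uS' hS hS'.
    by have := IH2 _ a b; rewrite c; lra.
  have bdK : has_ubound (E K) by eexists; apply: (ub [::]).
  split=> [k|S uS hS]; first by rewrite ltnS leq_eqVlt => /orP[/eqP->|/IH1].
  rewrite big_ord_recr /=.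
  have := ge_sup (E0 K) (ub S uS hS); rewrite ler_pdivlMr //; lra.
exists (fun k => sup (E k)); split=> [k|K].
  apply: IH => S uS hS; apply: ub_le_sup; last by exists S.
  by have [+ _] := key k.+1; apply.
by have [_ /(_ [::] isT)] := key K; rewrite big_nil addr0; apply.
Qed.

Lemma mkPS0 m : mkPS m (fun=> 0) = 0.
Proof. by elim: m => [//|m IH] /=; apply/funext => k; rewrite IH. Qed.

Lemma ev_delta m (x : R) be e : size be = m ->
  ev (mkPS m (fun al => if al == be then x else 0)) e = x * mon m e be.
Proof.
elim: m be => [|m IH] [|k be] //=; first by rewrite mulr1.
move=> [sz]; apply: has_sum_tsum.
rewrite [X in has_sum _ X](_ : _ = \sum_(j < k.+1)
   (ev (mkPS m (fun al => if (j : nat) :: al == k :: be then x else 0)) e * e m ^+ j)); last first.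
  rewrite big_ord_recr /= big1 ?add0r => [|j _].
    by under eq_fun do rewrite eqseq_cons eqxx; rewrite IH // mulrA.
  under eq_fun do rewrite eqseq_cons ltn_eqF //=.
  by rewrite mkPS0 ev0 mul0r.
apply: has_sum_finsupp => j kj.
under eq_fun do rewrite eqseq_cons gtn_eqF //=.
by rewrite mkPS0 ev0 mul0r.
Qed.

Lemma mkPSD m F G : mkPS m (fun al => F al + G al) = mkPS m F + mkPS m G.
Proof. by elim: m F G => [//|m IH] F G /=; apply/funext => k; rewrite fpsDE IH. Qed.

Lemma bd_le m F G r M : pos r -> (forall al, `|G al| <= `|F al|) -> bd m F r M -> bd m G r M.
Proof.
move=> r0 h hF S uS hS; apply: le_trans (hF S uS hS); apply: ler_sum => al _.
by rewrite ler_wpM2r // mon_ge0.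
Qed.

Lemma off_le S F al : `|off S F al| <= `|F al|.
Proof. by rewrite /off; case: ifP => // _; rewrite normr0. Qed.

Lemma ev_off m F r M e S : pos r -> bd m F r M -> inbox m r e -> uniq S ->
  (forall al, al \in S -> size al = m) ->
  ev (mkPS m F) e = ev (mkPS m (off S F)) e + \sum_(al <- S) F al * mon m e al.
Proof.
move=> r0 hF he; elim: S => [|al S IH] /=.
  by rewrite big_nil addr0.
move=> /andP[alS uS] hS; rewrite IH //; last by move=> be h; apply: hS; rewrite inE h orbT.
rewrite big_cons addrA; congr (_ + _).
have hal : size al = m by apply: hS; rewrite mem_head.
have -> : off S F = fun be => off (al :: S) F be + (if be == al then F al else 0).
  apply/funext => be; rewrite /off inE; case: eqVneq => [->|_] /=; rewrite ?(negbTE alS) ?add0r ?addr0 //.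
have bdel : bd m (fun be => if be == al then F al else 0) r M.
  by apply: bd_le hF => // be; case: eqP => [->//|_]; rewrite normr0.
have boff : bd m (off (al :: S) F) r M by apply: bd_le hF => // be; exact: off_le.
by rewrite mkPSD (evD r0 (nrm_mk r0 boff) (nrm_mk r0 bdel) he) ev_delta.
Qed.

Lemma ev_approx m F r M : pos r -> bd m F r M -> forall eps : R, 0 < eps ->
  exists2 S0 : seq (seq nat), (forall al, al \in S0 -> size al = m) &
   forall S e, uniq S -> (forall al, al \in S -> size al = m) -> {subset S0 <= S} ->
   inbox m r e -> `|ev (mkPS m F) e - \sum_(al <- S) F al * mon m e al| <= eps.
Proof.
move=> r0 hF eps eps0.
pose E := [set s : R | exists S : seq (seq nat), [/\ uniq S,
  forall al, al \in S -> size al = m & s = \sum_(al <- S) `|F al| * mon m r al]].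
have hE : has_sup E.
  split; first by exists 0, [::]; split=> //; rewrite big_nil.
  by exists M => _ [S [uS hS ->]]; exact: hF.
have [_ [S0 [uS0 hS0 ->]] h0] := sup_adherent eps0 hE.
exists S0 => // S e uS hS sub he.
rewrite (ev_off r0 hF he uS hS) addrK.
suff hoff : bd m (off S F) r eps by exact: ev_bound (nrm_mk r0 hoff) he.
move=> T uT hT; rewrite (bigID (mem S)) /= big1 => [|al hal]; last first.
  by rewrite /off hal normr0 mul0r.
rewrite add0r -big_filter; set T' := [seq _ <- _ | _].
have uT' : uniq (T' ++ S0).
  rewrite cat_uniq uS0 filter_uniq // andbT; apply/hasPn => al /sub.
  by rewrite mem_filter => ->.
have : \sum_(al <- T' ++ S0) `|F al| * mon m r al <= sup E.
  apply: ub_le_sup; first exact: hE.2.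
  by exists (T' ++ S0); split=> // al; rewrite mem_cat mem_filter => /orP[/andP[_ /hT]|/hS0].
rewrite big_cat /=.
have -> : \sum_(al <- T') `|off S F al| * mon m r al = \sum_(al <- T') `|F al| * mon m r al.
  apply: eq_big_seq => al; rewrite mem_filter => /andP[h _].
  by rewrite /off (negbTE h).
lra.
Qed.

Section FiniteSums.
Context (T : choiceType) (v : T -> \bar R) (v0 : forall x, (0 <= v x)%E).
Context (vfin : (\esum_(x in setT) v x < +oo)%E).

Lemma esum_fin : (\esum_(x in setT) v x)%E \is a fin_num.
Proof. by rewrite ge0_fin_numE // esum_ge0. Qed.

Lemma sum_fineE (S : seq T) : (\sum_(x <- S) v x = (\sum_(x <- S) fine (v x))%:E)%E.
Proof.
rewrite -sumEFin; apply: eq_bigr => x _; rewrite fineK // ge0_fin_numE //.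
apply: le_lt_trans vfin; apply: esum_ge.
by exists [set` [:: x]]; [split=> // ; exact: finite_seq | rewrite -fsbig_seq //= big_seq1].
Qed.

Lemma sum_le_esum S : uniq S -> \sum_(x <- S) fine (v x) <= fine (\esum_(x in setT) v x)%E.
Proof.
move=> uS; rewrite -lee_fin (fineK esum_fin) -sum_fineE; apply: esum_ge.
by exists [set` S]; [split=> //; exact: finite_seq | rewrite -fsbig_seq].
Qed.

Lemma esum_approx (eps : R) : 0 < eps ->
  exists S0 : seq T, forall S, uniq S -> {subset S0 <= S} ->
  fine (\esum_(x in setT) v x)%E - eps <= \sum_(x <- S) fine (v x).
Proof.
move=> eps0.
have [_ [A [/finite_seqP[S1 ->] _] <-] h1] := ub_ereal_sup_adherent eps0 esum_fin.
exists S1 => S uS sub.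
rewrite -lee_fin EFinB (fineK esum_fin); apply: le_trans (ltW h1) _.
have -> : [set` S1] = [set` undup S1] by apply/seteqP; split=> x /=; rewrite mem_undup.
rewrite -fsbig_seq ?undup_uniq // sum_fineE lee_fin.
rewrite [leRHS](bigID (mem S1)) /= -[leLHS]addr0; apply: lerD; last first.
  by apply: sumr_ge0 => x _; rewrite fine_ge0.
rewrite -[leRHS]big_filter le_eqVlt; apply/orP; left; apply/eqP; apply: perm_big; apply: uniq_perm; rewrite ?undup_uniq ?filter_uniq //.
move=> x; rewrite mem_undup mem_filter; case h: (x \in S1) => //=.
by rewrite sub.
Qed.

End FiniteSums.

End PowerSeriesOfFamily.

(** * From analytic functions of row vectors to definable sets *)

Section Analytic.
Context {R : realType}.
Local Notation env := (nat -> R).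
Implicit Types (e r c : env).

Definition erow n e : 'rV[R]_n := \row_i e i.

Lemma nbhs_erow n c (P : 'rV[R]_n -> Prop) : (\forall x \near erow n c, P x) ->
  nearm n c (fun e => P (erow n e)).
Proof.
move=> /nbhs_enorm[d d0 hd]; exists (d / n.+1%:R) => [|e he].
  by rewrite divr_gt0 // ltr0Sn.
apply: hd; rewrite /dist; apply: le_lt_trans (enorm_le_sum _) _.
apply: (@le_lt_trans _ _ (\sum_(i < n) d / n.+1%:R)).
  by apply: ler_sum => i _; rewrite !mxE; apply: he.
rewrite sumr_const card_ord -[X in X < _]mulr_natl mulrCA gtr_pMr //.
by rewrite ltr_pdivrMr ?ltr0Sn // mul1r ltr_nat.
Qed.

(** The reversal accounts for the head of an exponent list belonging to the last variable. *)
Definition psi n (al : seq nat) : {ffun 'I_n -> nat} := [ffun i : 'I_n => nth 0%N (rev al) i].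
Definition phi n (m : {ffun 'I_n -> nat}) : seq nat := rev [seq m i | i <- enum 'I_n].

Lemma size_phi n (m : {ffun 'I_n -> nat}) : size (phi m) = n.
Proof. by rewrite size_rev size_map size_enum_ord. Qed.

Lemma phiK n : cancel (@phi n) (@psi n).
Proof.
move=> m; apply/ffunP => i; rewrite ffunE revK (nth_map i) ?size_enum_ord //.
by rewrite nth_ord_enum.
Qed.

Lemma psiK n al : size al = n -> phi (psi n al) = al.
Proof.
move=> sz; rewrite -[RHS]revK; congr rev; apply: (@eq_from_nth _ 0%N) => [|i].
  by rewrite size_map size_enum_ord size_rev.
rewrite size_map size_enum_ord => ilt.
by rewrite (nth_map (Ordinal ilt)) ?size_enum_ord // ffunE /= nth_enum_ord.
Qed.

Lemma mon_prod n e al : size al = n -> mon n e al = \prod_(i < n) e i ^+ psi n al i.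
Proof.
elim: n al => [|n IH] [|k al] //=; first by rewrite big_ord0.
move=> [sz]; rewrite big_ord_recr /= IH //; congr (_ * _ ^+ _).
  by apply: eq_bigr => i _; rewrite !ffunE /= rev_cons nth_rcons size_rev sz ltn_ord.
by rewrite ffunE /= rev_cons nth_rcons size_rev sz ltnn eqxx.
Qed.

Lemma monomial_mon n e c (m : {ffun 'I_n -> nat}) :
  monomial (erow n e - erow n c) m = mon n (fun i => e i - c i) (phi m).
Proof.
rewrite mon_prod ?size_phi // phiK; apply: eq_bigr => i _.
by rewrite !mxE.
Qed.

Lemma analytic_an n (f : 'rV[R]_n -> R) c : analytic_at f (erow n c) ->
  an n c (fun e => f (erow n e)).
Proof.
move=> [w /nbhs_erow[d d0 hd]].
pose F al := w (psi n al); pose r : env := fun=> d.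
have rp : pos r by [].
pose u e m := (w m * monomial (erow n e - erow n c) m)%:E.
have FE e m : fine (u e m) = F (phi m) * mon n (fun i => e i - c i) (phi m).
  by rewrite /= monomial_mon /F phiK.
(* Absolute summability at the corner, where all coordinate differences equal d, is exactly a bound
   on the l^1 norm with all radii d. *)
have [/= sm _] := hd (fun i => c i + d) (fun i _ => ltac:(by rewrite addrC addKr ger0_norm // ltW)).
have [M hM] : exists M, bd n F r M.
  have hs := sum_le_esum (fun=> abse_ge0 _) sm.
  eexists => S uS hS.
  have uS' : uniq (map (psi n) S).
    rewrite map_inj_in_uniq // => al be /hS ha /hS hb E.
    by rewrite -(psiK ha) -(psiK hb) E.
  apply: le_trans (hs _ uS'); rewrite big_map le_eqVlt; apply/orP; left; apply/eqP.
  apply: eq_big_seq => al /hS ha.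
  rewrite /= monomial_mon psiK // normrM; congr (_ * _).
  rewrite [RHS]ger0_norm; last by apply: mon_ge0 => i; rewrite addrC addKr.
  by congr mon; apply/funext => i; rewrite addrC addKr.
exists (mkPS n F), r, M; split=> //; first exact: nrm_mk.
move=> e he; have [/= se fE] := hd e he.
apply/eqP; rewrite -subr_eq0 -normr_le0; apply/ler_addgt0Pr => eps eps0; rewrite add0r.
have eps4 : 0 < eps / 4 by rewrite divr_gt0.
have [S0 hS0 h0] := ev_approx rp hM eps4.
have sp : (\esum_(x in setT) (u e)^\+ x < +oo)%E.
  apply: le_lt_trans (summable_funepos se); apply: le_esum => m _.
  exact: lee_abs.
have sn : (\esum_(x in setT) (u e)^\- x < +oo)%E.
  apply: le_lt_trans (summable_funeneg se); apply: le_esum => m _.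
  exact: lee_abs.
have p0 m : (0 <= (u e)^\+ m)%E by exact: funepos_ge0.
have n0 m : (0 <= (u e)^\- m)%E by exact: funeneg_ge0.
have [S1 h1] := esum_approx p0 sp eps4.
have [S2 h2] := esum_approx n0 sn eps4.
pose S := undup (map (psi n) S0 ++ S1 ++ S2).
have uS : uniq S by exact: undup_uniq.
have := h1 S uS; have := h2 S uS; have := sum_le_esum p0 sp uS; have := sum_le_esum n0 sn uS.
have := h0 (map (@phi n) S) (fun i => e i - c i).
rewrite map_inj_uniq //; last exact: can_inj (@phiK n).
move=> /(_ uS) H0 a1 a2 a3 a4.
have {}H0 := H0 (fun al => ltac:(by move=> /mapP[m _ ->]; exact: size_phi)).
have sub0 : {subset S0 <= map (@phi n) S}.
  move=> al h; apply/mapP; exists (psi n al); last by rewrite psiK // hS0.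
  by rewrite mem_undup mem_cat map_f.
have {}a4 := a4 (fun m h => ltac:(by rewrite mem_undup !mem_cat h ?orbT)).
have {}a3 := a3 (fun m h => ltac:(by rewrite mem_undup !mem_cat h ?orbT)).
have {}H0 := H0 sub0 he.
have Efin := esum_fin p0 sp; have Nfin := esum_fin n0 sn.
have : f (erow n e) = fine (\esum_(m in setT) (u e)^\+ m)%E - fine (\esum_(m in setT) (u e)^\- m)%E.
  by apply/EFin_inj; rewrite EFinB !fineK.
have : \sum_(al <- map (@phi n) S) F al * mon n (fun i => e i - c i) al =
   \sum_(m <- S) fine ((u e)^\+ m) - \sum_(m <- S) fine ((u e)^\- m).
  rewrite big_map -sumrB; apply: eq_bigr => m _; rewrite -FE.
  rewrite funeposE funenegE /u -EFinN -!EFin_max /= /Order.max; clear.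

  by rewrite oppr_lt0; case: ltrgtP; lra.
move: H0 a1 a2 a3 a4; rewrite !ler_norml => /andP[? ?] ? ? ? ? ? ?; apply/andP; split; lra.
Qed.

Lemma semianalytic_sa n (A : set 'rV[R]_n) c : semianalytic A -> sa n c (fun e => A (erow n e)).
Proof.
move=> /(_ (erow n c))[U [Uo Uc [p [q [f [s [han hA]]]]]]].
apply: (@sa_near R n c (fun e => exists i, forall j, if s i j then f i j (erow n e) = 0 else 0 < f i j (erow n e))).
  have := nbhs_erow (open_nbhs_nbhs (conj Uo Uc)); apply: nearmW => e Ue.
  have <- : (A `&` U) (erow n e) <-> A (erow n e) by split=> [[]|].
  by rewrite hA; split=> [|[]].
apply: (bc_ex (sa_bc n c)) => i; apply: (bc_all (sa_bc n c)) => j.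
have := analytic_an (han i j _ Uc).
by case: (s i j) => h; [apply: sa_eq | apply: sa_lt] => //; exact: anC.
Qed.

Lemma compact_enorm n (A : set 'rV[R]_n) : compact A -> exists M : R, forall x, A x -> enorm x <= M.
Proof.
move=> cA; have ce : continuous (@enorm R n).
  move=> x B /nbhs_ballP[eps /= eps0 hB]; apply/nbhs_enorm; exists eps => // y yx.
  apply: hB; rewrite /ball /=.
  apply: le_lt_trans yx; rewrite ler_norml; have := enormD (x - y) y; have := enormD (y - x) x.
  by rewrite !subrK -/(dist x y) -/(dist y x) (distC x y) => ? ?; apply/andP; split; lra.
have /compact_bounded[M [_ hM]] := continuous_compact (continuous_subspaceT ce) cA.
exists (M + 1) => x Ax; have := hM (M + 1) (ltac:(by rewrite ltrDl)) (enorm x).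
by rewrite /= ger0_norm ?enorm_ge0 //; apply; exists x.
Qed.

Lemma lsub_erow n k (e y : env) : lsubmx (erow (n + k) (cat n e y)) = erow n e.
Proof. by apply/rowP => i; rewrite !mxE /cat /= ltn_ord. Qed.

(** Relative compactness of the lifted set A bounds the coordinates that are projected away, so the
    projection is a bounded quantifier. *)
Lemma subanalytic_Def n (X : set 'rV[R]_n) : subanalytic X -> Def (fun e => X (erow n e)).
Proof.
move=> hX; exists n; split=> [e e' ee'|c].
  by rewrite (_ : erow n e = erow n e') //; apply/rowP => i; rewrite !mxE ee'.
have [U [Uo Uc [k [A [sA cA hA]]]]] := hX (erow n c).
have [M hM] := compact_enorm cA.
apply: (@sub_near R n c (exbox k n (fun=> - M) (fun=> M) (fun e => A (erow (n + k) e)))); last first.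
  by apply: sub_exbox => b _; rewrite addnC; apply/sub_sa/semianalytic_sa.
have := nbhs_erow (open_nbhs_nbhs (conj Uo Uc)); apply: nearmW => e Ue.
have -> : X (erow n e) <-> (X `&` U) (erow n e) by split=> [|[]].
rewrite hA; split=> [[y _ Ay]|[z Az zE]].
  by exists (erow (n + k) (cat n e y)) => //; exact: lsub_erow.
pose y : env := fun i => if insub (n + i)%N is Some j then z 0 (j : 'I_(n + k)) else 0.
exists y => [i ik|].
  rewrite /y; case: insubP => [j _ _|_]; rewrite -ler_norml.
    by apply: le_trans (enorm_coord _ _) (hM _ (subset_closure Az)).
  by rewrite normr0; apply: le_trans (enorm_ge0 _) (hM _ (subset_closure Az)).
suff -> : erow (n + k) (cat n e y) = z by [].
rewrite -[RHS]hsubmxK -[LHS]hsubmxK; congr row_mx; first by rewrite lsub_erow.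
apply/rowP => i; rewrite !mxE /cat /= ltnNge leq_addr /= addKn /y.
case: insubP => [j _ jE|]; last by rewrite ltn_add2l ltn_ord.
by congr (z 0 _); apply: val_inj.
Qed.

End Analytic.

(** * Definable vectors and spheres *)

Section Sqrt.
Context {R : realType}.
Local Notation env := (nat -> R).

Lemma DFun_sqrt (f : env -> R) : DFun f -> DFun (fun e => Num.sqrt (f e)).
Proof.
move=> hf; have [[m [sf bf]] gf] := hf; split.
  exists m; split=> [e e' /sf->//|a]; have [B hB] := bf a.
  exists (B + 1); apply: nearmW hB => e he; rewrite ger0_norm ?sqrtr_ge0 //.
  have := sqrtr_ge0 (f e); have [f0|f0] := lerP 0 (f e).
    by have := sqr_sqrtr f0; move: he; rewrite ger0_norm //; nra.
  by rewrite ltr0_sqrtr //; have := normr_ge0 (f e); lra.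
have ht : DFun (fun e : env => f (tl e)) by exact: DFun_tl.
apply: (@Def_iff _ (fun e => 0 <= e 0%N /\ ((0 <= f (tl e) -> e 0%N * e 0%N = f (tl e)) /\
   (f (tl e) < 0 -> e 0%N = 0)))) => [e|]; last by dfp.
split=> [[e0 [h1 h2]]|->]; last first.
  split; [exact: sqrtr_ge0 | split=> h]; first by rewrite -expr2 sqr_sqrtr.
  by rewrite ltr0_sqrtr.
have [f0|f0] := lerP 0 (f (tl e)); last by rewrite ltr0_sqrtr // h2.
by rewrite -(h1 f0) -expr2 sqrtr_sqr ger0_norm.
Qed.

Lemma DFun_abs (f : env -> R) : DFun f -> DFun (fun e => `|f e|).
Proof.
move=> hf; have -> : (fun e => `|f e|) = (fun e => Num.sqrt (f e * f e)).
  by apply/funext => e; rewrite -expr2 sqrtr_sqr.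
by apply: DFun_sqrt; apply: DFun_mul.
Qed.

Lemma Lip_germ_scaled (f : env -> R) e (c : R) : 0 < c -> DFun f -> evt (fun s => `|f (cons s e)| <= c * s) ->
  evt (fun d => forall s s', 0 < s < d -> 0 < s' < d ->
    `|f (cons s e) - f (cons s' e)| <= 2 * c * `|s - s'|).
Proof.
move=> c0 hf h; have hg : DFun (fun e => c^-1 * f e) by apply: DFun_mul => //; exact: DFun_const.
have [|d d0 H] := Lip_germ (e := e) hg.
  by apply: evtW h => s s0; rewrite normrM (gtr0_norm (x := c^-1)) ?invr_gt0 // ler_pdivrMl.
exists d => // d' d'0 dd s s' /andP[s0 sd] /andP[s'0 s'd].
have := H s s'; rewrite s0 s'0 !(lt_trans _ dd) // => /(_ isT isT).
rewrite -mulrBr normrM (gtr0_norm (x := c^-1)) ?invr_gt0 // ler_pdivrMl //; lra.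
Qed.

Lemma tame0 (P : env -> Prop) (e : env) : Def P ->
  evt (fun s => P (cons s e)) \/ evt (fun s => ~ P (cons s e)).
Proof.
by move=> /(tame_line e 0 1)[] h; [left|right]; apply: evtW h => s _; rewrite add0r mul1r.
Qed.

End Sqrt.

(** * Definable vectors, definable choice of tuples, motion between spheres *)

Section Vectors.
Context {R : realType} {N : nat}.
Local Notation env := (nat -> R).
Local Notation V := ('rV[R]_N).
Implicit Types (e : env) (v w : env -> V).

Definition DV v := forall i, DFun (fun e => v e 0 i).

Lemma DV_var (f : nat -> nat) : DV (fun e => erow N (fun i => e (f i))).
Proof.
by move=> i; under eq_fun do rewrite mxE; exact: DFun_var.
Qed.

Lemma DV_sub v w : DV v -> DV w -> DV (fun e => v e - w e).
Proof. by move=> hv hw i; under eq_fun do rewrite !mxE; apply: DFun_sub. Qed.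

Lemma DV_add v w : DV v -> DV w -> DV (fun e => v e + w e).
Proof. by move=> hv hw i; under eq_fun do rewrite !mxE; apply: DFun_add. Qed.

Lemma DV_scale (f : env -> R) v : DFun f -> DV v -> DV (fun e => f e *: v e).
Proof. by move=> hf hv i; under eq_fun do rewrite !mxE; apply: DFun_mul. Qed.

Lemma DV_pull v (k : nat -> nat) : DV v -> DV (fun e => v (fun i => e (k i))).
Proof. by move=> hv i; exact: (DFun_pull k (hv i)). Qed.

Definition coords (x : V) : env := fun i => if insub i is Some j then x 0 (j : 'I_N) else 0.

Lemma coordsK x : erow N (coords x) = x.
Proof. by apply/rowP => i; rewrite mxE /coords valK. Qed.

Lemma DV_coord v : DV v -> forall i : nat, DFun (fun e => coords (v e) i).
Proof. by move=> hv i; rewrite /coords; case: insubP => [j _ _|_]; [exact: hv | exact: DFun_const]. Qed.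

Lemma DFun_enorm v : DV v -> DFun (fun e => enorm (v e)).
Proof.
move=> /DV_coord hv; apply: DFun_sqrt.
have -> : (fun e => \sum_i v e 0 i ^+ 2) = (fun e => \sum_(i < N) (fun l e => coords (v e) l * coords (v e) l) i e).
  by apply/funext => e; apply: eq_bigr => i _; rewrite /coords valK expr2.
by apply: (@DFun_sum R N (fun l e => coords (v e) l * coords (v e) l)) => i; apply: DFun_mul.
Qed.

Lemma DFun_dist v w : DV v -> DV w -> DFun (fun e => dist (v e) (w e)).
Proof. by move=> hv hw; apply: DFun_enorm; exact: DV_sub. Qed.

Lemma Def_set (X : set V) v : Def (fun e => X (erow N e)) -> DV v -> Def (fun e => X (v e)).
Proof.
move=> hX hv; apply: Def_iff (Def_app hX (DV_coord hv)) => e.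
by rewrite coordsK.
Qed.

Definition vecs e (j : nat) : V := erow N (drop (j * N) e).

Lemma DV_vecs j : DV (fun e => vecs e j).
Proof. exact: (DV_var (fun i => i + j * N)%N). Qed.

Definition unvecs (q : nat -> V) : env := fun l => if insub (l %% N)%N is Some i then q (l %/ N)%N 0 (i : 'I_N) else 0.

Lemma unvecsK q : vecs (unvecs q) = q.
Proof.
apply/funext => j; apply/rowP => i; rewrite mxE /drop /unvecs.
have Np : (0 < N)%N by exact: leq_ltn_trans (ltn_ord i).
by rewrite addnC modnMDl modn_small ?ltn_ord // valK divnMDl // divn_small ?ltn_ord // addn0.
Qed.

Lemma unvecs_bound q (l k : nat) : (l < k * N)%N -> (forall j, (j < k)%N -> enorm (q j) <= 1) -> -1 <= unvecs q l <= 1.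
Proof.
move=> lk h; rewrite -ler_norml /unvecs.
have Np : (0 < N)%N by case: (N) lk; rewrite ?muln0.
case: insubP => [i _ _|_]; last by rewrite normr0.
by apply: le_trans (enorm_coord _ _) (h _ _); rewrite ltn_divLR.
Qed.

Lemma vecs_ext k e e' : (forall l, (l < k * N)%N -> e l = e' l) -> forall j, (j < k)%N -> vecs e j = vecs e' j.
Proof.
move=> h j jk; apply/rowP => i; rewrite !mxE /drop h //.
by apply: leq_trans (_ : j.+1 * N <= _)%N; rewrite ?leq_mul2r ?jk ?orbT // mulSn ltn_add2r.
Qed.

Lemma drop_cat n (y e : env) : drop n (cat n y e) = e.
Proof. by apply/funext => i; rewrite /drop /cat ltnNge leq_addl /= addnK. Qed.

Section Quant.
Variables (k : nat) (Q : (nat -> V) -> env -> Prop).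
Hypothesis Qk : forall q q' e, (forall j, (j < k)%N -> q j = q' j) -> Q q e -> Q q' e.
Hypothesis hQ : Def (fun e => Q (vecs e) (drop (k * N) e)).

Let Q1 e := (forall j, (j < k)%N -> enorm (vecs e j) <= 1) /\ Q (vecs e) (drop (k * N) e).

Let hQ1 : Def Q1.
Proof.
apply: Def_and hQ; apply: Def_alln => j _.
by apply: Def_le (DFun_const _); apply/DFun_enorm/DV_vecs.
Qed.

Let vecs_cat y e j : (j < k)%N -> vecs (cat (k * N) y e) j = vecs y j.
Proof. by apply: vecs_ext => l lk; rewrite /cat lk. Qed.

Lemma Def_exV : Def (fun e => exists2 q, (forall j, (j < k)%N -> enorm (q j) <= 1) & Q q e).
Proof.
have := @Def_exn _ (k * N) (fun y e => (forall j, (j < k)%N -> enorm (vecs y j) <= 1) /\ Q (vecs y) e) (-1) 1 _ hQ1.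
move=> h; apply: Def_iff (h _) => [e|y y' e /vecs_ext yy [h1 h2]].
  split=> [[y _ [h1 h2]]|[q h1 h2]]; first by exists (vecs y).
  by exists (unvecs q) => [l lk|]; [exact: unvecs_bound lk h1 | rewrite unvecsK].
by split=> [j jk|]; [rewrite -yy // h1 | exact: Qk h2].
Qed.

Lemma sel_vecs : exists p : nat -> env -> V, (forall j, DV (p j)) /\
  forall e, (exists2 q, (forall j, (j < k)%N -> enorm (q j) <= 1) & Q q e) ->
  (forall j, (j < k)%N -> enorm (p j e) <= 1) /\ Q (fun j => p j e) e.
Proof.
have [g [hg H]] := selvec (k * N) hQ1.
exists (fun j e => vecs (vec (k * N) g e) j); split=> [j i|e [q h1 h2]].
  under eq_fun do rewrite mxE /drop /vec.
  by have [_|_] := boolP (i + j * N < k * N)%N; [exact: hg | exact: DFun_const].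
have [|_ []] := H e.
  exists (fun l => if (l < k * N)%N then unvecs q l else 0) => [l|].
    by case lk: (l < k * N)%N => //; exact: unvecs_bound lk h1.
  have E j : (j < k)%N -> vecs (cat (k * N) (fun l => if (l < k * N)%N then unvecs q l else 0) e) j = q j.
    by move=> jk; rewrite -[in RHS](unvecsK q); move: j jk; apply: vecs_ext => l lk; rewrite /cat lk.
  split=> [j jk|]; first by rewrite E // h1.
  by rewrite drop_cat; apply: Qk h2 => j jk; rewrite E.
rewrite drop_cat => h3 h4; split=> [j jk|]; first by rewrite -(vecs_cat _ e jk) h3.
by apply: Qk h4 => j jk; rewrite vecs_cat.
Qed.

End Quant.

(** Each of the N coordinates is Lipschitz with constant 2 c, and the Euclidean norm is at most the
    sum of the coordinates in absolute value. *)
Lemma Lip_vec (p : env -> V) e (c : R) : 0 < c -> DV p -> evt (fun s => enorm (p (cons s e)) <= c * s) ->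
  evt (fun d => forall s s', 0 < s < d -> 0 < s' < d ->
    dist (p (cons s e)) (p (cons s' e)) <= 2 * N%:R * c * `|s - s'|).
Proof.
move=> c0 hp h.
have hl (l : nat) : (l < N)%N -> evt (fun d => forall s s', 0 < s < d -> 0 < s' < d -> forall i : 'I_N, i = l :> nat ->
    `|p (cons s e) 0 i - p (cons s' e) 0 i| <= 2 * c * `|s - s'|).
  move=> lN; have := @Lip_germ_scaled _ _ e c c0 (hp (Ordinal lN)).
  move=> /(_ (evtW (fun s _ => le_trans (enorm_coord _ _)) h)); apply: evtW => d _ H s s' hs hs' i il.
  by have -> : i = Ordinal lN by [apply: val_inj]; apply: H.
apply: evtW (evt_all hl) => d _ H s s' hs hs'.
apply: le_trans (enorm_le_sum _) _.
apply: le_trans (_ : \sum_(i < N) 2 * c * `|s - s'| <= _).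
  by apply: ler_sum => i _; rewrite !mxE; exact: H (ltn_ord i) _ _ hs hs' i erefl.
by rewrite sumr_const card_ord -[_ *+ N]mulr_natl; lra.
Qed.

Variable X : set V.
Hypothesis hX : Def (fun e => X (erow N e)).

Definition Xs (t : R) : set V := [set u | X u /\ enorm u = t].

Lemma Def_Xs v (f : env -> R) : DV v -> DFun f -> Def (fun e => Xs (f e) (v e)).
Proof. by move=> hv hf; apply: Def_and; [exact: Def_set | apply: Def_eq => //; exact: DFun_enorm]. Qed.

(* A definable selection of counterexamples is Lipschitz by [Lip_germ], and so contradicts itself. *)
Lemma sheets : exists2 C : R, 1 <= C & evt (fun t => forall u, Xs t u -> forall t', 0 < t' -> t' <= 2 * t ->
  exists2 u', Xs t' u' & dist u u' <= C * `|t - t'|).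
Proof.
pose C : R := 2 * N%:R * 1 + 1.
have C1 : 1 <= C by rewrite /C; have : 0 <= N%:R :> R by []; lra.
exists C => //.
pose hit u t t' := exists2 q : nat -> V, (forall j, (j < 1)%N -> enorm (q j) <= 1) &
    Xs t' (q 0%N) /\ dist u (q 0%N) <= C * `|t - t'|.
pose bad u t := Xs t u /\ exists2 t', 0 <= t' <= 1 & ((0 < t' /\ t' <= 2 * t) /\ ~ hit u t t').
pose Bad (e : env) := exists2 q : nat -> V, (forall j, (j < 1)%N -> enorm (q j) <= 1) & bad (q 0%N) (e 0%N).
have hbad : Def (fun e => bad (vecs e 0%N) (drop (1 * N) e 0%N)).
  apply: Def_and; first by apply: Def_Xs (DV_vecs 0) (DFun_var _).
  apply: Def_ex; apply: Def_and; first by rewrite /drop; dfp; exact: DFun_var.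
  apply: Def_not; apply: (@Def_exV 1 (fun q e => Xs (e 0%N) (q 0%N) /\
     dist (vecs (tl e) 0%N) (q 0%N) <= C * `|drop (1 * N) (tl e) 0%N - e 0%N|)) => [q q' e qq|].
    by rewrite qq.
  apply: Def_and; first by apply: Def_Xs (DV_vecs 0) (DFun_var _).
  apply: Def_le.
    apply: DFun_dist (DV_vecs 0); exact: (DV_pull (fun i => i.+1 + 1 * N)%N (DV_vecs 0)).
  apply: DFun_mul (DFun_const _) _.
  by apply: DFun_abs; apply: DFun_sub; exact: DFun_var.
have qk (q q' : nat -> V) (e : env) : (forall j, (j < 1)%N -> q j = q' j) -> bad (q 0%N) (e 0%N) -> bad (q' 0%N) (e 0%N).
  by move=> ->.
have hBad : Def Bad by exact: Def_exV qk hbad.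
have [[d d0 H]|H] := tame0 (fun=> 0) hBad; last first.
  apply: evtW (evtI H (evt_lt (_ : 0 < 1 / 2 :> R))) => [t t0 [nb t1] u ut t' t'0 t't|]; last by lra.
  apply: contrapT => nh; apply: nb; exists (fun=> u) => [j _|]; first by rewrite ut.2; lra.
  split=> //; exists t'; first by lra.
  by split=> // -[q h1 [h2 h3]]; apply: nh; exists (q 0%N).
have [p [hp P]] := sel_vecs qk hbad.
have Pt t : 0 < t -> t < d -> enorm (p 0%N (cons t (fun=> 0))) <= 1 /\ bad (p 0%N (cons t (fun=> 0))) t.
  by move=> t0 td; have [h1 h2] := P _ (H t t0 td); split=> //; exact: h1.
have [|d1 d10 L] := evt_ex (@Lip_vec (p 0%N) (fun=> 0) 1 ltr01 (hp 0%N) _).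
  exists d => // s s0 sd; rewrite mul1r; by have [_ [[_ ->]]] := Pt s s0 sd.
(* Every t' <= 2 * t is then still within the range of the selection; its point at t' lies in X on
   the sphere of radius t' and is close enough to be the one declared missing. *)
pose t := Num.min d d1 / 3.
have m0 : 0 < Num.min d d1 by rewrite lt_min d0.
have [md md1] : Num.min d d1 <= d /\ Num.min d d1 <= d1 by split; rewrite ge_min lexx ?orbT.
have t0 : 0 < t by rewrite /t; lra.
have [_ [_ [t' _ [[t'0 t't] nh]]]] := Pt t t0 (ltac:(rewrite /t; lra)).
have [n1 [b1 _]] := Pt t' t'0 (ltac:(rewrite /t in t't; lra)).
exfalso; apply: nh; exists (fun=> p 0%N (cons t' (fun=> 0))) => //; split=> //.
apply: le_trans (L t t' _ _) _; try by rewrite /t in t't *; lra.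
by rewrite ler_wpM2r // /C; lra.
Qed.

End Vectors.

(** * Refining chains on a sphere *)

Section Refinement.
Context {R : realType} {N : nat}.
Local Notation env := (nat -> R).
Local Notation V := ('rV[R]_N).
Implicit Types (e : env) (v w : env -> V).

Lemma maxr_lip (a x y : R) : `|Num.max a x - Num.max a y| <= `|x - y|.
Proof.
by rewrite /Order.max; case: (ltrP a x) => ?; case: (ltrP a y) => ?; rewrite ?subrr ?normr0 //;
  case: (ger0P (x - y)) => ?; rewrite ler_norml; apply/andP; split; lra.
Qed.

Lemma minr_lip (a x y : R) : `|Num.min a x - Num.min a y| <= `|x - y|.
Proof.
have E z : Num.min a z = - Num.max (- a) (- z) by rewrite -oppr_min opprK.
rewrite !E -opprD normrN; apply: le_trans (maxr_lip _ _ _) _.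
by rewrite -opprD normrN.
Qed.

(* A function on the line that differs from the identity by a 1/4-Lipschitz one expands distances. *)
Lemma expand_dist (s s' t x D : R) : `|t - s - (x - s')| <= 2 * 8^-1 * `|s - s'| -> `|x - t| <= D ->
  `|s - s'| <= 2 * D.
Proof.
by case: (ger0P (s - s')) => ?; rewrite !ler_norml => /andP[? ?] /andP[? ?]; lra.
Qed.

Lemma lip_ivt (f : R -> R) (a b v K : R) : a <= b -> 0 <= K ->
  (forall s s', a <= s <= b -> a <= s' <= b -> `|f s - f s'| <= K * `|s - s'|) ->
  f a <= v <= f b -> exists2 c, a <= c <= b & f c = v.
Proof.
move=> ab K0 hf fv; pose cl s : R := Num.max a (Num.min s b).
have hcl s : a <= cl s <= b by rewrite /cl le_max lexx ge_max ab ge_min lexx orbT.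
have lcl s s' : `|cl s - cl s'| <= `|s - s'|.
  by apply: le_trans (maxr_lip _ _ _) _; rewrite ![Num.min _ b]minC minr_lip.
have cE s : a <= s <= b -> cl s = s.
  by move=> /andP[h1 h2]; rewrite /cl (min_idPl h2) (max_idPr h1).
have cg : continuous (f \o cl).
  move=> s; apply/cvgrPdist_lt => eps eps0; apply/nbhs_ballP; exists (eps / (K + 1)) => /=.
    by rewrite divr_gt0 // ltr_wpDl.
  move=> s' hs' /=; apply: le_lt_trans (hf _ _ (hcl s) (hcl s')) _.
  apply: le_lt_trans (ler_wpM2l K0 (lcl s s')) _.
  have : `|s - s'| < eps / (K + 1) by exact: hs'.
  rewrite ltr_pdivlMr ?ltr_wpDl // => h; have := normr_ge0 (s - s'); nra.
have ga : (f \o cl) a = f a by rewrite /= cE // lexx.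
have gb : (f \o cl) b = f b by rewrite /= cE // lexx ab.
have [| c] := IVT (v := v) ab (continuous_subspaceT cg).
  by rewrite ga gb ge_min le_max; case/andP: fv => -> ->; rewrite orbT.
rewrite in_itv /= => hc E; exists c => //; rewrite -E /= cE //.
Qed.

(** A definable condition needs a prescribed number of points. Sampling the parametrisation by
    length at m equal intervals gives steps of at most M / m, plus the error delta. *)
Lemma chn_points (Z : set V) (delta L M : R) (x y : V) (m : nat) : (0 < m)%N ->
  chn dist Z delta x L y -> 0 <= delta -> L <= M -> delta <= M / m%:R ->
  exists p : nat -> V, [/\ p 0%N = x, p m = y, forall i, Z (p i) & forall i, dist (p i) (p i.+1) <= 2 * M / m%:R].
Proof.
move=> m0 c d0 LM dM; have [_ _ L0] := chn_in (@dist_ge0 _ _) c; have [f [f0 fL Zf lf]] := chn_param d0 c.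
have mp : 0 < m%:R :> R by rewrite ltr0n.
exists (fun i => f (i%:R * (L / m%:R))); split=> //.
- by rewrite mul0r.
- by rewrite mulrCA divff ?gt_eqF // mulr1.
- move=> i; apply: le_trans (lf _ _ _) _.
    by rewrite ler_wpM2r ?ler_nat // divr_ge0 // ltW.
  rewrite -mulrBl -natrB // subSnn mul1r -mulrA [2 * _]mulr_natl mulr2n lerD //.
  by rewrite ler_wpM2r // invr_ge0 ltW.
Qed.

Variable X : set V.
Hypothesis hX : Def (fun e => X (erow N e)).
Variables (C ep : R).
Hypothesis C1 : 1 <= C.
Hypothesis ep0 : 0 < ep.
Hypothesis lne : forall x y, X x -> X y -> enorm x < ep -> enorm y < ep -> conn dist X (C * dist x y) x y.

(** For end points at distance at most kap * t, points within 2 * C times this distance of the start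
    are within t / 8 of it. This is the slope bound on which the estimates with 8^-1, such as
    [expand_dist], rely. *)
Let kap : R := (16 * C)^-1.
Let C0 : 0 < C := lt_le_trans ltr01 C1.
Let kap0 : 0 < kap. Proof. by rewrite /kap invr_gt0 mulr_gt0. Qed.
Let Ck : C * kap = 1 / 16. Proof. by rewrite /kap; field; exact: lt0r_neq0. Qed.

Section Bad.
Variable m : nat.
(** Equivalent to [small_step]: before the move to the sphere the steps are at most 4 * C / m times
    the distance of the ends, the move multiplies them by at most 8 * N + 1, and the result must be
    at most a quarter. *)
Hypothesis hm : (128 * N%:R + 16) * C <= m%:R.

Let mp : 0 < m%:R :> R.
Proof. by apply: lt_le_trans hm; have N0 : 0 <= N%:R :> R by []; apply: mulr_gt0 => //; lra. Qed.

Let m0 : (0 < m)%N. Proof. by rewrite -(ltr0n R). Qed.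

Definition fine_arc (t eta : R) (x y : V) (r : nat -> V) :=
  [/\ r 0%N = x, r m = y, forall j, (j < m.+1)%N -> Xs X t (r j) &
      forall j, (j < m)%N -> dist (r j) (r j.+1) <= eta / 4].

(** The conditions of [fine_arc] in a form suited to definability: equality of end points is written
    as distance at most 0. *)
Let link (t : R) (q r : nat -> V) := ((dist (r 0%N) (q 0%N) <= 0 /\ dist (r m) (q m) <= 0) /\
  (forall j, (j < m.+1)%N -> Xs X t (r j))) /\
  (forall j, (j < m)%N -> dist (r j) (r j.+1) <= dist (q 0%N) (q m) * 4^-1).

Let arc (t : R) (q : nat -> V) := (Xs X t (q 0%N) /\ Xs X t (q m)) /\ dist (q 0%N) (q m) <= kap * t /\
  (forall j, (j < m.+1)%N -> X (q j)) /\
  (forall j, (j < m)%N -> dist (q j) (q j.+1) <= 2 * C / m%:R * dist (q 0%N) (q m)).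

Let badQ (q : nat -> V) (e : env) := arc (e 0%N) q /\
  ~ exists2 r : nat -> V, (forall j, (j < m.+1)%N -> enorm (r j) <= 1) & link (e 0%N) q r.

Let link_ext t q r q' r' : (forall j, (j < m.+1)%N -> q j = q' j) -> (forall j, (j < m.+1)%N -> r j = r' j) ->
  link t q r -> link t q' r'.
Proof.
move=> qq rr [[[h1 h2] h3] h4]; rewrite /link -!qq -?rr //; split; first split=> //.
  by move=> j jm; rewrite -rr //; exact: h3.
by move=> j jm; rewrite -!rr // ?ltnS ?(ltnW jm) //; exact: h4.
Qed.

Let badQ_ext q q' e : (forall j, (j < m.+1)%N -> q j = q' j) -> badQ q e -> badQ q' e.
Proof.
move=> qq [[h1 [h2 [h3 h4]]] nl]; split.
  rewrite /arc -!qq //; split=> //; split=> //; split=> [j jm|j jm]; first by rewrite -qq //; exact: h3.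
  by rewrite -!qq // ?ltnS ?(ltnW jm) //; exact: h4.
move=> [r h5 h6]; apply: nl; exists r => //; apply: link_ext h6 => // j jm; by rewrite qq.
Qed.

Let hbadQ : Def (fun e => badQ (vecs e) (drop (m.+1 * N) e)).
Proof.
have hd j : DV (fun e => vecs (drop (m.+1 * N) e) j : V) by exact: (DV_pull (fun i => i + m.+1 * N)%N (DV_vecs j)).
have hv := @DV_vecs R N.
have h0 : DFun (fun e : env => drop (m.+1 * N) e 0%N) by exact: DFun_var.
have h1 : DFun (fun e : env => drop (m.+1 * N) (drop (m.+1 * N) e) 0%N) by exact: DFun_var.
apply: Def_and; first apply: Def_and.
- by apply: Def_and; exact: Def_Xs.
- apply: Def_and.
    by apply: Def_le; [exact: DFun_dist | apply: DFun_mul => //; exact: DFun_const].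
  apply: Def_and; apply: Def_alln => j _; first exact: Def_set.
  by apply: Def_le; [exact: DFun_dist | apply: DFun_mul; [exact: DFun_const | exact: DFun_dist]].
apply: Def_not; apply: (@Def_exV _ _ m.+1 (fun r e => link (drop (m.+1 * N) e 0%N) (vecs e) r)) => [r r' e rr|].
  exact: link_ext.
apply: Def_and; first apply: Def_and.
- by apply: Def_and; apply: Def_le; [exact: DFun_dist | exact: DFun_const | exact: DFun_dist | exact: DFun_const].
- by apply: Def_alln => j _; exact: Def_Xs.
- apply: Def_alln => j _; apply: Def_le; first exact: DFun_dist.
  by apply: DFun_mul; [exact: DFun_dist | exact: DFun_const].
Qed.

Let arc_dist t q : arc t q -> forall j, (j <= m)%N -> dist (q 0%N) (q j) <= 2 * C * dist (q 0%N) (q m).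
Proof.
move=> [_ [_ [_ h]]] j jm; have d0 := dist_ge0 (q 0%N) (q m); set eta := dist (q 0%N) (q m) in h d0 *.
have : dist (q 0%N) (q j) <= j%:R * (2 * C / m%:R * eta).
  elim: j jm => [|j IH] jm; first by rewrite distxx mul0r.
  apply: le_trans (dist_tri _ (q j) _) _.
  by rewrite -natr1 mulrDl mul1r lerD // ?h // IH // ltnW.
move/le_trans; apply; have -> : j%:R * (2 * C / m%:R * eta) = (j%:R / m%:R) * (2 * C * eta) by field; exact: lt0r_neq0.
apply: ler_piMl; first by rewrite !mulr_ge0 // ltW.
by rewrite ler_pdivrMr // mul1r ler_nat.
Qed.

Let small_step : 4 * C / m%:R * (8 * N%:R + 1) <= 4^-1.
Proof. by rewrite mulrAC ler_pdivrMr //; move: hm; lra. Qed.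

(* Bad chains, chosen definably in the radius, are Lipschitz arcs; moving along each of them to the
   moment when it crosses the sphere of radius [t] gives a good chain. *)
Let bad_absurd : evt (fun t => exists2 q : nat -> V, (forall j, (j < m.+1)%N -> enorm (q j) <= 1) & badQ q (cons t (fun=> 0))) -> False.
Proof.
move=> hb; have [p [hp P]] := sel_vecs badQ_ext hbadQ.
pose c t : env := cons t (fun=> 0); pose et t := dist (p 0%N (c t)) (p m (c t)).
have hB : evt (fun t => badQ (fun j => p j (c t)) (c t)).
  by apply: evtW hb => t _ /P[].
pose hh j e := enorm (p j e) - e 0%N.
have hE t j : 0 < t -> badQ (fun j => p j (c t)) (c t) -> (j <= m)%N -> `|hh j (c t)| <= 2 * C * et t.
  move=> t0 [hA _] jm; have [[[_ E0] _] _] := hA.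
  rewrite /hh -/(c t) -[X in _ - X]E0; apply: le_trans (dist_enorm _ _) _.
  by rewrite distC; exact: arc_dist hA j jm.
have etk t : badQ (fun j => p j (c t)) (c t) -> et t <= kap * t by move=> [[_ [+ _]] _].
have et0 t : 0 <= et t by exact: dist_ge0.
have he t j : 0 < t -> badQ (fun j => p j (c t)) (c t) -> (j <= m)%N -> `|hh j (c t)| <= 8^-1 * t.
  move=> t0 hA jm; apply: le_trans (hE t j t0 hA jm) _.
  have := etk t hA; have := et0 t; move: C1 Ck; nra.
have L1 : evt (fun d => forall j, (j < m.+1)%N -> forall s s', 0 < s < d -> 0 < s' < d ->
    `|hh j (c s) - hh j (c s')| <= 2 * 8^-1 * `|s - s'|).
  apply: evt_all => j jm; apply: Lip_germ_scaled => //.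
    by apply: DFun_sub; [exact: DFun_enorm | exact: DFun_var].
  by apply: evtW hB => t t0 hA; apply: he.
have L2 : evt (fun d => forall j, (j < m.+1)%N -> forall s s', 0 < s < d -> 0 < s' < d ->
    dist (p j (c s)) (p j (c s')) <= 2 * N%:R * 2 * `|s - s'|).
  apply: evt_all => j jm; apply: Lip_vec => //.
  apply: evtW hB => t t0 hA; have := he t j t0 hA jm; rewrite /hh ler_norml => /andP[_]; rewrite /c /=; lra.
have L3 : evt (fun d => forall s s', 0 < s < d -> 0 < s' < d -> `|et s - et s'| <= 2 * kap * `|s - s'|).
  apply: (@Lip_germ_scaled _ (fun e => dist (p 0%N e) (p m e)) (fun=> 0) kap kap0 (DFun_dist (hp 0%N) (hp m))).
  by apply: evtW hB => t t0 hA; rewrite ger0_norm ?dist_ge0 //; exact: etk.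
have [d' d'0 [[H1 H2] H3]] := evt_ex (evtI (evtI L1 L2) L3).
have [d'' d''0 HB] := hB.
pose d := Num.min d' (Num.min d'' 1).
have d0 : 0 < d by rewrite !lt_min d'0 d''0 ltr01.
have dd' : d <= d' by rewrite ge_min lexx.
have dd'' : d <= d'' by rewrite !ge_min lexx !orbT.
have d1 : d <= 1 by rewrite !ge_min lexx !orbT.
pose t := d / 4; have t0 : 0 < t by rewrite /t; lra.
have rng s : t / 2 <= s <= 2 * t -> (0 < s) /\ (0 < s < d') /\ s < d''.
  by rewrite /t => hs; split; [|split]; move: dd' dd''; lra.
have tr : t / 2 <= t <= 2 * t by lra.
(* Crossing times: the norm of the j-th arc at radius s differs from s by at most s / 8, so it is
   below t at t / 2 and above t at 2 * t. *)
have [sg sgP] : exists sg : nat -> R, forall j, (j < m.+1)%N -> t / 2 <= sg j <= 2 * t /\ enorm (p j (c (sg j))) = t.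
  have : forall j, exists s, (j < m.+1)%N -> t / 2 <= s <= 2 * t /\ enorm (p j (c s)) = t.
    move=> j; have [jm|_] := boolP (j < m.+1)%N; last by exists 0.
    have [|//|||s h1 h2] := @lip_ivt (fun s => enorm (p j (c s))) (t / 2) (2 * t) t 2; first by lra.
    - move=> s s' /rng[_ [hs _]] /rng[_ [hs' _]]; have := H1 j jm s s' hs hs'; rewrite /hh /c /= => h.
      by apply: le_trans (_ : _ <= `|s - s'| + 2 * 8^-1 * `|s - s'|) _; [|have := normr_ge0 (s - s'); lra];
        move: h; rewrite !ler_norml; have := ler_norm (s - s'); have := ler_norm (- (s - s')); rewrite normrN; lra.
    - have h1 := rng (t / 2) (ltac:(lra)); have h2 := rng (2 * t) (ltac:(lra)).
      have := he (t / 2) j h1.1 (HB _ h1.1 h1.2.2) jm; have := he (2 * t) j h2.1 (HB _ h2.1 h2.2.2) jm.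
      rewrite /hh /c /= !ler_norml; lra.
    - by exists s.
  by move=> /choice[sg H]; exists sg.
have [_ nl] := HB t t0 (rng t tr).2.2; apply: nl; exists (fun j => p j (c (sg j))).
  by move=> j /sgP[_ ->]; rewrite /t; lra.
have [[E0 Em] _] : arc t (fun j => p j (c t)) by case: (HB t t0 (rng t tr).2.2).
have sgt j : (j < m.+1)%N -> `|sg j - t| <= 2 * C * et (sg j).
  move=> jm; have [hs hj] := sgP j jm; have [s0 [_ sd]] := rng _ hs.
  by have := hE (sg j) j s0 (HB _ s0 sd) jm; rewrite /hh hj /c /= distrC.
(* The function [et] is Lipschitz with constant 2 * kap, and [sg j] is within 2 * C * et (sg j) of
   t; since C * kap = 1 / 16, the two values of [et] differ by at most a quarter of et (sg j). *)
have ets j : (j < m.+1)%N -> et (sg j) <= 2 * et t.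
  move=> jm; have [/rng[_ [hs _]] _] := sgP j jm.
  have := H3 _ _ hs (rng t tr).2.1; rewrite ler_norml => /andP[_].
  have := sgt j jm; have := et0 (sg j); have := et0 t; move: C1 Ck kap0; nra.
(* The two end arcs stay on their spheres, hence cross the sphere of radius t at time t: the new
   chain has the given end points. *)
have sg_end j : (j < m.+1)%N -> (forall s, 0 < s < d -> enorm (p j (c s)) = s) -> sg j = t.
  by move=> jm hj; have [hs <-] := sgP j jm; rewrite hj //; move: hs; rewrite /t; lra.
split; first split; first split.
- rewrite sg_end ?distxx // => s /andP[s0 sd].
  by have [[[[_ ->] _] _] _] := HB s s0 (lt_le_trans sd dd'').
- rewrite sg_end ?distxx // => s /andP[s0 sd].
  by have [[[_ [_ ->]] _] _] := HB s s0 (lt_le_trans sd dd'').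
- move=> j jm; have [hs hj] := sgP j jm; split=> //; have [s0 [_ sd]] := rng _ hs.
  by have [[_ [_ [h _]]] _] := HB _ s0 sd; exact: h.
move=> j jm; have jm1 : (j < m.+1)%N by exact: ltnW.
have [hs hj] := sgP j jm1; have [hs' hj'] := sgP j.+1 jm.
have [s0 [sd sd2]] := rng _ hs; have [s'0 [s'd s'd2]] := rng _ hs'.
have [[_ [_ [_ /(_ j jm) h1]]] _] := HB _ s'0 s'd2.
have h2 := H2 j jm1 _ _ sd s'd; have h3 := H1 j jm1 _ _ sd s'd.
have h4 := ets j.+1 jm; have h5 := dist_tri (p j (c (sg j))) (p j (c (sg j.+1))) (p j.+1 (c (sg j.+1))).
have h6 := dist_enorm (p j (c (sg j.+1))) (p j.+1 (c (sg j.+1))).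
rewrite hj' in h6; rewrite /hh hj /c /= -/(c _) -/(c _) in h3.
set D := dist (p j (c (sg j.+1))) _ in h1 h5 h6; rewrite -/(et (sg j.+1)) in h1.
have h7 : `|sg j - sg j.+1| <= 2 * D.
  exact: expand_dist h3 h6.
rewrite -/(et t).
have h8 : D <= 4 * C / m%:R * et t.
  apply: le_trans h1 _; have -> : 4 * C / m%:R * et t = 2 * C / m%:R * (2 * et t) by ring.
  by rewrite ler_wpM2l // divr_ge0 // mulr_ge0 // ltW.
have h9 := small_step.

have N0 : 0 <= N%:R :> R by [].
have Dp : 0 <= D by exact: dist_ge0.
have h10 : dist (p j (c (sg j))) (p j (c (sg j.+1))) <= D * (8 * N%:R).
  apply: le_trans h2 _; rewrite (_ : D * _ = 2 * N%:R * 2 * (2 * D)); last by ring.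
  by rewrite ler_wpM2l // !mulr_ge0.
apply: le_trans h5 _; apply: le_trans (_ : D * (8 * N%:R + 1) <= _).
  by rewrite mulrDr mulr1 lerD2r.
apply: le_trans (ler_wpM2r _ h8) _; first by rewrite addr_ge0 ?mulr_ge0.
by rewrite mulrAC mulrC ler_wpM2l.
Qed.

Lemma refine_arc : evt (fun t => forall x y, Xs X t x -> Xs X t y -> dist x y <= kap * t ->
  exists r, fine_arc t (dist x y) x y r).
Proof.
have hD := Def_exV badQ_ext hbadQ.
have [/bad_absurd//|H] := tame0 (fun=> 0) hD.
have e1 : 0 < Num.min ep (1 / 2) by rewrite lt_min ep0; lra.
apply: evtW (evtI H (evt_lt e1)) => t t0 [nb]; rewrite lt_min => /andP[tep t1] x y [Xx xt] [Xy yt] hxy.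
have [E|nE] := eqVneq (dist x y) 0.
  have {}E := dist_eq0 E; exists (fun=> x); split; [by []|exact: E|by move=> j _; split|].
  by move=> j _; rewrite distxx divr_ge0 ?dist_ge0.
have dp : 0 < dist x y by rewrite lt_neqAle eq_sym nE dist_ge0.
have cd : 0 < C * dist x y / m%:R by rewrite divr_gt0 // mulr_gt0 //; lra.
have [L LM ch] := lne Xx Xy (ltac:(by rewrite xt)) (ltac:(by rewrite yt)) cd.
have [q [q0 qm Xq sq]] := chn_points m0 ch (ltW cd) LM (lexx _).
have hA : arc t q.
  split; first by rewrite q0 qm.
  split; first by rewrite q0 qm.
  split=> // j jm; apply: le_trans (sq j) _; rewrite q0 qm.
  by rewrite mulrA mulrAC.
apply: contrapT => nr; apply: nb; exists q.
  move=> j jm; have := arc_dist hA (jm : (j <= m)%N); have := dist_enorm (q 0%N) (q j).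
  rewrite q0 qm xt ler_norml => /andP[h _]; have := dist_ge0 x y; move: hxy C1 Ck; nra.
split=> // -[r r1 [[[h1 h2] h3] h4]]; apply: nr; exists r; split=> //.
- by rewrite -q0; apply: dist_eq0; apply/eqP; rewrite eq_le h1 dist_ge0.
- by rewrite -qm; apply: dist_eq0; apply/eqP; rewrite eq_le h2 dist_ge0.
- by move=> j jm; have := h4 j jm; rewrite q0 qm.
Qed.

End Bad.
End Refinement.

Lemma chn_map (R : realType) (T T' : Type) (d : T -> T -> R) (d' : T' -> T' -> R) (f : T -> T') (c delta : R)
  (Z : T -> Prop) (Z' : T' -> Prop) x L y : 0 <= c ->
  (forall z, Z z -> Z' (f z)) -> (forall z w, d' (f z) (f w) <= c * d z w) ->
  chn d Z delta x L y -> exists L', chn d' Z' (c * delta) (f x) L' (f y).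
Proof.
move=> c0 hZ hd; elim=> [Zx|L1 y1 z1 _ [L' h] Zz le]; first by exists 0; apply: chn0; exact: hZ.
exists (L' + d' (f y1) (f z1)); apply: chnS => //; first exact: hZ.
by apply: le_trans (hd _ _) _; rewrite ler_wpM2l.
Qed.

(** * Connecting nearby points within a sphere *)

Section SphereConnected.
Context {R : realType} {N : nat}.
Local Notation env := (nat -> R).
Local Notation V := ('rV[R]_N).
Variable X : set V.
Hypothesis hX : Def (fun e => X (erow N e)).

Lemma dist_erow (y y' : env) : dist (erow N y) (erow N y') <= l1 N y y'.
Proof.
by apply: le_trans (enorm_le_sum _) _; apply: ler_sum => i _; rewrite !mxE.
Qed.

Lemma l1_coords (x x' : V) : l1 N (coords x) (coords x') <= N%:R * dist x x'.
Proof.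
apply: l1_small => i iN; rewrite /coords insubT.
by have := enorm_coord (x - x') (Sub i iN); rewrite !mxE.
Qed.

Lemma cube_coords (x : V) : enorm x <= 1 -> cube N (coords x).
Proof.
move=> hx i; rewrite /coords; case: ifP => iN; last by rewrite insubF.
by rewrite insubT -ler_norml; apply: le_trans (enorm_coord _ _) hx.
Qed.

(* The fibre over the parameters [t], [z], [x] is the part of [Xs X t] in the
   box of radius [z] about [x], rescaled to the unit cube. *)
Definition window (E : env) : Prop :=
  let e := drop N E in Xs X (e 0%N) (erow N (drop 2 e) + e 1%N *: erow N E).

Lemma Def_window : Def window.
Proof.
apply: Def_Xs => //; last exact: DFun_var.
apply: DV_add; first exact: (DV_var (fun i => i + 2 + N)%N).
by apply: DV_scale; [exact: DFun_var | exact: (DV_var id)].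
Qed.

Lemma erow_cat (y e : env) : erow N (cat N y e) = erow N y.
Proof. by apply/rowP => i; rewrite !mxE /cat ltn_ord. Qed.

(** All windows form one definable family after rescaling, so [fibre_diam] bounds their inner
    diameters uniformly; scaling back by z makes the bound proportional to the size of the
    window. *)
Lemma window_conn : exists2 M : R, 0 <= M & forall (t z : R) (x u v : V),
  0 <= t <= 1 -> 0 < z <= 1 -> enorm x <= 1 ->
  (forall delta : R, 0 < delta -> exists L, chn dist (fun w => Xs X t w /\ dist x w <= z) delta u L v) ->
  conn dist (Xs X t) (M * z) u v.
Proof.
have [M M0 H] := @fibre_diam _ N (N + 2) window Def_window.
exists M => // t z x u v ht /andP[z0 z1] hx hc.
pose e : env := cons t (cons z (coords x)).
have ce : cube (N + 2) e.
  move=> i; rewrite addn2; case: i => [|[|i]] /=; rewrite ?ltnS.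
  - by rewrite (le_trans _ (_ : 0 <= t)) //; lra.
  - by apply/andP; split; lra.
  - exact: (cube_coords hx i).
pose f (w : V) : env := coords (z^-1 *: (w - x)).
pose g (y : env) : V := x + z *: erow N y.
have gf w : g (f w) = w by rewrite /g /f coordsK scalerA divff ?gt_eqF // scale1r addrC subrK.
have xE : erow N (drop 2 e) = x.
  by rewrite -[RHS]coordsK; apply/rowP => i; rewrite !mxE /drop addn2.
have gP y : fib N window e y -> Xs X t (g y).
  by move=> [_]; rewrite /window drop_cat erow_cat xE.
have fP w : Xs X t w /\ dist x w <= z -> fib N window e (f w).
  move=> [Xw xw]; split.
    apply: cube_coords; rewrite enormZ gtr0_norm ?invr_gt0 // mulrC ler_pdivrMr // mul1r.
    by rewrite -/(dist w x) distC.
  by rewrite /window drop_cat erow_cat xE -/(g (f w)) gf.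
have : cc (l1 N) (fib N window e) (f u) (f v).
  move=> delta delta0; have N1 : 0 < N%:R + 1 :> R by rewrite ltr_wpDl.
  have c0 : 0 < (N%:R + 1) / z by rewrite divr_gt0.
  have [L hL] := hc (delta / ((N%:R + 1) / z)) (divr_gt0 delta0 c0).
  have [|L' hL'] := chn_map (ltW c0) fP _ hL (d' := l1 N).
    move=> w w'; apply: le_trans (l1_coords _ _) _.
    rewrite /dist -scalerBr enormZ gtr0_norm ?invr_gt0 // opprB addrA subrK.
    rewrite mulrA ler_wpM2r ?enorm_ge0 // ler_pM2r ?invr_gt0 //; lra.
  by exists L'; move: hL'; rewrite mulrC divfK // gt_eqF.
move/(H e ce) => hM; rewrite -(gf u) -(gf v) mulrC.
apply: conn_map (ltW z0) _ gP _ hM => [y y'|y y' _ _]; first exact: l1_ge0.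
rewrite /g /dist opprD addrACA subrr add0r -scalerBr enormZ gtr0_norm // ler_wpM2l ?(ltW z0) //.
exact: dist_erow.
Qed.

(** Iterating [refine_arc] gives arbitrarily fine chains on the sphere, of uncontrolled length, but
    all within K * dist x y of x. Chain connectedness inside this window is all that [window_conn]
    needs to produce chains of length at most M * K * dist x y. *)
Lemma sphere_conn : forall C ep : R, 1 <= C -> 0 < ep ->
  (forall x y, X x -> X y -> enorm x < ep -> enorm y < ep -> conn dist X (C * dist x y) x y) ->
  exists M kap : R, [/\ 0 <= M, 0 < kap & evt (fun t => forall x y, Xs X t x -> Xs X t y ->
   dist x y <= kap * t -> conn dist (Xs X t) (M * dist x y) x y)].
Proof.
move=> C ep C1 ep0 lne; have [m hm] : exists m : nat, (128 * N%:R + 16) * C <= m%:R.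
  by eexists; apply: ltW; apply: archi_boundP; rewrite mulr_ge0 ?addr_ge0 ?mulr_ge0 //; lra.
pose K : R := m%:R + 1; have m0 : 0 <= m%:R :> R by [].
have [M M0 HM] := window_conn; have := refine_arc hX C1 ep0 lne hm.
set kap := (16 * C)^-1 => hev.
have kap0 : 0 < kap by rewrite /kap invr_gt0 mulr_gt0 //; lra.
have K0 : 0 < K by rewrite /K; lra.
exists (M * K), kap; split=> //; first by rewrite mulr_ge0 // ltW.
have b0 : 0 < Num.min 1 (K * kap)^-1 by rewrite lt_min ltr01 invr_gt0 mulr_gt0.
apply: evtW (evtI hev (evt_lt b0)) => t t0 [harc]; rewrite lt_min => /andP[t1 tk] x y Xx Xy hxy.
have hK : K * (kap * t) <= 1.
  by move: tk; rewrite -[_^-1]mul1r ltr_pdivlMr ?mulr_gt0 // => tk; nra.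
(* The window is preserved: with K = m + 1, the points stay within (m + K) * (dist x y / 4) <= K *
   dist x y of x. *)
have ref j : forall x y, Xs X t x -> Xs X t y -> dist x y <= kap * t -> exists L,
    chn dist (fun w => Xs X t w /\ dist x w <= K * dist x y) (dist x y * 4^-1 ^+ j) x L y.
  elim: j => [|j IH] {Xx Xy hxy}x {}y Xx Xy hxy; have d0 := dist_ge0 x y.
    exists (0 + dist x y); apply: chnS; rewrite ?expr0 ?mulr1 //.
      by apply: chn0; split=> //; rewrite distxx mulr_ge0 // ltW.
    by split=> //; rewrite /K mulrDl mul1r lerDr mulr_ge0.
  have [r [r0 rm Xr sr]] := harc x y Xx Xy hxy.
  rewrite -rm; suff h i : (i <= m)%N -> dist x (r i) <= i%:R * (dist x y / 4) /\
     exists L, chn dist (fun w => Xs X t w /\ dist x w <= K * dist x y) (dist x y * 4^-1 ^+ j.+1) x L (r i).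
    by have [_] := h m (leqnn m); rewrite rm.
  elim: i => [_|i IHi im].
    rewrite r0 distxx mul0r; split=> //; exists 0; apply: chn0; split=> //.
    by rewrite distxx mulr_ge0 // ltW.
  have [h1 [L1 c1]] := IHi (ltnW im); have s1 := sr i im.
  split; first by apply: le_trans (dist_tri _ (r i) _) _; rewrite -natr1 mulrDl mul1r lerD.
  have [|L2 c2] := IH (r i) (r i.+1) (Xr _ (ltnW im : (i < m.+1)%N)) (Xr i.+1 im); first by lra.
  exists (L1 + L2); apply: chn_trans c1 _; apply: chn_mono c2 => [w [Xw rw]|].
    split=> //; apply: le_trans (dist_tri _ (r i) _) _.
    have h2 : i%:R <= m%:R :> R by rewrite ler_nat ltnW.
    have h3 : K * dist (r i) (r i.+1) <= K * (dist x y / 4) by rewrite ler_wpM2l // ltW.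
    have h4 : i%:R * (dist x y / 4) <= m%:R * (dist x y / 4) by rewrite ler_wpM2r // divr_ge0.
    have h5 : m%:R * dist x y = K * dist x y - dist x y by rewrite /K; ring.
    have h6 : 0 <= K * dist x y by rewrite mulr_ge0 // ltW.
    lra.
  rewrite exprS mulrA ler_wpM2r ?exprn_ge0 ?invr_ge0 //; lra.
have [E|nE] := eqVneq (dist x y) 0.
  by rewrite E mulr0 -(dist_eq0 E); apply: conn_refl.
have dp : 0 < dist x y by rewrite lt_neqAle eq_sym nE dist_ge0.
rewrite -mulrA; apply: (HM t (K * dist x y) x); rewrite ?(ltW t0) ?(ltW t1) ?mulr_gt0 //=.
- by apply: le_trans hK; rewrite ler_wpM2l // ltW.
- by rewrite Xx.2 ltW.
move=> delta delta0; have [j hj] : exists j, dist x y * 4^-1 ^+ j <= delta.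
  have /cvgrPdist_lt/(_ (delta / dist x y)) : (fun j => (4^-1 : R) ^+ j) @ \oo --> (0 : R).
    by apply: cvg_expr; rewrite ger0_norm ?invr_ge0 //; lra.
  rewrite divr_gt0 // => /(_ isT)[j _ /(_ j (leqnn j))] /=.
  rewrite sub0r normrN ger0_norm ?exprn_ge0 ?invr_ge0 // ltr_pdivlMr // mulrC => h.
  by exists j; rewrite ltW.
have [L c] := ref j x y Xx Xy hxy.
by exists L; apply: chn_mono c.
Qed.

End SphereConnected.

(** * Germs of components *)

Section Components.
Context {R : realType} {N : nat}.
Local Notation V := ('rV[R]_N).
Implicit Types (x y z : V) (A Z X : set V) (M : R).

(** Adding to a component a limit point that lies in A keeps it connected, so maximality already
    puts the point in it. *)
Lemma component_relclosed A x z : closure (connected_component A x) z -> A z -> A x ->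
  connected_component A x z.
Proof.
move=> cz Az Ax; set C := connected_component A x in cz *.
have Cx : C x by exact: connected_component_refl.
apply: (@connected_component_max _ A (C `|` [set z])); [by left | | | by right].
  by move=> w [/connected_component_sub//|->].
move=> B [w0 Bw0] [U Uo BU] [D Dc BD].
have [[c [Cc Bc]]|nC] := pselect (exists c, C c /\ B c).
  have CB : C `<=` B.
    have <- : B `&` C = C.
      apply: (component_connected (x := x) (A := A)); first by exists c.
        by exists U => //; apply/seteqP; split=> w; rewrite BU; [move=> [[_ ?] ?]; split|move=> [? ?]; split; [split; [left|]|]].
      by exists D => //; apply/seteqP; split=> w; rewrite BD; [move=> [[_ ?] ?]; split|move=> [? ?]; split; [split; [left|]|]].
    by move=> w [].
  rewrite eqEsubset; split=> [w|w [/CB//|->]]; first by rewrite BU => -[].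
  rewrite BD; split; first by right.
  by apply: Dc; apply: closure_subset cz => v /CB; rewrite BD => -[].
have Bz w : B w -> w = z.
  by move=> Bw; move: (Bw); rewrite BU => -[[Cw|//] _]; case: nC; exists w.
have Uz : U z by have := Bw0; rewrite (Bz w0 Bw0) BU => -[].
have [w [Cw Uw]] := cz U (open_nbhs_nbhs (conj Uo Uz)).
by case: nC; exists w; split=> //; rewrite BU; split=> //; left.
Qed.

Lemma path_in_component Z x y (g : R -> V) A : path_in Z x y g -> Z `<=` A -> A x ->
  path_in (Z `&` connected_component A x) x y g.
Proof.
move=> [cg g0 g1 Zg] ZA Ax; split=> // t ht; split; first exact: Zg.
apply: (@connected_component_max _ A (g @` `[0, 1])); last by exists t.
- by exists 0; rewrite ?g0 //= in_itv /= lexx ler01.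
- by move=> _ [s hs <-]; apply: ZA; exact: Zg.
- by apply: connected_continuous_connected => //; exact: segment_connected.
Qed.

(** The infimum need not be attained, whence the slightly larger constant. *)
Lemma inner_conn Z x y M M' : (inner_dist Z x y <= M%:E)%E -> M < M' -> conn dist Z M' x y.
Proof.
move=> h MM'; have : (inner_dist Z x y < M'%:E)%E by apply: le_lt_trans h _; rewrite lte_fin.
by move=> /ereal_inf_lt[_ [g [hg _] <-] gM]; apply: path_conn hg (ltW gM).
Qed.

Lemma conn_inner Z Z' x y M : closed Z -> (exists B : R, forall z, Z z -> enorm z <= B) -> 0 <= M ->
  conn dist Z M x y -> Z `<=` Z' -> (inner_dist Z' x y <= M%:E)%E.
Proof.
move=> cZ bZ M0 h ZZ; have [g hg gM] := conn_path cZ bZ M0 h.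
have gf := le_lt_trans gM (ltry M); apply: le_trans gM; apply: ereal_inf_lbound; exists g => //; split=> //.
exact: path_in_mono hg ZZ.
Qed.

Lemma seq_cluster (u : nat -> V) (B : R) : (forall n, enorm (u n) <= B) ->
  exists l, forall eps : R, 0 < eps -> forall n0, exists2 n, (n0 <= n)%N & dist (u n) l <= eps.
Proof.
move=> uB; have [U [uU Uoo]] := ultraFilterLemma (F := eventually) _.
have pU : ProperFilter U by exact: ultra_proper.
have [l Hl] := ulim_vec uU uB; exists l => eps eps0 n0.
have h0 : U [set n | (n0 <= n)%N] by apply: Uoo; exists n0.
by have [n [h1 h2]] := @filter_ex _ _ pU _ (filterI (Hl eps eps0) h0); exists n.
Qed.

Lemma closed_norm (a b : R) : closed [set x : V | a <= enorm x <= b].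
Proof.
move=> x /closure_enorm cx /=; apply/andP; split; apply/ler_addgt0Pr => r r0;
  by have [z /= /andP[h1 h2]] := cx r r0; rewrite /dist -/(dist z x) => h3; have := dist_enorm z x;
    rewrite ler_norml => /andP[]; lra.
Qed.

Lemma open_eball (e : R) : open (eball (n := N) e).
Proof.
rewrite openE => x xe; apply/nbhs_enorm; exists (e - enorm x) => [|y hy]; first by rewrite subr_gt0.
by have := dist_enorm y x; rewrite /eball /= ler_norml => /andP[]; lra.
Qed.

(** What later arguments take from [germ_components]. The field [germ_conn] keeps from the stability
    of germs that smaller traces are connected and that each component accumulates at the origin. *)
Record germ_rep X r (C : 'I_r -> set V) (e : R) : Prop := GermRep {
  germ_pos : 0 < e;
  germ_in : forall i x, C i x -> [/\ X x, x <> 0 & enorm x < e];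
  germ_comp : forall i x, C i x -> C i = connected_component ((X `\ 0) `&` eball e) x;
  germ_cover : forall x, X x -> x <> 0 -> enorm x < e -> exists i, C i x;
  germ_inj : injective C;
  germ_conn : forall d : R, 0 < d < e -> forall i, connected (C i `&` eball d) /\ exists x, C i x /\ enorm x < d }.

Lemma germ_repP X r (C : 'I_r -> set V) : germ_components X C -> exists e, germ_rep X C e.
Proof.
move=> [e [e0 [injC rC] hd]]; exists e.
have CE i : exists2 x, ((X `\ 0) `&` eball e) x & C i = connected_component ((X `\ 0) `&` eball e) x.
  have : range C (C i) by exists i.
  by rewrite rC => -[x hx <-]; exists x.
have Cin i x : C i x -> ((X `\ 0) `&` eball e) x.
  by have [x0 _ ->] := CE i; exact: connected_component_sub.
split=> //.
- by move=> i x /Cin[[Xx x0] xe].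
- by move=> i x; have [x0 _ ->] := CE i; exact: same_connected_component.
- move=> x Xx x0 xe; have : [set connected_component ((X `\ 0) `&` eball e) x | x in (X `\ 0) `&` eball e]
    (connected_component ((X `\ 0) `&` eball e) x) by exists x.
  by rewrite -rC => -[i _ Ei]; exists i; rewrite Ei; exact: connected_component_refl.
- move=> d /hd[_ rd] i; have : range (fun i => C i `&` eball d) (C i `&` eball d) by exists i.
  rewrite rd => -[x hx E]; split; first by rewrite -E; exact: component_connected.
  have : (C i `&` eball d) x by rewrite -E; exact: connected_component_refl.
  by move=> [? ?]; exists x.
Qed.

Section Rep.
Variables (X : set V) (r : nat) (C : 'I_r -> set V) (e : R).
Hypotheses (cX : closed X) (hC : germ_rep X C e).

Lemma germ_disj i j x : C i x -> C j x -> i = j.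
Proof. by move=> /(germ_comp hC) hi /(germ_comp hC) hj; apply: (germ_inj hC); rewrite hi hj. Qed.

Lemma germ_sub i : closure (C i) `<=` X.
Proof. by apply: subset_trans cX; apply: closure_subset => x /(germ_in hC)[]. Qed.

Lemma germ_closure i x : closure (C i) x -> x <> 0 -> enorm x < e -> C i x.
Proof.
move=> cx x0 xe; have /andP[e2 e2'] : 0 < e / 2 < e by have := germ_pos hC; lra.
have [_ [y [Cy _]]] := germ_conn hC (ltac:(by rewrite e2 e2') : 0 < e / 2 < e) i.
move: cx; rewrite (germ_comp hC Cy) => cx; apply: component_relclosed => //.
  by split=> //; split=> //; apply: (@germ_sub i); rewrite (germ_comp hC Cy).
by have [Xy y0 ye] := germ_in hC Cy.
Qed.

Lemma germ_closure0 i : closure (C i) 0.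
Proof.
apply/closure_enorm => s s0; have e0 := germ_pos hC.
have m0 : 0 < Num.min s (e / 2) by rewrite lt_min s0 divr_gt0.
have [|_ [y [Cy]]] := germ_conn hC (d := Num.min s (e / 2)) _ i.
  by rewrite m0 gt_min; apply/orP; right; lra.
by rewrite lt_min => /andP[ys _]; exists y => //; rewrite /dist subr0.
Qed.

Lemma germ_path i Z x y (g : R -> V) : path_in Z x y g -> C i x ->
  (forall z, Z z -> [/\ X z, z <> 0 & enorm z < e]) -> path_in (Z `&` C i) x y g.
Proof.
move=> hg Cx hZ; rewrite (germ_comp hC Cx); apply: path_in_component hg _ _ => [z /hZ[]//|].
by have [] := germ_in hC Cx.
Qed.

Lemma germ_path_end i Z x y (g : R -> V) : path_in Z x y g -> C i x ->
  (forall z, Z z -> [/\ X z, z <> 0 & enorm z < e]) -> C i y.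
Proof.
move=> hg Cx /(germ_path hg Cx)[_ _ <- /(_ 1)]; rewrite in_itv /= lexx ler01.
by case/(_ isT).
Qed.

Variables (D rho : R).
Hypotheses (D1 : 1 <= D) (rho0 : 0 < rho).
Hypothesis hD : forall t, 0 < t < rho -> forall u, Xs X t u -> forall t', 0 < t' -> t' <= 2 * t ->
  exists2 u', Xs X t' u' & dist u u' <= D * `|t - t'|.

Lemma push i y (s : R) : C i y -> enorm y < rho -> 0 < s -> s <= enorm y ->
  exists y', [/\ C i y', enorm y' = s &
   conn dist (closure (C i) `&` [set z | enorm z <= enorm y]) ((D + 1) * (enorm y - s)) y y'].
Proof.
move=> Cy yr s0; set t := enorm y in yr *; rewrite le_eqVlt => /orP[/eqP->|st].
  exists y; split=> //; rewrite subrr mulr0; apply: conn_refl => //.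
    split; [exact: subset_closure | exact: lexx].
have [Xy y0 ye] := germ_in hC Cy.
pose Z : set V := X `&` [set z | s <= enorm z <= t].
have cZ : closed Z by apply: closedI => //; exact: closed_norm.
have bZ : exists B : R, forall z, Z z -> enorm z <= B by exists t => z [_ /andP[]].
have Zin z : Z z -> [/\ X z, z <> 0 & enorm z < e].
  move=> [Xz /andP[sz zt]]; split=> // [z0|]; last exact: le_lt_trans zt ye.
  by move: sz; rewrite z0 enorm0; lra.
have D0 : 0 < D by move: D1; lra.
(* The radius is decreased in n.+1 equal moves, so the total cost is independent of n while the
   steps tend to 0. The end point depends on n, and a cluster point of these is taken next. *)
have step n : exists u, Xs X s u /\ exists2 L, L <= D * (t - s) & chn dist Z (D * (t - s) / n.+1%:R) y L u.
  have n0 : 0 < n.+1%:R :> R by rewrite ltr0n.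
  set h := (t - s) / n.+1%:R; have h0 : 0 < h by rewrite divr_gt0 // subr_gt0.
  have hn : n.+1%:R * h = t - s by rewrite mulrC divfK // gt_eqF.
  suff H k : (k <= n.+1)%N -> exists u, Xs X (t - k%:R * h) u /\
      exists2 L, L <= D * (k%:R * h) & chn dist Z (D * (t - s) / n.+1%:R) y L u.
    by have [u] := H n.+1 (leqnn _); rewrite hn opprB addrCA subrr addr0; exists u.
  elim: k => [_|k IH kn].
    rewrite mul0r mulr0 subr0; exists y; split=> //; exists 0 => //; apply: chn0.
    by split=> //=; rewrite lexx andbT ltW.
  have [u [Xu [L LD c]]] := IH (ltnW kn).
  have kh : k%:R * h + h <= t - s by rewrite -hn -[X in _ + X <= _]mul1r -mulrDl natr1 ler_wpM2r ?ler_nat // ltW.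
  have k0 : 0 <= k%:R * h by rewrite mulr_ge0 // ltW.
  have kE : k.+1%:R * h = k%:R * h + h by rewrite -natr1 mulrDl mul1r.
  have [|||u' Xu' du] := hD (t := t - k%:R * h) _ Xu (t' := t - k.+1%:R * h); rewrite ?kE; try lra.

  rewrite kE in Xu' du; exists u'; split=> //.
  have E : `|t - k%:R * h - (t - (k%:R * h + h))| = h.
    by rewrite (_ : _ - _ = h); [rewrite gtr0_norm | ring].
  rewrite E in du; exists (L + dist u u'); first by rewrite mulrDr lerD.
  apply: chnS => //; last by rewrite -mulrA.
  by have [Xu'1 u't] := Xu'; split=> //=; rewrite u't; apply/andP; split; lra.
have [u hu] := choice step.
have [l hl] : exists l, forall eps : R, 0 < eps -> forall n0, exists2 n, (n0 <= n)%N & dist (u n) l <= eps.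
  by apply: (seq_cluster (B := s)) => n; have [[_ ->]] := hu n.
have Xl : Xs X s l.
  have cS : closed (X `&` [set x : V | s <= enorm x <= s]) by apply: closedI => //; exact: closed_norm.
  have [|Xl hl'] := closed_enorm cS (x := l).
    move=> q q0; have q20 : 0 < q / 2 by rewrite divr_gt0.
    have [n _ hn] := hl (q / 2) q20 0%N; exists (u n); last by lra.
    by have [[? E] _] := hu n; split=> //=; rewrite E lexx.
  by split=> //; apply/eqP; rewrite eq_le andbC.
(* The additional 1 pays for the last jump to the cluster point, which is made at most t - s. *)
have cl : conn dist Z ((D + 1) * (t - s)) y l.
  move=> delta delta0; have ts : 0 < t - s by rewrite subr_gt0.
  have m0 : 0 < Num.min delta (t - s) by rewrite lt_min delta0.
  have md : Num.min delta (t - s) <= delta /\ Num.min delta (t - s) <= t - s by split; rewrite ge_min lexx ?orbT.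
  have d0 : 0 < delta / (D * (t - s)) by rewrite divr_gt0 // mulr_gt0.
  have [n0 _ hn0] := near_infty_natSinv_lt (PosNum d0).
  have [n nn hn] := hl _ m0 n0; have [_ [L LD c]] := hu n.
  exists (L + dist (u n) l); first by rewrite mulrDl mul1r; lra.
  apply: chnS; [| by have [? E] := Xl; split=> //=; rewrite E lexx ltW | lra].
  apply: chn_mono c => //; have := hn0 n nn; rewrite /= => h.
  by rewrite mulrC -ler_pdivlMr ?mulr_gt0 // ltW.
have ts0 : 0 <= (D + 1) * (t - s) by rewrite mulr_ge0 //; [move: D1; lra | lra].
have [g hg gl] := conn_path cZ bZ ts0 cl.
exists l; split; [exact: germ_path_end hg Cy Zin | by case: Xl |].
apply: conn_mono (path_conn (germ_path hg Cy Zin) gl) => // z [[_ /andP[_ zt]] Cz].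
by split=> //; exact: subset_closure.
Qed.

(** Once pushed to a radius of at most delta, the point reaches the origin by one more admissible
    step. *)
Lemma push0 i y : C i y -> enorm y < rho ->
  conn dist (closure (C i) `&` [set z | enorm z <= enorm y]) ((D + 2) * enorm y) y 0.
Proof.
move=> Cy yr delta delta0; have [Xy y0 ye] := germ_in hC Cy.
have t0 : 0 < enorm y.
  by rewrite lt_neqAle enorm_ge0 andbT eq_sym; apply/eqP => /enorm_eq0.
have m0 : 0 < Num.min delta (enorm y) by rewrite lt_min delta0.
have md : Num.min delta (enorm y) <= delta /\ Num.min delta (enorm y) <= enorm y by split; rewrite ge_min lexx ?orbT.
have [y' [Cy' Ey' /(_ delta delta0)[L LM c]]] := push Cy yr m0 md.2.
have E : dist y' 0 = Num.min delta (enorm y) by rewrite /dist subr0.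
exists (L + dist y' 0).
  by rewrite E; move: LM md.2 m0 D1 t0; set m := Num.min _ _; set t := enorm y; nra.
apply: chnS => //; last by rewrite E md.1.
by split; [exact: germ_closure0 | rewrite /= enorm0 ltW].
Qed.

End Rep.
End Components.

(** * Each small sphere meets a component in one chain component *)

Section LinkComponents.
Context {R : realType} {N : nat}.
Local Notation env := (nat -> R).
Local Notation V := ('rV[R]_N).
Variable X : set V.
Hypothesis hX : Def (fun e => X (erow N e)).

Definition ccs (t : R) := cc (@dist R N) (Xs X t).

(** Apply [fibre_conn] with the radius as the only parameter: finitely many definable functions of
    the radius meet every chain component of every small sphere. By tameness each is, for small
    radii, either never in the set or always, and in the latter case Lipschitz. *)
Lemma arcs : exists K d : R, [/\ 0 <= K, 0 < d & forall t, 0 < t < d -> forall z, Xs X t z ->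
  exists a : R -> V, (forall s s', 0 < s < d -> 0 < s' < d -> Xs X s (a s) /\ dist (a s) (a s') <= K * `|s - s'|) /\
    ccs t z (a t)].
Proof.
pose P (E : env) := Xs X (E N) (erow N E).
have hP : Def P by apply: Def_Xs (DFun_var _) => //; exact: (DV_var id).
have [G [M [M0 hG H]]] := @fibre_conn _ N 1 P hP.
pose c t : env := cons t (fun=> 0).
pose arc (g : nat -> env -> R) (e : env) : V := erow N (fun i => g i e).
have Darc g : List.In g G -> DV (arc g) by move=> /hG hg i; under eq_fun do rewrite mxE; exact: hg.
pose K : R := 2 * N%:R * 1; have K0 : 0 <= K by rewrite /K !mulr_ge0.
have hev : evt (fun d => forall g, List.In g G -> (forall s, 0 < s < d -> ~ Xs X s (arc g (c s))) \/
   (forall s s', 0 < s < d -> 0 < s' < d -> Xs X s (arc g (c s)) /\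
      dist (arc g (c s)) (arc g (c s')) <= K * `|s - s'|)).
  apply: evt_all_In => g gG; have hA : Def (fun e => Xs X (e 0%N) (arc g e)).
    by apply: Def_Xs => //; [exact: Darc | exact: DFun_var].
  have [h|[d d0 h]] := tame0 (fun=> 0) hA.
    have hn : evt (fun s => enorm (arc g (c s)) <= 1 * s).
      by apply: evtW h => s _ [_ ->]; rewrite mul1r.
    have [d d0 hd] := evtI (@Lip_vec R N (arc g) (fun=> 0) 1 ltr01 (Darc g gG) hn) h.
    exists d => // d' d'0 dd; right=> s s' hs hs'; split; last exact: (hd d' d'0 dd).1.
    by case/andP: hs => s0 sd; apply: (hd s s0 (lt_trans sd dd)).2.
  by exists d => // d' d'0 dd; left=> s /andP[s0 sd]; apply: h => //; exact: lt_trans dd.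
have [d d0 [hd d1]] := evt_ex (evtI hev (evt_lt ltr01)).
exists K, d; split=> // t /andP[t0 td] z [Xz zt].
have ct : cube 1 (c t) by move=> [|i] //=; apply/andP; split; lra.
have catE y : cat N y (c t) N = t by rewrite /cat ltnn subnn.
have fz : fib N P (c t) (coords z).
  split; first by apply: cube_coords; rewrite zt; lra.
  by rewrite /P catE erow_cat coordsK.
have [g gG hg] := H _ ct _ fz.
have avec : erow N (vec N g (c t)) = arc g (c t).
  by apply/rowP => i; rewrite !mxE /vec ltn_ord.
have fP y : fib N P (c t) y -> Xs X t (erow N y) by move=> [_]; rewrite /P catE erow_cat.
have hc : conn dist (Xs X t) (1 * M) z (arc g (c t)).
  rewrite -(coordsK z) -avec; apply: conn_map hg => // [y y'|y y' _ _]; first exact: l1_ge0.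
  by rewrite mul1r; exact: dist_erow.
exists (fun s => arc g (c s)); split; last exact: conn_cc hc.
have [nh|//] := hd g gG; case: (nh t (ltac:(by rewrite t0 td))).
by have [] := conn_in (@dist_ge0 _ _) hc.
Qed.

Variables (D M kap rho : R).
Hypotheses (D1 : 1 <= D) (kap0 : 0 < kap).
Hypothesis hD : forall t, 0 < t < rho -> forall u, Xs X t u -> forall t', 0 < t' -> t' <= 2 * t ->
  exists2 u', Xs X t' u' & dist u u' <= D * `|t - t'|.
Hypothesis hS : forall t, 0 < t < rho -> forall x y, Xs X t x -> Xs X t y -> dist x y <= kap * t ->
  conn dist (Xs X t) (M * dist x y) x y.

(** A chain with steps of at most kap * s / 8 is moved point by point by [hD]. Consecutive images
    are within 3 * kap * s / 8 of each other, below kap * s', so [hS] joins them on the new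
    sphere. *)
Lemma transport (s s' : R) u v u' v' : 0 < s < rho -> 0 < s' < rho -> D * `|s - s'| <= kap * s / 8 ->
  `|s - s'| <= s / 2 -> ccs s u v -> Xs X s' u' -> Xs X s' v' -> dist u u' <= kap * s / 8 ->
  dist v v' <= kap * s / 8 -> ccs s' u' v'.
Proof.
move=> hs hs' Ds ss uv Xu' Xv' uu'; have [s0 sr] := andP hs; have [s'0 s'r] := andP hs'.
have k8 : 0 < kap * s / 8 by rewrite divr_gt0 // mulr_gt0.
have ks : kap * s / 2 <= kap * s'.
  by rewrite -mulrA ler_wpM2l ?(ltW kap0) //; move: ss; rewrite ler_norml => /andP[_]; lra.
have [L c] := uv _ k8.
elim: c v' Xv' => [Xu|L1 w z cw IH Xz wz] v' Xv' hv'.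
  apply: (@conn_cc _ _ _ _ (M * dist u' v')); apply: hS => //; apply: le_trans ks.
  by have := dist_tri u' u v'; rewrite (distC u' u); lra.
have [_ Xw _] := chn_in (@dist_ge0 _ _) cw.
have s's : s' <= 2 * s by move: ss; rewrite ler_norml => /andP[]; lra.
have [w' Xw' ww'] := hD hs Xw s'0 s's.
have {}ww' := le_trans ww' Ds.
apply: cc_trans (IH w' Xw' ww') _.
apply: (@conn_cc _ _ _ _ (M * dist w' v')); apply: hS => //; apply: le_trans ks.
have := dist_tri w' w v'; have := dist_tri w z v'; rewrite (distC w' w); lra.
Qed.

Variables (r : nat) (C : 'I_r -> set V) (e : R).
Hypotheses (hC : germ_rep X C e) (rho0 : 0 < rho).

(* Transport of chains between nearby spheres makes being chain connected to a given definable arc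
   a locally constant property on [C i]. *)
Lemma component_cc : exists2 d : R, 0 < d & forall t, 0 < t < d -> forall i x y, C i x -> C i y ->
  enorm x = t -> enorm y = t -> ccs t x y.
Proof.
have [K [d1 [K0 d10 harc]]] := arcs; have e0 := germ_pos hC.
pose d := Num.min d1 (Num.min rho (e / 2)).
have d0 : 0 < d by rewrite !lt_min d10 rho0 divr_gt0.
have dd1 : d <= d1 by rewrite ge_min lexx.
have dr : d <= rho by rewrite !ge_min lexx !orbT.
have de : d < e by apply: (@le_lt_trans _ _ (e / 2)); [rewrite !ge_min lexx !orbT | lra].
exists d => // t /andP[t0 td] i x y Cx Cy xt yt.
have Xsx j w : C j w -> Xs X (enorm w) w by move=> /(germ_in hC)[].
have [||a [ha xa]] := harc t _ x; first by rewrite t0 (lt_le_trans td dd1).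
  by rewrite -xt; exact: Xsx Cx.
pose P w := ccs (enorm w) w (a (enorm w)).

have [hcon _] := germ_conn hC (ltac:(by rewrite d0) : 0 < d < e) i.
have hP : P y.
  apply: (connected_loc_const (P := P) hcon) (_ : (C i `&` eball d) x) _ _; last 3 first.
  - by split=> //; rewrite /eball /= xt.
  - by split=> //; rewrite /eball /= yt.
  - by rewrite /P xt.
  move=> w [Cw wd]; set s := enorm w in wd *.
  have s0 : 0 < s by have [_ w0 _] := germ_in hC Cw; rewrite lt_neqAle enorm_ge0 andbT eq_sym; apply/eqP => /enorm_eq0.
  (* One constant for three displacements: of moved points (D), of the arc [a] (K) and of w itself
     (1). *)
  pose B := D + K + 1; have B0 : 0 < B by rewrite /B; move: D1; lra.
  pose q := Num.min (s / 4) (kap * s / (16 * B)).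
  have q0 : 0 < q by rewrite lt_min !divr_gt0 ?mulr_gt0.
  have q1 : q <= s / 4 by rewrite ge_min lexx.
  have q2 : B * q <= kap * s / 16.
    have : q <= kap * s / (16 * B) by rewrite ge_min lexx orbT.
    by rewrite ler_pdivlMr ?mulr_gt0 //; lra.
  exists q => // w' [Cw' w'd] ww'; set s' := enorm w' in w'd *.
  have ss' : `|s' - s| < q by apply: le_lt_trans ww'; exact: dist_enorm.
  have [h1 h2] : s' - s < q /\ s - s' < q by move: ss'; rewrite ltr_norml => /andP[]; lra.
  have s'0 : 0 < s' by lra.
  have hs : 0 < s < rho by rewrite s0 (lt_le_trans wd dr).
  have hs' : 0 < s' < rho by rewrite s'0 (lt_le_trans w'd dr).
  have Bs : B * `|s' - s| <= kap * s / 16 by apply: le_trans q2; rewrite ler_wpM2l // ltW.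
  have Dn : D * `|s' - s| <= B * `|s' - s| by rewrite ler_wpM2r // /B; lra.
  have Kn : K * `|s' - s| <= B * `|s' - s| by rewrite ler_wpM2r // /B; move: D1; lra.
  have wn : dist w' w <= kap * s / 16.
    have B1 : 1 <= B by rewrite /B; move: D1; lra.
    by apply: le_trans q2; apply: le_trans (ltW ww') _; rewrite ler_peMl // ltW.
  have ks' : kap * s / 16 <= kap * s' / 8.
    by rewrite ler_pdivrMr // -!mulrA ler_wpM2l ?(ltW kap0) //; lra.
  have ks : kap * s / 16 <= kap * s / 8.
    by have : 0 < kap * s by [exact: mulr_gt0]; lra.
  have [Xa la] := ha s s' (ltac:(by rewrite s0 (lt_le_trans wd dd1))) (ltac:(by rewrite s'0 (lt_le_trans w'd dd1))).
  have [Xa' la'] := ha s' s (ltac:(by rewrite s'0 (lt_le_trans w'd dd1))) (ltac:(by rewrite s0 (lt_le_trans wd dd1))).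
  have [g1 g2] : `|s' - s| <= s' / 2 /\ `|s' - s| <= s / 2 by split; lra.
  have KL := le_trans Kn Bs; have DL := le_trans Dn Bs; have dss := distrC s s'; split=> hw.
    apply: (transport hs' hs) hw _ _ _ _; rewrite -/s -/s'.
    - exact: le_trans DL ks'.
    - exact: g1.
    - exact: Xsx Cw.
    - exact: Xa.
    - exact: le_trans wn ks'.
    - exact: le_trans la' (le_trans KL ks').
  rewrite dss in la; apply: (transport hs hs') hw _ _ _ _; rewrite -/s -/s' ?dss.
  - exact: le_trans DL ks.
  - exact: g2.
  - exact: Xsx Cw'.
  - exact: Xa'.
  - by rewrite distC; exact: le_trans wn ks.
  - exact: le_trans la (le_trans KL ks).
rewrite /P yt in hP; apply: cc_trans xa _; exact: (cc_sym (@distC _ _) (@dist_ge0 _ _) hP).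
Qed.

End LinkComponents.

(** * From links to germs and back *)

Section PathsAndGerms.
Context {R : realType} {N : nat}.
Local Notation V := ('rV[R]_N).
Implicit Types (x y z : V) (Z : set V) (M : R).

Lemma near0_evt (P : R -> Prop) : (\forall t \near 0^'+, P t) <-> evt P.
Proof.
split=> [/nbhs_ballP[d /= d0 H]|[d d0 H]].
  exists d => // s s0 sd; apply: H => //.
  by rewrite /ball /= sub0r normrN gtr0_norm.
apply/nbhs_ballP; exists d => //= s; rewrite /ball /= sub0r normrN => sd s0.
by apply: H => //; rewrite gtr0_norm in sd.
Qed.

Lemma path_sym Z x y g : path_in Z x y g -> exists g', path_in Z y x g'.
Proof.
move=> [/path_cont cg g0 g1 Zg]; exists (fun t => g (1 - t)); split.
- apply/path_cont => t ht eps eps0; have [|d d0 H] := cg (1 - t) _ eps eps0; first lra.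
  exists d => // s hs st; apply: H; first lra.
  by rewrite opprB addrCA addrAC subrr add0r distrC.
- by rewrite subr0.
- by rewrite subrr.
- by move=> t; rewrite in_itv /= => ht; apply: Zg; rewrite in_itv /=; lra.
Qed.

Lemma path_trans Z x y z g g' : path_in Z x y g -> path_in Z y z g' -> exists h, path_in Z x z h.
Proof.
move=> [/path_cont cg g0 g1 Zg] [/path_cont cg' g'0 g'1 Zg'].
pose h (t : R) := g (Num.min 1 (2 * t)) + g' (Num.max 0 (2 * t - 1)) - y; exists h.
have hl t : t <= 1 / 2 -> h t = g (2 * t).
  by move=> ht; rewrite /h (min_idPr _) ?(max_idPl _) ?g'0 ?addrK //; lra.
have hr t : 1 / 2 <= t -> h t = g' (2 * t - 1).
  by move=> ht; rewrite /h (min_idPl _) ?(max_idPr _) ?g1 ?(addrC y) ?addrK //; lra.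
have rng (t : R) : 0 <= t <= 1 -> 0 <= Num.min 1 (2 * t) <= 1 /\ 0 <= Num.max 0 (2 * t - 1) <= 1.
  move=> /andP[t0 t1]; split; first by rewrite le_min ler01 mulr_ge0 // ge_min lexx.
  by rewrite le_max lexx ge_max ler01 /=; lra.
split.
- apply/path_cont => t /rng[m1 m2] eps eps0; have e2 : 0 < eps / 2 by rewrite divr_gt0.
  have [d1 d10 H1] := cg _ m1 _ e2; have [d2 d20 H2] := cg' _ m2 _ e2.
  exists (Num.min d1 d2 / 2); first by rewrite divr_gt0 // lt_min d10.
  move=> s /rng[n1 n2]; rewrite ltr_pdivlMr // lt_min => /andP[s1 s2].
  have E : `|2 * s - 2 * t| = `|s - t| * 2 by rewrite -mulrBr normrM ger0_norm // mulrC.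
  have h1 : dist (g (Num.min 1 (2 * s))) (g (Num.min 1 (2 * t))) < eps / 2.
    by apply: H1 => //; apply: le_lt_trans (minr_lip _ _ _) _; rewrite E.
  have E' : 2 * s - 1 - (2 * t - 1) = 2 * s - 2 * t by ring.
  have h2 : dist (g' (Num.max 0 (2 * s - 1))) (g' (Num.max 0 (2 * t - 1))) < eps / 2.
    by apply: H2 => //; apply: le_lt_trans (maxr_lip _ _ _) _; rewrite E' E.
  rewrite /h /dist opprB addrA subrK opprD addrACA.
  by apply: le_lt_trans (enormD _ _) _; move: h1 h2; rewrite /dist; lra.
- by rewrite hl ?mulr0 ?g0 //; lra.
- rewrite hr; last lra.
  by have -> : 2 * 1 - 1 = 1 :> R by ring.
- move=> t; rewrite in_itv /= => ht; have [t1|t1] := lerP t (1 / 2).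
    by rewrite hl //; apply: Zg; rewrite in_itv /=; lra.
  by rewrite hr; [apply: Zg'; rewrite in_itv /=; lra | lra].
Qed.

Lemma path_refl Z x : Z x -> exists g, path_in Z x x g.
Proof.
move=> Zx; exists (fun=> x); split=> //; apply/path_cont => t _ eps eps0.
by exists 1 => // s _ _; rewrite distxx.
Qed.

Lemma path_component_eq Z x y g : path_in Z x y g -> path_component Z x = path_component Z y.
Proof.
move=> hg; have [g' hg'] := path_sym hg.
by apply/seteqP; split=> z [h hh]; [exact: path_trans hg' hh | exact: path_trans hg hh].
Qed.

Lemma conn_dist Z M x y : conn dist Z M x y -> dist x y <= M.
Proof.
move=> h; have [L LM c] := h 1 ltr01; apply: le_trans LM.
elim: c => [_|L1 u v _ IH _ _]; first by rewrite distxx.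
by apply: le_trans (dist_tri _ u _) _; rewrite lerD2r.
Qed.

Lemma conn_swap Z M x y : conn dist Z M x y -> conn dist Z M y x.
Proof. exact: (conn_sym (@distC _ _) (@dist_ge0 _ _)). Qed.

Lemma enorm_gt0 x : x <> 0 -> 0 < enorm x.
Proof. by move=> x0; rewrite lt_neqAle enorm_ge0 andbT eq_sym; apply/eqP => /enorm_eq0. Qed.

Lemma lne_conn Z (c : R) x y : C_LNE c Z -> Z x -> Z y -> conn dist Z ((c + 1) * dist x y) x y.
Proof.
move=> h Zx Zy; have [E|nE] := eqVneq (dist x y) 0.
  by rewrite E mulr0 -(dist_eq0 E); exact: conn_refl.
apply: inner_conn (h x y Zx Zy) _.
by rewrite mulrDl mul1r ltrDl lt_neqAle eq_sym nE dist_ge0.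
Qed.

(** Weaker than [LNE_at0] in form: the connecting chains may leave the neighbourhood of the origin.
    It suffices for the passage to the links and is what can be glued from the components when no
    control on the position of their chains is available. *)
Definition weak_LNE Z := exists c ep : R, [/\ 1 <= c, 0 < ep &
  forall x y, Z x -> Z y -> enorm x < ep -> enorm y < ep -> conn dist Z (c * dist x y) x y].

Lemma LNE_weak Z : LNE_at0 Z -> weak_LNE Z.
Proof.
move=> [U [oU U0 [c c1 hc]]].
have /nbhs_enorm[ep ep0 hU] := open_nbhs_nbhs (conj oU U0).
exists (c + 1), ep; split=> //; first by lra.
move=> x y Zx Zy xe ye; have inU z : Z z -> enorm z < ep -> (Z `&` U) z.
  by move=> Zz ze; split=> //; apply: hU; rewrite /dist subr0.
by apply: conn_mono (lne_conn hc (inU x Zx xe) (inU y Zy ye)) => // z [].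
Qed.

(** Confinement to the closed ball of radius enorm y keeps the chains inside [eball d] and provides
    the compactness required by [conn_path]. *)
Lemma conn_LNE Z M (d : R) : closed Z -> 0 <= M -> 0 < d -> (forall x y, Z x -> Z y -> enorm x <= enorm y ->
  enorm y < d -> conn dist (Z `&` [set z | enorm z <= enorm y]) (M * dist x y) x y) -> LNE_at0 Z.
Proof.
move=> cZ M0 d0 H; exists (eball d); split; [exact: open_eball | by rewrite /eball /= enorm0 |].
exists (M + 1); first by lra.
have fin t u v : t < d -> conn dist (Z `&` [set z | enorm z <= t]) (M * dist u v) u v ->
    (inner_dist (Z `&` eball d) u v <= ((M + 1) * dist u v)%:E)%E.
  move=> td h; apply: (@le_trans _ _ (M * dist u v)%:E); last by rewrite lee_fin ler_wpM2r ?dist_ge0 //; lra.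
  have cl : closed (Z `&` [set z | 0 <= enorm z <= t]) by apply: closedI => //; exact: closed_norm.
  apply: conn_inner cl _ _ (conn_mono _ (lexx _) h) _.
  - by exists t => z [_ /andP[]].
  - by rewrite mulr_ge0 ?dist_ge0.
  - by move=> z [Zz zt]; split=> //=; rewrite enorm_ge0.
  - by move=> z [Zz /andP[_ zt]]; split=> //; exact: le_lt_trans zt td.
move=> x y [Zx xd] [Zy yd]; have [xy|/ltW yx] := lerP (enorm x) (enorm y).
  exact: fin yd (H x y Zx Zy xy yd).
apply: (fin (enorm x)) => //; rewrite distC; apply: conn_swap.
exact: H.
Qed.

Lemma closed_Xs (X : set V) t : closed X -> closed (Xs X t).
Proof.
move=> cX; have -> : Xs X t = X `&` [set x : V | t <= enorm x <= t].
  apply/seteqP; split=> x [Xx /= h]; split=> //=; first by rewrite h lexx.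
  by apply/eqP; rewrite eq_le andbC.
by apply: closedI => //; exact: closed_norm.
Qed.

Variables (X : set V) (r : nat) (C : 'I_r -> set V) (e : R).
Hypotheses (cX : closed X) (X0 : X 0) (hX : Def (fun e => X (erow N e))) (hC : germ_rep X C e).

(** The common source of both parts of the link statement: the clause on close points yields the
    linear separation, the clause on one component yields [LLNE_at0]. *)
Definition link_conn := exists M kap d : R, [/\ 0 <= M, 0 < kap, 0 < d & forall t, 0 < t < d ->
  (forall x y, Xs X t x -> Xs X t y -> dist x y <= kap * t -> conn dist (Xs X t) (M * dist x y) x y) /\
  (forall i x y, C i x -> C i y -> enorm x = t -> enorm y = t -> conn dist (Xs X t) (M * dist x y) x y)].

Definition d0_linear := exists2 K : R, 0 < K &
  \forall t \near 0^'+, ((K * t)%:E <= d0 (X `&` esphere t))%E.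

Lemma sheets_rho : exists D rho : R, [/\ 1 <= D, 0 < rho & forall t, 0 < t < rho -> forall u, Xs X t u ->
  forall t', 0 < t' -> t' <= 2 * t -> exists2 u', Xs X t' u' & dist u u' <= D * `|t - t'|].
Proof.
have [D D1 [rho rho0 H]] := sheets hX; exists D, rho; split=> // t /andP[t0 tr]; exact: H.
Qed.

Lemma weak_link : weak_LNE X -> link_conn.
Proof.
move=> [c [ep [c1 ep0 lne]]].
have [M1 [kap [M10 kap0 [d1 d10 hS]]]] := sphere_conn hX c1 ep0 lne.
have [M2 M20 hW] := window_conn hX; have [D [rho [D1 rho0 hD]]] := sheets_rho.
pose rr := Num.min rho (Num.min d1 1); have rr0 : 0 < rr by rewrite !lt_min rho0 d10 ltr01.
have rrho : rr <= rho by rewrite ge_min lexx.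
have rd1 : rr <= d1 by rewrite !ge_min lexx !orbT.
have r1 : rr <= 1 by rewrite !ge_min lexx !orbT.
have hS' t : 0 < t < rr -> forall x y, Xs X t x -> Xs X t y -> dist x y <= kap * t ->
    conn dist (Xs X t) (M1 * dist x y) x y.
  by move=> /andP[t0 tr]; apply: hS => //; exact: lt_le_trans tr rd1.
have hD' t : 0 < t < rr -> forall u, Xs X t u -> forall t', 0 < t' -> t' <= 2 * t ->
    exists2 u', Xs X t' u' & dist u u' <= D * `|t - t'|.
  by move=> /andP[t0 tr]; apply: hD; rewrite t0 (lt_le_trans tr).
have [d d0 hcc] := component_cc hX D1 kap0 hD' hS' hC rr0.
have M0 : 0 <= M1 + M2 / kap by rewrite addr_ge0 // divr_ge0 // ltW.
exists (M1 + M2 / kap), kap, (Num.min d rr); split=> //; first by rewrite lt_min d0.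
move=> t; rewrite lt_min => /andP[t0 /andP[td tr]].
have h1 x y : Xs X t x -> Xs X t y -> dist x y <= kap * t -> conn dist (Xs X t) ((M1 + M2 / kap) * dist x y) x y.
  move=> Xx Xy xy; apply: conn_mono (hS' t (ltac:(by rewrite t0)) x y Xx Xy xy) => //.
  by rewrite ler_wpM2r ?dist_ge0 // lerDl divr_ge0 // ltW.
split=> // i x y Cx Cy xt yt.
have [Xx _ _] := germ_in hC Cx; have [Xy _ _] := germ_in hC Cy.
have [xy|xy] := lerP (dist x y) (kap * t); first exact: h1.
(* For distant points the window of radius t about the origin is used, which is the whole sphere
   section; its diameter bound is linear in t, and t is below dist x y / kap. *)
have hc : conn dist (Xs X t) (M2 * t) x y.
  apply: (hW t t 0) => [||| delta delta0]; rewrite ?enorm0 ?ler01 ?(ltW t0) ?t0 ?(ltW (lt_le_trans tr r1)) //.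
  have [L cL] := hcc t (ltac:(by rewrite t0)) i x y Cx Cy xt yt delta delta0.
  exists L; apply: chn_mono cL => // w [Xw wt]; split=> //.
  by rewrite distC /dist subr0 wt.
apply: conn_mono hc => //; apply: le_trans (_ : M2 / kap * dist x y <= _).
  by rewrite -mulrA ler_wpM2l // mulrC ler_pdivlMr // mulrC ltW.
by rewrite ler_wpM2r ?dist_ge0 // lerDr.
Qed.

Lemma germ_inner i Z Z' M x y : closed Z -> (forall z, Z z -> [/\ X z, z <> 0 & enorm z < e]) -> 0 <= M ->
  C i x -> conn dist Z M x y -> (forall z, Z z -> C i z -> Z' z) -> (inner_dist Z' x y <= M%:E)%E.
Proof.
move=> cZ hZ M0 Cx h ZZ.
have [|g hg gM] := conn_path cZ _ M0 h; first by exists e => z /hZ[_ _ /ltW].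
have gf := le_lt_trans gM (ltry M); apply: le_trans gM; apply: ereal_inf_lbound; exists g => //; split=> //.
by apply: path_in_mono (germ_path hC hg Cx hZ) _ => z [Zz Cz]; exact: ZZ.
Qed.

Lemma comp_sub i z : closure (C i) z -> X z.
Proof. exact: (@germ_sub _ _ X r C e cX hC i z). Qed.

Lemma Xs_in t z : 0 < t < e -> Xs X t z -> [/\ X z, z <> 0 & enorm z < e].
Proof.
move=> /andP[t0 te] [Xz zt]; split=> //; last by rewrite zt.
by move=> z0; move: zt; rewrite z0 enorm0 => t0'; rewrite t0' ltxx in t0.
Qed.

Lemma link_LLNE : link_conn -> forall i, LLNE_at0 (closure (C i)).
Proof.
move=> [M [kap [d [M0 kap0 d0 H]]]] i; have e0 := germ_pos hC.
have m0 : 0 < Num.min d e by rewrite lt_min d0.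
have [md me] : Num.min d e <= d /\ Num.min d e <= e by split; rewrite ge_min lexx ?orbT.
exists (M + 1), (Num.min d e / 2); split; [lra|lra|] => t ht x y [cx xt] [cy yt].
have te : 0 < t < e by lra.
have inC z : closure (C i) z -> enorm z = t -> C i z.
  move=> cz zt; have [|_ z0 ze] := @Xs_in t z te; first by split=> //; exact: comp_sub cz.
  exact: (germ_closure cX hC).
have [_ /(_ i x y (inC x cx xt) (inC y cy yt) xt yt) hc] := H t (ltac:(lra)).
apply: (@le_trans _ _ (M * dist x y)%:E); last first.
  by rewrite lee_fin ler_wpM2r ?dist_ge0 //; lra.
apply: (germ_inner (i := i)) hc _ => //.
- exact: closed_Xs.
- by move=> z; exact: Xs_in.
- by rewrite mulr_ge0 ?dist_ge0.
- exact: inC.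
- by move=> z [_ zt] Cz; split=> //; exact: subset_closure.
Qed.

Lemma link_d0 : link_conn -> d0_linear.
Proof.
(* The bound by 1 serves the path-connected case, in which [d0] equals 1 and t < 1. *)
move=> [M [kap [d [M0 kap0 d0' H]]]]; exists (Num.min kap 1); first by rewrite lt_min kap0 ltr01.
have [k1 k2] : Num.min kap 1 <= kap /\ Num.min kap 1 <= 1 by split; rewrite ge_min lexx ?orbT.
apply/near0_evt; apply: evtW (evtI (evt_lt d0') (evt_lt ltr01)) => t t0 [td t1].
rewrite /d0; case: asboolP => _; first by rewrite lee_fin; nra.
apply: le_ereal_inf_tmp => _ [Y [Z [[x Xx <-] [y Xy <-] YZ ->]]].
apply: le_ereal_inf_tmp => _ [u [g hg] [v [h hh] <-]]; rewrite lee_fin leNgt; apply/negP => uv.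
apply: YZ; rewrite (path_component_eq hg) (path_component_eq hh).
have Xu : Xs X t u by have [_ _ <- /(_ 1)] := hg; rewrite in_itv /= lexx ler01; exact.
have Xv : Xs X t v by have [_ _ <- /(_ 1)] := hh; rewrite in_itv /= lexx ler01; exact.
have [/(_ u v Xu Xv) hS _] := H t (ltac:(by rewrite t0)).
have {}hS := hS (ltac:(rewrite /dist; nra)).
have [||q hq _] := conn_path (closed_Xs (t := t) cX) _ _ hS; first by exists t => z [_ ->].
  by rewrite mulr_ge0 ?dist_ge0.
exact: path_component_eq hq.
Qed.

(** A path on the sphere avoids the origin and so cannot leave a component; points of different
    components thus lie in different members of [pi0]. *)
Lemma d0_sep : d0_linear -> exists K d : R, [/\ 0 < K, 0 < d & forall i j x y, C i x -> C j y -> i <> j ->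
  enorm x = enorm y -> enorm x < d -> K * enorm x <= dist x y].
Proof.
move=> [K K0 /near0_evt[d d0' H]]; have e0 := germ_pos hC.
exists K, (Num.min d e); split=> //; first by rewrite lt_min d0'.
move=> i j x y Cx Cy ij xy; rewrite lt_min => /andP[xd xe]; set t := enorm x in xy xd xe *.
have [Xx x0 _] := germ_in hC Cx; have [Xy _ _] := germ_in hC Cy.
have t0 : 0 < t := enorm_gt0 x0.
have te : 0 < t < e by rewrite t0.
have np g : ~ path_in (X `&` esphere t) x y g.
  move=> hg; apply: ij; apply: (germ_disj hC) Cy.
  by apply: (germ_path_end hC hg Cx) => z; exact: Xs_in.
have Ax : (X `&` esphere t) x by [].
have Ay : (X `&` esphere t) y by split=> //; rewrite /esphere /= -xy.
have := H t t0 xd; rewrite /d0; case: asboolP => [/(_ x y Ax Ay)[g /np]//|_ h].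
rewrite -lee_fin; apply: le_trans h _.
apply: le_trans (_ : set_dist (path_component (X `&` esphere t) x) (path_component (X `&` esphere t) y) <= _)%E.
  apply: ereal_inf_lbound; exists (path_component (X `&` esphere t) x), (path_component (X `&` esphere t) y).
  split=> //; [by exists x | by exists y | move=> E].
  have [g hg] : path_component (X `&` esphere t) x y by rewrite E; exact: path_refl.
  exact: np hg.
apply: ereal_inf_lbound; exists x; first exact: path_refl.
by exists y => //; exact: path_refl.
Qed.

(** The family [W] abstracts where chains may run: in X within a ball to obtain [LNE_at0 X], or
    anywhere in X to obtain [weak_LNE X]. *)
Lemma glue (W : R -> set V) : (forall s t, s <= t -> W s `<=` W t) ->
  (forall i t, closure (C i) `&` [set z | enorm z <= t] `<=` W t) -> (forall t, 0 <= t -> W t 0) ->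
  d0_linear -> (exists M d : R, [/\ 0 <= M, 0 < d & forall i x y, closure (C i) x -> closure (C i) y ->
    enorm x <= enorm y -> enorm y < d -> conn dist (W (enorm y)) (M * dist x y) x y]) ->
  exists M d : R, [/\ 1 <= M, 0 < d & forall x y, X x -> X y -> enorm x <= enorm y -> enorm y < d ->
    conn dist (W (enorm y)) (M * dist x y) x y].
Proof.
move=> Wm CW W0 /d0_sep[K [d1 [K0 d10 sep]]] [M [d2 [M0 d20 H]]].
have [D [rho [D1 rho0 hD]]] := sheets_rho; have e0 := germ_pos hC.
pose d := Num.min (Num.min d1 d2) (Num.min rho e).
have d0' : 0 < d by rewrite !lt_min d10 d20 rho0 e0.
(* Points of different components are joined through the origin at cost (D + 2) * (enorm x + enorm
   y). Pushing y to the sphere of x and using [sep] bounds enorm x by (D + 2) / K * dist x y, and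
   enorm y exceeds enorm x by at most dist x y. *)
pose B := (D + 2) * (2 * (D + 2) / K + 1).
have B0 : D + 2 <= B by rewrite /B ler_peMr //; [lra | rewrite lerDr divr_ge0 // ?(ltW K0) //; lra].
have conn0 i x : C i x -> enorm x < rho -> forall t, enorm x <= t -> conn dist (W t) ((D + 2) * enorm x) x 0.
  move=> Cx xr t xt; apply: conn_mono (push0 cX hC D1 hD Cx xr) => // z hz.
  by apply: (Wm _ _ xt); exact: CW hz.
exists (M + B), d; split=> //; first by lra.
move=> x y Xx Xy xy; rewrite !lt_min => /andP[/andP[y1 y2] /andP[y3 y4]].
have dxy : dist x y <= dist x y := lexx _; have dp := dist_ge0 x y.
have incr M' : M' <= M + B -> conn dist (W (enorm y)) (M' * dist x y) x y ->
    conn dist (W (enorm y)) ((M + B) * dist x y) x y.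
  by move=> hM; apply: conn_mono => //; rewrite ler_wpM2r.
have ex_i z : X z -> enorm z <= enorm y -> z <> 0 -> exists i, C i z.
  by move=> Xz zy z0; apply: (germ_cover hC) => //; exact: le_lt_trans zy y4.
have [y0|/eqP y0] := eqVneq y 0.
  have x0 : x = 0 by apply: enorm_eq0; apply/eqP; rewrite eq_le enorm_ge0 andbT (le_trans xy) // y0 enorm0.
  by rewrite x0 y0 distxx mulr0 enorm0; apply: conn_refl => //; exact: W0.
have [j Cy] := ex_i y Xy (lexx _) y0.
have [x0|/eqP x0] := eqVneq x 0.
  apply: (incr (D + 2)); first by lra.
  rewrite {1}x0 distC /dist subr0; apply: conn_swap.
  by rewrite x0; exact: conn0 Cy y3 _ (lexx _).
have [i Cx] := ex_i x Xx xy x0.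
have [ij|/eqP ij] := eqVneq i j.
  apply: (incr M); first by move: B0 D1; lra.
  by apply: (H j) => //; apply: subset_closure => //; rewrite -ij.
have xp := enorm_gt0 x0.
have [y' [Cy' y'x cy']] := push cX hC D1 hD Cy y3 xp xy.
have ts : enorm y - enorm x <= dist x y.
  by have := dist_enorm x y; rewrite ler_norml => /andP[]; lra.
have h1 := conn_dist cy'; have h2 := sep i j x y' Cx Cy' ij (esym y'x) (le_lt_trans xy y1).
have h3 : K * enorm x <= (D + 2) * dist x y.
  by apply: le_trans h2 _; have := dist_tri x y y'; move: D1; nra.
apply: (incr B); first by lra.
apply: conn_mono (conn_trans (conn0 i x Cx (le_lt_trans xy y3) _ xy)
  (conn_swap (conn0 j y Cy y3 _ (lexx _)))) => //.
have h4 : enorm x <= (D + 2) / K * dist x y by rewrite mulrAC ler_pdivlMr // mulrC.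
rewrite -mulrDr /B -mulrA ler_wpM2l //; first by move: D1; lra.
have -> : (2 * (D + 2) / K + 1) * dist x y = 2 * ((D + 2) / K * dist x y) + dist x y by ring.
lra.
Qed.

Lemma fin_bounds (P : 'I_r -> R -> R -> Prop) : (forall i M M' d d', M <= M' -> d' <= d -> P i M d -> P i M' d') ->
  (forall i, exists M d : R, [/\ 0 <= M, 0 < d & P i M d]) ->
  exists M d : R, [/\ 0 <= M, 0 < d & forall i, P i M d].
Proof.
move=> mono /choice[M /choice[d H]].
have [dd dd0 hd] := fin_min (fun i => let: And3 _ d0 _ := H i in d0).
have M0 i : 0 <= M i by case: (H i).
exists (\sum_i M i), dd; split=> //; first by apply: sumr_ge0.
move=> i; have [_ _ h] := H i; apply: mono h => //.
by rewrite (bigD1 i) //= lerDl sumr_ge0.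
Qed.

(** The outer point y is pushed to y' on the sphere of x, at cost at most (D + 1) * dist x y, and
    the link property is used for x and y', whose distance is at most (D + 2) * dist x y. If x is
    the origin, [push0] does the work. *)
Lemma LLNE_local : (forall i, LLNE_at0 (closure (C i))) -> exists M d : R, [/\ 0 <= M, 0 < d &
  forall i x y, closure (C i) x -> closure (C i) y -> enorm x <= enorm y -> enorm y < d ->
    conn dist (closure (C i) `&` [set z | enorm z <= enorm y]) (M * dist x y) x y].
Proof.
move=> hL; pose P i M d := forall x y, closure (C i) x -> closure (C i) y -> enorm x <= enorm y -> enorm y < d ->
    conn dist (closure (C i) `&` [set z | enorm z <= enorm y]) (M * dist x y) x y.
apply: (@fin_bounds P) => [i M M' d d' MM dd h x y cx cy xy yd|i].
  by apply: conn_mono (h x y cx cy xy (lt_le_trans yd dd)) => //; rewrite ler_wpM2r ?dist_ge0.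
have [c [d [c1 d0' H]]] := hL i; have [D [rho [D1 rho0 hD]]] := sheets_rho; have e0 := germ_pos hC.
pose B := (c + 1) * (D + 2) + (D + 2); have cD : 0 <= (c + 1) * (D + 2) by rewrite mulr_ge0; lra.
exists B, (Num.min d (Num.min rho e)); split; [by rewrite /B; lra | by rewrite !lt_min d0' rho0 |].
move=> x y cx cy xy; rewrite !lt_min => /andP[yd /andP[yr ye]]; have dp := dist_ge0 x y.
have C0 := germ_closure0 hC i.
have [y0|/eqP y0] := eqVneq y 0.
  have x0 : x = 0 by apply: enorm_eq0; apply/eqP; rewrite eq_le enorm_ge0 andbT (le_trans xy) // y0 enorm0.
  by rewrite x0 y0 distxx mulr0 enorm0; apply: conn_refl => //; split=> //=; rewrite enorm0.
have Cy := germ_closure cX hC cy y0 ye.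
have [x0|/eqP x0] := eqVneq x 0.
  rewrite {1}x0 distC /dist subr0 x0; apply: conn_swap.
  apply: conn_mono (push0 cX hC D1 hD Cy yr) => //.
  by rewrite ler_wpM2r ?enorm_ge0 // /B; lra.
have Cx := germ_closure cX hC cx x0 (le_lt_trans xy ye).
have xp := enorm_gt0 x0.
have [y' [Cy' y'x cy']] := push cX hC D1 hD Cy yr xp xy.
have ts : enorm y - enorm x <= dist x y.
  by have := dist_enorm x y; rewrite ler_norml => /andP[]; lra.
have h1 := conn_dist cy'.
have h2 := lne_conn (H (enorm x) (ltac:(by rewrite xp (ltW (le_lt_trans xy yd))))) (conj cx (erefl : esphere _ x))
  (conj (subset_closure Cy') (y'x : esphere _ y')).
have {}h2 : conn dist (closure (C i) `&` [set z | enorm z <= enorm y]) ((c + 1) * dist x y') x y'.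
  by apply: conn_mono h2 => // z [? zx]; split=> //=; rewrite zx.
apply: conn_mono (conn_trans h2 (conn_swap cy')) => //.
have h3 : dist x y' <= (D + 2) * dist x y by have := dist_tri x y y'; move: D1; nra.
rewrite /B [leRHS]mulrDl; apply: lerD; first by rewrite -mulrA ler_wpM2l //; lra.
by move: D1; nra.
Qed.

Lemma LLNE_LNE_comp : (forall i, LLNE_at0 (closure (C i))) -> forall i, LNE_at0 (closure (C i)).
Proof.
move=> /LLNE_local[M [d [M0 d0' H]]] i; apply: (conn_LNE _ M0 d0' (H i)); exact: closed_closure.
Qed.

Lemma LLNE_LNE : (forall i, LLNE_at0 (closure (C i))) -> d0_linear -> LNE_at0 X.
Proof.
move=> /LLNE_local[M [d [M0 d0' H]]] hd.
have [||||M' [d' [M'1 d'0 H']]] := @glue (fun t => X `&` [set z | enorm z <= t]) _ _ _ hd _.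
- by move=> s t st z [Xz zs]; split=> //=; exact: le_trans zs st.
- by move=> i t z [cz zt]; split=> //; exact: comp_sub cz.
- by move=> t t0; split=> //=; rewrite enorm0.
- exists M, d; split=> // i x y cx cy xy yd; apply: conn_mono (H i x y cx cy xy yd) => // z [cz zt].
  by split=> //; exact: comp_sub cz.
exact: conn_LNE (le_trans ler01 M'1) d'0 H'.
Qed.

(** The chains obtained from [LNE_weak] stay in the component but not in the ball of the outer
    point, so gluing gives the weak property; [weak_link] asks no more. *)
Lemma LNE_comp_weak : (forall i, LNE_at0 (closure (C i))) -> d0_linear -> weak_LNE X.
Proof.
move=> hL hd.
have [||||M' [d' [M'1 d'0 H']]] := @glue (fun=> X) _ _ _ hd _ => //.
- by move=> s t _ z.
- by move=> i t z [cz _]; exact: comp_sub cz.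
- have [|i|M [d [M0 d0' H]]] := @fin_bounds (fun i M d => forall x y, closure (C i) x -> closure (C i) y ->
      enorm x < d -> enorm y < d -> conn dist X (M * dist x y) x y).
  + move=> i M M' d d' MM dd h x y cx cy xd yd.
    by apply: conn_mono (h x y cx cy (lt_le_trans xd dd) (lt_le_trans yd dd)) => //; rewrite ler_wpM2r ?dist_ge0.
  + have [c [ep [c1 ep0 hc]]] := LNE_weak (hL i); exists c, ep; split=> //; first by lra.
    move=> x y cx cy xe ye; apply: conn_mono (hc x y cx cy xe ye) => // z cz.
    exact: comp_sub cz.
  + by exists M, d; split=> // i x y cx cy xy yd; apply: (H i) => //; exact: le_lt_trans xy yd.
exists M', d'; split=> // x y Xx Xy xd yd; have [xy|/ltW yx] := lerP (enorm x) (enorm y).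
  exact: H'.
by rewrite distC; apply: conn_swap; exact: H'.
Qed.

End PathsAndGerms.

Theorem corollary3p3 (R : realType) (N : nat) (X : set 'rV[R]_N)
  (Xclosed : closed X) (Xsub : subanalytic X) (X0 : X 0)
  (r : nat) (C : 'I_r -> set 'rV[R]_N) (CX : germ_components X C) :
  [<-> LNE_at0 X;
       (forall i, LNE_at0 (closure (C i))) /\
       (exists2 K : R, 0 < K &
          \forall t \near 0^'+, ((K * t)%:E <= d0 (X `&` esphere t))%E);
       (forall i, LLNE_at0 (closure (C i))) /\
       (exists2 K : R, 0 < K &
          \forall t \near 0^'+, ((K * t)%:E <= d0 (X `&` esphere t))%E)].
Proof.
have hX := subanalytic_Def Xsub; have [e hC] := germ_repP CX.
have wl := weak_link hX hC.
(* [lk] leads from the weak property of X to the third statement. It serves twice: from the first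
   statement, and from the second after gluing. *)
have lk h := conj (link_LLNE Xclosed hC (wl h)) (link_d0 Xclosed (wl h)).
tfae.
- move=> /LNE_weak/lk[h1 h2]; split=> //; exact: (LLNE_LNE_comp Xclosed hX hC).
- by move=> [h1 h2]; apply: lk; exact: (LNE_comp_weak Xclosed X0 hX hC).
- by move=> [h1 h2]; exact: (LLNE_LNE Xclosed X0 hX hC).
Qed.
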